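(* Let $M=\mathbb{R}\times\Sigma$ be a standard static spacetime with static potentials $A$, $Y$ as described in the context, and assume that the operator $L$ (defined in the context) is essentially self-adjoint on $C^\infty_c(\Sigma)$ with respect to $L^2(\Sigma)$. Then the Klein--Gordon operator $$K=-\frac1\beta (D_t+V)^2+|g|^{-\frac12}(D_i-A_i)|g|^{\frac12}g^{ij}(D_j-A_j)+Y$$ is essentially self-adjoint on $C^2_c(M)$ with respect to $L^2(M)$.
   Context: Let $\Sigma$ be a manifold and $M=\mathbb{R}\times\Sigma$ with Lorentzian metric $g=-\beta\,dt^2+g_\Sigma$, where $g_\Sigma$ is a time-independent Riemannian metric of class $C^2$ on $\Sigma$, $\beta\in C^2(\Sigma)$ is positive, and there is $C_0>0$ with $C_0\le\beta\le C_0^{-1}$. Write $|g|=|\det[g_{\mu\nu}]|$, so $|g|^{1/2}=\beta^{1/2}|g_\Sigma|^{1/2}$, and $D=-i\partial$; indices $i,j$ refer to local coordinates on $\Sigma$. Put $L^2(M)=L^2(M,|g|^{1/2})$ and $L^2(\Sigma)=L^2(\Sigma,\beta^{1/2}|g_\Sigma|^{1/2})$. Let $A\in C^1(T^*M)$ be a real 1-form and $Y\in L^2_{\mathrm{loc}}(M)$, $Y\ge 0$, both independent of time, with $V:=-A_0$ bounded. Define on $C_c^\infty(\Sigma)$ $$L:=\beta^{\frac12}|g|^{-\frac12}(D_i-A_i)|g|^{\frac12}g^{ij}(D_j-A_j)\beta^{\frac12}+\beta Y .$$ *)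

(* Defs.v *)
From HB Require Import structures.
From mathcomp Require Import all_boot all_order all_algebra.
From mathcomp Require Import all_classical all_reals all_analysis.
From mathcomp Require Export complex.

Set Implicit Arguments.
Unset Strict Implicit.
Unset Printing Implicit Defensive.

Import Order.TTheory GRing.Theory Num.Theory.
Import numFieldNormedType.Exports.

Local Open Scope classical_set_scope.
Local Open Scope ring_scope.
Local Open Scope complex_scope.

(* Elements of L2 are represented by functions; the graph of a closed operator
   is then a set of pairs of functions that is saturated for equality a.e. *)

Section L2.
Context d (T : measurableType d) (R : realType)
  (mu : {measure set T -> \bar R}).
Implicit Types (f u v : T -> R[i]) (D : set (T -> R[i]))
  (G : set ((T -> R[i]) * (T -> R[i]))).

Definition L2norm f : \bar R := Lnorm mu 2%:E (fun x => (complex.Re `|f x|)%:E).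

Definition L2 : set (T -> R[i]) :=
  [set f | [/\ measurable_fun setT (fun x => complex.Re (f x)),
               measurable_fun setT (fun x => complex.Im (f x)) &
               (L2norm f < +oo)%E]].

Definition complex_integral f : R[i] :=
  (\int[mu]_x complex.Re (f x)) +i* (\int[mu]_x complex.Im (f x)).

Definition L2inner u v : R[i] := complex_integral (fun x => conjc (u x) * v x).

Definition dense_in_L2 D :=
  D `<=` L2 /\
  forall f, L2 f -> forall e : R, 0 < e ->
    exists2 u, D u & (L2norm (fun x => f x - u x)%R < e%:E)%E.

Definition op_graph D (A : (T -> R[i]) -> (T -> R[i])) :=
  [set uf | D uf.1 /\ uf.2 = A uf.1].

Definition graph_closure G : set ((T -> R[i]) * (T -> R[i])) :=
  [set uf | [/\ L2 uf.1, L2 uf.2 & forall e : R, 0 < e ->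
     exists2 vh, G vh & (L2norm (fun x => uf.1 x - vh.1 x)%R < e%:E)%E /\
                        (L2norm (fun x => uf.2 x - vh.2 x)%R < e%:E)%E]].

Definition graph_adjoint G : set ((T -> R[i]) * (T -> R[i])) :=
  [set vh | [/\ L2 vh.1, L2 vh.2 &
     forall uf, G uf -> L2inner vh.1 uf.2 = L2inner vh.2 uf.1]].

Definition selfadjoint G := dense_in_L2 (fst @` G) /\ graph_adjoint G = G.

Definition essentially_selfadjoint D (A : (T -> R[i]) -> (T -> R[i])) :=
  [/\ dense_in_L2 D, (forall u, D u -> L2 (A u)) &
      selfadjoint (graph_closure (op_graph D A))].

End L2.

HB.instance Definition _ (T U : ptopologicalType) :=
  Topological.on (T * U)%type.

Definition borel (T : ptopologicalType) := g_sigma_algebraType (@open T).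
HB.instance Definition _ (T : ptopologicalType) :=
  Measurable.on (borel T).

(* Lebesgue measure of Borel subsets of R^n, by iterated integration. *)
Fixpoint lebesgue_rV (R : realType) (n : nat) : set 'rV[R]_n -> \bar R :=
  match n return set 'rV[R]_n -> \bar R with
  | 0 => fun B => (\1_B (0 : 'rV[R]_0))%:E
  | m.+1 => fun B => (\int[@lebesgue_measure R]_t
      lebesgue_rV [set y : 'rV[R]_m | B (row_mx (t%:M : 'M[R]_1) y)])%E
  end.

Section Ck.
Context (R : realType) (n : nat).

Definition basis_rV (j : 'I_n) : 'rV[R]_n := delta_mx 0 j.

Fixpoint Ck_on (k : nat) (U : set 'rV[R]_n) (f : 'rV[R]_n -> R) : Prop :=
  {in U, continuous f} /\
  if k is k'.+1 then forall j : 'I_n,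
    (forall x, U x -> derivable f x (basis_rV j)) /\
    Ck_on k' U ('D_(basis_rV j) f)
  else True.

End Ck.

Record chart (R : realType) (X : ptopologicalType) (n : nat) := Chart {
  chart_dom : set X;
  chart_map : X -> 'rV[R]_n;
  chart_inv : 'rV[R]_n -> X }.

Definition chart_cod (R : realType) (X : ptopologicalType) n
  (c : chart R X n) : set 'rV[R]_n := chart_map c @` chart_dom c.

(* [chart_at p] is the index of a chart whose domain contains [p]. *)
Record atlas (R : realType) (X : ptopologicalType) (n : nat) := Atlas {
  idx : Type;
  chart_of : idx -> chart R X n;
  chart_at : X -> idx }.

Section Manifold.
Context (R : realType) (X : ptopologicalType) (n : nat).
Implicit Types (c : chart R X n) (M : atlas R X n).

Definition is_chart c :=
  [/\ open (chart_dom c), open (chart_cod c),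
      {in chart_dom c, cancel (chart_map c) (chart_inv c)},
      {in chart_dom c, continuous (chart_map c)} &
      {in chart_cod c, continuous (chart_inv c)}].

Definition transition M (i j : idx M) : 'rV[R]_n -> 'rV[R]_n :=
  chart_map (chart_of j) \o chart_inv (chart_of i).

Definition overlap M (i j : idx M) : set X :=
  chart_dom (chart_of i) `&` chart_dom (chart_of j).

Definition smooth_manifold M :=
  [/\ hausdorff_space X, @second_countable X,
      (forall i : idx M, is_chart (chart_of i)),
      (forall p, chart_dom (chart_of (chart_at M p)) p) &
      forall (i j : idx M) (b : 'I_n) (k : nat),
        Ck_on k (chart_map (chart_of i) @` overlap i j)
          (fun y => transition i j y 0 b)].

Definition Ck_fun M (k : nat) (f : X -> R) :=
  forall i : idx M, Ck_on k (chart_cod (chart_of i)) (f \o chart_inv (chart_of i)).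

Definition Ck_cfun M (k : nat) (u : X -> R[i]) :=
  Ck_fun M k (fun x => complex.Re (u x)) /\ Ck_fun M k (fun x => complex.Im (u x)).

Definition compactly_supported (u : X -> R[i]) :=
  compact (closure [set x | u x != 0]).

Definition Cck M (k : nat) : set (X -> R[i]) :=
  [set u | Ck_cfun M k u /\ compactly_supported u].

Definition Cc_infty M : set (X -> R[i]) :=
  [set u | (forall k, Ck_cfun M k u) /\ compactly_supported u].

(* [A i p] is the row of components at [p], in the chart [i], of a 1-form; the
   Jacobian acts on row vectors, so a tangent vector with components [v] in the
   chart [i] has components [v *m 'J (transition i j) _] in the chart [j]. *)
Definition one_form M (k : nat) (A : idx M -> X -> 'rV[R]_n) :=
  (forall (i : idx M) (a : 'I_n), Ck_on k (chart_cod (chart_of i))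
     (fun y => A i (chart_inv (chart_of i) y) 0 a)) /\
  (forall (i j : idx M) p, overlap i j p ->
     A i p = A j p *m (jacobian (transition i j) (chart_map (chart_of i) p))^T).

Definition riemannian_metric M (k : nat) (g : idx M -> X -> 'M[R]_n) :=
  [/\ (forall (i : idx M) (a b : 'I_n), Ck_on k (chart_cod (chart_of i))
         (fun y => g i (chart_inv (chart_of i) y) a b)),
      (forall (i : idx M) p, chart_dom (chart_of i) p -> (g i p)^T = g i p),
      (forall (i : idx M) p, chart_dom (chart_of i) p ->
         forall v : 'rV[R]_n, v != 0 -> 0 < (v *m g i p *m v^T) 0 0) &
      forall (i j : idx M) p, overlap i j p ->
        let J := jacobian (transition i j) (chart_map (chart_of i) p) in
        g i p = J *m g j p *m J^T].

(* On a second countable manifold, countably many charts cover [X], so that this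
   determines [mu]. *)
Definition is_density_measure M (w : idx M -> X -> R)
    (mu : {measure set (borel X) -> \bar R}) :=
  forall (i : idx M) (B : set (borel X)), measurable B ->
    B `<=` chart_dom (chart_of i) ->
    mu B = (\int[@lebesgue_rV R n : set (borel 'rV[R]_n) -> \bar R]_(
      y in chart_map (chart_of i) @` B)
        (w i (chart_inv (chart_of i) y))%:E)%E.

Definition locally_L2 (mu : {measure set (borel X) -> \bar R}) (f : X -> R) :=
  measurable_fun [set: borel X] (f : borel X -> R) /\
  forall C : set X, compact C ->
    (\int[mu]_(x in C) ((f x) ^+ 2)%:E < +oo)%E.

Definition cpartial c (a : 'I_n) (F : X -> R[i]) (p : X) : R[i] :=
  'D_(basis_rV R a) (fun y => complex.Re (F (chart_inv c y))) (chart_map c p) +i*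
  'D_(basis_rV R a) (fun y => complex.Im (F (chart_inv c y))) (chart_map c p).

Definition mom c (a : 'I_n) (F : X -> R[i]) (p : X) : R[i] :=
  - 'i * cpartial c a F p.

Definition magnetic_mom c (a : 'I_n) (Aa : X -> R) (F : X -> R[i]) (p : X) : R[i] :=
  mom c a F p - (Aa p)%:C * F p.

(* w^-1 (D_j - A_j) w h^{jk} (D_k - A_k), where j and k run over the coordinates
   of the chart that are selected by [s] *)
Definition magnetic_laplacian c (m : nat) (s : 'I_m -> 'I_n) (w : X -> R)
    (h : X -> 'M[R]_m) (A : 'I_m -> X -> R) (F : X -> R[i]) (p : X) : R[i] :=
  ((w p)^-1)%:C * \sum_(j < m) magnetic_mom c (s j) (A j)
    (fun q => (w q)%:C * \sum_(k < m)
       (h q j k)%:C * magnetic_mom c (s k) (A k) F q) p.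

End Manifold.

(* Coordinate 0 is time. *)
Definition time_chart (R : realType) (X : ptopologicalType) n (c : chart R X n) :
    chart R (R * X)%type (1 + n) :=
  Chart (setT `*` chart_dom c)
        (fun q => row_mx (q.1%:M : 'M[R]_1) (chart_map c q.2))
        (fun y => (lsubmx y 0 0, chart_inv c (rsubmx y))).

Definition time_atlas (R : realType) (X : ptopologicalType) n (S : atlas R X n) :
    atlas R (R * X)%type (1 + n) :=
  @Atlas R (R * X)%type (1 + n) (idx S) (fun i => time_chart (chart_of i))
    (fun q => chart_at S q.2).

Definition time_independent (R : realType) (X W : Type) (f : R * X -> W) :=
  forall s t p, f (s, p) = f (t, p).

Section Static.
Context (R : realType) (X : ptopologicalType) (n : nat) (S : atlas R X n).
Variables (beta : X -> R) (g : idx S -> X -> 'M[R]_n).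
Variables (A : idx (time_atlas S) -> R * X -> 'rV[R]_(1 + n)) (Y : R * X -> R).

Definition time_index : 'I_(1 + n) := lshift n ord0.
Definition space_index (j : 'I_n) : 'I_(1 + n) := rshift 1 j.

Definition static_metric (i : idx S) (p : X) : 'M[R]_(1 + n) :=
  block_mx (- beta p)%:M 0 0 (g i p).

Definition static_density (i : idx S) (p : X) : R :=
  Num.sqrt `|\det (static_metric i p)|.

(* The spatial components g^{jk} of the inverse metric. *)
Definition static_inv (i : idx S) (p : X) : 'M[R]_n :=
  drsubmx (invmx (static_metric i p)).

(* V = - A_0, which does not depend on the chart of X that is used *)
Definition static_V (q : R * X) : R :=
  - A (chart_at (time_atlas S) q) q 0 time_index.

(* The expressions below are invariant under changes of coordinates on X; they
   are evaluated at each point in the chart selected by [chart_at]. Objects on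
   R x X that are independent of time are restricted to X at time 0. *)
Definition op_L (u : X -> R[i]) (p : X) : R[i] :=
  let i := chart_at S p in
  let sqrt_beta q := (Num.sqrt (beta q))%:C in
  sqrt_beta p *
    magnetic_laplacian (chart_of i) id (static_density i) (static_inv i)
      (fun j x => A i (0, x) 0 (space_index j)) (fun x => sqrt_beta x * u x) p
  + (beta p * Y (0, p))%:C * u p.

Definition op_DtV (i : idx (time_atlas S)) (F : R * X -> R[i]) (q : R * X) : R[i] :=
  mom (chart_of i) time_index F q + (static_V q)%:C * F q.

Definition op_K (u : R * X -> R[i]) (q : R * X) : R[i] :=
  let i := chart_at (time_atlas S) q in
  - ((beta q.2)^-1)%:C * op_DtV i (op_DtV i u) q
  + magnetic_laplacian (chart_of i) space_index
      (fun r => static_density i r.2) (fun r => static_inv i r.2)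
      (fun j r => A i r 0 (space_index j)) u q
  + (Y q)%:C * u q.

End Static.

(* Main.v *)
(* The operator K is symmetric by integration by parts in charts, so it is enough that its
   adjoint be symmetric, i.e. <h,b> = <v,c> for all (v,h), (b,c) in the adjoint graph. Since
   sqrt(beta) K sqrt(beta) = -(D_t + V)^2 + L, testing (v,h) against
   rho(s - t) sqrt(beta) psi(x), with rho a mollifier and psi smooth with compact support in
   Sigma, shows that each slice at time s of the mollification in time of v / sqrt(beta) lies
   in the domain of L^*, with an explicit image. Essential self-adjointness makes L^*
   symmetric on each slice; after integration over s the terms with time derivatives cancel,
   because convolutions in time commute with translations, the terms with V cancel because V
   is a real multiplication, and the limit of concentrating mollifiers gives the claim. The
   chart independence of the differential expressions, needed for the symmetry of K, follows
   from that of their weak form. *)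

Require Import Defs.
From HB Require Import structures.
From mathcomp Require Import all_boot all_order all_algebra.
From mathcomp Require Import all_classical all_reals all_analysis.
From mathcomp Require Import measurable_realfun.
From mathcomp Require Import ring lra.

Set Implicit Arguments.
Unset Strict Implicit.
Unset Printing Implicit Defensive.

Import Order.TTheory GRing.Theory Num.Theory.
Import numFieldNormedType.Exports.

Local Open Scope classical_set_scope.
Local Open Scope ring_scope.

(** * Hilbert space projection *)

(** Mollification in time takes the place of a Fourier decomposition. For a mollified function
    [-(D_t + V)^2] acts on each slice by functions already in L2, because all time derivatives fall
    on [rho] and [V] is bounded; the only unbounded operator left on a slice is [L]. An element of
    the adjoint domain has no regularity to exploit and [Y] is merely locally L2, so the adjoint
    relation is only ever used after pairing with explicit test functions. Three features shape the
    details. Elements of L2 are functions and not classes, so inner products are semidefinite, and a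
    slice at a given time makes sense only for representatives whose time sections are all square
    integrable ([nice]). [beta] is only C^2, so the packets [sqrt(beta) rho psi] are only C^2, even
    for smooth [psi]; accordingly truncated powers of polynomials serve as mollifiers and cutoffs.
    The measures are prescribed by their densities in charts, so the measure on [R * Sigma] has to
    be identified with a product measure before Fubini can be used. The bounds on [beta] make
    multiplication by [sqrt(beta)] and by its inverse bounded on L2. *)

Lemma le_eps_eq0 (R : realType) (c x : R) : (forall e, 0 < e -> `|x| <= c * e) -> x = 0.
Proof.
move=> h; apply/eqP; apply/negPn/negP => x0.
have x1 : 0 < `|x| by rewrite normr_gt0.
have c0 : 0 < `|c| + 1 by rewrite ltr_wpDl.
have := h (`|x| / (2 * (`|c| + 1))); rewrite divr_gt0 ?mulr_gt0 // => /(_ isT).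
apply/negP; rewrite -ltNge.
apply: (@le_lt_trans _ _ ((`|c| + 1) * (`|x| / (2 * (`|c| + 1))))).
  rewrite ler_wpM2r ?divr_ge0 ?mulr_ge0 ?addr_ge0 //.
  by apply: (le_trans (ler_norm c)); rewrite lerDl.
have -> : (`|c| + 1) * (`|x| / (2 * (`|c| + 1))) = `|x| / 2 by field; rewrite gt_eqF.
by rewrite ltr_pdivrMr // ltr_pMr // ltr1n.
Qed.

Lemma div_succ_le (R : realType) (e w : R) : 0 <= e -> 0 <= w ->
  e / (4 * (w + 1)) * w <= e / 4.
Proof.
move=> e0 w0.
have -> : e / (4 * (w + 1)) * w = e / 4 - e / (4 * (w + 1)).
  by field; rewrite gt_eqF // ltr_wpDl.
by rewrite gerBl divr_ge0 // mulr_ge0 // addr_ge0.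
Qed.

Section Projection.
Context (R : realType) (V : lmodType R) (H : set V) (ip : V -> V -> R).
Hypotheses (H_lin : forall (k : R) u v, H u -> H v -> H (k *: u + v))
  (ipC : forall u v, H u -> H v -> ip u v = ip v u)
  (ipL : forall (k : R) u v w, H u -> H v -> H w ->
     ip (k *: u + v) w = k * ip u w + ip v w)
  (ip_ge0 : forall u, H u -> 0 <= ip u u)
  (H_complete : forall u : nat -> V, (forall n, H (u n)) ->
     (forall e : R, 0 < e -> exists N, forall n m, (N <= n)%N -> (N <= m)%N ->
        ip (u n - u m) (u n - u m) < e) ->
     exists2 l, H l & forall e : R, 0 < e ->
       exists N, forall n, (N <= n)%N -> ip (l - u n) (l - u n) < e).

Lemma ipR (k : R) u v w : H u -> H v -> H w ->
  ip w (k *: u + v) = k * ip w u + ip w v.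
Proof.
move=> Hu Hv Hw; rewrite ipC ?ipL //; last exact: H_lin.
by congr (_ * _ + _); exact: ipC.
Qed.

Lemma ip_norm_lin (k : R) u v : H u -> H v ->
  ip (k *: u + v) (k *: u + v) = k ^+ 2 * ip u u + 2 * k * ip u v + ip v v.
Proof.
move=> Hu Hv; rewrite ipL ?ipR //; last exact: H_lin.
rewrite (ipC Hv Hu); ring.
Qed.

(** [ip] is only semidefinite. If [ip u u = 0] the quadratic in [k] is affine, and its positivity
    for all [k] forces [ip u v = 0]; otherwise it is evaluated at its minimum. *)
Lemma ip_cauchy_schwarz u v : H u -> H v -> (ip u v) ^+ 2 <= ip u u * ip v v.
Proof.
move=> Hu Hv.
have P k : 0 <= k ^+ 2 * ip u u + 2 * k * ip u v + ip v v.
  by rewrite -ip_norm_lin //; apply: ip_ge0; exact: H_lin.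
have Q k : 0 <= k ^+ 2 * ip v v + 2 * k * ip u v + ip u u.
  by rewrite (ipC Hu Hv) -ip_norm_lin //; apply: ip_ge0; exact: H_lin.
have u0 := ip_ge0 Hu; have v0 := ip_ge0 Hv.
have [u00|un0] := eqVneq (ip u u) 0.
  rewrite u00 mul0r.
  have := P (- (ip v v + 1) * ip u v / (2 * (ip v v + 1)) - ip u v * (ip v v)).
  have := P (- (ip v v + 1) * ip u v); rewrite u00.
  move=> h _.
  have : 0 <= - (2 * (ip v v + 1) * ip u v ^+ 2) + ip v v.
    by move: h; congr (0 <= _); ring.
  have [->|w0] := eqVneq (ip u v) 0; first by rewrite expr0n.
  move=> _.
  (* At this [k] the affine function takes the value -1. *)
  have h2 := P (- (ip v v + 1) / (2 * ip u v)); rewrite u00 mulr0 add0r in h2.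
  exfalso; move: h2.
  have -> : 2 * (- (ip v v + 1) / (2 * ip u v)) * ip u v = - (ip v v + 1).
    by field.
  by lra.
have := P (- ip u v / ip u u).
have -> : (- ip u v / ip u u) ^+ 2 * ip u u + 2 * (- ip u v / ip u u) * ip u v
    + ip v v = ip v v - ip u v ^+ 2 / ip u u by field.
rewrite subr_ge0 ler_pdivrMr; last by rewrite lt_neqAle eq_sym un0.
by rewrite mulrC.
Qed.

Lemma H_sub u v : H u -> H v -> H (u - v).
Proof. by move=> Hu Hv; rewrite addrC -scaleN1r; exact: H_lin. Qed.

(* The minimizing sequence for the distance from [f] to [G] is Cauchy by the
   parallelogram identity. *)
Lemma projection (G : set V) (f : V) :
  G 0 -> (forall (k : R) u v, G u -> G v -> G (k *: u + v)) -> G `<=` H -> H f ->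
  exists p, [/\ H p,
    forall e : R, 0 < e -> exists2 g, G g & ip (p - g) (p - g) < e &
    forall g, G g -> ip (f - p) g = 0].
Proof.
move=> G0 G_lin GH Hf.
pose D := [set ip (f - g) (f - g) | g in G].
have D0 : D !=set0 by exists (ip (f - 0) (f - 0)), 0.
have Dlb : has_lbound D.
  by exists 0 => _ [g Gg <-]; apply/ip_ge0/H_sub => //; exact: GH.
have Dinf : has_inf D by [].
pose d := inf D.
have dle g : G g -> d <= ip (f - g) (f - g) by move=> Gg; apply: ge_inf => //; exists g.
have /choice [u uP] : forall n : nat, exists g, G g /\ ip (f - g) (f - g) < d + n.+1%:R^-1.
  move=> n; have n0 : 0 < n.+1%:R^-1 :> R by rewrite invr_gt0 ltr0n.
  by have [_ [g Gg <-] lt] := inf_adherent n0 Dinf; exists g.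
have uG n : G (u n) by case: (uP n).
have uH n : H (u n) by apply: GH.
have small (e : R) : 0 < e -> exists N : nat, forall n, (N <= n)%N -> n.+1%:R^-1 < e.
  move=> e0; have [N _ HN] := near_infty_natSinv_lt (PosNum e0).
  by exists N => n Nn; exact: (HN n Nn).
have par n m : ip (u n - u m) (u n - u m) <=
    2 * (n.+1%:R^-1 + m.+1%:R^-1).
  pose a := f - u n; pose b := f - u m.
  have Ha : H a by exact: H_sub.
  have Hb : H b by exact: H_sub.
  have Gm : G ((2^-1 : R) *: u n + (2^-1 : R) *: u m).
    by apply: (G_lin) => //; rewrite -[_ *: u m]addr0; apply: (G_lin).
  have Hm := dle _ Gm.
  have E1 : f - ((2^-1 : R) *: u n + (2^-1 : R) *: u m) = (2^-1 : R) *: a + (2^-1 : R) *: b.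
    rewrite /a /b !scalerBr addrACA -scalerDl -opprD.
    have -> : 2^-1 + 2^-1 = 1 :> R by field.
    by rewrite scale1r.
  have E2 : u n - u m = (-1 : R) *: a + b.
    by rewrite /a /b scaleN1r opprB addrA subrK.
  have Hhb : H ((2^-1 : R) *: b).
    by rewrite -[_ *: b]addr0; apply: H_lin => //; exact: GH.
  have bb : ip ((2^-1:R) *: b) ((2^-1:R) *: b) = 4^-1 * ip b b.
    have Hz : H 0 by exact: GH.
    have z : ip 0 0 = 0.
      have := ip_norm_lin 1 Hz Hz; rewrite scaler0 addr0; lra.
    have zb : ip b 0 = 0.
      have := ipR (-1) Hb Hb Hb; rewrite scaleN1r addrC subrr; lra.
    rewrite -[_ *: b]addr0 ip_norm_lin // z zb mulr0 !addr0.
    by congr (_ * _); field.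
  have ab : ip a ((2^-1:R) *: b) = 2^-1 * ip a b.
    have Hz : H 0 by exact: GH.
    have za : ip a 0 = 0.
      have := ipR (-1) Ha Ha Ha; rewrite scaleN1r addrC subrr; lra.
    by rewrite -[_ *: b]addr0 ipR // za addr0.
  move: Hm; rewrite E1 E2 !ip_norm_lin // bb ab => Hm.
  have [_ Ua] := uP n; have [_ Ub] := uP m.
  move: Ua Ub; rewrite -/a -/b.
  rewrite sqrrN expr1n mul1r.
  move: (n.+1%:R^-1) (m.+1%:R^-1) => r s Ua Ub.
  by move: Hm; have -> : 2 / 2 = 1 :> R by [field]; have -> : 2^-1 ^+ 2 = 4^-1 :> R by [field]; lra.
have [|p Hp pP] := H_complete uH.
  move=> e e0; have e4 : 0 < e / 4 by rewrite divr_gt0.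
  have [N NP] := small _ e4; exists N => n m Nn Nm.
  apply: le_lt_trans (par n m) _; move: (NP _ Nn) (NP _ Nm).
  by move: (n.+1%:R^-1) (m.+1%:R^-1) => r s; lra.
exists p; split => //.
  move=> e e0; have [N NP] := pP _ e0; exists (u N) => //; exact: NP.
move=> g Gg; have Hg := GH _ Gg.
have Hfp : H (f - p) by exact: H_sub.
(* Minimality is known for elements of [G], while [p] is merely a limit of them; here it is
   transferred to [p]. *)
have dle2 k : d <= ip (f - p) (f - p) + 2 * k * ip g (f - p) + k ^+ 2 * ip g g.
  have -> : ip (f - p) (f - p) + 2 * k * ip g (f - p) + k ^+ 2 * ip g g =
      ip (k *: g + (f - p)) (k *: g + (f - p)) by rewrite ip_norm_lin //; ring.
  set w := k *: g + _; have Hw : H w by exact: H_lin.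
  rewrite leNgt; apply/negP => wd.
  (* w + (p - u n) = f - (u n - k g) has squared norm >= d, and p - u n -> 0 *)
  pose e := d - ip w w; have e0 : 0 < e by rewrite subr_gt0.
  have W0 := ip_ge0 Hw.
  (* The weight of Young's inequality for the cross term. With [ip q q < t * e / 8] the errors are
     at most [e/4], [e/8] and [e/8], in total less than [e]. *)
  pose t := Num.min 1 (e / (4 * (ip w w + 1))).
  have t0 : 0 < t by rewrite lt_min ltr01 divr_gt0 // mulr_gt0 // ltr_wpDl.
  have s0 : 0 < (t / 2) ^+ 2 * 1 by rewrite mulr1 exprn_gt0 // divr_gt0.
  have [N NP] := pP _ (divr_gt0 (mulr_gt0 t0 e0) (ltr0Sn _ 7)).
  have /NP {}NP := leqnn N.
  set q := p - u N in NP; have Hq : H q by exact: H_sub.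
  have Gq : G ((- k) *: g + u N) by exact: (G_lin).
  have := dle _ Gq.
  have -> : f - (- k *: g + u N) = 1 *: w + q.
    by rewrite scale1r /w /q scaleNr opprD opprK -[RHS]addrA [f - p + _]addrA subrK addrCA.
  rewrite ip_norm_lin // expr1n !mul1r mulr1 leNgt => /negP; apply.
  have cs := ip_cauchy_schwarz Hw Hq.
  have q0 := ip_ge0 Hq.
  (* 2 <w,q> <= t |w|^2 + |q|^2 / t *)
  have young : 2 * ip w q <= t * ip w w + t^-1 * ip q q.
    have := ip_ge0 (H_lin (- t) Hw Hq).
    rewrite ip_norm_lin // => h.
    have h2 : 0 <= t^-1 * ((- t) ^+ 2 * ip w w + 2 * - t * ip w q + ip q q).
      by rewrite mulr_ge0 // invr_ge0 ltW.
    have E : t^-1 * ((- t) ^+ 2 * ip w w + 2 * - t * ip w q + ip q q) =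
      t * ip w w - 2 * ip w q + t^-1 * ip q q by field; rewrite gt_eqF.
    by move: h2; rewrite E; lra.
  have tw : t * ip w w <= e / 4.
    apply: le_trans (div_succ_le (ltW e0) W0).
    by rewrite ler_wpM2r // /t ge_min lexx orbT.
  have tq : t^-1 * ip q q <= e / 8.
    by rewrite mulrC ler_pdivrMr //; have := ltW NP; rewrite (mulrC t); lra.
  have qe : ip q q <= e / 8.
    apply: (le_trans (ltW NP)); rewrite ler_pM2r // -[leRHS]mul1r ler_wpM2r ?(ltW e0) //.
    by rewrite /t ge_min lexx.
  have -> : d = ip w w + e by rewrite /e addrC subrK.
  by lra.
(* The infimum is attained at [p]: the same weighted inequality, now as a lower bound for
   [f - u N = w + q], contradicts the near-minimality of [u N]. *)
have dfp : ip (f - p) (f - p) <= d.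
  rewrite leNgt; apply/negP => wd.
  pose w := f - p; pose e := ip w w - d; have e0 : 0 < e by rewrite subr_gt0.
  have W0 := ip_ge0 Hfp.
  pose t := Num.min 1 (e / (4 * (ip w w + 1))).
  have t0 : 0 < t by rewrite lt_min ltr01 divr_gt0 // mulr_gt0 // ltr_wpDl.
  have [N1 NP1] := pP _ (divr_gt0 (mulr_gt0 t0 e0) (ltr0Sn _ 7)).
  have e8 : 0 < e / 8 by rewrite divr_gt0.
  have [N2 NP2] := small _ e8.
  pose N := maxn N1 N2.
  have /NP1 {}NP := leq_maxl N1 N2; have {NP2}/NP2 sm := leq_maxr N1 N2.
  set q := p - u N in NP; have Hq : H q by exact: H_sub.
  have [_] := uP N.
  have -> : f - u N = 1 *: w + q by rewrite scale1r /w /q addrA subrK.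
  rewrite ip_norm_lin // expr1n !mul1r mulr1.
  have young : - 2 * ip w q <= t * ip w w + t^-1 * ip q q.
    have := ip_ge0 (H_lin t Hfp Hq).
    rewrite ip_norm_lin // => h.
    have h2 : 0 <= t^-1 * (t ^+ 2 * ip w w + 2 * t * ip w q + ip q q).
      by rewrite mulr_ge0 // invr_ge0 ltW.
    have E : t^-1 * (t ^+ 2 * ip w w + 2 * t * ip w q + ip q q) =
      t * ip w w + 2 * ip w q + t^-1 * ip q q by field; rewrite gt_eqF.
    by move: h2; rewrite E; lra.
  have tw : t * ip w w <= e / 4.
    apply: le_trans (div_succ_le (ltW e0) W0).
    by rewrite ler_wpM2r // /t ge_min lexx orbT.
  have tq : t^-1 * ip q q <= e / 8.
    by rewrite mulrC ler_pdivrMr //; have := ltW NP; rewrite (mulrC t); lra.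
  have q0 := ip_ge0 Hq.
  have dE : d = ip w w - e by rewrite /e opprB addrC subrK.
  by move: (N.+1%:R^-1) sm => s sm; lra.
have key k : 0 <= 2 * k * ip g (f - p) + k ^+ 2 * ip g g.
  by have := dle2 k; lra.
rewrite (ipC Hfp Hg); set x := ip g (f - p) in key *.
have g0 := ip_ge0 Hg.
apply/eqP; apply/negPn/negP => x0.
(* Close to the minimizer of the quadratic; the [+ 1] keeps the denominator positive when
   [ip g g = 0]. *)
have := key (- x / (ip g g + 1)).
have -> : 2 * (- x / (ip g g + 1)) * x + (- x / (ip g g + 1)) ^+ 2 * ip g g =
  - (x ^+ 2 * (ip g g + 2) / (ip g g + 1) ^+ 2).
  by field; rewrite gt_eqF // ltr_wpDl.
rewrite oppr_ge0 leNgt => /negP; apply.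
rewrite divr_gt0 // ?exprn_gt0 ?ltr_wpDl // mulr_gt0 ?ltr_wpDl //.
by rewrite exprn_even_gt0.
Qed.

End Projection.

(** * Square integrable real functions *)

Section RealL2.
Context d (T : measurableType d) (R : realType) (mu : {measure set T -> \bar R}).
Implicit Types f g h : T -> R.

Definition l2 f := measurable_fun setT f /\ (\int[mu]_x (f x ^+ 2)%:E < +oo)%E.

Definition ip f g : R := \int[mu]_x (f x * g x).

Lemma l2_sqr f : l2 f -> mu.-integrable setT (EFin \o (fun x => f x ^+ 2)).
Proof.
move=> [mf lf]; apply/integrableP; split.
  by apply/measurable_EFinP; exact: measurable_funX.
apply: le_lt_trans lf; apply: ge0_le_integral => //.
- by apply: measurableT_comp => //; apply/measurable_EFinP; exact: measurable_funX.
- by apply/measurable_EFinP; exact: measurable_funX.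
- by move=> x _ /=; rewrite lee_fin ger0_norm ?sqr_ge0.
Qed.

Lemma l2_int f g : l2 f -> l2 g -> mu.-integrable setT (EFin \o (fun x => f x * g x)).
Proof.
move=> lf lg; have [mf _] := lf; have [mg _] := lg.
apply: (@le_integrable _ _ _ mu setT measurableT _
    ((EFin \o (fun x => (f x ^+ 2)%R)) \+ (EFin \o (fun x => (g x ^+ 2)%R)))%E).
- by apply/measurable_EFinP; exact: measurable_funM.
- move=> x _; rewrite (_ : (_ + _)%E = (f x ^+ 2 + g x ^+ 2)%:E) //=.
  rewrite lee_fin normrM [leRHS]ger0_norm ?addr_ge0 ?sqr_ge0 //.
  rewrite -(real_normK (num_real (f x))) -(real_normK (num_real (g x))).
  have := sqr_ge0 (`|f x| - `|g x|).
  have := mulr_ge0 (normr_ge0 (f x)) (normr_ge0 (g x)).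
  by move: (`|f x|) (`|g x|) => a b; nra.
- by apply: integrableD => //; exact: l2_sqr.
Qed.

Lemma l2M_bounded f h (M : R) : measurable_fun setT h -> (forall x, `|h x| <= M) ->
  l2 f -> l2 (fun x => h x * f x).
Proof.
move=> mh hM lf; have [mf _] := lf; split; first exact: measurable_funM.
have M0 (x : T) : 0 <= M by exact: le_trans (normr_ge0 (h x)) (hM x).
have /integrableP[_] := integrableZl measurableT (M ^+ 2) (l2_sqr lf).
apply: le_lt_trans; apply: ge0_le_integral => //.
- by move=> x _; rewrite lee_fin sqr_ge0.
- apply/measurable_EFinP/measurable_funX; exact: measurable_funM.
- apply: measurableT_comp => //; apply: measurable_funeM.
  by apply/measurable_EFinP; exact: measurable_funX.
- move=> x _ /=; rewrite lee_fin [leRHS]ger0_norm; last by rewrite mulr_ge0 // sqr_ge0.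
  rewrite exprMn ler_wpM2r ?sqr_ge0 // -(real_normK (num_real (h x))).
  by rewrite lerXn2r ?nnegrE ?hM ?(M0 x).
Qed.

Lemma l2_le f g : measurable_fun setT f -> (forall x, `|f x| <= `|g x|) -> l2 g -> l2 f.
Proof.
move=> mf fg [mg lg]; split => //; apply: le_lt_trans lg; apply: ge0_le_integral => //.
- by move=> x _; rewrite lee_fin sqr_ge0.
- by apply/measurable_EFinP; exact: measurable_funX.
- by apply/measurable_EFinP; exact: measurable_funX.
- move=> x _; rewrite lee_fin -(real_normK (num_real (f x))) -(real_normK (num_real (g x))).
  by rewrite lerXn2r ?nnegrE.
Qed.

Lemma l2Z f (k : R) : l2 f -> l2 (fun x => k * f x).
Proof. by apply: (@l2M_bounded f (cst k) `|k|) => //= x; exact: measurable_cst. Qed.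

Lemma l2_0 : l2 (fun=> 0).
Proof.
split; first exact: measurable_cst.
under eq_integral do rewrite expr0n /=.
by rewrite integral0_eq.
Qed.

Lemma l2D f g : l2 f -> l2 g -> l2 (fun x => f x + g x).
Proof.
move=> lf lg; have [mf _] := lf; have [mg _] := lg.
split; first exact: measurable_funD.
have /integrableP[_] := integrableD measurableT
  (integrableZl measurableT 2 (l2_sqr lf)) (integrableZl measurableT 2 (l2_sqr lg)).
apply: le_lt_trans; apply: ge0_le_integral => //.
- by move=> x _; rewrite lee_fin sqr_ge0.
- by apply/measurable_EFinP/measurable_funX; exact: measurable_funD.
- apply: measurableT_comp => //; apply: emeasurable_funD; apply: measurable_funeM;
    by apply/measurable_EFinP; exact: measurable_funX.
- move=> x _.
  rewrite (_ : (_ + _)%E = (2 * f x ^+ 2 + 2 * g x ^+ 2)%:E) //.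
  rewrite /= lee_fin [leRHS]ger0_norm; last first.
    by rewrite addr_ge0 // mulr_ge0 // sqr_ge0.
  have := sqr_ge0 (f x - g x); rewrite -subr_ge0 -[in X in _ -> X]subr_ge0.
  by congr (0 <= _); ring.
Qed.

Lemma l2N f : l2 f -> l2 (fun x => - f x).
Proof.
move=> lf; have := l2Z (-1) lf; congr (l2 _); apply/funext => x; ring.
Qed.

Lemma l2B f g : l2 f -> l2 g -> l2 (fun x => f x - g x).
Proof. by move=> lf lg; exact: (l2D lf (l2N lg)). Qed.

Lemma ipC f g : ip f g = ip g f.
Proof. by rewrite /ip; apply: eq_Rintegral => x _; rewrite mulrC. Qed.

Lemma ipDl f g h : l2 f -> l2 g -> l2 h -> ip (fun x => f x + g x) h = ip f h + ip g h.
Proof.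
move=> lf lg lh; rewrite /ip -RintegralD //; try exact: l2_int.
by apply: eq_Rintegral => x _; rewrite mulrDl.
Qed.

Lemma ipZl (k : R) f h : l2 f -> l2 h -> ip (fun x => k * f x) h = k * ip f h.
Proof.
move=> lf lh; rewrite /ip -RintegralZl //; last exact: l2_int.
by apply: eq_Rintegral => x _; rewrite mulrA.
Qed.

Lemma ipNl f h : l2 f -> l2 h -> ip (fun x => - f x) h = - ip f h.
Proof.
move=> lf lh; rewrite -mulN1r -ipZl //; congr ip; apply/funext => x; ring.
Qed.

Lemma ipBl f g h : l2 f -> l2 g -> l2 h -> ip (fun x => f x - g x) h = ip f h - ip g h.
Proof. by move=> lf lg lh; rewrite ipDl ?ipNl //; exact: l2N. Qed.

Lemma ipDr f g h : l2 f -> l2 g -> l2 h -> ip h (fun x => f x + g x) = ip h f + ip h g.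
Proof. by move=> *; rewrite ipC ipDl // !(ipC h). Qed.

Lemma ipZr (k : R) f h : l2 f -> l2 h -> ip h (fun x => k * f x) = k * ip h f.
Proof. by move=> *; rewrite ipC ipZl // (ipC h). Qed.

Lemma ipNr f h : l2 f -> l2 h -> ip h (fun x => - f x) = - ip h f.
Proof. by move=> *; rewrite ipC ipNl // (ipC h). Qed.

Lemma ipBr f g h : l2 f -> l2 g -> l2 h -> ip h (fun x => f x - g x) = ip h f - ip h g.
Proof. by move=> *; rewrite ipC ipBl // !(ipC h). Qed.

Lemma ip_ge0 f : 0 <= ip f f.
Proof. by apply: Rintegral_ge0 => x _; rewrite -expr2 sqr_ge0. Qed.

Lemma ipE f : l2 f -> (\int[mu]_x (f x ^+ 2)%:E)%E = (ip f f)%:E.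
Proof.
move=> lf; rewrite /ip /Rintegral fineK; last exact/integrable_fin_num/l2_int.
by apply: eq_integral => x _; rewrite expr2.
Qed.

Lemma l2_ae f g : measurable_fun setT g -> {ae mu, forall x, f x = g x} -> l2 f -> l2 g.
Proof.
move=> mg fg [mf lf]; split => //.
suff <- : (\int[mu]_x (f x ^+ 2)%:E = \int[mu]_x (g x ^+ 2)%:E)%E by [].
apply: ae_eq_integral => //.
- by apply/measurable_EFinP/measurable_funX.
- by apply/measurable_EFinP/measurable_funX.
- by apply: filterS fg => x /= -> .
Qed.

Lemma ip_ae f f' g : l2 f -> l2 f' -> l2 g -> {ae mu, forall x, f x = f' x} ->
  ip f g = ip f' g.
Proof.
move=> lf lf' lg ff'; rewrite /ip /Rintegral; congr fine.
apply: ae_eq_integral => //; try by apply: (measurable_int mu); exact: l2_int.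
by apply: filterS ff' => x /= -> .
Qed.

Lemma ip_cs f g : l2 f -> l2 g -> (ip f g) ^+ 2 <= ip f f * ip g g.
Proof.
move=> lf lg.
apply: (@ip_cauchy_schwarz R (T -> R) l2 ip) => //.
- by move=> k u v lu lv; exact: (l2D (l2Z k lu) lv).
- by move=> u v *; exact: ipC.
- move=> k u v w lu lv lw; have := ipDl (l2Z k lu) lv lw.
  by rewrite ipZl.
- by move=> u _; exact: ip_ge0.
Qed.

Lemma ipD_le f g : l2 f -> l2 g ->
  ip (fun x => f x + g x) (fun x => f x + g x) <= 2 * ip f f + 2 * ip g g.
Proof.
move=> lf lg; have := ip_ge0 (fun x => f x - g x).
rewrite (ipBl lf lg (l2B lf lg)) (ipBr lf lg lf) (ipBr lf lg lg).
rewrite (ipDl lf lg (l2D lf lg)) (ipDr lf lg lf) (ipDr lf lg lg).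
rewrite (ipC g f); lra.
Qed.

(* Along a fast subsequence, [sum 2^k d_k^2] is integrable and
   [|d_k| <= 2^-k + 2^k d_k^2], so that the increments [d_k] are summable a.e. *)
Lemma l2_fast_cvg (u : nat -> T -> R) : (forall n, l2 (u n)) ->
  (forall n, ip (fun x => u n.+1 x - u n x) (fun x => u n.+1 x - u n x) <= 4^-1 ^+ n) ->
  exists v : nat -> T -> R, [/\ forall n, measurable_fun setT (v n),
    forall n, {ae mu, forall x, v n x = u n x} &
    forall x, cvgn (v ^~ x)].
Proof.
move=> lu fast.
pose dd k x := u k.+1 x - u k x.
have ld k : l2 (dd k) by exact: l2B.
pose F k x := ((2 ^+ k * dd k x ^+ 2)%:E : \bar R).
have F0 k x : (0 <= F k x)%E by rewrite lee_fin mulr_ge0 ?sqr_ge0 // exprn_ge0.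
have mF k : measurable_fun setT (F k).
  apply/measurable_EFinP; apply: measurable_funM => //.
  by apply: measurable_funX; case: (ld k).
pose S x := (\sum_(k <oo) F k x)%E.
have mS : measurable_fun setT S by apply: ge0_emeasurable_sum.
have intF k : (\int[mu]_x F k x <= (2^-1 ^+ k)%:E)%E.
  have -> : (\int[mu]_x F k x = (2 ^+ k)%:E * \int[mu]_x (dd k x ^+ 2)%:E)%E.
    rewrite -ge0_integralZl //.
    - by apply/measurable_EFinP/measurable_funX; case: (ld k).
    - by move=> x _; rewrite lee_fin sqr_ge0.
  rewrite ipE // -EFinM lee_fin.
  apply: le_trans (ler_wpM2l _ (fast k)) _; first by rewrite exprn_ge0.
  by rewrite -exprMn (_ : 2 * 4^-1 = 2^-1) //; field.
have Soo : (\int[mu]_x S x < +oo)%E.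
  rewrite integral_nneseries //.
  apply: (@le_lt_trans _ _ (\sum_(k <oo) (2^-1 ^+ k)%:E)%E).
    by apply: lee_nneseries => k *; [apply: integral_ge0 => x _; exact: F0 | exact: intF].
  have -> : (\sum_(k <oo) ((2^-1 : R) ^+ k)%:E = 2%:E)%E.
    apply/cvg_lim => //.
    have -> : (fun n => (\sum_(0 <= k < n) ((2^-1 : R) ^+ k)%:E)%E) =
       EFin \o (series (geometric 1 (2^-1:R))).
      apply/funext => n /=; rewrite sumEFin /series /= /geometric /=.
      by congr EFin; apply: eq_bigr => i _; rewrite mul1r.
    apply: cvg_EFin; first by near=> n.
    have h := @cvg_geometric_series R 1 2^-1; rewrite [X in _ --> X](_ : 2 = 1 * (1 - 2^-1)^-1); last by field.
    apply: h.
    by rewrite ger0_norm ?invr_ge0 // invf_lt1 // ltr1n.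
  by rewrite ltry.
have iS : mu.-integrable setT S.
  apply/integrableP; split => //; apply: le_lt_trans Soo.
  under eq_integral do rewrite gee0_abs ?nneseries_ge0 //.
  by [].
pose N := [set x | S x = +oo%E].
have mN : measurable N.
  have -> : N = setT `&` S @^-1` [set +oo%E] by rewrite setTI.
  exact: mS.
have aeN : {ae mu, forall x, ~ N x}.
  have := integrable_ae measurableT iS.
  by apply: filterS => x /= /(_ I) + Nx; rewrite Nx.
(* Setting the functions to zero on the null set where the series diverges gives convergence at
   every point, so the pointwise limit is measurable even if the measure is not complete. *)
exists (fun n x => \1_(~` N) x * u n x); split.
- move=> n; apply: measurable_funM; last by case: (lu n).
  by apply: measurable_indic; exact: measurableC.
- move=> n; apply: filterS aeN => x Nx; rewrite indicE mem_set //= mul1r //.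
- move=> x; have [Nx|Nx] := pselect (N x).
    rewrite (_ : (fun n => _) = cst 0); first exact: is_cvg_cst.
    apply/funext => n; rewrite indicE memNset ?mul0r //= => /(_ Nx); exact.
  have -> : (fun n => \1_(~` N) x * u n x) = (fun n => u n x).
    by apply/funext => n; rewrite indicE mem_set ?mul1r.
  have -> : (fun n => u n x) = (fun n => u 0 x + series (dd ^~ x) n).
    apply/funext => n; rewrite /series /= /dd telescope_sumr //.
    by rewrite addrC subrK.
  apply: is_cvgD; first exact: is_cvg_cst.
  apply: normed_cvg.
  have Sfin : (S x < +oo)%E by rewrite ltey; apply/eqP.
  apply: nondecreasing_is_cvgn.
    by apply: nondecreasing_series => k _ _; rewrite normr_ge0.
  exists (2 + fine (S x)) => _ [n _ <-].
  rewrite /series /=.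
  apply: (@le_trans _ _ (\sum_(0 <= k < n) (2^-1 ^+ k + 2 ^+ k * dd k x ^+ 2))).
    apply: ler_sum => k _; have k0 : 0 < (2 : R) ^+ k by rewrite exprn_gt0.
    have : 0 <= (2 ^+ k)^-1 * (1 - 2 ^+ k * `|dd k x|) ^+ 2.
      by rewrite mulr_ge0 ?sqr_ge0 // invr_ge0 ltW.
    rewrite -(real_normK (num_real (dd k x))).
    have := normr_ge0 (dd k x).
    move: (`|dd k x|) => t t0.
    have -> : (2 ^+ k)^-1 * (1 - 2 ^+ k * t) ^+ 2 =
      (2 ^+ k)^-1 - 2 * t + 2 ^+ k * t ^+ 2 by field; rewrite gt_eqF.
    by rewrite exprVn; lra.
  rewrite big_split /=; apply: lerD.
    have := @geometric_seriesE R 1 2^-1.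
    move=> /(_ _) E.
    rewrite (_ : \sum_(0 <= i < n) 2^-1 ^+ i = series (geometric 1 2^-1) n); last first.
      by rewrite /series /=; apply: eq_bigr => i _; rewrite /geometric /= mul1r.
    rewrite E /=; last by rewrite lt_eqF // invf_lt1 // ltr1n.
    have : 0 <= (2^-1 : R) ^+ n by rewrite exprn_ge0 // invr_ge0.
    by move: (2^-1 ^+ n) => z z0; rewrite mul1r ler_pdivrMr; lra.
  rewrite -lee_fin -sumEFin fineK; last first.
    by rewrite ge0_fin_numE // nneseries_ge0.
  by apply: (@nneseries_lim_ge R (fun k => F k x) xpredT 0 n) => k _ _; exact: F0.
Unshelve. all: by end_near.
Qed.

(** A subsequence with increments below [4^-k] converges pointwise after a change on null sets;
    Fatou then carries the Cauchy bound over to the distance from the limit. *)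
Lemma riesz_fischer (u : nat -> T -> R) : (forall n, l2 (u n)) ->
  (forall e : R, 0 < e -> exists N, forall n m, (N <= n)%N -> (N <= m)%N ->
    ip (fun x => u n x - u m x) (fun x => u n x - u m x) < e) ->
  exists2 f, l2 f & forall e : R, 0 < e -> exists N, forall n, (N <= n)%N ->
    ip (fun x => f x - u n x) (fun x => f x - u n x) < e.
Proof.
move=> lu cau.
have /choice[s sP] : forall k : nat, exists N, forall n m, (N <= n)%N -> (N <= m)%N ->
    ip (fun x => u n x - u m x) (fun x => u n x - u m x) < 4^-1 ^+ k.
  by move=> k; apply: cau; rewrite exprn_gt0 // invr_gt0.
pose t := fix t k := if k is k'.+1 then maxn (t k').+1 (s k) else s 0%N.
have t_lt k : (t k < t k.+1)%N by rewrite /= leq_maxl.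
have st k : (s k <= t k)%N by case: k => [//|k] /=; rewrite leq_maxr.
have kt k : (k <= t k)%N by elim: k => // k /leq_ltn_trans; apply.
have [|n|v [mv vu cv]] := @l2_fast_cvg (u \o t).
- by move=> n; exact: lu.
- by apply/ltW/sP; rewrite ?(st n)// (leq_trans (st n)) // ltnW.
pose f x := limn (v ^~ x).
have cvf x : v ^~ x @ \oo --> f x by exact: cv.
have mf : measurable_fun setT f.
  by apply: (@measurable_fun_cvg _ _ _ _ v) => // x _; exact: cvf.
have lv n : l2 (v n).
  by apply: l2_ae (lu (t n)) => //; apply: filterS (vu n) => x /= ->.
have bnd (e : R) : 0 < e -> exists N, forall n, (N <= n)%N ->
    (\int[mu]_x ((f x - u n x) ^+ 2)%:E <= e%:E)%E.
  move=> e0; have [N NP] := cau _ e0; exists N => n Nn.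
  (* Written as a lower limit so that Fatou applies; the terms with [k >= N] are bounded by the
     Cauchy tail because [k <= t k]. *)
  have E x : ((f x - u n x) ^+ 2)%:E = limn_einf (fun k => ((v k x - u n x) ^+ 2)%:E).
    apply/esym; have := @cvg_limn_einf_sup R (fun k => ((v k x - u n x) ^+ 2)%:E).
    move=> /(_ ((f x - u n x) ^+ 2)%:E) []//.
    apply: cvg_EFin; first by near=> k.
    by apply: cvgM; (apply: cvgB; [exact: cvf | exact: cvg_cst]).
  under eq_integral do rewrite E.
  apply: le_trans (fatou _ _ _ _) _ => //.
  - move=> k; apply/measurable_EFinP/measurable_funX; apply: measurable_funB => //.
    by case: (lu n).
  - by move=> k x _; rewrite lee_fin sqr_ge0.
  rewrite limn_einf_lim; apply: lime_le; first exact: is_cvg_einfs.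
  near=> k.
  apply: (@le_trans _ _ ((fun k => \int[mu]_x ((v k x - u n x) ^+ 2)%:E)%E k)).
    by apply: ereal_inf_lbound; exists k => //=.
  have -> : (\int[mu]_x ((v k x - u n x) ^+ 2)%:E =
      \int[mu]_x ((u (t k) x - u n x) ^+ 2)%:E)%E.
    apply: ae_eq_integral => //.
    - apply/measurable_EFinP/measurable_funX; apply: measurable_funB => //.
      by case: (lu n).
    - apply/measurable_EFinP/measurable_funX; apply: measurable_funB.
        by case: (lu (t k)).
      by case: (lu n).
    - by apply: filterS (vu k) => x /= -> .
  rewrite (ipE (l2B (lu _) (lu _))) lee_fin; apply/ltW/NP => //.
  by apply: leq_trans (kt k); near: k; exists N.
have lfu : exists N, forall n, (N <= n)%N -> l2 (fun x => f x - u n x).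
  have [N NP] := bnd 1 ltr01; exists N => n Nn; split.
    by apply: measurable_funB => //; case: (lu n).
  by apply: le_lt_trans (NP n Nn) _; rewrite ltry.
have lf : l2 f.
  have [N NP] := lfu; have := l2D (NP _ (leqnn N)) (lu N).
  by congr (l2 _); apply/funext => x; rewrite subrK.
exists f => // e e0; have e2 : 0 < e / 2 by rewrite divr_gt0.
have [N NP] := bnd _ e2; exists N => n Nn.
have := NP _ Nn; rewrite (ipE (l2B lf (lu n))) lee_fin => /le_lt_trans; apply.
by lra.
Unshelve. all: by end_near.
Qed.

End RealL2.

(** * Convolution in one variable *)

Section ParametricIntegral.
Context d1 d2 (T1 : measurableType d1) (T2 : measurableType d2) (R : realType).
Context (m2 : {sigma_finite_measure set T2 -> \bar R}).

(** Tonelli gives measurability of the integrals of the positive and negative parts; [fine] of their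
    difference is then measurable whether or not they are finite. *)
Lemma measurable_Rintegral_param (F : T1 * T2 -> R) : measurable_fun setT F ->
  measurable_fun setT (fun x => \int[m2]_y F (x, y)).
Proof.
move=> mF; rewrite /Rintegral.
have -> : (fun x => fine (\int[m2]_y (F (x, y))%:E)) =
    fine \o (fun x => \int[m2]_y ((EFin \o F)^\+ (x, y)) - \int[m2]_y ((EFin \o F)^\- (x, y)))%E.
  apply/funext => x /=; rewrite integralE.
  by congr (fine (_ - _)%E); apply: eq_integral => y _; rewrite ?funeposE ?funenegE.
have mE : measurable_fun setT (EFin \o F) by apply/measurable_EFinP.
apply: measurableT_comp; first exact: (fine_measurable measurableT).
apply: emeasurable_funB.
- apply: (measurable_fun_fubini_tonelli_F (m2 := m2) ((EFin \o F)^\+%E)).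
    exact: measurable_funepos.
  by move=> x; exact: funepos_ge0.
- apply: (measurable_fun_fubini_tonelli_F (m2 := m2) ((EFin \o F)^\-%E)).
    exact: measurable_funeneg.
  by move=> x; exact: funeneg_ge0.
Qed.

End ParametricIntegral.

Section Norm.
Context d (T : measurableType d) (R : realType) (mu : {measure set T -> \bar R}).
Implicit Types f g : T -> R.
Local Notation ip := (ip mu).
Local Notation l2 := (l2 mu).

Definition nrm f := Num.sqrt (ip f f).

Lemma nrm_ge0 f : 0 <= nrm f.
Proof. exact: sqrtr_ge0. Qed.

Lemma nrm_sqr f : nrm f ^+ 2 = ip f f.
Proof. by rewrite sqr_sqrtr // ip_ge0. Qed.

Lemma ip_le_nrm f g : l2 f -> l2 g -> `|ip f g| <= nrm f * nrm g.
Proof.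
move=> lf lg; rewrite -sqrtr_sqr -sqrtrM ?ip_ge0 // ler_wsqrtr //.
exact: ip_cs.
Qed.

Lemma nrm_le f (c : R) : 0 <= c -> ip f f <= c ^+ 2 -> nrm f <= c.
Proof. by move=> c0 h; rewrite -[c]ger0_norm // -sqrtr_sqr ler_wsqrtr. Qed.

End Norm.

(* Lebesgue measure on the canonical measurable space of [R], whose display differs
   from that of [measurableTypeR R]. *)
Definition lebR (R : realType) : set R -> \bar R := @lebesgue_measure R.

Section LebR.
Variable R : realType.

Let lebR0 : lebR (set0 : set R) = 0%E.
Proof. exact: measure0. Qed.

Let lebR_ge0 (A : set R) : (0 <= lebR A)%E.
Proof. exact: measure_ge0. Qed.

Let lebR_sigma : semi_sigma_additive (@lebR R).
Proof. exact: (@measure_semi_sigma_additive _ (measurableTypeR R) R (@lebesgue_measure R)). Qed.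

HB.instance Definition _ := isMeasure.Build _ R R (@lebR R) lebR0 lebR_ge0 lebR_sigma.

Let lebR_sigma_finite : sigma_finite setT (@lebR R).
Proof. exact: (sigma_finiteT (@lebesgue_measure R)). Qed.

HB.instance Definition _ := Measure_isSigmaFinite.Build _ R R (@lebR R) lebR_sigma_finite.

(** The identity is measurable between the two copies of the line, and the pushforward formula along
    it compares the integrals. *)
Lemma lebR_integral (D : set R) (f : R -> \bar R) : measurable D -> measurable_fun D f ->
  (forall x, (0 <= f x)%E) ->
  (\int[@lebR R]_(x in D) f x = \int[@lebesgue_measure R]_(x in D) f x)%E.
Proof.
move=> mD mf f0.
have mi : @measurable_fun _ _ (measurableTypeR R) R setT (fun x : R => x).
  exact: (@measurable_id _ R).
have := @ge0_integral_pushforward _ _ _ _ R _ mi (@lebesgue_measure R) D f mD mf (fun x _ => f0 x).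
rewrite preimage_id => E; apply: etrans E.
pose F : {mfun measurableTypeR R >-> R} := HB.pack (fun x : R => x)
  (isMeasurableFun.Build _ _ _ _ _ mi).
by apply: (@eq_measure_integral _ R R D (pushforward (@lebesgue_measure R) F) (@lebR R)).
Qed.

End LebR.

Section Line.
Variable R : realType.
Local Notation leb := (@lebR R).
Implicit Types (f g phi : R -> R) (a M : R).

Lemma measurable_shift (r : R) : measurable_fun setT (fun t : R => t + r).
Proof. by apply: measurable_funD => //; exact: measurable_cst. Qed.

(** The pushforward agrees with Lebesgue measure on half-open intervals, which determine it. *)
Lemma lebesgue_shift (r : R) (A : set R) : measurable A ->
  pushforward leb (fun t : R => t + r) A = leb A.
Proof.
move=> mA; apply/esym.
pose F : {mfun measurableTypeR R >-> measurableTypeR R} := HB.pack (fun t : R => t + r)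
  (isMeasurableFun.Build _ _ (measurableTypeR R) (measurableTypeR R) _ (measurable_shift r)).
apply: (@lebesgue_measure_unique R (pushforward (@lebesgue_measure R) F) _ A mA) => X.
rewrite /ocitv => -[[a b] _ <-].
have E : pushforward (@lebesgue_measure R) F `]a, b]%classic =
    lebesgue_measure (`]a - r, b - r]%classic : set R).
  rewrite /pushforward; congr (lebesgue_measure _); apply/seteqP.
  by split => x /=; rewrite !in_itv /= lerBrDr ltrBlDr.
apply: etrans (esym E).
rewrite !lebesgue_measure_itv /= !lte_fin ltrD2r; case: ifP => // _.
by rewrite -!EFinB; congr EFin; ring.
Qed.

Lemma integral_shift (r : R) (f : R -> \bar R) : measurable_fun setT f ->
  (forall x, (0 <= f x)%E) -> (\int[leb]_t f (t + r)%R = \int[leb]_t f t)%E.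
Proof.
move=> mf f0.
have := @ge0_integral_pushforward _ _ _ _ R _ (measurable_shift r) leb setT f measurableT mf.
rewrite preimage_setT => <- //.
pose F : {mfun R >-> R} := HB.pack (fun t : R => t + r)
  (isMeasurableFun.Build _ _ _ _ _ (measurable_shift r)).
apply: (@eq_measure_integral _ R R setT leb (pushforward leb F)) => A mA _.
exact: lebesgue_shift.
Qed.

Lemma Rintegral_shift (r : R) f : measurable_fun setT f ->
  \int[leb]_t f (t + r) = \int[leb]_t f t.
Proof.
move=> mf; rewrite /Rintegral; congr fine; rewrite [LHS]integralE [RHS]integralE.
have mE : measurable_fun setT (EFin \o f) by apply/measurable_EFinP.
congr (_ - _)%E.
  transitivity (\int[leb]_t (EFin \o f)^\+ (t + r)%R)%E.
    by apply: eq_integral => x _; rewrite !funeposE.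
  apply: (integral_shift r (f := (EFin \o f)^\+%E)) => //; exact: measurable_funepos.
transitivity (\int[leb]_t (EFin \o f)^\- (t + r)%R)%E.
  by apply: eq_integral => x _; rewrite !funenegE.
apply: (integral_shift r (f := (EFin \o f)^\-%E)) => //; exact: measurable_funeneg.
Qed.

Definition bump a M phi := [/\ measurable_fun setT phi, 0 <= a, 0 <= M,
  forall r, a < `|r| -> phi r = 0 & forall r, `|phi r| <= M].

(** A bump is unchanged when multiplied by this window. Keeping the window on the other factor in
    Cauchy-Schwarz localizes the bound, and this yields Young's inequality for convolutions. *)
Definition win a : R -> R := \1_(`[- a, a]%classic).

Lemma win_ge0 a r : 0 <= win a r.
Proof. by rewrite /win indicE. Qed.

Lemma win_le1 a r : win a r <= 1.
Proof. by rewrite /win indicE; case: (_ \in _). Qed.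

Lemma measurable_win a : measurable_fun setT (win a).
Proof. by apply: measurable_indic. Qed.

Lemma int_win a s : 0 <= a -> (\int[leb]_t (win a (s - t))%:E = (2 * a)%:E)%E.
Proof.
move=> a0; rewrite [LHS](_ : _ = \int[leb]_t (\1_(`[s - a, s + a]%classic) t)%:E)%E.
  pose I : set R := `[s - a, s + a]%classic.
  have -> : (\int[leb]_t (\1_I t)%:E = lebesgue_measure I)%E.
    by rewrite integral_indic ?setIT //; exact: measurable_itv.
  rewrite /I.
  rewrite lebesgue_measure_itv /= lte_fin.
  case: ltP => h; rewrite -?EFinB; first by congr EFin; ring.
  by congr EFin; lra.
apply: eq_integral => t _; rewrite /win !indicE; congr ((_ : bool)%:R%:E).
by rewrite !mem_setE !in_itv /=; apply/andP/andP => -[]; split; lra.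
Qed.

Lemma int_win' a t : 0 <= a -> (\int[leb]_s (win a (s - t))%:E = (2 * a)%:E)%E.
Proof.
move=> a0; rewrite [LHS](_ : _ = \int[leb]_t' (win a (t - t'))%:E)%E; first exact: int_win.
apply: eq_integral => s _; rewrite /win !indicE; congr ((_ : bool)%:R%:E).
by rewrite !mem_setE !in_itv /=; apply/andP/andP => -[]; split; lra.
Qed.

Lemma measurable_sub2 : measurable_fun setT (fun p : R * R => p.1 - p.2).
Proof. by apply: measurable_funB; [exact: measurable_fst|exact: measurable_snd]. Qed.

Lemma measurable_refl (s : R) : measurable_fun setT (fun t : R => s - t).
Proof. by apply: measurable_funB => //; exact: measurable_cst. Qed.

Lemma bump_win a M phi r : bump a M phi -> phi r = win a r * phi r.
Proof.
move=> [_ _ _ h _]; rewrite /win indicE mem_setE in_itv /=.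
have [|nr] := boolP (- a <= r <= a); first by rewrite mul1r.
rewrite mul0r; apply: h; move: nr; rewrite -ler_norml -ltNge //.
Qed.

Lemma bump_refl_l2 a M phi s : bump a M phi ->
  l2 leb (fun t => phi (s - t)) /\
  ip leb (fun t => phi (s - t)) (fun t => phi (s - t)) <= 2 * a * M ^+ 2.
Proof.
move=> B; have [mphi a0 M0 supp bnd] := B.
have ms : measurable_fun setT (fun t : R => phi (s - t)).
  by apply: measurableT_comp mphi (measurable_refl s).
have le : (\int[leb]_t ((phi (s - t)) ^+ 2)%:E <= (2 * a * M ^+ 2)%:E)%E.
  rewrite mulrC EFinM -(int_win s a0) -ge0_integralZl //.
  - apply: ge0_le_integral => //.
    + by move=> t _; rewrite lee_fin sqr_ge0.
    + by apply/measurable_EFinP/measurable_funX.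
    + apply: measurable_funeM; apply/measurable_EFinP.
      exact: measurableT_comp (measurable_win a) (measurable_refl s).
    + move=> t _; rewrite -EFinM lee_fin (bump_win _ B) /win indicE.
      case: (_ \in _); rewrite ?mul1r ?mulr1 ?mul0r ?mulr0 ?expr0n //=.
      rewrite -(real_normK (num_real (phi _))) lerXn2r ?nnegrE //; exact: bnd.
  - apply/measurable_EFinP.
    exact: measurableT_comp (measurable_win a) (measurable_refl s).
  - by move=> t _; rewrite lee_fin win_ge0.
  - by rewrite lee_fin sqr_ge0.
have l : l2 leb (fun t => phi (s - t)).
  by split => //; apply: le_lt_trans le _; rewrite ltry.
by split => //; rewrite -lee_fin -ipE.
Qed.

(** Convolution as an inner product at each point, so that bilinearity and Cauchy-Schwarz for [ip]
    apply directly. *)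
Definition conv phi g (s : R) := ip leb (fun t => phi (s - t)) g.

Lemma convD phi psi a M b N g s : bump a M phi -> bump b N psi -> l2 leb g ->
  conv (fun r => phi r + psi r) g s = conv phi g s + conv psi g s.
Proof.
move=> /(bump_refl_l2 s)[l1 _] /(bump_refl_l2 s)[l2 _] lg.
exact: ipDl.
Qed.

Lemma convZ (k : R) phi a M g s : bump a M phi -> l2 leb g ->
  conv (fun r => k * phi r) g s = k * conv phi g s.
Proof. by move=> /(bump_refl_l2 s)[l1 _] lg; exact: ipZl. Qed.

Lemma convDr phi a M f g s : bump a M phi -> l2 leb f -> l2 leb g ->
  conv phi (fun t => f t + g t) s = conv phi f s + conv phi g s.
Proof. by move=> /(bump_refl_l2 s)[l1 _] lf lg; exact: ipDr. Qed.

Lemma convZr (k : R) phi a M g s : bump a M phi -> l2 leb g ->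
  conv phi (fun r => k * g r) s = k * conv phi g s.
Proof. by move=> /(bump_refl_l2 s)[l1 _] lg; exact: ipZr. Qed.

Lemma conv_shift phi (r : R) g s : conv (fun t => phi (t + r)) g s = conv phi g (s + r).
Proof.
by rewrite /conv; congr ip; apply/funext => t; congr phi; ring.
Qed.

Lemma measurable_conv phi g : measurable_fun setT phi -> measurable_fun setT g ->
  measurable_fun setT (conv phi g).
Proof.
move=> mphi mg.
apply: (@measurable_Rintegral_param _ _ _ _ R leb (fun p : R * R => phi (p.1 - p.2) * g p.2)).
apply: measurable_funM.
  exact: measurableT_comp mphi measurable_sub2.
by apply: measurableT_comp => //; exact: measurable_snd.
Qed.

Lemma conv_sqr_le a M phi g s : bump a M phi -> l2 leb g ->
  ((conv phi g s ^+ 2)%:E <=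
   (2 * a * M ^+ 2)%:E * \int[leb]_t (win a (s - t) * g t ^+ 2)%:E)%E.
Proof.
move=> B lg; have [lphi bnd] := bump_refl_l2 s B; have [mg _] := lg.
have mw : measurable_fun setT (fun t : R => win a (s - t)).
  exact: measurableT_comp (measurable_win a) (measurable_refl s).
have lw : l2 leb (fun t => win a (s - t) * g t).
  by apply: (@l2M_bounded _ _ _ _ _ _ 1) => // t; rewrite ger0_norm ?win_ge0 ?win_le1.
have -> : conv phi g s = ip leb (fun t => phi (s - t)) (fun t => win a (s - t) * g t).
  by apply: eq_Rintegral => t _; rewrite [in LHS](bump_win _ B); ring.
have -> : (\int[leb]_t (win a (s - t) * g t ^+ 2)%:E =
    \int[leb]_t ((win a (s - t) * g t) ^+ 2)%:E)%E.
  apply: eq_integral => t _; congr EFin; rewrite exprMn /win indicE.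
  by case: (_ \in _); rewrite ?expr1n // expr0n.
rewrite (ipE lw) -EFinM lee_fin.
apply: le_trans (ip_cs lphi lw) _.
by rewrite ler_wpM2r // ip_ge0.
Qed.

(** Young's inequality: Cauchy-Schwarz gives the factor [2 a M^2] and the windowed integral of
    [g^2]; integrating over [s] by Tonelli contributes the length [2 a] of the window. *)
Lemma conv_l2 a M phi g : bump a M phi -> l2 leb g -> l2 leb (conv phi g) /\
  ip leb (conv phi g) (conv phi g) <= (2 * a * M) ^+ 2 * ip leb g g.
Proof.
move=> B lg; have [mphi a0 M0 _ _] := B; have [mg _] := lg.
have mc := measurable_conv mphi mg.
have mK : measurable_fun setT (fun p : R * R => (win a (p.1 - p.2) * g p.2 ^+ 2)%:E).
  apply/measurable_EFinP; apply: measurable_funM.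
    exact: measurableT_comp (measurable_win a) measurable_sub2.
  by apply: measurable_funX; apply: measurableT_comp => //; exact: measurable_snd.
have K0 p : (0 <= (win a (p.1 - p.2) * g p.2 ^+ 2)%:E)%E.
  by rewrite lee_fin mulr_ge0 ?win_ge0 ?sqr_ge0.
have le : (\int[leb]_s (conv phi g s ^+ 2)%:E <= ((2 * a * M) ^+ 2 * ip leb g g)%:E)%E.
  apply: (@le_trans _ _ (\int[leb]_s ((2 * a * M ^+ 2)%:E *
      \int[leb]_t (win a (s - t) * g t ^+ 2)%:E))%E).
    apply: ge0_le_integral => //.
    - by move=> s _; rewrite lee_fin sqr_ge0.
    - by apply/measurable_EFinP/measurable_funX.
    - apply: measurable_funeM.
      exact: (measurable_fun_fubini_tonelli_F (m2 := leb) _ mK).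
    - by move=> s _; exact: conv_sqr_le.
  rewrite ge0_integralZl //; first last.
  - by rewrite lee_fin !mulr_ge0 // sqr_ge0.
  - by move=> s _; apply: integral_ge0 => t _; exact: (K0 (s, t)).
  - exact: (measurable_fun_fubini_tonelli_F (m2 := leb) _ mK).
  rewrite (fubini_tonelli (m1 := leb) (m2 := leb) _ mK) //=.
  have -> : (\int[leb]_t \int[leb]_s (win a (s - t) * g t ^+ 2)%:E =
      \int[leb]_t ((2 * a)%:E * (g t ^+ 2)%:E))%E.
    apply: eq_integral => t _; under eq_integral do rewrite EFinM muleC.
    rewrite ge0_integralZl //.
    - by rewrite int_win' // muleC.
    - apply/measurable_EFinP; apply: measurableT_comp (measurable_win a) _.
      by apply: measurable_funB => //; exact: measurable_cst.
    - by move=> s _; rewrite lee_fin win_ge0.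
    - by rewrite lee_fin sqr_ge0.
  rewrite ge0_integralZl //; first last.
  - by rewrite lee_fin mulr_ge0.
  - by move=> t _; rewrite lee_fin sqr_ge0.
  - by apply/measurable_EFinP/measurable_funX.
  rewrite ipE // -!EFinM lee_fin le_eqVlt; apply/orP; left; apply/eqP; ring.
have lc : l2 leb (conv phi g).
  by split => //; apply: le_lt_trans le _; rewrite ltry.
by split => //; rewrite -lee_fin -ipE.
Qed.

Lemma conv_nrm a M phi g : bump a M phi -> l2 leb g ->
  nrm leb (conv phi g) <= 2 * a * M * nrm leb g.
Proof.
move=> B lg; have [_ a0 M0 _ _] := B; apply: nrm_le.
  by rewrite !mulr_ge0 // nrm_ge0.
by rewrite exprMn nrm_sqr; have [] := conv_l2 B lg.
Qed.

(** Uniformity in [r], together with bounded supports, makes the difference quotients converge in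
    the operator norm of convolution on L2, by [conv_nrm]. *)
Definition udiff a M phi phi' := [/\ bump a M phi, bump a M phi' &
  forall e : R, 0 < e -> exists2 h0 : R, 0 < h0 & forall h r, `|h| < h0 ->
    `|phi (r + h) - phi r - h * phi' r| <= e * `|h|].

Lemma bumpD a M b N phi psi : bump a M phi -> bump b N psi ->
  bump (Num.max a b) (M + N) (fun r => phi r + psi r).
Proof.
move=> [m1 a0 M0 s1 b1] [m2 b0 N0 s2 b2]; split.
- exact: measurable_funD.
- by rewrite le_max a0.
- by rewrite addr_ge0.
- by move=> r; rewrite gt_max => /andP[h1 h2]; rewrite s1 // s2 // addr0.
- by move=> r; apply: le_trans (ler_normD _ _) _; exact: lerD.
Qed.

Lemma bump_sup a M N phi : bump a M phi -> 0 <= N -> (forall r, `|phi r| <= N) -> bump a N phi.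
Proof. by move=> [m1 a0 M0 s1 b1] N0 h. Qed.

Lemma bumpZ k a M phi : bump a M phi -> bump a (`|k| * M) (fun r => k * phi r).
Proof.
move=> [m1 a0 M0 s1 b1]; split => //; first exact: measurable_funM.
- by rewrite mulr_ge0.
- by move=> r /s1 ->; rewrite mulr0.
- by move=> r; rewrite normrM ler_wpM2l.
Qed.

Lemma bump_shift h a M phi : `|h| <= 1 -> bump a M phi ->
  bump (a + 1) M (fun r => phi (r + h)).
Proof.
move=> h1 [m1 a0 M0 s1 b1]; split => //.
- exact: measurableT_comp m1 (measurable_shift h).
- by rewrite addr_ge0.
- move=> r ar; apply: s1; have := ler_normB (r + h) h; rewrite addrK.
  by move: h1 ar; move: (`|h|) (`|r|) (`|r + h|) => x y z; lra.
Qed.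

Lemma ip_conv_shift phi chi f g (r : R) :
  measurable_fun setT phi -> measurable_fun setT chi ->
  measurable_fun setT f -> measurable_fun setT g ->
  ip leb (conv (fun t => phi (t + r)) f) (conv (fun t => chi (t + r)) g) =
  ip leb (conv phi f) (conv chi g).
Proof.
move=> m1 m2 mf mg; rewrite /ip -[RHS](@Rintegral_shift r); last first.
  by apply: measurable_funM; exact: measurable_conv.
by apply: eq_Rintegral => s _; rewrite !conv_shift.
Qed.

Lemma convB_le phi psi a M b N c e g : bump a M phi -> bump b N psi -> l2 leb g ->
  0 <= c -> 0 <= e -> (forall r, c < `|r| -> phi r - psi r = 0) ->
  (forall r, `|phi r - psi r| <= e) ->
  nrm leb (fun s => conv phi g s - conv psi g s) <= 2 * c * e * nrm leb g.
Proof.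
move=> B1 B2 lg c0 e0 supp bnd.
have B : bump c e (fun r => phi r + (-1) * psi r).
  have [m1 _ _ _ _] := bumpD B1 (bumpZ (-1) B2).
  by split => // r; rewrite mulN1r; [exact: supp | exact: bnd].
have := conv_nrm B lg; congr (nrm _ _ <= _); apply/funext => t.
by rewrite (convD _ B1 (bumpZ (-1) B2) lg) (convZ _ _ B2 lg) mulN1r.
Qed.

(* Differentiate the translation invariant quantity [ip (conv phi f) (conv chi g)]. *)
Lemma conv_by_parts a M phi phi' chi chi' f g :
  udiff a M phi phi' -> udiff a M chi chi' -> l2 leb f -> l2 leb g ->
  ip leb (conv phi' f) (conv chi g) = - ip leb (conv phi f) (conv chi' g).
Proof.
move=> [B1 B1' d1] [B2 B2' d2] lf lg; have [mf _] := lf; have [mg _] := lg.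
have [m1 a0 M0 s1 b1] := B1; have [m1' _ _ s1' b1'] := B1'.
have [m2 _ _ s2 b2] := B2; have [m2' _ _ s2' b2'] := B2'.
set F := conv phi f; set G := conv chi g; set F' := conv phi' f; set G' := conv chi' g.
have [lF _] : l2 leb F /\ _ := conv_l2 B1 lf; have [lF' _] : l2 leb F' /\ _ := conv_l2 B1' lf.
have [lG _] : l2 leb G /\ _ := conv_l2 B2 lg; have [lG' _] : l2 leb G' /\ _ := conv_l2 B2' lg.
apply/eqP; rewrite -subr_eq0 opprK; apply/eqP.
pose K := 2 * (a + 1); have K0 : 0 <= K by rewrite mulr_ge0 // addr_ge0.
pose nf := nrm leb f; pose ng := nrm leb g.
have nf0 : 0 <= nf by exact: nrm_ge0.
have ng0 : 0 <= ng by exact: nrm_ge0.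
(* The three summands belong to the three error terms of the final decomposition. *)
apply: (@le_eps_eq0 _ (K * nf * nrm leb G + K * (M + 1) * nf * (K * ng) + nrm leb F * (K * ng))).
move=> e0 e0_gt0.
pose e := Num.min e0 1.
have e_gt0 : 0 < e by rewrite lt_min e0_gt0 ltr01.
have e_le : e <= e0 by rewrite ge_min lexx.
have e_le1 : e <= 1 by rewrite ge_min lexx orbT.
have [h1 h1_gt0 H1] := d1 e e_gt0; have [h2 h2_gt0 H2] := d2 e e_gt0.
(* [h] lies below both radii of uniformity, and [h * (M + 1) <= e <= 1] bounds the change under the
   shift and keeps shifted supports within radius [a + 1]. *)
pose h := Num.min (Num.min (h1 / 2) (h2 / 2)) (e / (M + 1)).
have M1 : 0 < M + 1 by rewrite ltr_wpDl.
have h_gt0 : 0 < h by rewrite !lt_min !divr_gt0.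
have hn : `|h| = h by rewrite ger0_norm // ltW.
have hh1 : `|h| < h1.
  rewrite hn; apply: (@le_lt_trans _ _ (h1 / 2)); first by rewrite !ge_min lexx.
  by rewrite ltr_pdivrMr // ltr_pMr // ltr1n.
have hh2 : `|h| < h2.
  rewrite hn; apply: (@le_lt_trans _ _ (h2 / 2)); first by rewrite !ge_min lexx orbT.
  by rewrite ltr_pdivrMr // ltr_pMr // ltr1n.
have hM : h * (M + 1) <= e by rewrite -ler_pdivlMr // !ge_min lexx !orbT.
have h_le1 : `|h| <= 1.
  rewrite hn; apply: le_trans (le_trans hM e_le1).
  by rewrite ler_peMr ?(ltW h_gt0) // lerDr.
have quot (p p' : R -> R) : bump a M p -> bump a M p' ->
    (forall r, `|p (r + h) - p r - h * p' r| <= e * `|h|) ->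
    [/\ bump (a + 1) (M + 1) (fun r => h^-1 * (p (r + h) - p r)),
        forall r, `|p' r - h^-1 * (p (r + h) - p r)| <= e,
        forall r, a + 1 < `|r| -> p' r - h^-1 * (p (r + h) - p r) = 0,
        forall r, `|p r - p (r + h)| <= e &
        forall r, a + 1 < `|r| -> p r - p (r + h) = 0].
  move=> Bp Bp' Hp; have [mp _ _ sp bp] := Bp; have [mp' _ _ sp' bp'] := Bp'.
  have [msh _ _ ssh bsh] := bump_shift h_le1 Bp.
  have small r : `|p' r - h^-1 * (p (r + h) - p r)| <= e.
    have -> : p' r - h^-1 * (p (r + h) - p r) = - (h^-1 * (p (r + h) - p r - h * p' r)).
      by field; rewrite gt_eqF.
    rewrite normrN normrM normfV hn mulrC ler_pdivrMr //.
    by apply: le_trans (Hp r) _; rewrite hn.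
  have a1 r : a + 1 < `|r| -> a < `|r| by apply: lt_trans; rewrite ltrDl.
  have z r : a + 1 < `|r| -> p r - p (r + h) = 0.
    by move=> ar; rewrite ssh // sp ?subrr //; exact: a1.
  split => //.
  - split => //.
    + by apply: measurable_funM => //; exact: measurable_funB.
    + by rewrite addr_ge0.
    + by rewrite addr_ge0.
    + by move=> r /z /eqP; rewrite subr_eq0 => /eqP ->; rewrite subrr mulr0.
    + move=> r; have := small r; have := bp' r.
      have := ler_normB (p' r) (p' r - h^-1 * (p (r + h) - p r)).
      rewrite opprB addrC subrK.
      move: (`|_ * _|) (`|p' r|) (`|_ - _|) => x y w; lra.
  - move=> r ar; rewrite sp'; last exact: a1.
    by have /eqP := z r ar; rewrite subr_eq0 => /eqP ->; rewrite subrr mulr0 subr0.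
  - move=> r; have -> : p r - p (r + h) = - ((p (r + h) - p r - h * p' r) + h * p' r) by ring.
    rewrite normrN; apply: le_trans (ler_normD _ _) _.
    apply: (@le_trans _ _ (e * h + h * M)); last first.
      apply: le_trans hM; rewrite mulrDr mulr1 addrC lerD2l -[leRHS]mul1r ler_wpM2r //.
      exact: ltW.
    rewrite lerD //; first by have := Hp r; rewrite hn.
    by rewrite normrM hn ler_wpM2l // ltW.
have [BD dD zD dT zT] := quot phi phi' B1 B1' (fun r => H1 h r hh1).
have [BE dE zE dU zU] := quot chi chi' B2 B2' (fun r => H2 h r hh2).
set D := (fun r => h^-1 * (phi (r + h) - phi r)) in BD dD zD.
set E := (fun r => h^-1 * (chi (r + h) - chi r)) in BE dE zE.
have Bs := bump_shift h_le1 B2; have Bp := bump_shift h_le1 B1.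
set X := conv D f; set Z := conv E g; set Y := conv (fun r => chi (r + h)) g.
have [lX _] : l2 leb X /\ _ := conv_l2 BD lf; have [lZ _] : l2 leb Z /\ _ := conv_l2 BE lg; have [lY _] : l2 leb Y /\ _ := conv_l2 Bs lg.
(* The discrete product rule: multiplied by [h], the left side telescopes to the shifted pairing
   minus the original one, and these agree by translation invariance. *)
have key : ip leb X Y + ip leb F Z = 0.
  have hX : (fun s => h * X s) = (fun s => conv (fun r => phi (r + h)) f s - F s).
    apply/funext => s; rewrite /X -(convZ h s BD lf).
    have -> : (fun r => h * D r) = (fun r => phi (r + h) + (-1) * phi r).
      by apply/funext => r; rewrite /D mulrA divff ?gt_eqF // mul1r mulN1r.
    by rewrite (convD _ Bp (bumpZ (-1) B1) lf) (convZ _ _ B1 lf) mulN1r.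
  have hZ : (fun s => h * Z s) = (fun s => Y s - G s).
    apply/funext => s; rewrite /Z -(convZ h s BE lg).
    have -> : (fun r => h * E r) = (fun r => chi (r + h) + (-1) * chi r).
      by apply/funext => r; rewrite /E mulrA divff ?gt_eqF // mul1r mulN1r.
    by rewrite (convD _ Bs (bumpZ (-1) B2) lg) (convZ _ _ B2 lg) mulN1r.
  have [lW _] := conv_l2 Bp lf.
  have : h * (ip leb X Y + ip leb F Z) = 0.
    rewrite mulrDr -(ipZl h lX lY) -(ipZr h lZ lF) hX hZ (ipBl lW lF lY) (ipBr lY lG lF).
    have -> : ip leb (conv (fun r => phi (r + h)) f) Y = ip leb F G.
      exact: ip_conv_shift.
    move: (ip leb F Y) (ip leb F G) => p q; ring.
  by move/eqP; rewrite mulf_eq0 gt_eqF //= => /eqP.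
(* Replacing derivatives by difference quotients, and [G] by its shift, leaves three terms of size
   proportional to [e]. *)
have -> : ip leb F' G + ip leb F G' =
    ip leb (fun s => F' s - X s) G + ip leb X (fun s => G s - Y s)
    + ip leb F (fun s => G' s - Z s).
  rewrite (ipBl lF' lX lG) (ipBr lG lY lX) (ipBr lG' lZ lF).
  have -> : ip leb X Y = - ip leb F Z by apply/eqP; rewrite -addr_eq0 key.
  move: (ip leb F' G) (ip leb X G) (ip leb F G') (ip leb F Z) => p q u w; ring.
have lFX := l2B lF' lX.
have lGY := l2B lG lY.
have lGZ := l2B lG' lZ.
have a10 : 0 <= a + 1 by rewrite addr_ge0.
have n1 : nrm leb (fun s => F' s - X s) <= K * e * nf.
  by apply: (convB_le B1' BD) => //; exact: ltW.
have n2 : nrm leb (fun s => G s - Y s) <= K * e * ng.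
  by apply: (convB_le B2 Bs) => //; exact: ltW.
have n3 : nrm leb (fun s => G' s - Z s) <= K * e * ng.
  by apply: (convB_le B2' BE) => //; exact: ltW.
have n4 : nrm leb X <= K * (M + 1) * nf by exact: conv_nrm.
have N0 f' : 0 <= nrm leb f' by exact: nrm_ge0.
apply: le_trans (ler_normD _ _) _; rewrite mulrDl lerD //.
  apply: le_trans (ler_normD _ _) _; rewrite mulrDl lerD //.
    apply: le_trans (ip_le_nrm lFX lG) _.
    apply: (@le_trans _ _ (K * e * nf * nrm leb G)); first exact: (ler_wpM2r (N0 _) n1).
    have -> : K * e * nf * nrm leb G = K * nf * nrm leb G * e by ring.
    by rewrite ler_wpM2l // !mulr_ge0.
  apply: le_trans (ip_le_nrm lX lGY) _.
  apply: (@le_trans _ _ ((K * (M + 1) * nf) * (K * e * ng))).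
    exact: (ler_pM (N0 _) (N0 _) n4 n2).
  have -> : K * (M + 1) * nf * (K * e * ng) = K * (M + 1) * nf * (K * ng) * e by ring.
  by rewrite ler_wpM2l // !mulr_ge0 // ltW.
apply: le_trans (ip_le_nrm lF lGZ) _.
apply: (@le_trans _ _ (nrm leb F * (K * e * ng))); first exact: (ler_wpM2l (N0 _) n3).
have -> : nrm leb F * (K * e * ng) = nrm leb F * (K * ng) * e by ring.
by rewrite ler_wpM2l // !mulr_ge0.
Qed.

End Line.

(** * Approximate identities in L2 of the line *)

Section Mollifier.
Variable R : realType.
Local Notation leb := (@lebR R).
Implicit Types (f g : R -> R).

Variable rho : nat -> R -> R.
Hypothesis rho_bump : forall n, bump n.+1%:R^-1 (2 * n.+1%:R) (rho n).
Hypothesis rho_int : forall n, \int[leb]_t rho n t = 1.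

Let n1 n : 0 < n.+1%:R :> R. Proof. by rewrite ltr0n. Qed.

Lemma rho_refl_int n s : \int[leb]_t rho n (s - t) = 1.
Proof.
have [mr _ _ _ _] := rho_bump n.
rewrite -(rho_int n) /Rintegral; congr fine.
pose F : {mfun R >-> R} := HB.pack (fun t : R => s - t)
  (isMeasurableFun.Build _ _ _ _ _ (measurable_refl s)).
have mE : measurable_fun setT (EFin \o rho n) by apply/measurable_EFinP.
have key (h : R -> \bar R) : measurable_fun setT h -> (forall x, 0 <= h x)%E ->
    (\int[leb]_t h (s - t)%R = \int[leb]_t h t)%E.
  move=> mh h0.
  have := @ge0_integral_pushforward _ _ _ _ R _ (measurable_refl s) leb setT h measurableT mh.
  rewrite preimage_setT => <- //.
  apply: (@eq_measure_integral _ R R setT leb (pushforward leb F)) => A mA _.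
  apply/esym.
  pose F' : {mfun measurableTypeR R >-> measurableTypeR R} := HB.pack (fun t : R => s - t)
    (isMeasurableFun.Build _ _ (measurableTypeR R) (measurableTypeR R) _ (measurable_refl s)).
  apply: (@lebesgue_measure_unique R (pushforward (@lebesgue_measure R) F') _ A mA) => X.
  rewrite /ocitv => -[[a b] _ <-].
  have E : pushforward (@lebesgue_measure R) F' `]a, b]%classic =
      lebesgue_measure (`[s - b, s - a[%classic : set R).
    rewrite /pushforward; congr (lebesgue_measure _); apply/seteqP.
    by split => x /=; rewrite !in_itv /= => /andP[h1 h2]; apply/andP; split; lra.
  apply: etrans (esym E).
  rewrite !lebesgue_measure_itv /= !lte_fin.
  have -> : (s - b < s - a) = (a < b) by rewrite ltrD2l ltrN2.
  by case: ifP => // _; rewrite -!EFinB; congr EFin; ring.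
rewrite [LHS]integralE [RHS]integralE; congr (_ - _)%E.
  transitivity (\int[leb]_t (EFin \o rho n)^\+ (s - t)%R)%E.
    by apply: eq_integral => x _; rewrite !funeposE.
  by apply: (key (EFin \o rho n)^\+%E) => //; exact: measurable_funepos.
transitivity (\int[leb]_t (EFin \o rho n)^\- (s - t)%R)%E.
  by apply: eq_integral => x _; rewrite !funenegE.
by apply: (key (EFin \o rho n)^\-%E) => //; exact: measurable_funeneg.
Qed.

Lemma bump_integrable a M phi s : bump a M phi ->
  leb.-integrable setT (EFin \o (fun t : R => phi (s - t))).
Proof.
move=> B; have [mphi a0 M0 _ b] := B.
have mw : measurable_fun setT (fun t : R => win a (s - t)).
  exact: measurableT_comp (measurable_win a) (measurable_refl s).
apply: (@le_integrable _ _ _ leb setT measurableT _ (EFin \o (fun t : R => M * win a (s - t)))).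
- by apply/measurable_EFinP; exact: measurableT_comp mphi (measurable_refl s).
- move=> t _ /=; rewrite lee_fin (bump_win _ B) normrM mulrC.
  rewrite [`|win _ _|]ger0_norm ?win_ge0 // [leRHS]ger0_norm; last by rewrite mulr_ge0 ?win_ge0.
  by rewrite ler_wpM2r ?win_ge0.
- apply/integrableP; split.
    by apply/measurable_EFinP; exact: measurable_funM.
  rewrite [ltLHS](_ : _ = (M%:E * \int[leb]_t (win a (s - t))%:E)%E).
    by rewrite int_win // -EFinM ltry.
  rewrite -ge0_integralZl //.
  - by apply: eq_integral => t _ /=; rewrite ger0_norm // mulr_ge0 ?win_ge0.
  - exact/measurable_EFinP.
  - by move=> t _; rewrite lee_fin win_ge0.
Qed.

(** The mollifier has height [2 (n+1)] and the interval has length [4 / (n+1)], hence the 8. The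
    radius is twice that of the support, so that points outside the open ball lie strictly outside
    the support. *)
Lemma mollify_osc n g s : l2 leb g ->
  (`|conv (rho n) g s - g s|%:E <= 8%:E * davg g s (2 * n.+1%:R^-1))%E.
Proof.
move=> lg; have [mg _] := lg; have B := rho_bump n; have [mr _ _ supp bnd] := B.
set r : R := 2 * n.+1%:R^-1.
have r0 : 0 < r by rewrite mulr_gt0 // invr_gt0.
have [lr _] := bump_refl_l2 s B.
have i1 := l2_int lr lg.
have i0 := bump_integrable s B.
have i2 : leb.-integrable setT (EFin \o (fun t : R => g s * rho n (s - t))).
  have := integrableZl measurableT (g s) i0.
  by apply: eq_integrable => // t _ /=; rewrite EFinM.
have -> : conv (rho n) g s - g s = \int[leb]_t (rho n (s - t) * (g t - g s)).
  rewrite -[in X in _ - X](mulr1 (g s)) -(rho_refl_int n s) -RintegralZl // /conv /ip -RintegralB //.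
  by apply: eq_Rintegral => t _; ring.
have i3 : leb.-integrable setT (EFin \o (fun t : R => rho n (s - t) * (g t - g s))).
  have := integrableB measurableT i1 i2.
  by apply: eq_integrable => // t _ /=; rewrite -EFinB; congr EFin; ring.
rewrite EFin_normr_Rintegral //.
have /integrableP[mprod _] := i3.
apply: le_trans (le_abse_integral leb measurableT mprod) _.
have mgs : measurable_fun setT (fun t : R => `|g t - g s|).
  by apply: measurableT_comp => //; apply: measurable_funB => //; exact: measurable_cst.
pose A : set R := ball s r.
have mA : measurable A by exact: measurable_ball.
apply: (@le_trans _ _ ((2 * n.+1%:R)%:E * \int[leb]_(t in A) `|g t - g s|%:E)%E).
  rewrite -ge0_integralZl //; first last.
  - by apply: measurable_funTS; exact/measurable_EFinP.
  rewrite [leRHS]integral_mkcond; apply: ge0_le_integral => //.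
  - by apply: measurableT_comp.
  - have mF : measurable_fun setT (fun t : R => (2 * n.+1%:R)%:E * `|g t - g s|%:E)%E.
      by apply: measurable_funeM; exact/measurable_EFinP.
    apply/(measurable_restrictT _ mA); exact: (measurable_funS measurableT _ mF).
  - move=> t _; rewrite patchE; case: ifPn => [tA|]; last first.
      rewrite notin_setE /A /ball /= => /negP; rewrite -leNgt => rt.
      rewrite /= supp ?mul0r ?normr0 //.
      apply: lt_le_trans rt; rewrite /r ltr_pMl ?invr_gt0 // ltr1n //.
    by rewrite -EFinM lee_fin normrM ler_wpM2r.
have -> : davg g s r = ((2 * r)^-1%:E * \int[leb]_(t in A) `|g t - g s|%:E)%E.
  rewrite /davg /iavg lebesgue_measure_ball ?(ltW r0) //.
  rewrite inver mulrn_eq0 /= gt_eqF // mulr_natl lebR_integral //.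
  by apply: measurable_funTS; exact/measurable_EFinP.
rewrite muleA -EFinM (_ : 8 * (2 * r)^-1 = 2 * n.+1%:R) //.
by rewrite /r; field; rewrite gt_eqF.
Qed.

Lemma mollify_pointwise g s : l2 leb g -> lebesgue_pt g s ->
  (fun n => conv (rho n) g s) @ \oo --> g s.
Proof.
move=> lg pt.
pose r n : R := 2 * n.+1%:R^-1.
have r0 n : 0 < r n by rewrite mulr_gt0 // invr_gt0.
have rcvg : r @ \oo --> (0 : R).
  rewrite -(mulr0 2); apply: cvgM; first exact: cvg_cst.
  exact: cvg_harmonic.
have dc : (fun n => 8%:E * davg g s (r n))%E @ \oo --> 0%E.
  rewrite -(mule0 8%:E); apply: cvgeM => //; first exact: cvg_cst.
  by move/cvge_at_rightP : pt => /(_ r); apply.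
have ac : (fun n => `|conv (rho n) g s - g s|%:E) @ \oo --> 0%E.
  apply: (@squeeze_cvge _ _ _ _ (cst 0%E) _ (fun n => 8%:E * davg g s (r n))%E) => //.
    by apply: nearW => n; rewrite lee_fin normr_ge0 /=; exact: mollify_osc.
  exact: cvg_cst.
have {}ac : (fun n => `|conv (rho n) g s - g s|) @ \oo --> 0 by exact: (fine_cvg ac).
apply/cvgrPdist_le => e e0; move/cvgrPdist_le: ac => /(_ e e0).
by apply: filterS => n /=; rewrite sub0r normrN normr_id distrC.
Qed.

Lemma conv_bounded n g (k : R) s : l2 leb g -> 0 <= k -> (forall t, `|g t| <= k) ->
  `|conv (rho n) g s| <= 4 * k.
Proof.
move=> lg k0 gk; have B := rho_bump n; have [mr _ _ supp bnd] := B.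
have [lr _] := bump_refl_l2 s B; have i1 := l2_int lr lg.
rewrite -lee_fin /conv /ip EFin_normr_Rintegral //.
have /integrableP[mprod _] := i1.
apply: le_trans (le_abse_integral leb measurableT mprod) _.
have wm : measurable_fun setT (fun t : R => (win n.+1%:R^-1 (s - t))%:E).
  apply/measurable_EFinP; exact: measurableT_comp (measurable_win _) (measurable_refl s).
apply: (@le_trans _ _ ((2 * n.+1%:R * k)%:E * \int[leb]_t (win n.+1%:R^-1 (s - t))%:E)%E).
  rewrite -ge0_integralZl //.
  - apply: ge0_le_integral => //.
    + exact: measurableT_comp.
    + exact: measurable_funeM.
    + move=> t _; rewrite -EFinM lee_fin (bump_win _ B) !normrM.
      have h := ler_pM (normr_ge0 _) (normr_ge0 _) (bnd (s - t)) (gk t).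
      rewrite [`|win _ _|]ger0_norm ?win_ge0 // -mulrA [leRHS]mulrC.
      exact: (ler_wpM2l (win_ge0 _ _) h).
  - by move=> t _; rewrite lee_fin win_ge0.
  - by rewrite lee_fin !mulr_ge0.
rewrite int_win ?invr_ge0 // -EFinM lee_fin.
rewrite [leLHS](_ : _ = 4 * k) //.
by field; rewrite gt_eqF.
Qed.

(** Dominated convergence, with almost everywhere convergence from Lebesgue's differentiation
    theorem. By [conv_bounded] the difference is at most [4 k + k], and both functions vanish
    outside radius [k + 1]. *)
Lemma mollify_cvg_bounded g (k : R) : l2 leb g -> 0 <= k -> (forall t, `|g t| <= k) ->
  (forall t, k < `|t| -> g t = 0) ->
  (\int[leb]_s ((conv (rho n) g s - g s) ^+ 2)%:E)%E @[n --> \oo] --> 0%E.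
Proof.
move=> lg k0 gk gs; have [mg _] := lg.
pose G s : \bar R := ((5 * k) ^+ 2 * win (k + 1) s)%:E.
have mG : measurable_fun setT G.
  by apply/measurable_EFinP/measurable_funM => //; exact: measurable_win.
have k10 : 0 <= k + 1 by rewrite addr_ge0.
have iwin a : 0 <= a -> leb.-integrable setT (EFin \o win a).
  move=> a0; apply/integrableP; split; first by apply/measurable_EFinP; exact: measurable_win.
  rewrite [ltLHS](_ : _ = (\int[leb]_t (win a (t - 0)%R)%:E)%E).
    by rewrite int_win' // ltry.
  by apply: eq_integral => t _ /=; rewrite ger0_norm ?win_ge0 // subr0.
have iG : leb.-integrable setT G by exact: integrableZl (iwin _ k10).
have ig : leb.-integrable setT (EFin \o g).
  apply: (@le_integrable _ _ _ leb setT measurableT _ (fun s => (k%:E * (EFin \o win k) s)%E)).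
  - exact/measurable_EFinP.
  - move=> t _ /=; rewrite lee_fin normrM [`|k|]ger0_norm // [`|win _ _|]ger0_norm ?win_ge0 //.
    have [tk|tk] := leP `|t| k; last by rewrite gs // normr0 mulr_ge0 ?win_ge0.
    by rewrite /win indicE mem_setE in_itv /= -ler_norml tk mulr1.
  - by apply: integrableZl => //; exact: iwin.
have loc : locally_integrable setT g.
  apply: open_integrable_locally; first exact: openT.
  have /integrableP[m b] := ig; apply/integrableP; split; first exact: m.
  by rewrite -lebR_integral //; exact: measurableT_comp.
have ae : {ae leb, forall x : R, lebesgue_pt g x} by exact: (lebesgue_differentiation loc).
have := @dominated_convergence _ R R leb setT measurableT
  (fun n s => ((conv (rho n) g s - g s) ^+ 2)%:E) (cst 0%E) G.
case=> //.
- move=> n; apply/measurable_EFinP/measurable_funX/measurable_funB => //.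
  by apply: measurable_conv => //; have [] := rho_bump n.
- apply: filterS ae => s pt _; apply: cvg_EFin; first by near=> n.
  rewrite /= -[X in _ --> X](expr0n _ 2) -(subrr (g s)).
  by apply: cvgM; (apply: cvgB; [exact: mollify_pointwise | exact: cvg_cst]).
- apply: nearW => s n _; rewrite /G /= lee_fin ger0_norm ?sqr_ge0 //.
  have [sk|sk] := leP `|s| (k + 1).
    rewrite /win indicE mem_setE in_itv /= -ler_norml sk mulr1.
    rewrite -(real_normK (num_real (_ - _))) lerXn2r ?nnegrE ?mulr_ge0 //.
    apply: le_trans (ler_normB _ _) _.
    have := conv_bounded n s lg k0 gk; have := gk s; move: (`|g s|) (`|conv _ _ _|) => x y; lra.
  have -> : conv (rho n) g s = 0.
    rewrite /conv /ip; under eq_Rintegral => t _.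
      rewrite (_ : rho n (s - t) * g t = 0); first over.
      have [tk|tk] := leP `|t| k; last by rewrite gs ?mulr0.
      have [_ _ _ supp _] := rho_bump n; rewrite supp ?mul0r //.
      apply: (@le_lt_trans _ _ 1); first by rewrite invf_le1 // ler1n.
      have := ler_normD (s - t) t; rewrite subrK.
      by move: sk tk; move: (`|s|) (`|t|) (`|s - t|) => x y z; lra.
    by rewrite /Rintegral integral0_eq.
  rewrite gs ?subrr ?expr0n ?mulr_ge0 ?win_ge0 ?sqr_ge0 //.
  by apply: lt_trans sk; rewrite ltrDl.
by move=> _ _; rewrite integral_cst // mul0e.
Unshelve. all: by end_near.
Qed.

Definition cutoff (k : nat) g t := if (`|g t| <= k%:R) && (`|t| <= k%:R) then g t else 0.

Lemma measurable_cutoff k g : measurable_fun setT g -> measurable_fun setT (cutoff k g).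
Proof.
move=> mg; apply: measurable_fun_ifT => //.
apply: measurable_and; apply: measurable_fun_ler.
- by apply: measurableT_comp.
- exact: measurable_cst.
- exact: normr_measurable.
- exact: measurable_cst.
Qed.

Lemma cutoff_l2 k g : l2 leb g -> l2 leb (cutoff k g).
Proof.
move=> lg; have [mg _] := lg; apply: l2_le lg; first exact: measurable_cutoff.
by move=> t; rewrite /cutoff; case: ifP => // _; rewrite normr0.
Qed.

Lemma cutoff_cvg g : l2 leb g ->
  (\int[leb]_s ((g s - cutoff k g s) ^+ 2)%:E)%E @[k --> \oo] --> 0%E.
Proof.
move=> lg; have [mg _] := lg.
have := @dominated_convergence _ R R leb setT measurableT
  (fun k s => ((g s - cutoff k g s) ^+ 2)%:E) (cst 0%E) (EFin \o (fun s => g s ^+ 2)).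
case=> //.
- move=> k; apply/measurable_EFinP/measurable_funX/measurable_funB => //.
  exact: measurable_cutoff.
- apply: nearW => s _; apply: cvg_near_cst; near=> k.
  rewrite /cutoff ifT ?subrr ?expr0n //; apply/andP; split.
    by near: k; exact: nbhs_infty_ger.
  by near: k; exact: nbhs_infty_ger.
- exact: l2_sqr.
- apply: nearW => s k _ /=; rewrite lee_fin ger0_norm ?sqr_ge0 // /cutoff.
  by case: ifP => _; rewrite ?subrr ?subr0 // expr0n sqr_ge0.
by move=> _ _; rewrite integral_cst // mul0e.
Unshelve. all: by end_near.
Qed.

(** Truncations in height and support are dense, and convolution with [rho n] has norm at most
    [2 * n.+1^-1 * (2 * n.+1) = 4], uniformly in [n]. *)
Lemma mollify_cvg g : l2 leb g ->
  (\int[leb]_s ((conv (rho n) g s - g s) ^+ 2)%:E)%E @[n --> \oo] --> 0%E.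
Proof.
move=> lg.
have lc n h : l2 leb h -> l2 leb (conv (rho n) h).
  by move=> lh; have [] := conv_l2 (rho_bump n) lh.
have E n h : l2 leb h -> (\int[leb]_s ((conv (rho n) h s - h s) ^+ 2)%:E)%E =
    (ip leb (fun s => conv (rho n) h s - h s) (fun s => conv (rho n) h s - h s))%:E.
  by move=> lh; rewrite (ipE (l2B (lc n h lh) lh)).
have E2 k : (\int[leb]_s ((g s - cutoff k g s) ^+ 2)%:E)%E =
    (ip leb (fun s => g s - cutoff k g s) (fun s => g s - cutoff k g s))%:E.
  by rewrite (ipE (l2B lg (cutoff_l2 k lg))).
under eq_fun do rewrite (E _ _ lg).
apply: cvg_EFin; first by near=> n.
apply/cvgrPdist_le => e e0.
(* The error is at most [2 z + 2 (2 * 16 + 2) x], with [z] the error for the truncation and [x] the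
   squared norm of the remainder; with both at most [e/80] this is [70 e / 80]. *)
have e80 : 0 < e / 80 by rewrite divr_gt0.
have [k kP] : exists k, ip leb (fun s => g s - cutoff k g s) (fun s => g s - cutoff k g s) <= e / 80.
  have := cutoff_cvg lg; under eq_fun do rewrite E2.
  move=> /fine_cvg /= /cvgrPdist_le /(_ _ e80) [k _ /(_ k (leqnn k))].
  by rewrite /= sub0r normrN ger0_norm ?ip_ge0 //; exists k.
have lk := cutoff_l2 k lg.
have b1 t : `|cutoff k g t| <= k%:R.
  by rewrite /cutoff; case: ifP => [/andP[]//|]; rewrite normr0.
have b2 t : k%:R < `|t| -> cutoff k g t = 0.
  by rewrite /cutoff ltNge => /negbTE ->; rewrite andbF.
have := mollify_cvg_bounded lk (ler0n _ _) b1 b2.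
under eq_fun do rewrite (E _ _ lk).
move=> /fine_cvg /= /cvgrPdist_le /(_ _ e80) [N _ NP].
exists N => // n Nn; rewrite /= sub0r normrN ger0_norm ?ip_ge0 //.
have := NP n Nn; rewrite /= sub0r normrN ger0_norm ?ip_ge0 // => h.
pose d s := g s - cutoff k g s.
have ld : l2 leb d := l2B lg lk.
have -> : (fun s => conv (rho n) g s - g s) =
    (fun s => (conv (rho n) (cutoff k g) s - cutoff k g s) + (conv (rho n) d s - d s)).
  apply/funext => s; rewrite [in LHS](_ : g = fun t => cutoff k g t + d t); last first.
    by apply/funext => t; rewrite /d addrC subrK.
  by rewrite (convDr _ (rho_bump n) lk ld); ring.
have l1 := l2B (lc n _ lk) lk; have l2' := l2B (lc n _ ld) ld.
apply: le_trans (ipD_le l1 l2') _.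
have h3 := ipD_le (lc n _ ld) (l2N ld).
have [_ h4] := conv_l2 (rho_bump n) ld.
rewrite (_ : 2 * n.+1%:R^-1 * (2 * n.+1%:R) = 4) in h4; last by field; rewrite gt_eqF.
have h5 : ip leb (fun s => - d s) (fun s => - d s) = ip leb d d.
  by rewrite ipNl ?ipNr ?opprK //; exact: l2N.
rewrite h5 in h3; move: kP h h3 h4; rewrite -/d.
move: (ip leb d d) (ip leb (conv _ d) _) => x y.
have -> : (4 : R) ^+ 2 = 16 by ring.
move: (ip _ _ _) (ip _ _ _) => z w; lra.
Unshelve. all: by end_near.
Qed.

End Mollifier.

(** * Convolution in the time variable *)

Section RFubini.
Context d1 d2 (T1 : measurableType d1) (T2 : measurableType d2) (R : realType).
Context (m1 : {sigma_finite_measure set T1 -> \bar R}).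
Context (m2 : {sigma_finite_measure set T2 -> \bar R}).

(** Every section is required to be integrable, not almost every one: [fine] sends infinite inner
    integrals to 0, and this keeps it from altering the iterated integral. *)
Lemma Rintegral_fubini12 (k : T1 * T2 -> R) :
  (m1 \x m2)%E.-integrable setT (EFin \o k) ->
  (forall x, m2.-integrable setT (fun y => (k (x, y))%:E)) ->
  \int[(m1 \x m2)%E]_z k z = \int[m1]_x \int[m2]_y k (x, y).
Proof.
move=> ik ik2; rewrite /Rintegral; congr fine.
rewrite -(integral12_prod_meas1 ik); apply: eq_integral => x _.
by rewrite fineK //; exact: integrable_fin_num.
Qed.

Lemma Rintegral_fubini21 (k : T1 * T2 -> R) :
  (m1 \x m2)%E.-integrable setT (EFin \o k) ->
  (forall y, m1.-integrable setT (fun x => (k (x, y))%:E)) ->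
  \int[(m1 \x m2)%E]_z k z = \int[m2]_y \int[m1]_x k (x, y).
Proof.
move=> ik ik1; rewrite /Rintegral; congr fine.
rewrite -(integral21_prod_meas1 ik); apply: eq_integral => y _.
by rewrite fineK //; exact: integrable_fin_num.
Qed.

End RFubini.

Section TimeConvolution.
Context d (T : measurableType d) (R : realType).
Context (mu : {sigma_finite_measure set T -> \bar R}).
Local Notation leb := (@lebR R).
Local Notation P := ((@lebR R) \x mu)%E.
Implicit Types (f g : R * T -> R) (phi chi : R -> R).

Definition sec f x : R -> R := fun t => f (t, x).
Definition slice f s : T -> R := fun x => f (s, x).

(** All time sections are square integrable, so that convolution in time is meaningful above every
    point of [T] and identities can be proved section by section. *)
Definition nice f := l2 P f /\ forall x, l2 leb (sec f x).

Definition tconv phi f (z : R * T) := conv phi (sec f z.2) z.1.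

Lemma measurable_sec f x : measurable_fun setT f -> measurable_fun setT (sec f x).
Proof. by move=> mf; apply: measurableT_comp mf _; exact: measurable_pair2. Qed.

Lemma measurable_slice f s : measurable_fun setT f -> measurable_fun setT (slice f s).
Proof. by move=> mf; apply: measurableT_comp mf _; exact: measurable_pair1. Qed.

Lemma measurable_tconv phi f : measurable_fun setT phi -> measurable_fun setT f ->
  measurable_fun setT (tconv phi f).
Proof.
move=> mphi mf.
apply: (@measurable_Rintegral_param _ _ (R * T)%type R R leb
  (fun p => phi (p.1.1 - p.2) * f (p.2, p.1.2))).
apply: measurable_funM.
  apply: (measurableT_comp mphi); apply: measurable_funB.
    by apply: measurableT_comp; [exact: measurable_fst | exact: measurable_fst].
  exact: measurable_snd.
apply: (measurableT_comp mf); apply: measurable_fun_pair; first exact: measurable_snd.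
by apply: measurableT_comp; [exact: measurable_snd | exact: measurable_fst].
Qed.

Lemma l2_tonelli f : measurable_fun setT f ->
  (\int[P]_z (f z ^+ 2)%:E = \int[mu]_x \int[leb]_t (sec f x t ^+ 2)%:E)%E.
Proof.
move=> mf; apply: (fubini_tonelli2 (m1 := leb) (m2 := mu) (fun z => (f z ^+ 2)%:E)).
- by apply/measurable_EFinP/measurable_funX.
- by move=> z; rewrite lee_fin sqr_ge0.
Qed.

Lemma measurable_energy f : measurable_fun setT f ->
  measurable_fun setT (fun x => \int[leb]_t (sec f x t ^+ 2)%:E)%E.
Proof.
move=> mf.
apply: (measurable_fun_fubini_tonelli_G (m1 := leb) (fun z => (f z ^+ 2)%:E)).
- by apply/measurable_EFinP/measurable_funX.
- by move=> z; rewrite lee_fin sqr_ge0.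
Qed.

(** By Tonelli the energy of the section above [x] is finite for almost every [x]; the function is
    set to zero above the exceptional null set. *)
Lemma nice_ae f : l2 P f -> exists2 f', nice f' & {ae P, forall z, f z = f' z}.
Proof.
move=> lf; have [mf fin] := lf.
pose E x := (\int[leb]_t (sec f x t ^+ 2)%:E)%E.
have mE : measurable_fun setT E by exact: measurable_energy.
have E0 x : (0 <= E x)%E by apply: integral_ge0 => t _; rewrite lee_fin sqr_ge0.
pose N := [set x | E x = +oo%E].
have mN : measurable N.
  have -> : N = setT `&` E @^-1` [set +oo%E] by rewrite setTI.
  exact: mE.
have N0 : mu N = 0%E.
  have iE : mu.-integrable setT E.
    apply/integrableP; split => //; under eq_integral do rewrite gee0_abs //.
    by rewrite -l2_tonelli.
  have := integrable_ae measurableT iE.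
  move=> [B [mB B0 sB]]; apply/eqP; rewrite eq_le measure_ge0 andbT -B0.
  by apply: le_measure; rewrite ?inE // => x Nx; apply: sB => /= /(_ I); rewrite Nx.
pose f' (z : R * T) := \1_(~` N) z.2 * f z.
have m1N : measurable_fun setT (fun z : R * T => \1_(~` N) z.2 : R).
  have m1 : measurable_fun setT (\1_(~` N) : T -> R).
    by apply: measurable_indic; exact: measurableC.
  exact: (measurableT_comp m1 measurable_snd).
have lf' : l2 P f'.
  apply: (@l2M_bounded _ _ _ _ _ _ 1) => // z.
  by rewrite indicE; case: (_ \in _); rewrite ?normr1 ?normr0.
exists f'.
  split => // x; split.
    by apply: measurable_sec; case: lf'.
  have [Nx|Nx] := pselect (N x).
    by rewrite integral0_eq ?ltry // => t _; rewrite /sec /f' /= indicE memNset ?mul0r ?expr0n.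
  rewrite (_ : (\int[leb]_t (sec f' x t ^+ 2)%:E)%E = E x).
    by rewrite ltey; apply/eqP.
  by apply: eq_integral => t _; rewrite /sec /f' /= indicE mem_set ?mul1r.
exists (setT `*` N); split.
- exact: measurableX.
- by rewrite product_measure1E // N0 mule0.
- move=> [t x] /= h; split => //; apply: contrapT => Nx; apply: h.
  by rewrite /f' /= indicE mem_set ?mul1r.
Qed.

Lemma tconv_nice phi a M f : bump a M phi -> nice f -> nice (tconv phi f).
Proof.
move=> B [lf sf]; have [mphi a0 M0 _ _] := B; have [mf fin] := lf.
have mc := measurable_tconv mphi mf.
split; last by move=> x; have [] := conv_l2 B (sf x).
split => //; rewrite l2_tonelli //.
apply: (@le_lt_trans _ _ (\int[mu]_x (((2 * a * M) ^+ 2)%:E *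
    \int[leb]_t (sec f x t ^+ 2)%:E))%E).
  apply: ge0_le_integral => //.
  - by move=> x _; apply: integral_ge0 => t _; rewrite lee_fin sqr_ge0.
  - exact: measurable_energy.
  - by apply: measurable_funeM; exact: measurable_energy.
  - move=> x _; have [lc le] := conv_l2 B (sf x).
    by rewrite (ipE lc) (ipE (sf x)) -EFinM lee_fin.
rewrite ge0_integralZl //.
- by rewrite -l2_tonelli // lte_mul_pinfty // lee_fin sqr_ge0.
- exact: measurable_energy.
- by move=> x _; apply: integral_ge0 => t _; rewrite lee_fin sqr_ge0.
- by rewrite lee_fin sqr_ge0.
Qed.

Lemma ip_sec f g : nice f -> nice g -> ip P f g = \int[mu]_x ip leb (sec f x) (sec g x).
Proof.
move=> [lf sf] [lg sg]; apply: Rintegral_fubini21; first exact: l2_int.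
by move=> x; exact: (l2_int (sf x) (sg x)).
Qed.

Lemma tconv_by_parts a M phi phi' chi chi' f g :
  udiff a M phi phi' -> udiff a M chi chi' -> nice f -> nice g ->
  ip P (tconv phi' f) (tconv chi g) = - ip P (tconv phi f) (tconv chi' g).
Proof.
move=> u1 u2 nf ng; have [B1 B1' _] := u1; have [B2 B2' _] := u2.
have n1 := tconv_nice B1 nf; have n1' := tconv_nice B1' nf.
have n2 := tconv_nice B2 ng; have n2' := tconv_nice B2' ng.
have -> : - ip P (tconv phi f) (tconv chi' g) =
    ip P (fun z => - tconv phi f z) (tconv chi' g).
  by rewrite ipNl //; [case: n1 | case: n2'].
have nn1 : nice (fun z => - tconv phi f z).
  by case: n1 => l s; split; [exact: l2N | move=> x; exact: (l2N (s x))].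
rewrite (ip_sec n1' n2) (ip_sec nn1 n2'); apply: eq_Rintegral => x _.
have [_ sf] := nf; have [_ sg] := ng; have [_ s1] := n1; have [_ s2] := n2'.
rewrite (conv_by_parts u1 u2 (sf x) (sg x)) -(ipNl (s1 x) (s2 x)) //.
Qed.

Lemma slice_le phi a M f s x : bump a M phi -> nice f ->
  (slice (tconv phi f) s x) ^+ 2 <= 2 * a * M ^+ 2 * ip leb (sec f x) (sec f x).
Proof.
move=> B [_ sf]; have [l le] := bump_refl_l2 s B.
apply: le_trans (ip_cs l (sf x)) _.
by rewrite ler_wpM2r // ip_ge0.
Qed.

(** After mollification every slice is square integrable, not only almost every one: Cauchy-Schwarz
    in time bounds its value at [x] by the energy of the section above [x]. *)
Lemma slice_l2 phi a M f s : bump a M phi -> nice f -> l2 mu (slice (tconv phi f) s).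
Proof.
move=> B nf; have [lf sf] := nf; have [mf fin] := lf; have [mphi a0 M0 _ _] := B.
have ms : measurable_fun setT (slice (tconv phi f) s).
  by apply: measurable_slice; exact: measurable_tconv.
split => //.
apply: (@le_lt_trans _ _ (\int[mu]_x ((2 * a * M ^+ 2)%:E *
    \int[leb]_t (sec f x t ^+ 2)%:E))%E).
  apply: ge0_le_integral => //.
  - by move=> x _; rewrite lee_fin sqr_ge0.
  - by apply/measurable_EFinP/measurable_funX.
  - by apply: measurable_funeM; exact: measurable_energy.
  - by move=> x _; rewrite (ipE (sf x)) -EFinM lee_fin; exact: slice_le.
have c0 : 0 <= 2 * a * M ^+ 2 by rewrite !mulr_ge0 // sqr_ge0.
rewrite ge0_integralZl //.
- by rewrite -l2_tonelli // lte_mul_pinfty.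
- exact: measurable_energy.
- by move=> x _; apply: integral_ge0 => t _; rewrite lee_fin sqr_ge0.
Qed.

Definition tensor phi (psi : T -> R) (z : R * T) := phi z.1 * psi z.2.

Lemma tensor_nice phi psi a M s : bump a M phi -> l2 mu psi ->
  nice (tensor (fun t => phi (s - t)) psi).
Proof.
move=> B lpsi; have [lphi _] := bump_refl_l2 s B.
have [mphi fphi] := lphi; have [mpsi fpsi] := lpsi.
have mt : measurable_fun setT (tensor (fun t => phi (s - t)) psi).
  apply: measurable_funM.
    apply: (measurableT_comp mphi); exact: measurable_fst.
  by apply: (measurableT_comp mpsi); exact: measurable_snd.
have st x : l2 leb (sec (tensor (fun t => phi (s - t)) psi) x).
  have := l2Z (psi x) lphi; congr l2; apply/funext => t.
  by rewrite /sec /tensor /= mulrC.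
split => //; split => //; rewrite l2_tonelli //.
rewrite (_ : (\int[mu]_x _)%E = (\int[mu]_x ((ip leb (fun t => phi (s - t)) (fun t => phi (s - t)))%:E *
    (psi x ^+ 2)%:E))%E).
  rewrite ge0_integralZl //.
  - by rewrite lte_mul_pinfty // lee_fin ip_ge0.
  - by apply/measurable_EFinP/measurable_funX.
  - by move=> x _; rewrite lee_fin sqr_ge0.
  - by rewrite lee_fin ip_ge0.
apply: eq_integral => x _; rewrite (ipE (st x)) -EFinM; congr EFin.
rewrite [sec _ _](_ : _ = fun t => psi x * phi (s - t)); last first.
  by apply/funext => t; rewrite /sec /tensor /= mulrC.
by rewrite (ipZl _ lphi (l2Z _ lphi)) (ipZr _ lphi lphi); ring.
Qed.

(** The integral over time of [f] against [phi (s - t)] is the convolution at time [s]; this is how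
    slices of the mollification enter the weak formulation. *)
Lemma ip_tensor phi psi a M s f : bump a M phi -> l2 mu psi -> nice f ->
  ip P f (tensor (fun t => phi (s - t)) psi) = ip mu (slice (tconv phi f) s) psi.
Proof.
move=> B lpsi nf; have nt := tensor_nice s B lpsi.
have [lphi _] := bump_refl_l2 s B; have [_ sf] := nf.
rewrite ip_sec //; apply: eq_Rintegral => x _.
rewrite [sec (tensor _ _) _](_ : _ = fun t => psi x * phi (s - t)); last first.
  by apply/funext => t; rewrite /sec /tensor /= mulrC.
by rewrite (ipZr _ lphi (sf x)) mulrC ipC.
Qed.

Variable rho : nat -> R -> R.
Hypothesis rho_bump : forall n, bump n.+1%:R^-1 (2 * n.+1%:R) (rho n).
Hypothesis rho_int : forall n, \int[leb]_t rho n t = 1.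

(** Dominated convergence in [x] applied to the one-dimensional errors. The factor 34 is
    [2 * 4^2 + 2], from the convolution bound and the parallelogram inequality [ipD_le]. *)
Lemma tconv_cvg f : nice f ->
  ip P (fun z => tconv (rho n) f z - f z) (fun z => tconv (rho n) f z - f z) @[n --> \oo] --> 0.
Proof.
move=> nf; have [lf sf] := nf; have [mf fin] := lf.
have lc n : nice (fun z => tconv (rho n) f z - f z).
  have [l s] := tconv_nice (rho_bump n) nf.
  by split; [exact: l2B | move=> x; exact: (l2B (s x) (sf x))].
pose F n x := (\int[leb]_s ((conv (rho n) (sec f x) s - sec f x s) ^+ 2)%:E)%E.
pose E x := (\int[leb]_t (sec f x t ^+ 2)%:E)%E.
have mE : measurable_fun setT E by exact: measurable_energy.
have E0 x : (0 <= E x)%E by apply: integral_ge0 => t _; rewrite lee_fin sqr_ge0.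
have F0 n x : (0 <= F n x)%E by apply: integral_ge0 => t _; rewrite lee_fin sqr_ge0.
have iE : mu.-integrable setT E.
  apply/integrableP; split => //; under eq_integral do rewrite gee0_abs //.
  by rewrite -l2_tonelli.
have mFn n : measurable_fun setT (F n).
  have [[m _] _] := lc n; exact: (measurable_energy m).
have FE n : ((ip P (fun z => tconv (rho n) f z - f z) (fun z => tconv (rho n) f z - f z))%:E
    = \int[mu]_x F n x)%E.
  by have [l _] := lc n; rewrite -(ipE l) l2_tonelli //; case: l.
have := @dominated_convergence _ T R mu setT measurableT F (cst 0%E) (fun x => 34%:E * E x)%E.
case => //.
- apply: nearW => x _; exact: (mollify_cvg rho_bump rho_int (sf x)).
- exact: integrableZl.
- apply: nearW => x n _; rewrite gee0_abs //.
  have [l1 h1] := conv_l2 (rho_bump n) (sf x).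
  rewrite (_ : 2 * n.+1%:R^-1 * (2 * n.+1%:R) = 4) in h1; last by field; rewrite gt_eqF.
  rewrite /F /E (ipE (l2B l1 (sf x))) (ipE (sf x)) -EFinM lee_fin.
  apply: le_trans (ipD_le l1 (l2N (sf x))) _.
  rewrite (ipNl (sf x) (l2N (sf x))) (ipNr (sf x) (sf x)) opprK.
  have := ip_ge0 leb (sec f x); move: h1.
  have -> : (4 : R) ^+ 2 = 16 by ring.
  move: (ip leb (sec f x) (sec f x)) (ip leb _ _) => p q; lra.
move=> _ _; rewrite integral_cst // mul0e => h.
have -> : (fun n => ip P (fun z => tconv (rho n) f z - f z)
    (fun z => tconv (rho n) f z - f z)) = fine \o (fun n => \int[mu]_x F n x)%E.
  by apply/funext => n /=; rewrite -FE.
exact: (fine_cvg h).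
Qed.

End TimeConvolution.

(** * Borel sets of products *)

Section Borel.
Variables X Y : ptopologicalType.

Lemma open_borel (U : set (borel X)) : open (U : set X) -> measurable U.
Proof. by move=> oU; exact: sub_sigma_algebra. Qed.

Lemma closed_borel (U : set (borel X)) : closed (U : set X) -> measurable U.
Proof.
move=> cU; rewrite -[U]setCK; apply: measurableC; apply: open_borel.
exact: closed_openC.
Qed.

Lemma continuous_borel (f : X -> Y) : continuous f ->
  measurable_fun [set: borel X] (f : borel X -> borel Y).
Proof.
move=> /continuousP cf; apply: (@measurability _ _ (borel X) (borel Y) setT f (@open Y)) => //.
by move=> _ [U oU <-]; rewrite setTI; apply: open_borel; exact: cf.
Qed.

Lemma open_continuous_borel (R : realType) (U : set X) (f : X -> R) : open U ->
  {in U, continuous f} -> measurable_fun (U : set (borel X)) (f : borel X -> R).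
Proof.
move=> oU cf; apply: (measurability _ (RGenOpens.measurableE R)).
move=> _ [_ [a [b ->] <-]]; apply: open_borel.
have -> : U `&` f @^-1` `]a, b[ = U `&` (U `&` f @^-1` `]a, b[) by rewrite setIA setIid.
rewrite openE => x [Ux [_ fx]]; have := cf x (mem_set Ux) _ (open_nbhs_nbhs (conj (interval_open (a := BRight a) (b := BLeft b) isT isT) fx)).
move=> nf; rewrite /interior; apply: filterI; first exact: open_nbhs_nbhs.
by apply: filterI => //; exact: open_nbhs_nbhs.
Qed.

Lemma continuous_borel_real (R : realType) (f : X -> R) : continuous f ->
  measurable_fun [set: borel X] (f : borel X -> R).
Proof.
move=> cf; apply: open_continuous_borel; first exact: openT.
by move=> x _; exact: cf.
Qed.

End Borel.

Section RationalBalls.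
Variable R : realType.

Lemma rat_ball (t e : R) : 0 < e -> exists q : rat * rat,
  `|t - ratr q.1| < ratr q.2 /\ forall s, `|s - ratr q.1| < ratr q.2 -> `|t - s| < e.
Proof.
move=> e0.
have [r] := @rat_in_itvoo R 0 (e / 2) ltac:(by rewrite divr_gt0).
rewrite in_itv /= => /andP[r0 re].
have [q] := @rat_in_itvoo R (t - ratr r) (t + ratr r) ltac:(by lra).
rewrite in_itv /= => /andP[q1 q2]; exists (q, r) => /=.
have tq : `|t - ratr q| < ratr r by rewrite ltr_norml; apply/andP; split; lra.
split=> // s sq; have := ler_distD (ratr q) t s; rewrite (distrC (ratr q)).
by move: tq sq; move: `|t - ratr q| `|s - ratr q| `|t - s| => a b c; lra.
Qed.

Lemma second_countable_rV n : @second_countable 'rV[R]_n.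
Proof.
pose box (p : 'rV[rat]_n * rat) : set 'rV[R]_n :=
  [set y | 0 < ratr p.2 :> R /\ forall j, `|y 0 j - ratr (p.1 0 j)| < ratr p.2].
exists (range box); first exact: sub_countable (card_image_le _ _) (countableP _).
split.
  move=> _ [[q r] _ <-]; rewrite openE => y [/= r0 yq].
  (* In dimension zero there is no coordinate to start the minimum from, and any radius will do. *)
  apply/nbhs_ballP; case: (pselect (exists j : 'I_n, True)) => [[j0 _]|no]; last first.
    by exists 1 => //= z _; split => // j; exfalso; apply: no; exists j.
  pose e := \big[Num.min/ratr r - `|y 0 j0 - ratr (q 0 j0)|]_j (ratr r - `|y 0 j - ratr (q 0 j)|).
  have e0 : 0 < e.
    by rewrite /e; elim/big_ind: _ => [|a b a0 b0|j _]; rewrite ?subr_gt0 ?yq // lt_min a0 b0.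
  exists e => //= z [_ yz]; split => //= j.
  have := yz 0 j; rewrite /ball /= => h.
  have : e <= ratr r - `|y 0 j - ratr (q 0 j)| by apply: bigmin_le.
  have := ler_distD (y 0 j) (z 0 j) (ratr (q 0 j)); rewrite (distrC (z 0 j) (y 0 j)).
  by move: h; move: `|_ - _| `|_ - _| `|_ - _| => a b c; lra.
move=> y A /nbhs_ballP[e /= e0 eA].
have [r] := @rat_in_itvoo R 0 (e / 2) ltac:(by rewrite divr_gt0).
rewrite in_itv /= => /andP[r0 re].
have hq j : exists q : rat, `|y 0 j - ratr q| < ratr r.
  have [q] := @rat_in_itvoo R (y 0 j - ratr r) (y 0 j + ratr r) ltac:(by lra).
  by rewrite in_itv /= => /andP[q1 q2]; exists q; rewrite ltr_norml; apply/andP; split; lra.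
have [q hq'] := choice hq.
exists (box (\row_j q j, r)).
  by split; [exists (\row_j q j, r) | split => //= j; rewrite mxE].
move=> z [/= _ hz]; apply: eA; split => // i j; rewrite (ord1 i) /ball /=.
have := hz j; rewrite mxE => h1; have h2 := hq' j.
have := ler_distD (ratr (q j)) (y 0 j) (z 0 j); rewrite (distrC (ratr (q j))).
by move: h1 h2; move: `|_ - _| `|_ - _| `|_ - _| => a b c; lra.
Qed.

Variable X : ptopologicalType.

(** An open set is the union of the boxes it contains of the form rational interval times basic open
    set, and there are countably many of these. *)
Lemma open_prod_measurable (U : set (R * X)) : @second_countable X -> open U ->
  measurable (U : set (R * borel X)).
Proof.
move=> [B cB [oB bB]] oU.
pose ball_ (q : rat * rat) : set R := [set s | `|s - ratr q.1| < ratr q.2].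
pose D : set ((rat * rat) * set X) := [set p | B p.2 /\ ball_ p.1 `*` p.2 `<=` U].
have -> : U = \bigcup_(p in D) (ball_ p.1 `*` p.2).
  apply/seteqP; split => [[t x] Utx|[t x] [p [_ Up] h]]; last exact: Up.
  have [[/= P Q] [nP nQ] PQ] : nbhs (t, x) U by exact: open_nbhs_nbhs.
  have [e /= e0 eP] := (nbhs_ballP t P).1 nP.
  have [q [q1 q2]] := rat_ball t e0.
  have [V [/= BV Vx] VQ] := bB x _ nQ.
  exists (q, V) => //; split => //= -[s z] [/= sq Vz]; apply: (PQ (s, z)); split => /=.
    by apply: eP; exact: q2.
  exact: VQ.
have cD : countable D.
  apply: (@sub_countable _ _ _ ([set: rat * rat] `*` B)).
    by apply: subset_card_le => -[q V] [].
  by apply: countableX => //; exact: countableP.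
(* Measurable unions are taken over [nat]: [f] numbers the boxes, and a number that is not attained
   contributes the empty set. *)
have [f If] : exists f : ((rat * rat) * set X) -> nat, {in D &, injective f}.
  by apply/countable_injP.
have -> : \bigcup_(p in D) (ball_ p.1 `*` p.2) =
    \bigcup_n \bigcup_(p in [set p | D p /\ f p = n]) (ball_ p.1 `*` p.2 : set (R * borel X)).
  apply/seteqP; split => [z [p Dp zp]|z [n _ [p [Dp _] zp]]]; last by exists p.
  by exists (f p) => //; exists p.
apply: bigcupT_measurable => n.
have [[p [Dp fp]]|no] := pselect (exists p, D p /\ f p = n).
  have -> : [set p | D p /\ f p = n] = [set p].
    apply/seteqP; split => [p' [Dp' fp']|_ ->] //.
    by apply: If; rewrite ?inE // fp'.
  rewrite bigcup_set1; apply: measurableX; last by apply: open_borel; exact: oB (Dp.1).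
  have -> : ball_ p.1 = ball (ratr p.1.1 : R) (ratr p.1.2).
    by apply/seteqP; split => s; rewrite /ball_ /ball /= distrC.
  exact: measurable_ball.
have -> : [set p | D p /\ f p = n] = set0.
  by apply/seteqP; split => p // h; apply: no; exists p.
by rewrite bigcup_set0.
Qed.

(** Second countability gives the first direction; the second only says that the two projections are
    Borel. Measures on Borel sets of [R * X] can thus be compared with product measures. *)
Lemma prod_borel_measurable (U : set (R * X)) : @second_countable X ->
  measurable (U : set (borel (R * X)%type)) <-> measurable (U : set (R * borel X)).
Proof.
move=> sc; split.
  move=> mU; have mi : measurable_fun [set: R * borel X] (id : R * borel X -> borel (R * X)%type).
    apply: (@measurability _ _ (R * borel X)%type (borel (R * X)%type) setT id (@open (R * X)%type)) => //.
    by move=> _ [V oV <-]; rewrite setTI; exact: open_prod_measurable.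
  by have := mi measurableT _ mU; rewrite setTI.
move=> mU; have mi : measurable_fun [set: borel (R * X)%type] (id : borel (R * X)%type -> R * borel X).
  apply/measurable_fun_pairP; split.
    by apply: continuous_borel_real => z; exact: cvg_fst.
  by apply: continuous_borel => z; exact: cvg_snd.
by have := mi measurableT _ mU; rewrite setTI.
Qed.

End RationalBalls.

(** * Lebesgue measure on row vectors *)

Section Row.
Variables (R : realType) (n : nat).

Definition consr (z : R * 'rV[R]_n) : 'rV[R]_(1 + n) := row_mx (z.1%:M : 'M[R]_1) z.2.

Lemma consr0 z : consr z 0 (lshift n ord0) = z.1.
Proof. by rewrite /consr row_mxEl mxE eqxx mulr1n. Qed.

Lemma consrS z j : consr z 0 (rshift 1 j) = z.2 0 j.
Proof. by rewrite /consr row_mxEr. Qed.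

Lemma continuous_consr : continuous consr.
Proof.
move=> [t y] A /nbhs_ballP[e /= e0 eA].
exists (ball t e, ball y e); first by split; exact: nbhsx_ballx.
move=> [s z] [/= ts [_ yz]]; apply: eA; split => // i j; rewrite (ord1 i).
case: (split_ordP j) => k ->; first by rewrite (ord1 k) !consr0.
by rewrite !consrS; exact: yz.
Qed.

Lemma measurable_consr :
  measurable_fun [set: R * borel 'rV[R]_n] (consr : R * borel 'rV[R]_n -> borel 'rV[R]_(1 + n)).
Proof.
apply: (@measurability _ _ (R * borel 'rV[R]_n)%type (borel 'rV[R]_(1 + n)) setT consr
  (@open 'rV[R]_(1 + n))) => //.
move=> _ [U oU <-]; rewrite setTI; apply: open_prod_measurable; first exact: second_countable_rV.
by apply: open_comp => // z _; exact: continuous_consr.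
Qed.

Lemma consr_hd_tl (y : 'rV[R]_(1 + n)) : consr (lsubmx y 0 0, rsubmx y) = y.
Proof.
apply/rowP => j; case: (split_ordP j) => k ->; last by rewrite consrS /= mxE.
by rewrite (ord1 k) consr0 /= mxE; congr (y _ _); apply/val_inj.
Qed.

End Row.

Section SigmaFinite.
Context d (T : measurableType d) (R : realType) (m : {measure set T -> \bar R}).
Hypothesis sf : sigma_finite setT m.

(** A copy of [m] indexed by the proof of sigma-finiteness, to which the canonical structure can be
    attached when that property is known only as a proposition. *)
Definition sf_measure of sigma_finite setT m : set T -> \bar R := m.

HB.instance Definition _ := Measure.copy (sf_measure sf) m.
HB.instance Definition _ := Measure_isSigmaFinite.Build _ _ R (sf_measure sf) sf.

End SigmaFinite.

Section LebesguePowers.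
Variable R : realType.

Lemma lebesgue_rV0 n : lebesgue_rV (set0 : set 'rV[R]_n) = 0%E.
Proof.
elim: n => [|n IH] /=; first by rewrite indicE in_set0.
by rewrite integral0_eq // => t _; exact: IH.
Qed.

Lemma lebesgue_rV_ge0 n (B : set 'rV[R]_n) : (0 <= lebesgue_rV B)%E.
Proof.
elim: n B => [|n IH] B /=; first by rewrite lee_fin.
by apply: integral_ge0 => t _; exact: IH.
Qed.

(** For a positive radius this is the ball of the sup norm; the description by coordinates makes its
    sections cubes again. *)
Definition cube n (p : 'rV[R]_n) (r : R) : set 'rV[R]_n :=
  [set y | forall j, `|y 0 j - p 0 j| < r].

Lemma cube_ball n (p : 'rV[R]_n) r : 0 < r -> cube p r = ball p r.
Proof.
move=> r0; apply/seteqP; split => y.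
  by move=> h; split => // i j; rewrite (ord1 i) /ball /= distrC.
by move=> [_ h] j; have := h 0 j; rewrite /ball /= distrC.
Qed.

Lemma lebesgue_cube n (p : 'rV[R]_n) r : 0 <= r ->
  lebesgue_rV (cube p r) = ((2 * r) ^+ n)%:E.
Proof.
move=> r0; elim: n p => [|n IH] p /=.
  by rewrite expr0 indicE mem_set // => -[].
pose t0 := p 0 (lshift n ord0 : 'I_(1 + n)).
have sec t : [set y | cube p r (consr (t, y))] =
    if `|t - t0| < r then cube (rsubmx (p : 'rV_(1 + n))) r else set0.
  apply/seteqP; split => y.
    move=> h; have := h (lshift n ord0 : 'I_(1 + n)); rewrite consr0 /= => ->.
    by move=> j; have := h (rshift 1 j : 'I_(1 + n)); rewrite consrS mxE.
  case: ifP => // ht h j; case: (split_ordP (j : 'I_(1 + n))) => k ->.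
    by rewrite (ord1 k) consr0.
  by have := h k; rewrite consrS mxE.
rewrite (_ : (fun t => _) = fun t => (((2 * r) ^+ n)%:E * (\1_(`]t0 - r, t0 + r[%classic) t)%:E)%E); last first.
  apply/funext => t; rewrite -[X in lebesgue_rV X]/([set y | cube p r (consr (t, y))]) sec.
  have E : (t \in `]t0 - r, t0 + r[%classic) = (`|t - t0| < r).
    apply/idP/idP; rewrite ?inE /= in_itv /= ltr_distl //.
  rewrite indicE E; case: ifP => _; first by rewrite mule1 IH.
  by rewrite mule0 lebesgue_rV0.
rewrite ge0_integralZl //=; last by rewrite lee_fin exprn_ge0 // mulr_ge0.
  rewrite integral_indic //= setIT lebesgue_measure_itv /= lte_fin.
  case: ifP => h.
    by rewrite -EFinB -EFinM; congr EFin; rewrite exprSr; congr (_ * _); ring.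
  have -> : r = 0 by apply/eqP; rewrite eq_le r0 andbT leNgt; apply/negP => ?; move: h; lra.
  by rewrite mulr0 mule0 exprS mul0r.
apply/measurable_EFinP; exact: measurable_indic.
Qed.

Definition lam n : set (borel 'rV[R]_n) -> \bar R := @lebesgue_rV R n.

Let measurable_cube n (p : 'rV[R]_n) r : measurable (cube p r : set (borel 'rV[R]_n)).
Proof.
apply: open_borel.
have [r0|r0] := ltP 0 r; first by rewrite cube_ball //; exact: ball_open.
rewrite openE => y h; case: n p y h => [|n] p y h.
  by apply/nbhs_ballP; exists 1 => //= z _ [].
by have := h 0 ; have := normr_ge0 (y 0 0 - p 0 0); move=> a b; lra.
Qed.

Let lam_sigma_finite n : sigma_finite setT (@lam n).
Proof.
exists (fun k => cube 0 k%:R).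
  apply/seteqP; split => // y _.
  exists (Num.truncn (\big[Num.max/0]_j `|(y : 'rV[R]_n) 0 j|)).+1 => // j; rewrite mxE subr0.
  by apply: le_lt_trans (truncnS_gt _); exact: le_bigmax.
by move=> k; split; [exact: measurable_cube|rewrite /lam lebesgue_cube // ltry].
Qed.

Section Instances.
Variable n : nat.
Hypothesis lam_sigma : semi_sigma_additive (@lam n).

Let lam_measure : {measure set (borel 'rV[R]_n) -> \bar R} := HB.pack (@lam n)
  (isMeasure.Build _ _ R (@lam n) (lebesgue_rV0 n) (@lebesgue_rV_ge0 n) lam_sigma).

Let lam_sf := sf_measure (m := lam_measure) (lam_sigma_finite n).

(** The iterated integral that defines [lam] in dimension [n+1] is the product measure evaluated by
    sections. Additivity in dimension [n] is a hypothesis because the measure structures exist only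
    after the induction. *)
Lemma lam_succ (B : set (borel 'rV[R]_n.+1)) : measurable B ->
  lam B = ((@lebR R) \x lam_sf)%E (@consr R n @^-1` B).
Proof.
move=> mB; have mC : measurable (@consr R n @^-1` B : set (R * borel 'rV[R]_n)).
  by rewrite -[X in measurable X]setTI; exact: measurable_consr.
have mf := measurable_fun_xsection lam_sf mC.
have -> : lam B = (\int[@lebesgue_measure R]_t (lam_sf \o xsection (@consr R n @^-1` B)) t)%E.
  rewrite /lam /=; apply: eq_integral => t _ /=; rewrite /sf_measure /= /lam; congr lebesgue_rV.
  by apply/seteqP; split => y; rewrite /xsection /= inE.
by rewrite -lebR_integral // => t; exact: lebesgue_rV_ge0.
Qed.

(** Preimages under [consr] respect disjointness and unions, so additivity is inherited from the
    product measure. *)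
Lemma lam_sigma_succ : semi_sigma_additive (@lam n.+1).
Proof.
move=> F mF tF mU; rewrite (lam_succ mU) preimage_bigcup.
under eq_fun do under eq_bigr do rewrite lam_succ //.
have mC (B : set (borel 'rV[R]_n.+1)) : measurable B -> measurable (@consr R n @^-1` B : set (R * borel 'rV[R]_n)).
  by move=> mB; rewrite -[X in measurable X]setTI; exact: measurable_consr.
apply: (@measure_semi_sigma_additive _ _ _ ((@lebR R) \x lam_sf)%E) => //.
- by move=> i; exact: mC.
- apply/trivIsetP => /= i j _ _ ij; rewrite -preimage_setI.
  by move/trivIsetP : tF => /(_ _ _ _ _ ij) ->//; rewrite preimage_set0.
- by rewrite -preimage_bigcup; exact: mC.
Qed.

End Instances.

Let lam_sigma n : semi_sigma_additive (@lam n).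
Proof.
elim: n => [|n IH]; last exact: lam_sigma_succ.
exact: (@measure_semi_sigma_additive _ _ _ (@dirac _ (borel 'rV[R]_0) (0 : 'rV[R]_0) R)).
Qed.

HB.instance Definition _ n := isMeasure.Build _ _ R (@lam n) (lebesgue_rV0 n)
  (@lebesgue_rV_ge0 n) (@lam_sigma n).
HB.instance Definition _ n := Measure_isSigmaFinite.Build _ _ R (@lam n) (lam_sigma_finite n).

Lemma lam_consr n (B : set (borel 'rV[R]_n.+1)) : measurable B ->
  lam B = ((@lebR R) \x @lam n)%E (@consr R n @^-1` B).
Proof. exact: lam_succ. Qed.

Lemma lam_pushforward n (f : 'rV[R]_(1 + n) -> \bar R) :
  measurable_fun [set: borel 'rV[R]_(1 + n)] (f : borel 'rV[R]_(1 + n) -> \bar R) ->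
  (forall y, 0 <= f y)%E ->
  (\int[@lam (1 + n)]_y f y = \int[(@lebR R) \x @lam n]_z f (consr z))%E.
Proof.
move=> mf f0; have mc := @measurable_consr R n.
rewrite -(@ge0_integral_pushforward _ _ _ _ R _ mc ((@lebR R) \x @lam n)%E setT f measurableT mf) //.
pose F : {mfun (R * borel 'rV[R]_n)%type >-> borel 'rV[R]_(1 + n)} := HB.pack (@consr R n)
  (isMeasurableFun.Build _ _ _ _ _ mc).
apply: (@eq_measure_integral _ _ _ setT (pushforward ((@lebR R) \x @lam n)%E F) (@lam (1 + n))).
by move=> A mA _; exact: (lam_consr (n := n) mA).
Qed.

Lemma lam_integrable n (f : 'rV[R]_(1 + n) -> R) :
  (@lam (1 + n)).-integrable setT (EFin \o f) ->
  ((@lebR R) \x @lam n)%E.-integrable setT (EFin \o (f \o @consr R n)).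
Proof.
move=> /integrableP[mf If]; have mc := @measurable_consr R n.
apply/integrableP; split; first exact: (measurableT_comp mf mc).
rewrite -(lam_pushforward (f := fun y => `|(f y)%:E|%E)) //.
exact: measurableT_comp.
Qed.

Lemma lam_Rintegral n (f : 'rV[R]_(1 + n) -> R) :
  (@lam (1 + n)).-integrable setT (EFin \o f) ->
  \int[@lam (1 + n)]_y f y = \int[((@lebR R) \x @lam n)%E]_z f (consr z).
Proof.
move=> /integrableP[mf If]; rewrite /Rintegral integralE [in RHS]integralE; congr (fine (_ - _)%E).
  have h := lam_pushforward (n := n) (f := ((EFin \o f)^\+)%E) (measurable_funepos mf) (@funepos_ge0 _ _ _).
  by apply: (etrans h); apply: eq_integral => z _; rewrite !funeposE.
have h := lam_pushforward (n := n) (f := ((EFin \o f)^\-)%E) (measurable_funeneg mf) (@funeneg_ge0 _ _ _).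
by apply: (etrans h); apply: eq_integral => z _; rewrite !funenegE.
Qed.

End LebesguePowers.

(** * Integration of partial derivatives *)

Section Support.
Context d (T : measurableType d) (R : realType) (mu : {measure set T -> \bar R}).

Lemma bounded_support_integrable (A : set T) (C : R) (f : T -> R) :
  measurable_fun setT f -> measurable A -> (mu A < +oo)%E ->
  (forall x, `|f x| <= C) -> (forall x, ~ A x -> f x = 0) ->
  mu.-integrable setT (EFin \o f).
Proof.
move=> mf mA Afin fC f0; apply/integrableP; split; first by apply/measurable_EFinP.
apply: (@le_lt_trans _ _ (\int[mu]_x (`|C|%:E * (\1_A x)%:E))%E).
  apply: ge0_le_integral => //.
  - by apply: measurableT_comp => //; apply/measurable_EFinP.
  - apply: emeasurable_funM => //; apply/measurable_EFinP; exact: measurable_indic.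
  move=> x _ /=; rewrite -EFinM lee_fin indicE.
  have [Ax|nAx] := pselect (A x).
    by rewrite mem_set // mulr1; apply: le_trans (fC x) (ler_norm _).
  by rewrite memNset // mulr0 f0 // normr0.
rewrite ge0_integralZl //; last by apply/measurable_EFinP; exact: measurable_indic.
by rewrite integral_indic // setIT lte_mul_pinfty // lee_fin.
Qed.

End Support.

Lemma compact_bounded_fun (X : topologicalType) (R : realType) (K : set X) (f : X -> R) :
  compact K -> {in K, continuous f} -> exists C, forall x, K x -> `|f x| <= C.
Proof.
move=> cK cf.
have cw : {within K, continuous f}.
  by apply: continuous_in_subspaceT.
have /compact_bounded [M [_ hM]] := continuous_compact cw cK.
by exists (M + 1) => x Kx; apply: (hM (M + 1)); [rewrite ltrDl | exists x].
Qed.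

Section LineDerivative.
Variables (R : realType) (V : normedModType R).

Lemma line_is_derive (f : V -> R) (x v : V) (s : R) : derivable f (s *: v + x) v ->
  is_derive s 1 (fun s : R => f (s *: v + x)) ('D_v f (s *: v + x)).
Proof.
move=> df.
have E : (fun h : R => h^-1 *: (f ((h *: (1 : R) + s) *: v + x) - f (s *: v + x))) =
    (fun h : R => h^-1 *: (f (h *: v + (s *: v + x)) - f (s *: v + x))).
  by apply/funext => h; rewrite [h *: 1]mulr1 scalerDl addrA.
apply: DeriveDef; first by rewrite /derivable; move: df; rewrite /derivable -E.
by rewrite /derive E.
Qed.

End LineDerivative.

Section Divergence.
Variable R : realType.

Lemma Rintegral_lebR (D : set R) (f : R -> R) : measurable D -> measurable_fun D f ->
  \int[@lebR R]_(t in D) f t = \int[@lebesgue_measure R]_(t in D) f t.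
Proof.
move=> mD mf; rewrite /Rintegral integralE [in RHS]integralE; congr (fine (_ - _)%E).
  by apply: lebR_integral => //; apply: measurable_funepos; apply/measurable_EFinP.
by apply: lebR_integral => //; apply: measurable_funeneg; apply/measurable_EFinP.
Qed.

Lemma lebR_itv_fin (a b : R) : (lebR `[a, b]%classic < +oo)%E.
Proof.
rewrite (_ : lebR _ = @lebesgue_measure R `[a, b]%classic) // lebesgue_measure_itv /=.
by case: ifP => _; rewrite -?EFinB ltry.
Qed.

Lemma lam_cube_fin n (p : 'rV[R]_n) r : 0 <= r -> (lam (cube p r) < +oo)%E.
Proof. by move=> r0; rewrite (_ : lam _ = lebesgue_rV (cube p r)) // lebesgue_cube // ltry. Qed.

Lemma Rintegral0 d (T : measurableType d) (mu : {measure set T -> \bar R}) :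
  \int[mu]_x (0 : R) = 0.
Proof. by rewrite /Rintegral integral0_eq. Qed.

Lemma Rintegral_support d (T : measurableType d) (mu : {measure set T -> \bar R})
  (A : set T) (f : T -> R) : (forall x, ~ A x -> f x = 0) ->
  \int[mu]_x f x = \int[mu]_(x in A) f x.
Proof.
move=> f0; rewrite [RHS]Rintegral_mkcond; congr Rintegral; apply/funext => x.
by rewrite patchE; case: ifPn => //; rewrite notin_setE => /f0.
Qed.

Lemma Rintegral_derivative (F f : R -> R) (r : R) : 0 < r ->
  (forall t : R, is_derive t (1 : R) F (f t)) -> continuous f -> (forall t, r <= `|t| -> F t = 0) ->
  \int[@lebR R]_t f t = 0.
Proof.
move=> r0 dF cf F0.
have cF : continuous F.
  by move=> t; apply/differentiable_continuous/derivable1_diffP; case: (dF t).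
have f0 t : ~ `[- (r + 1), r + 1]%classic t -> f t = 0.
  move=> nt; case: (dF t) => _ <-.
  have rt : r < `|t|.
    rewrite ltNge; apply/negP => h; apply: nt => /=; rewrite in_itv /= -ler_norml.
    by apply: le_trans h _; rewrite lerDl.
  rewrite -(derive_cst (0 : R) t (1 : R)); apply: near_eq_derive.
  apply/nbhs_ballP; exists (`|t| - r) => /=; first by rewrite subr_gt0.
  move=> s; rewrite /ball /= => ts; apply: F0.
  by have := ler_distD s t 0; rewrite !subr0; move: ts; move: `|t - s| `|t| `|s| => a b c; lra.
rewrite (Rintegral_support _ f0) Rintegral_lebR //; last first.
  by apply: (measurable_funS measurableT) => //; exact: continuous_measurable_fun.
rewrite /Rintegral (@continuous_FTC2 _ f F) //; first last.
- by move=> t _; rewrite derive1E; case: (dF t).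
- split; first by move=> t _; case: (dF t).
    by apply: cvg_at_right_filter; exact: cF.
  by apply: cvg_at_left_filter; exact: cF.
- exact: continuous_subspaceT.
- by lra.
have e1 : r <= `|r + 1| by rewrite ger0_norm; lra.
by rewrite F0 // F0 ?normrN // -EFinB subrr.
Qed.

Lemma consr_line n t (y : 'rV[R]_n) : consr (t, y) = t *: basis_rV R (lshift n ord0) + consr (0, y).
Proof.
apply/rowP => j; rewrite [RHS]mxE [X in _ = X + _]mxE; case: (split_ordP j) => k ->.
  by rewrite (ord1 k) !consr0 mxE eqxx /= mulr1 addr0.
by rewrite !consrS mxE eq_rlshift /= mulr0 add0r.
Qed.

Lemma consr_add n t (y : 'rV[R]_n) h j :
  consr (t, h *: basis_rV R j + y) = h *: basis_rV R (rshift 1 j) + consr (t, y).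
Proof.
apply/rowP => k; rewrite [RHS]mxE [X in _ = X + _]mxE; case: (split_ordP k) => l ->.
  by rewrite (ord1 l) !consr0 mxE eq_lrshift /= mulr0 add0r.
by rewrite !consrS !mxE /= eq_rshift.
Qed.

Let growth_consr n (f : 'rV[R]_(1 + n) -> R) t (y : 'rV[R]_n) j :
  (fun h : R => h^-1 *: (f (consr (t, h *: basis_rV R j + y)) - f (consr (t, y)))) =
  (fun h : R => h^-1 *: (f (h *: basis_rV R (rshift 1 j) + consr (t, y)) - f (consr (t, y)))).
Proof. by apply/funext => h; congr (_ *: (f _ - _)); exact: consr_add. Qed.

Lemma continuous_consr1 n (y : 'rV[R]_n) : continuous (fun t : R => consr (t, y)).
Proof.
move=> t A /nbhs_ballP[e /= e0 eA]; apply/nbhs_ballP; exists e => // s ts; apply: eA; split => // i j.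
rewrite (ord1 i); case: (split_ordP j) => k ->; first by rewrite (ord1 k) !consr0.
by rewrite !consrS; exact: ballxx.
Qed.

Lemma continuous_consr2 n (t : R) : continuous (fun y : 'rV[R]_n => consr (t, y)).
Proof.
move=> y A /nbhs_ballP[e /= e0 eA]; apply/nbhs_ballP; exists e => // z [_ yz]; apply: eA; split => // i j.
rewrite (ord1 i); case: (split_ordP j) => k ->; first by rewrite (ord1 k) !consr0; exact: ballxx.
by rewrite !consrS; exact: yz.
Qed.

Lemma derivable_consr n (f : 'rV[R]_(1 + n) -> R) t (y : 'rV[R]_n) j :
  derivable f (consr (t, y)) (basis_rV R (rshift 1 j)) =
  derivable (fun y => f (consr (t, y))) y (basis_rV R j).
Proof. by rewrite /derivable growth_consr. Qed.

Lemma derive_consr n (f : 'rV[R]_(1 + n) -> R) t (y : 'rV[R]_n) j :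
  'D_(basis_rV R j) (fun y => f (consr (t, y))) y = 'D_(basis_rV R (rshift 1 j)) f (consr (t, y)).
Proof. by rewrite /derive growth_consr. Qed.

Lemma compact_cube n (r : R) : compact [set y : 'rV[R]_n | forall j, `|y 0 j| <= r].
Proof.
have := @rV_compact R n (fun=> `[- r, r]%classic) (fun=> @segment_compact R _ _).
congr compact; apply/seteqP; split => y h j; have := h j; rewrite /= in_itv /= -ler_norml.
  by [].
by [].
Qed.

Lemma continuous_support_integrable n (f : 'rV[R]_n -> R) (r : R) : continuous f ->
  (forall y, ~ cube 0 r y -> f y = 0) -> (@lam R n).-integrable setT (EFin \o f).
Proof.
move=> cf f0; have mf := continuous_borel_real cf.
pose r' := `|r|; have r'0 : 0 <= r' := normr_ge0 r.
have f0' y : ~ cube 0 (r' + 1) y -> f y = 0.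
  move=> h; apply: f0 => h'; apply: h => j; apply: lt_trans (h' j) _.
  by apply: le_lt_trans (ler_norm r) _; rewrite ltrDl.
have [C hC] := compact_bounded_fun (@compact_cube n (r' + 1)) (fun x _ => cf x).
apply: (@bounded_support_integrable _ (borel 'rV[R]_n) R (@lam R n) (cube 0 (r' + 1)) `|C|) => //.
- apply: open_borel; rewrite cube_ball; first exact: ball_open.
  by rewrite ltr_wpDl.
- by apply: lam_cube_fin; rewrite addr_ge0.
move=> y; have [h|h] := pselect (cube 0 (r' + 1) y); last by rewrite f0' // normr0.
apply: le_trans (ler_norm C); apply: hC => j; have := h j; rewrite mxE subr0; exact: ltW.
Qed.

(** Induction on the dimension with Fubini: a derivative in the first coordinate is integrated
    first, by the fundamental theorem of calculus; for any other coordinate the remaining variables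
    are integrated first, by the induction hypothesis. *)
Lemma Rintegral_partial n (a : 'I_n) (f : 'rV[R]_n -> R) (r : R) : 0 < r ->
  (forall x, derivable f x (basis_rV R a)) -> continuous ('D_(basis_rV R a) f) ->
  (forall y, ~ cube 0 r y -> f y = 0) ->
  \int[@lam R n]_y 'D_(basis_rV R a) f y = 0.
Proof.
elim: n a f => [[]//|n IH] a f r0 df cdf f0.
(* A larger cube is used because the derivative at a boundary point of the first cube sees values
   inside it. *)
have g0 y : ~ cube 0 (r + 1) y -> 'D_(basis_rV R a) f y = 0.
  move=> h; rewrite -(derive_cst (0 : R) y (basis_rV R a)); apply: near_eq_derive.
  apply/nbhs_ballP; exists 1 => //= z [_ yz]; apply: f0 => hz; apply: h => j.
  have := yz 0 j; have := hz j; rewrite !mxE !subr0 /ball /=.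
  have := ler_distD (z 0 j) (y 0 j) 0; rewrite !subr0.
  by move: `|y 0 j - _| `|y 0 j| `|z 0 j| => b c e; lra.
have ig := continuous_support_integrable cdf g0.
rewrite (lam_Rintegral (n := n) ig); have ig' := lam_integrable (n := n) ig.
have [C hC] : exists C, forall y, `|'D_(basis_rV R a) f y| <= C.
  have [C hC] := compact_bounded_fun (@compact_cube n.+1 (r + 1)) (fun x _ => cdf x).
  exists `|C| => y; have [h|h] := pselect (cube 0 (r + 1) y); last by rewrite g0 // normr0.
  apply: le_trans (ler_norm C); apply: hC => j; have := h j; rewrite mxE subr0; exact: ltW.
have cut t y : cube 0 (r + 1) (consr (t, y)) -> `|t| < r + 1 /\ cube 0 (r + 1) (y : 'rV[R]_n).
  move=> h; split; first by have := h (lshift n ord0 : 'I_(1 + n)); rewrite consr0 !mxE subr0.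
  by move=> j; have := h (rshift 1 j : 'I_(1 + n)); rewrite consrS !mxE.
have cut' t y : cube 0 r (consr (t, y)) -> `|t| < r /\ cube 0 r (y : 'rV[R]_n).
  move=> h; split; first by have := h (lshift n ord0 : 'I_(1 + n)); rewrite consr0 !mxE subr0.
  by move=> j; have := h (rshift 1 j : 'I_(1 + n)); rewrite consrS !mxE.
case: (split_ordP (a : 'I_(1 + n))) => k ak.
  have ek : basis_rV R a = basis_rV R (lshift n ord0 : 'I_(1 + n)) by rewrite ak (ord1 k).
  pose F y t := f (t *: basis_rV R a + consr (0, y)).
  have EF y t : f (consr (t, y)) = F y t by rewrite /F ek -consr_line.
  have dF y t : is_derive t (1 : R) (F y) ('D_(basis_rV R a) f (consr (t, y))).
    by rewrite consr_line -ek; exact: line_is_derive.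
  have cF y : continuous (fun t : R => 'D_(basis_rV R a) f (consr (t, y))).
    move=> t; apply: (@continuous_comp _ _ _ (fun t : R => consr (t, y)) ('D_(basis_rV R a) f)).
      exact: continuous_consr1.
    exact: cdf.
  have z0 y : \int[@lebR R]_t 'D_(basis_rV R a) f (consr (t, y)) = 0.
    apply: (@Rintegral_derivative (F y) _ r r0 (dF y) (cF y)) => t rt.
    by rewrite -EF; apply: f0 => /cut'[]; rewrite ltNge rt.
  rewrite (Rintegral_fubini21 ig') => [|y].
    by rewrite (eq_Rintegral _ (g := fun=> 0)) ?Rintegral0 // => y _; exact: z0.
  apply: (@bounded_support_integrable _ R R (@lebR R) `[- (r + 1), r + 1]%classic `|C|) => //.
  - exact: continuous_measurable_fun (cF y).
  - exact: lebR_itv_fin.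
  - by move=> t; exact: le_trans (hC _) (ler_norm C).
  move=> t nt; apply: g0 => /cut[h _]; apply: nt => /=; rewrite in_itv /= -ler_norml.
  exact: ltW.
have z0 t : \int[@lam R n]_y 'D_(basis_rV R a) f (consr (t, y)) = 0.
  rewrite ak -(IH k (fun y => f (consr (t, y))) r0).
  - by apply: eq_Rintegral => y _; rewrite derive_consr.
  - by move=> y; rewrite -derivable_consr -ak.
  - have -> : 'D_(basis_rV R k) (fun y => f (consr (t, y))) =
        (fun y => 'D_(basis_rV R a) f (consr (t, y))).
      by apply/funext => y; rewrite derive_consr ak.
    move=> y; apply: (@continuous_comp _ _ _ (fun y : 'rV[R]_n => consr (t, y)) ('D_(basis_rV R a) f)).
      exact: continuous_consr2.
    exact: cdf.
  by move=> y h; apply: f0 => /cut'[].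
rewrite (Rintegral_fubini12 ig') => [|t].
  by rewrite (eq_Rintegral _ (g := fun=> 0)) ?Rintegral0 // => t _; exact: z0.
apply: (@continuous_support_integrable n _ (r + 1)).
  move=> y; apply: (@continuous_comp _ _ _ (fun y : 'rV[R]_n => consr (t, y)) ('D_(basis_rV R a) f)).
    exact: continuous_consr2.
  exact: cdf.
by move=> y h; apply: g0 => /cut[].
Qed.

End Divergence.

(** * Functions of class C^k *)

(** Only the derivative along [v] is assumed to exist, so the chain rule is applied on the line
    [h |-> f (h v + x)]. *)
Lemma derive_comp_real (R : realType) (V : normedModType R) (f : V -> R) (g : R -> R) (x v : V)
    (g' : R) : derivable f x v -> is_derive (f x) (1 : R) g g' ->
  derivable (g \o f) x v /\ 'D_v (g \o f) x = g' * 'D_v f x.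
Proof.
move=> df [dg eg']; pose F (h : R) := f (h *: v + x).
have x0 : 0 *: v + x = x by rewrite scale0r add0r.
have df0 : derivable f (0 *: v + x) v by rewrite x0.
have [dF eF] := line_is_derive df0.
have F0 : F 0 = f x by rewrite /F x0.
have dgF : derivable g (F 0) 1 by rewrite F0; exact: dg.
have dgf : derivable (g \o f) x v.
  apply/derivable1P/derivable1_diffP.
  have h1 : differentiable F 0 := (derivable1_diffP _ _).1 dF.
  have h2 : differentiable g (F 0) := (derivable1_diffP _ _).1 dgF.
  exact: (@differentiable_comp _ _ _ _ F g 0 h1 h2).
split => //; have dgf0 : derivable (g \o f) (0 *: v + x) v by rewrite x0.
have [_ egF] := line_is_derive dgf0.
have E1 : 'D_1 (g \o F) 0 = 'D_v (g \o f) (0 *: v + x) := egF.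
have E2 : 'D_1 F 0 = 'D_v f (0 *: v + x) := eF.
rewrite x0 in E1; rewrite x0 in E2.
rewrite -E1 -derive1E (@derive1_comp R F g 0 dF dgF) [g^`()%classic _]derive1E [F^`()%classic _]derive1E E2.
by rewrite /F x0 eg'.
Qed.

Section Ck.
Variables (R : realType) (n : nat).
Implicit Types (U W : set 'rV[R]_n) (f g : 'rV[R]_n -> R) (k : nat) (j : 'I_n).

Lemma Ck_on_continuous k U f : Ck_on k U f -> {in U, continuous f}.
Proof. by case: k => [|k] []. Qed.

Lemma Ck_on_derivable k U f j x : Ck_on k.+1 U f -> U x -> derivable f x (basis_rV R j).
Proof. by move=> [_ /(_ j)[h _]]; exact: h. Qed.

Lemma Ck_on_derive k U f j : Ck_on k.+1 U f -> Ck_on k U ('D_(basis_rV R j) f).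
Proof. by move=> [_ /(_ j)[]]. Qed.

Lemma Ck_on_pred k U f : Ck_on k.+1 U f -> Ck_on k U f.
Proof.
elim: k f => [|k IH] f [cf h]; first by split.
by split => // j; have [h1 h2] := h j; split => //; exact: IH.
Qed.

Lemma Ck_on_le k l U f : (k <= l)%N -> Ck_on l U f -> Ck_on k U f.
Proof.
move=> /subnK <-; elim: (l - k)%N => // m IH; rewrite addSn => /Ck_on_pred; exact: IH.
Qed.

Lemma Ck_on_sub k U W f : W `<=` U -> Ck_on k U f -> Ck_on k W f.
Proof.
move=> WU; elim: k f => [|k IH] f [cf h]; (split; first by move=> x xW; apply: cf; rewrite inE; apply: WU; rewrite -inE) => //.
by move=> j; have [h1 h2] := h j; split; [move=> x /WU; exact: h1 | exact: IH].
Qed.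

(** Continuity and directional derivatives depend only on germs, and the open witness [W] serves for
    the derivatives too, which drives the induction. *)
Lemma Ck_on_local k U f : (forall x, U x -> exists W g,
    [/\ open W, W x, Ck_on k W g & forall y, W y -> f y = g y]) -> Ck_on k U f.
Proof.
elim: k U f => [|k IH] U f h.
  split => // x; rewrite inE => /h[W [g [oW Wx [cg _] fg]]].
  move=> A; rewrite (fg _ Wx) => nA; have gA := cg x (mem_set Wx) A nA.
  have nW : nbhs x W by exact: open_nbhs_nbhs.
  by apply: filterS2 nW gA => y Wy; rewrite /= (fg _ Wy).
split.
  move=> x; rewrite inE => /h[W [g [oW Wx [cg _] fg]]].
  move=> A; rewrite (fg _ Wx) => nA; have gA := cg x (mem_set Wx) A nA.
  have nW : nbhs x W by exact: open_nbhs_nbhs.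
  by apply: filterS2 nW gA => y Wy; rewrite /= (fg _ Wy).
move=> j; split.
  move=> x /h[W [g [oW Wx Cg fg]]].
  apply: (@near_eq_derivable _ _ _ g); last exact: (Ck_on_derivable Cg).
  by apply: filterS (open_nbhs_nbhs (conj oW Wx)) => y /fg.
apply: IH => x /h[W [g [oW Wx Cg fg]]]; exists W, ('D_(basis_rV R j) g); split => //.
  exact: Ck_on_derive.
move=> y Wy; apply: near_eq_derive.
by apply: filterS (open_nbhs_nbhs (conj oW Wy)) => z /fg.
Qed.

Lemma Ck_on_ext k U f g : open U -> (forall x, U x -> f x = g x) -> Ck_on k U g -> Ck_on k U f.
Proof. by move=> oU fg Cg; apply: Ck_on_local => x Ux; exists U, g. Qed.

Lemma Ck_on_cst k U (c : R) : Ck_on k U (fun=> c).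
Proof.
elim: k c => [|k IH] c; (split; first by move=> x _; exact: cst_continuous) => // j; split.
  by move=> x _; exact: derivable_cst.
have -> : 'D_(basis_rV R j) (fun=> c) = (fun=> 0) by apply/funext => x; exact: derive_cst.
exact: IH.
Qed.

Lemma derive_coord (i j : 'I_n) (x : 'rV[R]_n) :
  is_derive x (basis_rV R j) (fun y : 'rV[R]_n => y 0 i) ((i == j)%:R : R).
Proof.
have E : (fun h : R => h^-1 *: ((h *: basis_rV R j + x) 0 i - x 0 i)) @ 0^' --> ((i == j)%:R : R).
  apply: (@cvg_trans _ ((fun=> (i == j)%:R : R) @ (0 : R)^')); last exact: cvg_cst.
  apply: near_eq_cvg; near=> h; rewrite !mxE /= addrK /GRing.scale /= mulrA mulVf ?mul1r //.
  by near: h; exact: nbhs_dnbhs_neq.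
apply: DeriveDef; first by apply/cvg_ex; eexists; exact: E.
exact: cvg_lim E.
Unshelve. all: by end_near. Qed.

Lemma Ck_on_coord k U (i : 'I_n) : Ck_on k U (fun y => y 0 i).
Proof.
case: k => [|k]; (split; first by move=> x _; exact: coord_continuous) => // j; split.
  by move=> x _; have [] := derive_coord i j x.
have -> : 'D_(basis_rV R j) (fun y : 'rV[R]_n => y 0 i) = (fun=> (i == j)%:R).
  by apply/funext => x; have [_ ->] := derive_coord i j x.
exact: Ck_on_cst.
Qed.

Lemma Ck_onD k U f g : open U -> Ck_on k U f -> Ck_on k U g -> Ck_on k U (fun x => f x + g x).
Proof.
move=> oU; elim: k f g => [|k IH] f g [cf hf] [cg hg];
  (split; first by move=> x Ux; exact: (cvgD (cf x Ux) (cg x Ux))) => // j.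
have [f1 f2] := hf j; have [g1 g2] := hg j; split.
  by move=> x Ux; apply: derivableD; [exact: f1 | exact: g1].
apply: (Ck_on_ext oU _ (IH _ _ f2 g2)) => x Ux.
exact: (deriveD (f1 x Ux) (g1 x Ux)).
Qed.

Lemma Ck_onM k U f g : open U -> Ck_on k U f -> Ck_on k U g -> Ck_on k U (fun x => f x * g x).
Proof.
move=> oU; elim: k f g => [|k IH] f g [cf hf] [cg hg];
  (split; first by move=> x Ux; exact: (cvgM (cf x Ux) (cg x Ux))) => // j.
have [f1 f2] := hf j; have [g1 g2] := hg j; split.
  by move=> x Ux; apply: derivableM; [exact: f1 | exact: g1].
have pf : Ck_on k U f by apply: Ck_on_pred.
have pg : Ck_on k U g by apply: Ck_on_pred.
apply: (Ck_on_ext oU _ (Ck_onD oU (IH _ _ pf g2) (IH _ _ pg f2))) => x Ux.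
exact: (deriveM (f1 x Ux) (g1 x Ux)).
Qed.

Lemma Ck_onZ k U (c : R) f : open U -> Ck_on k U f -> Ck_on k U (fun x => c * f x).
Proof. by move=> oU; apply: Ck_onM => //; exact: Ck_on_cst. Qed.

Lemma Ck_onN k U f : open U -> Ck_on k U f -> Ck_on k U (fun x => - f x).
Proof.
by move=> oU /(Ck_onZ (-1) oU); apply: Ck_on_ext => // x _; rewrite mulN1r.
Qed.

Lemma Ck_onB k U f g : open U -> Ck_on k U f -> Ck_on k U g -> Ck_on k U (fun x => f x - g x).
Proof. by move=> oU cf cg; apply: Ck_onD => //; exact: Ck_onN. Qed.

Lemma Ck_on_sum k U (I : Type) (r : seq I) (F : I -> 'rV[R]_n -> R) : open U ->
  (forall i, Ck_on k U (F i)) -> Ck_on k U (fun x => \sum_(i <- r) F i x).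
Proof.
move=> oU h; elim: r => [|i r IH].
  by apply: (Ck_on_ext oU _ (Ck_on_cst k U 0)) => x _; rewrite big_nil.
by apply: (Ck_on_ext oU _ (Ck_onD oU (h i) IH)) => x _; rewrite big_cons.
Qed.

Lemma Ck_on_prod k U (I : Type) (r : seq I) (F : I -> 'rV[R]_n -> R) : open U ->
  (forall i, Ck_on k U (F i)) -> Ck_on k U (fun x => \prod_(i <- r) F i x).
Proof.
move=> oU h; elim: r => [|i r IH].
  by apply: (Ck_on_ext oU _ (Ck_on_cst k U 1)) => x _; rewrite big_nil.
by apply: (Ck_on_ext oU _ (Ck_onM oU (h i) IH)) => x _; rewrite big_cons.
Qed.

(** The outer function comes with its successive derivatives [g 0], [g 1], and so on; the induction
    passes from [g] to the shifted sequence. *)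
Lemma Ck_on_comp k U f (g : nat -> R -> R) (Q : set R) : open U ->
  (forall i t, (i < k)%N -> Q t -> is_derive t (1 : R) (g i) (g i.+1 t)) ->
  (forall t, Q t -> {for t, continuous (g k)}) ->
  (forall x, U x -> Q (f x)) -> Ck_on k U f -> Ck_on k U (g 0%N \o f).
Proof.
move=> oU; elim: k g f => [|k IH] g f dg cg fQ Cf.
  split => // x xU; apply: continuous_comp; first exact: (Ck_on_continuous Cf).
  by apply: cg; apply: fQ; rewrite -inE.
split.
  move=> x xU; have Ux : U x by rewrite -inE.
  apply: continuous_comp; first exact: (Ck_on_continuous Cf).
  have [d0 _] := dg 0%N (f x) isT (fQ x Ux).
  exact/differentiable_continuous/derivable1_diffP.
move=> j.
have D x (Ux : U x) := derive_comp_real (Ck_on_derivable (j := j) Cf Ux) (dg 0%N (f x) isT (fQ x Ux)).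
split; first by move=> x Ux; have [] := D x Ux.
have C1 : Ck_on k U (g 1%N \o f).
  apply: (IH (fun i => g i.+1)) => //; first by move=> i t ik; exact: dg.
  exact: Ck_on_pred.
apply: (Ck_on_ext oU _ (Ck_onM oU C1 (Ck_on_derive j Cf))) => x Ux.
by have [_ ->] := D x Ux.
Qed.

End Ck.

(** * Chain rule, determinants and inverses *)

Section RealFunctions.
Variable R : realType.
Implicit Types t : R.

Lemma is_derive_inv t : t != 0 -> is_derive t (1 : R) (fun s : R => s^-1) (- (t ^- 2)).
Proof.
move=> t0; have [d e] := is_deriveV (f := id) t0 (is_derive_id t (1 : R)).
by apply: DeriveDef; [exact: d | rewrite [LHS]e [_ *: 1]mulr1].
Qed.

(** The derivative of order [i] of [1/t]. *)
Definition inv_chain (i : nat) t : R := (-1) ^+ i * i`!%:R * t^-1 ^+ i.+1.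

Lemma inv_chainP i t : t != 0 -> is_derive t (1 : R) (inv_chain i) (inv_chain i.+1 t).
Proof.
move=> t0.
have dV := is_derive_inv t0.
have := is_deriveZ ((-1) ^+ i * i`!%:R) (is_deriveX i.+1 dV).
have <- : inv_chain i = ((-1) ^+ i * i`!%:R) \*: (fun s : R => s^-1) ^+ i.+1.
  by apply/funext => s; rewrite /inv_chain /= exprfctE.
move=> [d e]; apply: DeriveDef; first exact: d.
rewrite [LHS]e /inv_chain /GRing.scale /= factS natrM -exprVn !exprS.
by move: (i.+1%:R) (i`!%:R) ((-1) ^+ i) (t^-1 ^+ i) => a b c x; ring.
Qed.

(** The derivative of order [i] of the square root, with [t^(1/2 - i)] written as [sqrt t / t^i]. *)
Definition sqrt_chain (i : nat) t : R := (\prod_(j < i) (2^-1 - j%:R)) * (Num.sqrt t * t^-1 ^+ i).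

Lemma sqrt_chainP i t : 0 < t -> is_derive t (1 : R) (sqrt_chain i) (sqrt_chain i.+1 t).
Proof.
move=> t0; have tn0 : t != 0 by rewrite gt_eqF.
have dV := is_derive_inv tn0.
have dS := is_derive1_sqrt t0.
have s0 : Num.sqrt t != 0 by rewrite gt_eqF // sqrtr_gt0.
have es : (2 * Num.sqrt t)^-1 = 2^-1 * Num.sqrt t * t^-1.
  rewrite -{3}[t]sqr_sqrtr ?ltW //; field; exact: s0.
case: i => [|i].
  have [d e] := dS; have E : sqrt_chain 0 = Num.sqrt.
    by apply/funext => s; rewrite /sqrt_chain big_ord0 expr0 mul1r mulr1.
  rewrite E; apply: DeriveDef => //; rewrite e es /sqrt_chain big_ord1 subr0 expr1; ring.
have := is_deriveZ (\prod_(j < i.+1) (2^-1 - j%:R)) (is_deriveM dS (is_deriveX i.+1 dV)).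
have <- : sqrt_chain i.+1 = (\prod_(j < i.+1) (2^-1 - j%:R)) \*:
    (@Num.sqrt R * (fun s : R => s^-1) ^+ i.+1).
  by apply/funext => s; rewrite /sqrt_chain /= exprfctE.
move=> [d e]; apply: DeriveDef; first exact: d.
rewrite [LHS]e exprfctE es /sqrt_chain [in RHS]big_ord_recr /= /GRing.scale /= -exprVn !exprS.
by move: (\prod_(_ < _) _) (i.+1%:R) (t^-1 ^+ i) (Num.sqrt t) (t^-1) => a b c x y; ring.
Qed.

(** The truncated power [t_+^m], of class C^(m-1) for [m >= 1]: the building block of all cutoffs
    and mollifiers below. *)
Definition ppow (m : nat) t : R := (Num.max 0 t) ^+ m.

Lemma ppow_ge0 m t : 0 <= ppow m t.
Proof. by rewrite exprn_ge0 // le_max lexx. Qed.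

Lemma ppow_pos m t : 0 <= t -> ppow m t = t ^+ m.
Proof. by move=> t0; rewrite /ppow max_r. Qed.

Lemma ppow_neg m t : t <= 0 -> ppow m.+1 t = 0.
Proof. by move=> t0; rewrite /ppow max_l // expr0n. Qed.

Lemma ppow_derive m t : is_derive t (1 : R) (ppow m.+2) (m.+2%:R * ppow m.+1 t).
Proof.
have [t0|t0|->] := ltgtP t 0.
- rewrite ppow_neg ?ltW // mulr0.
  apply: (near_eq_is_derive _ (is_derive_cst (0 : R) t (1 : R))).
  near=> s; rewrite ppow_neg // ltW //.
  by near: s; exact: lt_nbhsl.
- rewrite ppow_pos ?ltW //.
  have h : is_derive t (1 : R) (fun s : R => s ^+ m.+2) (m.+2%:R * t ^+ m.+1).
    by split; [exact: exprn_derivable | rewrite exp_derive [_ *: _]mulr1].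
  apply: (near_eq_is_derive _ h).
  by near=> s; rewrite ppow_pos // ltW //; near: s; exact: lt_nbhsr.
rewrite ppow_neg // mulr0.
have E : (fun h : R => h^-1 *: (ppow m.+2 (h *: 1 + 0) - ppow m.+2 0)) @ 0^' --> (0 : R).
  apply/cvgrPdist_le => e e0.
  near=> h; have h1 : `|h| <= 1 by near: h; apply: dnbhs0_le.
  have he : `|h| <= e by near: h; apply: dnbhs0_le.
  have h0 : h != 0 by near: h; exact: nbhs_dnbhs_neq.
  rewrite addr0 [_ *: 1]mulr1 (ppow_neg _ (lexx 0)) subr0 sub0r normrN normrM normfV.
  (* Since the exponent is at least 2, the difference quotient at 0 is at most [|h|]. *)
  have pb : `|ppow m.+2 h| <= `|h| * `|h|.
    rewrite /ppow normrX exprS; apply: (@le_trans _ _ (`|h| ^+ m.+2)).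
      rewrite -exprS; apply: lerXn2r; rewrite ?nnegrE //.
      by rewrite ger0_norm ?le_max ?lexx // ge_max normr_ge0 ler_norm.
    by rewrite !exprS mulrA ler_piMr // ?mulr_ge0 // exprn_ile1.
  apply: le_trans he; apply: le_trans (ler_wpM2l _ pb) _; first by rewrite invr_ge0.
  by rewrite mulKf // normr_eq0.
apply: DeriveDef; first by apply/cvg_ex; eexists; exact: E.
exact: cvg_lim E.
Unshelve. all: by end_near. Qed.

Lemma mvt_centered (F dF : R -> R) (h : R) :
  (forall s : R, `|s| <= `|h| -> is_derive s (1 : R) F (dF s)) ->
  exists2 c, `|c| <= `|h| & F h - F 0 = dF c * h.
Proof.
move=> d.
have cont s : `|s| <= `|h| -> {for s, continuous F}.
  by move=> /d[ds _]; apply/differentiable_continuous/derivable1_diffP.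
have [h0|h0|->] := ltgtP h 0; last by exists 0; rewrite ?normr0 // mulr0 subrr.
  have hn : `|h| = - h by rewrite ltr0_norm.
  have dc c : c \in `]h, 0[ -> is_derive c (1 : R) F (dF c).
    by rewrite in_itv /= => /andP[a b]; apply: d; rewrite hn ler_norml; apply/andP; split; lra.
  have cc : {within `[h, 0], continuous F}.
    apply: continuous_in_subspaceT => s; rewrite inE /= in_itv /= => /andP[a b].
    by apply: cont; rewrite hn ler_norml; apply/andP; split; lra.
  have [c ci e] := MVT h0 dc cc.
  move: ci; rewrite in_itv /= => /andP[a b]; exists c; first by rewrite hn ler_norml; apply/andP; split; lra.
  by rewrite -[LHS]opprB e sub0r mulrN opprK.
have hn : `|h| = h by rewrite gtr0_norm.
have dc c : c \in `]0, h[ -> is_derive c (1 : R) F (dF c).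
  by rewrite in_itv /= => /andP[a b]; apply: d; rewrite hn ler_norml; apply/andP; split; lra.
have cc : {within `[0, h], continuous F}.
  apply: continuous_in_subspaceT => s; rewrite inE /= in_itv /= => /andP[a b].
  by apply: cont; rewrite hn ler_norml; apply/andP; split; lra.
have [c ci e] := MVT h0 dc cc.
move: ci; rewrite in_itv /= => /andP[a b]; exists c; first by rewrite hn ler_norml; apply/andP; split; lra.
by rewrite e subr0.
Qed.

End RealFunctions.

(** * Total differentiability of C^1 functions *)

Section Frechet.
Variables (R : realType) (n : nat).
Implicit Types (U : set 'rV[R]_n) (f : 'rV[R]_n -> R).

(** The vertices of the path from 0 to [h] that runs parallel to the axes. *)
Definition prefix_rV (h : 'rV[R]_n) (k : nat) : 'rV[R]_n := \row_j (if (j < k)%N then h 0 j else 0).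

Lemma prefix_rV0 h : prefix_rV h 0 = 0.
Proof. by apply/rowP => j; rewrite !mxE. Qed.

Lemma prefix_rVn h : prefix_rV h n = h.
Proof. by apply/rowP => j; rewrite !mxE ltn_ord. Qed.

Lemma prefix_rVS h (k : 'I_n) : prefix_rV h k.+1 = h 0 k *: basis_rV R k + prefix_rV h k.
Proof.
apply/rowP => j; rewrite !mxE ltnS leq_eqVlt; case: (eqVneq (j : nat) k) => [jk|jk] /=.
  by have -> : j = k := val_inj jk; rewrite eqxx ltnn mulr1 addr0.
rewrite (_ : (j == k) = false) ?mulr0 ?add0r //.
by apply/negbTE; apply: contra jk => /eqP ->.
Qed.

Lemma coord_le_norm (h : 'rV[R]_n) j : `|h 0 j| <= `|h|.
Proof.
rewrite [in leRHS]/Num.norm /= mx_normrE.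
by apply: (le_bigmax _ (fun ij : 'I_1 * 'I_n => `|h ij.1 ij.2|) (0, j)).
Qed.

Lemma norm_le_coord (h : 'rV[R]_n) (c : R) : 0 <= c -> (forall j, `|h 0 j| <= c) -> `|h| <= c.
Proof.
move=> c0 hc; rewrite [in leLHS]/Num.norm /= mx_normrE.
by apply: bigmax_le => // -[i j] _; rewrite (ord1 i).
Qed.

(** Along each edge of the coordinate path the mean value theorem produces a partial derivative at a
    nearby point, which continuity compares with its value at [x]. *)
Lemma Ck_on_differentiable U f x : open U -> Ck_on 1 U f -> U x -> differentiable f x.
Proof.
move=> oU Cf Ux.
pose df (h : 'rV[R]_n) : R := \sum_j h 0 j * 'D_(basis_rV R j) f x.
have df_lin : linear df.
  move=> a u v; rewrite /df /GRing.scale /= mulr_sumr -big_split /=.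
  by apply: eq_bigr => j _; rewrite !mxE mulrDl mulrA.
pose dfM := GRing.isLinear.Build _ _ _ _ _ df_lin.
pose dfL : {linear 'rV[R]_n -> R} := HB.pack df dfM.
have cdf : continuous dfL.
  move=> y; apply: (Ck_on_continuous (k := 0) (U := setT)); last by rewrite inE.
  apply: Ck_on_sum; first exact: openT.
  by move=> j; apply: Ck_onM; [exact: openT | exact: Ck_on_coord | exact: Ck_on_cst].
suff E : f \o shift x = cst (f x) + dfL +o_ (0 : 'rV[R]_n) id.
  by apply/diff_locallyP; rewrite (diff_unique cdf E).
apply/eqaddoP => e e0 /=.
(* Each of the [n] edges contributes at most [e' |h|]; dividing by [n + 1] also covers dimension
   zero. *)
pose e' := e / n.+1%:R; have e'0 : 0 < e' by rewrite divr_gt0.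
have [r r0 hr] : exists2 r : R, 0 < r & forall y, `|y| <= r -> U (y + x) /\
    forall j, `|'D_(basis_rV R j) f (y + x) - 'D_(basis_rV R j) f x| <= e'.
  have : \forall y \near x, U y /\ forall j, `|'D_(basis_rV R j) f x - 'D_(basis_rV R j) f y| <= e'.
    apply: filterI; first exact: open_nbhs_nbhs.
    have c j : \forall y \near x, `|'D_(basis_rV R j) f x - 'D_(basis_rV R j) f y| <= e'.
      by have /cvgrPdist_le := Ck_on_continuous (Ck_on_derive j Cf) (mem_set Ux); apply.
    exact: (@filter_forall _ _ (fun j y => `|'D_(basis_rV R j) f x - 'D_(basis_rV R j) f y| <= e' : Prop) (nbhs x) _ c).
  move=> /nbhs_normP[r /= r0 hr]; exists (r / 2); first by rewrite divr_gt0.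
  move=> y yr; have [|h1 h2] := hr (y + x).
    by rewrite /ball_ /= opprD addrCA subrr addr0 normrN; apply: le_lt_trans yr _; rewrite ltr_pdivrMr // ltr_pMr // ltr1n.
  by split => // j; rewrite distrC.
have step h (k : nat) : `|h| <= r -> (k <= n)%N ->
    `|f (prefix_rV h k + x) - f x - \sum_(j < n | (j < k)%N) h 0 j * 'D_(basis_rV R j) f x| <=
    k%:R * (e' * `|h|).
  move=> hr'; elim: k => [|k IH] kn.
    by rewrite prefix_rV0 add0r subrr big1 ?subr0 ?normr0 ?mul0r.
  pose i := Ordinal kn.
  have pk s : `|s| <= `|h 0 i| -> `|s *: basis_rV R i + prefix_rV h k| <= `|h|.
    move=> sh; apply: norm_le_coord => // j; rewrite !mxE /=.
    case: (eqVneq j i) => [->|ji] /=.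
      by rewrite ltnn mulr1 addr0; apply: le_trans sh (coord_le_norm h i).
    by rewrite mulr0 add0r; case: ifP => _; rewrite ?normr0 // coord_le_norm.
  have [c hc E] := @mvt_centered R (fun s => f (s *: basis_rV R i + (prefix_rV h k + x)))
      (fun s => 'D_(basis_rV R i) f (s *: basis_rV R i + (prefix_rV h k + x))) (h 0 i) ltac:(
        move=> s sh; apply: line_is_derive; apply: (Ck_on_derivable Cf);
        rewrite addrA; exact: (hr _ (le_trans (pk s sh) hr')).1).
  have [_ /(_ i)] := hr _ (le_trans (pk c hc) hr'); rewrite -addrA => D.
  have -> : prefix_rV h k.+1 = h 0 i *: basis_rV R i + prefix_rV h k := prefix_rVS h i.
  rewrite (bigD1 i) //= -[h 0 i *: _ + _ + x]addrA.
  rewrite (eq_bigl (fun j : 'I_n => (j < k)%N)); last first.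
    move=> j; rewrite ltnS leq_eqVlt; case: (eqVneq j i) => [->|ji] /=.
      by rewrite andbF ltnn.
    rewrite andbT; case: (eqVneq (j : nat) k) => //= jk; exfalso; move/eqP: ji; apply; exact: val_inj.
  move: E; rewrite scale0r add0r => E.
  have -> : f (h 0 i *: basis_rV R i + (prefix_rV h k + x)) - f x -
      (h 0 i * 'D_(basis_rV R i) f x + \sum_(j < n | (j < k)%N) h 0 j * 'D_(basis_rV R j) f x) =
      (f (prefix_rV h k + x) - f x - \sum_(j < n | (j < k)%N) h 0 j * 'D_(basis_rV R j) f x) +
      h 0 i * ('D_(basis_rV R i) f (c *: basis_rV R i + (prefix_rV h k + x)) - 'D_(basis_rV R i) f x).
    move: E; set p := f (h 0 i *: _ + _); set q := f (prefix_rV h k + x).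
    set d := 'D_(basis_rV R i) f (c *: _ + _); set d0 := 'D_(basis_rV R i) f x.
    move: (\sum_(_ < n | _) _) (f x) => S z; rewrite -/d; clearbody p q d d0.
    by move=> E; have -> : p = d * h 0 i + q; [rewrite -E subrK | move: (h 0 i) => w; ring].
  apply: le_trans (ler_normD _ _) _; rewrite -natr1 mulrDl mul1r.
  apply: lerD; first exact: (IH (ltnW kn)).
  rewrite normrM mulrC; apply: ler_pM; [exact: normr_ge0 | exact: normr_ge0 | exact: D | exact: coord_le_norm].
have n0 : \forall h \near (0 : 'rV[R]_n), `|h| <= r by exact: (nbhs0_le r0).
apply: filterS n0 => h hr'.
have := step h n hr' (leqnn n); rewrite prefix_rVn.
rewrite (eq_bigl xpredT) => [|j]; last by rewrite ltn_ord.
rewrite -[(_ - (_ + _)) h]/(f (h + x) - (f x + df h)) opprD addrA => H.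
apply: le_trans H _; rewrite mulrA ler_wpM2r // /e' mulrCA ger_pMr //.
by rewrite ler_pdivrMr // mul1r ler_nat.
Qed.

End Frechet.

Lemma derive_chain (R : realType) (n m : nat) (U : set 'rV[R]_m) (T : 'rV[R]_m -> 'rV[R]_n) (f : 'rV[R]_n -> R) x (a : 'I_m) :
  open U -> U x -> (forall b, Ck_on 1 U (fun y => T y 0 b)) -> differentiable f (T x) ->
  derivable (f \o T) x (basis_rV R a) /\
  'D_(basis_rV R a) (f \o T) x = \sum_b jacobian T x a b * 'D_(basis_rV R b) f (T x).
Proof.
move=> oU Ux CT df.
have dT : differentiable T x.
  (* Differentiability of the vector-valued map is assembled from its components, the only data for
     which class C^1 is defined here. *)
  have -> : T = \sum_(b < n) (fun y => T y 0 b *: basis_rV R b).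
    by apply/funext => y; rewrite fct_sumE {1}[T y]row_sum_delta.
  apply: differentiable_sum => b; apply: differentiableZl.
  exact: (Ck_on_differentiable oU (CT b) Ux).
have dc : differentiable (f \o T) x by apply: differentiable_comp.
split; first exact: diff_derivable.
rewrite (deriveE _ dc) (diff_comp dT df) /=.
have -> : 'd T x (basis_rV R a) = row a (jacobian T x).
  by rewrite rowE /jacobian mul_rV_lin1.
rewrite [row a _]row_sum_delta linear_sum; apply: eq_bigr => b _.
by rewrite linearZ /= mxE -(deriveE _ df).
Qed.

Section Projection.
Variables (R : realType) (n : nat).
Implicit Types (U : set 'rV[R]_n) (f : 'rV[R]_n -> R).

Lemma rsubmx_line j (h : R) (y : 'rV[R]_(1 + n)) :
  rsubmx (h *: basis_rV R (rshift 1 j) + y) = h *: basis_rV R j + rsubmx y.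
Proof. by apply/rowP => k; rewrite !mxE eq_rshift. Qed.

Lemma rsubmx_line0 (k : 'I_1) (h : R) (y : 'rV[R]_(1 + n)) :
  rsubmx (h *: basis_rV R (lshift n k) + y) = rsubmx y.
Proof. by apply/rowP => l; rewrite !mxE eq_rlshift /= mulr0 add0r. Qed.

Let growth_rsubmx f j (y : 'rV[R]_(1 + n)) :
  (fun h : R => h^-1 *: (f (rsubmx (h *: basis_rV R (rshift 1 j) + y)) - f (rsubmx y))) =
  (fun h : R => h^-1 *: (f (h *: basis_rV R j + rsubmx y) - f (rsubmx y))).
Proof. by apply/funext => h; congr (_ *: (f _ - _)); exact: rsubmx_line. Qed.

Let growth_rsubmx0 f k (y : 'rV[R]_(1 + n)) :
  (fun h : R => h^-1 *: (f (rsubmx (h *: basis_rV R (lshift n k) + y)) - f (rsubmx y))) = (fun=> 0).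
Proof.
apply/funext => h; have -> := rsubmx_line0 k h y.
by rewrite subrr scaler0.
Qed.

Lemma derive_rsubmx f j (y : 'rV[R]_(1 + n)) : 'D_(basis_rV R (rshift 1 j)) (fun y : 'rV[R]_(1 + n) => f (rsubmx y)) y =
  'D_(basis_rV R j) f (rsubmx y).
Proof. by rewrite /derive growth_rsubmx. Qed.

Lemma derivable_rsubmx f j (y : 'rV[R]_(1 + n)) : derivable (fun y : 'rV[R]_(1 + n) => f (rsubmx y)) y (basis_rV R (rshift 1 j)) =
  derivable f (rsubmx y) (basis_rV R j).
Proof. by rewrite /derivable growth_rsubmx. Qed.

Lemma is_derive_rsubmx0 f k (y : 'rV[R]_(1 + n)) : is_derive y (basis_rV R (lshift n k)) (fun y : 'rV[R]_(1 + n) => f (rsubmx y)) 0.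
Proof.
have E : (fun h : R => h^-1 *: (f (rsubmx (h *: basis_rV R (lshift n k) + y)) - f (rsubmx y))) @ 0^' --> (0 : R).
  by rewrite growth_rsubmx0; exact: cvg_cst.
apply: DeriveDef; first by apply/cvg_ex; eexists; exact: E.
exact: cvg_lim E.
Qed.

Lemma Ck_on_rsubmx k U f : Ck_on k U f ->
  Ck_on k [set y : 'rV[R]_(1 + n) | U (rsubmx y)] (fun y => f (rsubmx y)).
Proof.
elim: k f => [|k IH] f [cf hf]; (split; first by (move=> y; rewrite inE /= => Uy;
  apply: (@continuous_comp _ _ _ (@rsubmx R 1 1 n) f); [exact: continuous_rsubmx | exact: cf (mem_set Uy)])) => // j.
case: (split_ordP (j : 'I_(1 + n))) => i ->.
  split; first by move=> y _; case: (is_derive_rsubmx0 f i y).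
  have -> : 'D_(basis_rV R (lshift n i)) (fun y => f (rsubmx y)) = (fun=> 0).
    by apply/funext => y; case: (is_derive_rsubmx0 f i y).
  exact: Ck_on_cst.
have [h1 h2] := hf i; split; first by move=> y Uy; rewrite derivable_rsubmx; exact: h1.
have -> : 'D_(basis_rV R (rshift 1 i)) (fun y => f (rsubmx y)) =
    (fun y => 'D_(basis_rV R i) f (rsubmx y)).
  by apply/funext => y; rewrite derive_rsubmx.
exact: (IH _ h2).
Qed.

End Projection.

(** * Regularity of determinants, roots and inverse matrices *)

Section MatrixCk.
Variables (R : realType) (n : nat).
Implicit Types (U : set 'rV[R]_n).

Lemma Ck_on_det k U m (F : 'rV[R]_n -> 'M[R]_m) : open U ->
  (forall i j, Ck_on k U (fun y => F y i j)) -> Ck_on k U (fun y => \det (F y)).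
Proof.
move=> oU CF; rewrite /determinant; apply: Ck_on_sum => // s.
by apply: Ck_onZ => //; apply: Ck_on_prod.
Qed.

Lemma Ck_on_inv k U (f : 'rV[R]_n -> R) : open U -> (forall y, U y -> f y != 0) ->
  Ck_on k U f -> Ck_on k U (fun y => (f y)^-1).
Proof.
move=> oU f0 Cf.
have := @Ck_on_comp R n k U f (@inv_chain R) [set t | t != 0] oU (fun i t _ => @inv_chainP R i t) _ f0 Cf.
move=> H; apply: (Ck_on_ext oU _ (H _)) => [y Uy|t t0]; first by rewrite /inv_chain /= expr0 !mul1r.
by have [d _] := inv_chainP k t0; exact/differentiable_continuous/derivable1_diffP.
Qed.

Lemma Ck_on_sqrt k U (f : 'rV[R]_n -> R) : open U -> (forall y, U y -> 0 < f y) ->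
  Ck_on k U f -> Ck_on k U (fun y => Num.sqrt (f y)).
Proof.
move=> oU f0 Cf.
have := @Ck_on_comp R n k U f (@sqrt_chain R) [set t | 0 < t] oU (fun i t _ => @sqrt_chainP R i t) _ f0 Cf.
move=> H; apply: (Ck_on_ext oU _ (H _)) => [y Uy|t t0]; first by rewrite /sqrt_chain /= big_ord0 expr0 mul1r mulr1.
by have [d _] := sqrt_chainP k t0; exact/differentiable_continuous/derivable1_diffP.
Qed.

Lemma Ck_on_abs k U (f : 'rV[R]_n -> R) : open U -> (forall y, U y -> f y != 0) ->
  Ck_on k U f -> Ck_on k U (fun y => `|f y|).
Proof.
move=> oU f0 Cf.
have H : Ck_on k U (fun y => Num.sqrt (f y * f y)).
  apply: Ck_on_sqrt => //; last exact: Ck_onM.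
  by move=> y Uy; rewrite -expr2 exprn_even_gt0 //= f0.
by apply: (Ck_on_ext oU _ H) => y _; rewrite -expr2 sqrtr_sqr.
Qed.

(** Cramer's rule expresses the entries as cofactors divided by the determinant. *)
Lemma Ck_on_invmx k U m (F : 'rV[R]_n -> 'M[R]_m) : open U ->
  (forall y, U y -> F y \in unitmx) ->
  (forall i j, Ck_on k U (fun y => F y i j)) ->
  forall i j, Ck_on k U (fun y => (invmx (F y)) i j).
Proof.
move=> oU uF CF i j.
have H : Ck_on k U (fun y => (\det (F y))^-1 * cofactor (F y) j i).
  apply: Ck_onM => //.
    apply: Ck_on_inv => //; last exact: Ck_on_det.
    by move=> y Uy; rewrite -unitfE -unitmxE uF.
  apply: Ck_onZ => //; apply: Ck_on_det => // a b.
  by apply: (Ck_on_ext oU _ (CF (lift j a) (lift i b))) => y _; rewrite !mxE.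
by apply: (Ck_on_ext oU _ H) => y Uy; rewrite /invmx uF // !mxE.
Qed.

Lemma Ck_on_ppow U m (f : 'rV[R]_n -> R) : open U -> Ck_on 2 U f ->
  Ck_on 2 U (fun y => ppow m.+3 (f y)).
Proof.
move=> oU Cf.
pose g (i : nat) (t : R) : R := match i with 0%N => ppow m.+3 t | 1%N => m.+3%:R * ppow m.+2 t
  | _ => m.+3%:R * (m.+2%:R * ppow m.+1 t) end.
apply: (@Ck_on_comp R n 2 U f g setT oU) => //.
  move=> [|[|//]] t _ _; first exact: ppow_derive.
  have [d e] := is_deriveZ (m.+3%:R : R) (ppow_derive m t).
  by apply: DeriveDef; [exact: d | rewrite [LHS]e].
move=> t _; apply: cvgM; first exact: cvg_cst.
apply: cvgM; first exact: cvg_cst.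
apply: (@continuous_comp _ _ _ (fun t : R => Num.max 0 t) (fun t => t ^+ m.+1)); last exact: exprn_continuous.
by apply: continuous_max; [exact: cst_continuous | move=> ?].
Qed.

End MatrixCk.

(** * Change of variables for densities *)

Section DensityTransport.
Local Open Scope ereal_scope.
Context d1 d2 (T1 : measurableType d1) (T2 : measurableType d2) (R : realType).
Variables (m1 : {measure set T1 -> \bar R}) (m2 : {measure set T2 -> \bar R}).
Variables (D : set T1) (E : set T2) (inv : T2 -> T1) (w : T2 -> R).
Hypotheses (mD : measurable D) (mE : measurable E) (minv : measurable_fun E inv).
Hypotheses (mw : measurable_fun E w) (w0 : forall y, E y -> (0 <= w y)%R).
Hypothesis dens : forall B, measurable B ->
  m1 (B `&` D) = \int[m2]_(y in E `&` inv @^-1` B) (w y)%:E.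

Import HBNNSimple.

Let transport_nnsfun (h : {nnsfun T1 >-> R}) :
  \int[m1]_(x in D) (h x)%:E = \int[m2]_(y in E) ((h (inv y))%:E * (w y)%:E).
Proof.
have mB k : measurable (h @^-1` [set k]) by rewrite -[X in measurable X]setTI; exact: measurable_funP.
have mI k : measurable (E `&` inv @^-1` (h @^-1` [set k])) by exact: minv.
transitivity (\sum_(k \in range h) k%:E * m1 (h @^-1` [set k] `&` D)).
  under eq_integral do rewrite fimfunE -fsumEFin //.
  rewrite ge0_integral_fsum //; last 2 first.
  - by move=> k; apply/measurable_EFinP/measurable_funM.
  - by move=> k x _; rewrite EFinM nnfun_muleindic_ge0.
  by apply: eq_fsbigr => k _; rewrite integralZl_indic_nnsfun // integral_indic.
transitivity (\int[m2]_(y in E) \sum_(k \in range h)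
    (k%:E * (\1_(h @^-1` [set k]) (inv y))%:E * (w y)%:E)); last first.
  apply: eq_integral => y _; rewrite [in RHS](fimfunE h) -fsumEFin //.
  rewrite ge0_mule_fsuml //; last by move=> k; rewrite EFinM nnfun_muleindic_ge0.
have m1i k : measurable_fun E (fun y => (\1_(h @^-1` [set k]) (inv y) : R)).
  by apply: (measurableT_comp _ minv); exact: measurable_indic.
rewrite ge0_integral_fsum //; last 2 first.
- move=> k; apply: emeasurable_funM; last exact/measurable_EFinP.
  by apply: emeasurable_funM => //; exact/measurable_EFinP.
- by move=> k y Ey; rewrite mule_ge0 ?nnfun_muleindic_ge0 // lee_fin w0.
(* The simple function [h] is nonnegative, so a negative [k] has an empty preimage and contributes
   zero to both sides. *)
apply: eq_fsbigr => k _; have [k0|k0] := ltP k 0%R.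
  rewrite preimage_nnfun0 // set0I measure0 mule0 integral0_eq // => y _.
  by rewrite indic0 mule0 mul0e.
under eq_integral do rewrite -muleA.
rewrite ge0_integralZl //; last 2 first.
- by apply: emeasurable_funM; exact/measurable_EFinP.
- by move=> y Ey; rewrite mule_ge0 // lee_fin ?w0.
congr (_ * _); rewrite dens // integral_mkcondr; apply: eq_integral => y _.
rewrite patchE indicE [(inv y \in _)](_ : _ = (y \in inv @^-1` (h @^-1` [set k]))).
  by case: ifP => _; rewrite ?mul1e ?mul0e.
by apply/idP/idP; rewrite !inE.
Qed.

(** The hypothesis [dens] is the case of indicator functions; simple functions follow by linearity
    and the general case by monotone convergence. *)
Lemma ge0_transport (F : T1 -> \bar R) : measurable_fun setT F -> (forall x, 0 <= F x) ->
  \int[m1]_(x in D) F x = \int[m2]_(y in E) (F (inv y) * (w y)%:E).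
Proof.
move=> mF F0; pose f_ := nnsfun_approx measurableT mF.
have cv x : (f_ n x)%:E @[n --> \oo] --> F x by apply: cvg_nnsfun_approx.
have nd x m n : (m <= n)%N -> (f_ m x <= f_ n x)%R by move=> mn; exact/lefP/nd_nnsfun_approx.
transitivity (limn (fun n => \int[m1]_(x in D) (f_ n x)%:E)).
  rewrite -monotone_convergence //.
  - by apply: eq_integral => x _; apply/esym/cvg_lim.
  - by move=> n; apply/measurable_EFinP; exact: measurable_funTS.
  - by move=> n x _; rewrite lee_fin.
  - by move=> x _ m n mn; rewrite lee_fin nd.
rewrite [X in limn X](_ : _ = (fun n => \int[m2]_(y in E) ((f_ n (inv y))%:E * (w y)%:E))); last first.
  by apply/funext => n; exact: transport_nnsfun.
rewrite -monotone_convergence //.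
- apply: eq_integral => y yE; apply/cvg_lim => //.
  by apply: cvgeMr => //; exact: cv.
- move=> n; apply: emeasurable_funM; last exact/measurable_EFinP.
  by apply/measurable_EFinP; apply: (measurableT_comp _ minv); exact: measurable_funP.
- by move=> n y Ey; rewrite mule_ge0 // lee_fin ?w0.
- by move=> y Ey m n mn; rewrite lee_wpmul2r ?lee_fin ?w0 // nd.
Qed.

End DensityTransport.

(** * A family of mollifiers *)

Section Mollifier.
Variable R : realType.
Implicit Types (f phi : R -> R) (t a M : R).

Lemma is_derive_continuous f (df : R -> R) : (forall t, is_derive t (1 : R) f (df t)) -> continuous f.
Proof. by move=> d t; apply/differentiable_continuous/derivable1_diffP; case: (d t). Qed.

Lemma continuous_bump f a : continuous f -> 0 <= a -> (forall t, a < `|t| -> f t = 0) ->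
  exists M, bump a M f.
Proof.
move=> cf a0 f0; have [C hC] := compact_bounded_fun (@segment_compact R (- a) a) (fun p _ => cf p).
exists `|C|; split => //; first exact: continuous_measurable_fun.
move=> t; have [ta|ta] := leP `|t| a; last by rewrite f0 // normr0.
apply: (le_trans (hC t _)); last exact: ler_norm.
by rewrite /= in_itv /= -ler_norml.
Qed.

(* The mean value theorem twice: the remainder is at most [sup |phi''| h^2]. *)
Lemma udiff_derive a M phi (d1 d2 : R -> R) : (forall t, is_derive t (1 : R) phi (d1 t)) ->
  (forall t, is_derive t (1 : R) d1 (d2 t)) -> bump a M phi -> bump a M d1 -> bump a M d2 ->
  udiff a M phi d1.
Proof.
move=> D1 D2 B0 B1 [_ _ M0 _ Bd]; split => // e e0.
have M1 : 0 < M + 1 by rewrite ltr_wpDl.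
exists (e / (M + 1)) => [|h r hh]; first by rewrite divr_gt0.
have sh (F dF : R -> R) : (forall t, is_derive t (1 : R) F (dF t)) ->
    forall k, exists2 c, `|c| <= `|k| & F (r + k) - F r = dF (r + c) * k.
  move=> DF k; have D s : `|s| <= `|k| -> is_derive s (1 : R) (fun s => F (r + s)) (dF (r + s)).
    move=> _; have [d0 e1] := DF (r + s); have rs : s *: (1 : R) + r = r + s by rewrite [_ *: _]mulr1 addrC.
    have [d3 e3] : is_derive s (1 : R) (fun s : R => F (s *: (1 : R) + r)) ('D_1 F (s *: (1 : R) + r)).
      by apply: line_is_derive; rewrite rs.
    have E : (fun s => F (r + s)) = (fun s : R => F (s *: (1 : R) + r)).
      by apply/funext => z; rewrite [_ *: _]mulr1 addrC.
    by rewrite E; apply: DeriveDef => //; rewrite e3 rs.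
  by have [c ck e1] := mvt_centered D; exists c => //; rewrite -e1 addr0.
have [c ch ->] := sh _ _ D1 h.
have [c' cc' e2] := sh _ _ D2 c.
have -> : d1 (r + c) * h - h * d1 r = (d1 (r + c) - d1 r) * h by ring.
rewrite e2 2!normrM; apply: ler_wpM2r => //.
apply: (@le_trans _ _ (M * `|h|)).
  by apply: ler_pM => //; exact: Bd.
apply: (@le_trans _ _ ((M + 1) * `|h|)); first by rewrite ler_wpM2r // lerDl.
by move: hh; rewrite ltr_pdivlMr // => /ltW; rewrite mulrC.
Qed.

Lemma ppow_continuous m : continuous (ppow m : R -> R).
Proof.
move=> t; apply: (@continuous_comp _ _ _ (fun t : R => Num.max 0 t) (fun t => t ^+ m)); last exact: exprn_continuous.
by apply: continuous_max; [exact: cst_continuous | move=> ?].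
Qed.

Section Profile.
Variable N : nat.
Local Notation k := (N.+1%:R : R).

Definition well t : R := 1 - (k * t) ^+ 2.
Definition dwell t : R := - 2 * k ^+ 2 * t.
(** [(1 - (k t)^2)_+^4] has three continuous derivatives: two enter the wave operator, and the third
    bounds the difference quotients of the first derivative in [udiff_derive]. Its support has
    radius [1/k]. *)
Definition profile t := ppow 4 (well t).
Definition profile1 t := 4 * ppow 3 (well t) * dwell t.
Definition profile2 t := 12 * ppow 2 (well t) * dwell t ^+ 2 - 8 * k ^+ 2 * ppow 3 (well t).
Definition profile3 t := 24 * ppow 1 (well t) * dwell t ^+ 3 - 72 * k ^+ 2 * ppow 2 (well t) * dwell t.

Let scE (x y : R) : x *: y = x * y. Proof. by []. Qed.
Let k0 : 0 < k. Proof. by rewrite ltr0n. Qed.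

Lemma dwell_derive t : is_derive t (1 : R) dwell (- 2 * k ^+ 2).
Proof.
have -> : dwell = (- 2 * k ^+ 2) \*: (id : R -> R) by apply/funext => s.
have [d e] := is_deriveZ (- 2 * k ^+ 2) (is_derive_id t (1 : R)).
by apply: DeriveDef; [exact: d | rewrite [LHS]e [_ *: _]mulr1].
Qed.

Lemma well_derive t : is_derive t (1 : R) well (dwell t).
Proof.
have -> : well = (cst 1 : R -> R) - (k ^+ 2 \*: (id ^+ 2 : R -> R)).
  by apply/funext => s; rewrite /well exprMn.
have [d e] := is_deriveB (is_derive_cst (1 : R) t (1 : R)) (is_deriveZ (k ^+ 2) (is_deriveX 2 (is_derive_id t (1 : R)))).
apply: DeriveDef; first exact: d.
by rewrite [LHS]e /dwell sub0r !scE /= expr1; ring.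
Qed.

Lemma ppow_well m t : is_derive t (1 : R) (ppow m.+2 \o well) (m.+2%:R * ppow m.+1 (well t) * dwell t).
Proof.
have [dw ew] := well_derive t.
have [d e] := derive_comp_real dw (ppow_derive m (well t)).
by apply: DeriveDef; [exact: d | rewrite e ew].
Qed.

Lemma profile_derive t : is_derive t (1 : R) profile (profile1 t).
Proof. exact: (ppow_well 2 t). Qed.

Lemma profile1_derive t : is_derive t (1 : R) profile1 (profile2 t).
Proof.
have -> : profile1 = ((4 : R) \*: (ppow 3 \o well)) * dwell by apply/funext => s.
have [d e] := is_deriveM (is_deriveZ (4 : R) (ppow_well 1 t)) (dwell_derive t).
apply: DeriveDef; first exact: d.
rewrite [LHS]e /profile2 /= !scE.
by move: (ppow 3 _) (ppow 2 _) (dwell t) (k ^+ 2) => a b c q; ring.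
Qed.

Lemma profile2_derive t : is_derive t (1 : R) profile2 (profile3 t).
Proof.
have -> : profile2 = ((12 : R) \*: (ppow 2 \o well)) * (dwell ^+ 2) - ((8 * k ^+ 2) \*: (ppow 3 \o well)).
  by apply/funext => s.
have [d e] := is_deriveB (is_deriveM (is_deriveZ (12 : R) (ppow_well 0 t)) (is_deriveX 2 (dwell_derive t)))
  (is_deriveZ (8 * k ^+ 2) (ppow_well 1 t)).
apply: DeriveDef; first exact: d.
rewrite [LHS]e /profile3 /= !scE exprfctE.
by move: (ppow 1 _) (ppow 2 _) (dwell t) (k ^+ 2) => a b c q; ring.
Qed.

Lemma profile_support t : k^-1 < `|t| -> well t <= 0.
Proof.
move=> kt; rewrite subr_le0 -real_normK ?num_real // exprn_ege1 // normrM (ger0_norm (ltW k0)).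
by rewrite -ler_pdivrMl // mulr1 ltW.
Qed.

Lemma profile3_continuous : continuous profile3.
Proof.
have cw : continuous well by exact: (is_derive_continuous well_derive).
have cd : continuous dwell by exact: (is_derive_continuous dwell_derive).
have cp m : continuous (ppow m \o well).
  by move=> t; apply: continuous_comp; [exact: cw | exact: ppow_continuous].
move=> t; apply: cvgB.
  apply: cvgM; first by apply: cvgM; [exact: cvg_cst | exact: cp].
  by apply: (@continuous_comp _ _ _ dwell (fun s => s ^+ 3)); [exact: cd | exact: exprn_continuous].
by apply: cvgM; [apply: cvgM; [exact: cvg_cst | exact: cp] | exact: cd].
Qed.

Lemma profile_range t : 0 <= profile t <= 1.
Proof.
rewrite ppow_ge0 /= exprn_ile1 // ?le_max ?lexx // ge_max ler01 /= lerBlDr lerDl sqr_ge0.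
by [].
Qed.

Lemma profile_bumps : exists M, [/\ bump k^-1 1 profile, bump k^-1 M profile, bump k^-1 M profile1,
  bump k^-1 M profile2 & bump k^-1 M profile3].
Proof.
have i0 : 0 <= k^-1 by rewrite invr_ge0 ltW.
have z m t : k^-1 < `|t| -> ppow m.+1 (well t) = 0 by move=> /profile_support; exact: ppow_neg.
have [M0 B0] := continuous_bump (is_derive_continuous profile_derive) i0 (fun t kt => z 3 t kt).
have z1 t : k^-1 < `|t| -> profile1 t = 0 by move=> kt; rewrite /profile1 z // mulr0 mul0r.
have z2 t : k^-1 < `|t| -> profile2 t = 0 by move=> kt; rewrite /profile2 !z // mulr0 mul0r mulr0 subr0.
have z3 t : k^-1 < `|t| -> profile3 t = 0 by move=> kt; rewrite /profile3 !z // !mulr0 !mul0r subr0.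
have [M1 B1] := continuous_bump (is_derive_continuous profile1_derive) i0 z1.
have [M2 B2] := continuous_bump (is_derive_continuous profile2_derive) i0 z2.
have [M3 B3] := continuous_bump profile3_continuous i0 z3.
have B0' : bump k^-1 1 profile.
  apply: (bump_sup B0) => // t; have /andP[p0 p1] := profile_range t; by rewrite ger0_norm.
pose M := 1 + M1 + M2 + M3.
have [[_ _ p1 _ _] [_ _ p2 _ _] [_ _ p3 _ _]] := And3 B1 B2 B3.
have up L f : bump k^-1 L f -> L <= M -> bump k^-1 M f.
  move=> B LM; have [_ _ L0 _ h] := B; apply: (bump_sup B); first exact: le_trans LM.
  by move=> t; exact: le_trans (h t) LM.
by exists M; split => //; [apply: (up 1 _ B0') | apply: (up M1 _ B1) | apply: (up M2 _ B2) | apply: (up M3 _ B3)];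
  rewrite /M; lra.
Qed.

Lemma profile_integrable : (@lebR R).-integrable setT (EFin \o profile).
Proof.
have [M [[mp _ _ z b] _ _ _ _]] := profile_bumps.
apply: (@bounded_support_integrable _ _ R (@lebR R) `[- k^-1, k^-1]%classic 1) => //.
  exact: lebR_itv_fin.
move=> t nt; apply: z; rewrite ltNge; apply/negP => h; apply: nt.
by rewrite /= in_itv /= -ler_norml.
Qed.

(* Two steps, of heights [(3/4)^4] and [(15/16)^4], below the profile. *)
Lemma profile_integral : (2 * k)^-1 <= \int[@lebR R]_t profile t.
Proof.
pose I r : set R := `[- (r / k), r / k]%classic.
pose q : R := 2^-1; pose q' : R := 4^-1.
(* The outer step is [(3/4)^4 = 81/256] and the increment [11/25] stays below [(15/16)^4 - 81/256];
   the area [(81/256 + 11/50) / k] exceeds [1 / (2 k)]. *)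
pose st t : R := (81 / 256) * \1_(I q) t + (11 / 25) * \1_(I q') t.
have leI r : 0 <= r -> \int[@lebR R]_t \1_(I r) t = 2 * r / k.
  move=> r0; have rk : 0 <= r / k by rewrite divr_ge0 // ltW.
  transitivity (fine (\int[@lebR R]_t (win (r / k) (0 - t))%:E)%E).
    congr fine; apply: eq_integral => t _; rewrite /win /I !indicE; congr ((_ : bool)%:R%:E).
    move: (r / k) => z.
    by rewrite !mem_setE !in_itv /=; apply/andP/andP => -[]; split; lra.
  by rewrite int_win //= mulrA.
have mI r : measurable (I r) by exact: measurable_itv.
have iI r : (@lebR R).-integrable setT (EFin \o (\1_(I r) : R -> R)).
  apply: (@bounded_support_integrable _ _ R (@lebR R) (I r) 1) => //.
  - exact: lebR_itv_fin.
  - by move=> t; rewrite indicE; case: (_ \in _); rewrite ?normr1 ?normr0.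
  by move=> t nt; rewrite indicE memNset.
have IE r t : 0 <= r -> I r t -> ((k * t) ^+ 2 <= r ^+ 2).
  move=> r0; rewrite /I /= in_itv /= -ler_norml ler_pdivlMr // => h.
  by rewrite -real_normK ?num_real // ler_sqr ?nnegrE // normrM (ger0_norm (ltW k0)) mulrC.
have le_st t : st t <= profile t.
  rewrite /st !indicE; have /andP[p0 _] := profile_range t.
  have low r c : 0 <= r -> 0 <= c -> c <= 1 - r ^+ 2 -> I r t -> c ^+ 4 <= profile t.
    move=> r0 c0 cr /(IE _ _ r0) h; have cw : c <= well t by apply: le_trans cr _; rewrite lerB.
    by rewrite /profile ppow_pos ?(le_trans c0) // ler_pXn2r // nnegrE // (le_trans c0).
  have sub : I q' t -> I q t.
    by rewrite /I /= !in_itv /= -!ler_norml => h; apply: le_trans h _; rewrite ler_pM2r ?invr_gt0 // /q /q'; lra.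
  case: (boolP (t \in I q')) => [|h']; last first.
    case: (boolP (t \in I q)) => [|h]; last by rewrite !mulr0 addr0.
    rewrite inE => /(low q (3 / 4)) h; rewrite mulr1 mulr0 addr0.
    apply: le_trans (h _ _ _); rewrite /q; lra.
  rewrite inE => h; rewrite (mem_set (sub h)) !mulr1.
  apply: le_trans (low q' (15 / 16) _ _ _ h); rewrite /q'; lra.
have iZ r c : (@lebR R).-integrable setT (EFin \o (fun t => c * \1_(I r) t : R)).
  exact: (integrableZl measurableT c (iI r)).
have ist : (@lebR R).-integrable setT (EFin \o st) by exact: (integrableD measurableT (iZ _ _) (iZ _ _)).
have le1 := le_Rintegral measurableT ist profile_integrable (fun t _ => le_st t).
apply: le_trans le1; rewrite RintegralD // !RintegralZl // !leI; [|by rewrite invr_ge0..].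
rewrite invfM; have : 0 < k^-1 by rewrite invr_gt0.
by rewrite /q /q'; move: (k^-1) => z z0; lra.
Qed.

End Profile.

(** The profiles divided by their integrals; the lower bound [1 / (2 (N+1))] for the integral
    becomes the height [2 (N+1)]. The explicit formula is retained so that class C^2 of the packets
    in charts can be read off from [Ck_on_ppow]. *)
Lemma mollifier_family : exists (rho rho1 rho2 : nat -> R -> R) (L : nat -> R),
  [/\ forall N, bump N.+1%:R^-1 (2 * N.+1%:R) (rho N), forall N, \int[@lebR R]_t rho N t = 1,
      forall N, udiff N.+1%:R^-1 (L N) (rho N) (rho1 N),
      forall N, udiff N.+1%:R^-1 (L N) (rho1 N) (rho2 N) &
      [/\ forall N t, is_derive t (1 : R) (rho N) (rho1 N t), forall N t, is_derive t (1 : R) (rho1 N) (rho2 N t) &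
      forall N, exists c, rho N = fun t => c * ppow 4 (1 - (N.+1%:R * t) ^+ 2)]].
Proof.
pose c N := \int[@lebR R]_t profile N t.
have c_ge N : (2 * N.+1%:R)^-1 <= c N by exact: profile_integral.
have c0 N : 0 < c N by apply: lt_le_trans (c_ge N); rewrite invr_gt0 mulr_gt0 // ltr0n.
have dZ (N : nat) (f df : R -> R) : (forall t, is_derive t (1 : R) f (df t)) ->
    forall t, is_derive t (1 : R) (fun t => (c N)^-1 * f t) ((c N)^-1 * df t).
  by move=> D t; have [d e] := is_deriveZ ((c N)^-1) (D t); apply: DeriveDef; [exact: d | rewrite [LHS]e].
have B N := profile_bumps N.
have [L hL] : exists L : nat -> R, forall N, [/\ bump N.+1%:R^-1 1 (profile N), bump N.+1%:R^-1 (L N) (profile N),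
    bump N.+1%:R^-1 (L N) (profile1 N), bump N.+1%:R^-1 (L N) (profile2 N) & bump N.+1%:R^-1 (L N) (profile3 N)].
  by have [L hL] := choice B; exists L.
exists (fun N t => (c N)^-1 * profile N t), (fun N t => (c N)^-1 * profile1 N t),
  (fun N t => (c N)^-1 * profile2 N t), (fun N => `|(c N)^-1| * L N).
split => [N|N|N|N|].
- have [B0 _ _ _ _] := hL N; apply: (bump_sup (bumpZ (c N)^-1 B0)) => [|t]; first by rewrite mulr_ge0 ?ler0n.
  have [_ _ _ _ h] := B0; have ci : 0 <= (c N)^-1 by rewrite invr_ge0 ltW.
  rewrite normrM (ger0_norm ci).
  apply: (@le_trans _ _ ((c N)^-1 * 1)); first by rewrite ler_wpM2l.
  rewrite mulr1 -[leRHS]invrK lef_pV2 // posrE; first exact: c0.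
  by rewrite invr_gt0 mulr_gt0 // ltr0n.
- rewrite RintegralZl //; last exact: profile_integrable.
  by rewrite mulVf // gt_eqF.
- have [_ B0 B1 B2 _] := hL N.
  apply: (udiff_derive (dZ N _ _ (profile_derive N)) (dZ N _ _ (profile1_derive N)));
    [exact: bumpZ B0 | exact: bumpZ B1 | exact: bumpZ B2].
- have [_ _ B1 B2 B3] := hL N.
  apply: (udiff_derive (dZ N _ _ (profile1_derive N)) (dZ N _ _ (profile2_derive N)));
    [exact: bumpZ B1 | exact: bumpZ B2 | exact: bumpZ B3].
split => [N|N|N]; [exact: dZ (profile_derive N) | exact: dZ (profile1_derive N) |].
by exists (c N)^-1.
Qed.

End Mollifier.

Local Open Scope complex_scope.

(** * Complex square integrable functions *)

Lemma ReM (R : rcfType) (a b : R[i]) :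
  complex.Re (a * b) = complex.Re a * complex.Re b - complex.Im a * complex.Im b.
Proof. by case: a b => [a1 a2] [b1 b2]. Qed.

Lemma ImM (R : rcfType) (a b : R[i]) :
  complex.Im (a * b) = complex.Re a * complex.Im b + complex.Im a * complex.Re b.
Proof. by case: a b => [a1 a2] [b1 b2]. Qed.

Lemma ReD (R : rcfType) (a b : R[i]) : complex.Re (a + b) = complex.Re a + complex.Re b.
Proof. by case: a b => [a1 a2] [b1 b2]. Qed.

Lemma ImD (R : rcfType) (a b : R[i]) : complex.Im (a + b) = complex.Im a + complex.Im b.
Proof. by case: a b => [a1 a2] [b1 b2]. Qed.

Lemma ReN (R : rcfType) (a : R[i]) : complex.Re (- a) = - complex.Re a.
Proof. by case: a. Qed.

Lemma ImN (R : rcfType) (a : R[i]) : complex.Im (- a) = - complex.Im a.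
Proof. by case: a. Qed.

Lemma ReB (R : rcfType) (a b : R[i]) : complex.Re (a - b) = complex.Re a - complex.Re b.
Proof. by rewrite ReD ReN. Qed.

Lemma ImB (R : rcfType) (a b : R[i]) : complex.Im (a - b) = complex.Im a - complex.Im b.
Proof. by rewrite ImD ImN. Qed.

Lemma ReJ (R : rcfType) (a : R[i]) : complex.Re (conjc a) = complex.Re a.
Proof. by case: a. Qed.

Lemma ImJ (R : rcfType) (a : R[i]) : complex.Im (conjc a) = - complex.Im a.
Proof. by case: a. Qed.

Lemma ReC (R : rcfType) (k : R) : complex.Re k%:C = k.
Proof. by []. Qed.

Lemma ImC (R : rcfType) (k : R) : complex.Im k%:C = 0.
Proof. by []. Qed.

Lemma complexP (R : rcfType) (a b : R[i]) :
  complex.Re a = complex.Re b -> complex.Im a = complex.Im b -> a = b.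
Proof. by case: a b => [a1 a2] [b1 b2] /= -> ->. Qed.

Lemma conjcD (R : rcfType) (a b : R[i]) : conjc (a + b) = conjc a + conjc b.
Proof. by apply: complexP; rewrite !(ReJ, ImJ, ReD, ImD) // opprD. Qed.

Lemma conjcM (R : rcfType) (a b : R[i]) : conjc (a * b) = conjc a * conjc b.
Proof. by apply: complexP; rewrite !(ReJ, ImJ, ReM, ImM); ring. Qed.

Lemma conjcN (R : rcfType) (a : R[i]) : conjc (- a) = - conjc a.
Proof. by case: a. Qed.

Definition ReImE := (ReB, ImB, ReD, ImD, ReN, ImN, ReM, ImM, ReJ, ImJ, ReC, ImC).

Section ComplexL2.
Context d (T : measurableType d) (R : realType) (mu : {measure set T -> \bar R}).
Implicit Types (u v w : T -> R[i]).

Local Notation ip := (ip mu).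
Local Notation l2 := (l2 mu).
Local Notation L2 := (L2 mu).
Local Notation inner := (L2inner mu).

Definition rpart u : T -> R := fun x => complex.Re (u x).
Definition ipart u : T -> R := fun x => complex.Im (u x).

(** The real part of the inner product, the form in which the real projection theorem and
    Cauchy-Schwarz are applied. *)
Definition rinner u v := ip (rpart u) (rpart v) + ip (ipart u) (ipart v).

Lemma normc_sqr (z : R[i]) :
  complex.Re `|z| ^+ 2 = complex.Re z ^+ 2 + complex.Im z ^+ 2.
Proof.
case: z => a b; rewrite normc_def /= sqr_sqrtr //.
by rewrite addr_ge0 ?sqr_ge0.
Qed.

Lemma normc_Re_ge0 (z : R[i]) : 0 <= complex.Re `|z|.
Proof. by case: z => a b; rewrite normc_def /= sqrtr_ge0. Qed.

Lemma L2norm_sqr u : L2norm mu u =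
  ((\int[mu]_x (rpart u x ^+ 2 + ipart u x ^+ 2)%:E) `^ 2^-1)%E.
Proof.
rewrite /L2norm unlock; congr (_ `^ _)%E.
apply: eq_integral => x _ /=.
rewrite ger0_norm ?normc_Re_ge0 // powR_mulrn ?normc_Re_ge0 //.
by rewrite normc_sqr.
Qed.

Lemma L2P u : L2 u <-> l2 (rpart u) /\ l2 (ipart u).
Proof.
split.
- move=> [mr mi]; rewrite L2norm_sqr => fin.
  have {}fin : (\int[mu]_x (rpart u x ^+ 2 + ipart u x ^+ 2)%:E < +oo)%E.
    by apply: lty_poweRy fin; rewrite ?invr_eq0.
  split; split => //; apply: le_lt_trans fin; apply: ge0_le_integral => //;
    try (by move=> x _; rewrite lee_fin sqr_ge0);
    try (by apply/measurable_EFinP; exact: measurable_funX);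
    try (by apply/measurable_EFinP; apply: measurable_funD; exact: measurable_funX).
  - by move=> x _; rewrite lee_fin lerDl sqr_ge0.
  - by move=> x _; rewrite lee_fin lerDr sqr_ge0.
- move=> [[mr lr] [mi li]]; split => //.
  rewrite L2norm_sqr.
  have -> : (\int[mu]_x (rpart u x ^+ 2 + ipart u x ^+ 2)%:E =
    \int[mu]_x (rpart u x ^+ 2)%:E + \int[mu]_x (ipart u x ^+ 2)%:E)%E.
    under eq_integral do rewrite EFinD.
    by rewrite ge0_integralD //; try (by move=> x _; rewrite lee_fin sqr_ge0);
      apply/measurable_EFinP; exact: measurable_funX.
  by rewrite poweR_lty // lte_add_pinfty.
Qed.

Lemma L2normE u : L2 u -> L2norm mu u = (Num.sqrt (rinner u u))%:E.
Proof.
move=> /L2P[lr li]; rewrite L2norm_sqr.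
under eq_integral do rewrite EFinD.
rewrite ge0_integralD //; try (by move=> x _; rewrite lee_fin sqr_ge0);
  try (by apply/measurable_EFinP; apply: measurable_funX; case: lr; case: li).
by rewrite !ipE // -EFinD poweR_EFin powR12_sqrt // addr_ge0 ?ip_ge0.
Qed.

Lemma rinner_ge0 u : 0 <= rinner u u.
Proof. by rewrite addr_ge0 ?ip_ge0. Qed.

Lemma L2norm_lt u (e : R) : 0 < e -> L2 u -> (L2norm mu u < e%:E)%E = (rinner u u < e ^+ 2).
Proof.
move=> e0 lu; rewrite L2normE // lte_fin.
rewrite -[in RHS](sqr_sqrtr (rinner_ge0 u)) ltr_pXn2r // nnegrE ?sqrtr_ge0 // ltW //.
Qed.

Lemma L2D u v : L2 u -> L2 v -> L2 (fun x => u x + v x).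
Proof.
move=> /L2P[ur ui] /L2P[vr vi]; apply/L2P; split.
  by have := l2D ur vr; congr l2; apply/funext => x; rewrite /rpart ReD.
by have := l2D ui vi; congr l2; apply/funext => x; rewrite /ipart ImD.
Qed.

Lemma L2M_bounded (k : T -> R[i]) (M : R) u :
  measurable_fun setT (rpart k) -> measurable_fun setT (ipart k) ->
  (forall x, `|rpart k x| <= M) -> (forall x, `|ipart k x| <= M) ->
  L2 u -> L2 (fun x => k x * u x).
Proof.
move=> mr mi rM iM /L2P[ur ui]; apply/L2P; split.
  have := l2B (l2M_bounded mr rM ur) (l2M_bounded mi iM ui).
  by congr l2; apply/funext => x; rewrite /rpart ReM.
have := l2D (l2M_bounded mr rM ui) (l2M_bounded mi iM ur).
by congr l2; apply/funext => x; rewrite /ipart ImM.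
Qed.

Lemma L2Z (k : R[i]) u : L2 u -> L2 (fun x => k * u x).
Proof.
apply: (@L2M_bounded (fun=> k) (`|complex.Re k| + `|complex.Im k|)).
- exact: measurable_cst.
- exact: measurable_cst.
- by move=> x; rewrite lerDl.
- by move=> x; rewrite lerDr.
Qed.

Lemma L2N u : L2 u -> L2 (fun x => - u x).
Proof. by move=> /(L2Z (-1)); congr L2; apply/funext => x; rewrite mulN1r. Qed.

Lemma L2B u v : L2 u -> L2 v -> L2 (fun x => u x - v x).
Proof. by move=> lu /L2N; exact: L2D. Qed.

Lemma L2_0 : L2 (fun=> 0).
Proof. by apply/L2P; split; exact: l2_0. Qed.

Lemma innerE u v : L2 u -> L2 v ->
  inner u v = rinner u v +i* (ip (rpart u) (ipart v) - ip (ipart u) (rpart v)).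
Proof.
move=> /L2P[ur ui] /L2P[vr vi]; rewrite /L2inner /complex_integral /rinner /ip.
rewrite -RintegralD // -?RintegralB //; try exact: l2_int.
congr (_ +i* _); apply: eq_Rintegral => x _; rewrite !ReImE /rpart /ipart; ring.
Qed.

Lemma Re_inner u v : L2 u -> L2 v -> complex.Re (inner u v) = rinner u v.
Proof. by move=> lu lv; rewrite innerE. Qed.

(** The inner product is conjugate linear in the first argument, so multiplying it by [i] turns the
    imaginary part into a real part and reduces every estimate to [rinner]. *)
Lemma Im_inner u v : L2 u -> L2 v ->
  complex.Im (inner u v) = rinner (fun x => 'i * u x) v.
Proof.
move=> lu lv; have [ur ui] := (L2P u).1 lu; have [vr vi] := (L2P v).1 lv.
rewrite innerE //= /rinner addrC.
have -> : rpart (fun x => 'i * u x) = (fun x => - ipart u x).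
  by apply/funext => x; rewrite /rpart /ipart ReM /= mul0r mul1r sub0r.
have -> : ipart (fun x => 'i * u x) = rpart u.
  by apply/funext => x; rewrite /rpart /ipart ImM /= mul0r mul1r add0r.
by rewrite ipNl.
Qed.

Lemma rinnerC u v : rinner u v = rinner v u.
Proof. by rewrite /rinner (ipC _ (rpart u)) (ipC _ (ipart u)). Qed.

Lemma inner_conj u v : L2 u -> L2 v -> inner v u = conjc (inner u v).
Proof.
move=> lu lv; rewrite !innerE //= rinnerC; congr (_ +i* _).
by rewrite opprB (ipC _ (rpart v)) (ipC _ (ipart v)).
Qed.

Lemma innerDr u v w : L2 u -> L2 v -> L2 w ->
  inner u (fun x => v x + w x) = inner u v + inner u w.
Proof.
move=> lu lv lw; have lvw := L2D lv lw; rewrite !innerE // /rinner.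
move: lu lv lw => /L2P[ur ui] /L2P[vr vi] /L2P[wr wi].
have -> : rpart (fun x => v x + w x) = (fun x => rpart v x + rpart w x).
  by apply/funext => x; rewrite /rpart ReD.
have -> : ipart (fun x => v x + w x) = (fun x => ipart v x + ipart w x).
  by apply/funext => x; rewrite /ipart ImD.
apply: complexP; rewrite /= ?ReD ?ImD /=.
- rewrite (ipDr vr wr ur) (ipDr vi wi ui); ring.
- rewrite (ipDr vi wi ur) (ipDr vr wr ui); ring.
Qed.

Lemma innerZr (k : R[i]) u v : L2 u -> L2 v -> inner u (fun x => k * v x) = k * inner u v.
Proof.
move=> lu lv; have lkv := L2Z k lv; rewrite !innerE // /rinner.
move: lu lv => /L2P[ur ui] /L2P[vr vi].
have -> : rpart (fun x => k * v x) = (fun x => complex.Re k * rpart v x - complex.Im k * ipart v x).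
  by apply/funext => x; rewrite /rpart ReM.
have -> : ipart (fun x => k * v x) = (fun x => complex.Re k * ipart v x + complex.Im k * rpart v x).
  by apply/funext => x; rewrite /ipart ImM.
apply: complexP; rewrite /= ?ReM ?ImM /=.
- rewrite (ipBr (l2Z _ vr) (l2Z _ vi) ur) (ipDr (l2Z _ vi) (l2Z _ vr) ui).
  rewrite !ipZr //; ring.
- rewrite (ipDr (l2Z _ vi) (l2Z _ vr) ur) (ipBr (l2Z _ vr) (l2Z _ vi) ui).
  rewrite !ipZr //; ring.
Qed.

Lemma innerDl u v w : L2 u -> L2 v -> L2 w ->
  inner (fun x => v x + w x) u = inner v u + inner w u.
Proof.
move=> lu lv lw; rewrite inner_conj // ?innerDr //; last exact: L2D.
by rewrite conjcD -!inner_conj.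
Qed.

Lemma innerZl (k : R[i]) u v : L2 u -> L2 v ->
  inner (fun x => k * v x) u = conjc k * inner v u.
Proof.
move=> lu lv; rewrite inner_conj // ?innerZr //; last exact: L2Z.
by rewrite conjcM -inner_conj.
Qed.

Lemma innerNr u v : L2 u -> L2 v -> inner u (fun x => - v x) = - inner u v.
Proof.
move=> lu lv; rewrite -mulN1r -innerZr //; congr inner; apply/funext => x.
by rewrite mulN1r.
Qed.

Lemma innerNl u v : L2 u -> L2 v -> inner (fun x => - v x) u = - inner v u.
Proof.
by move=> lu lv; rewrite inner_conj ?innerNr // ?conjcN -?inner_conj //; exact: L2N.
Qed.

Lemma innerBr u v w : L2 u -> L2 v -> L2 w ->
  inner u (fun x => v x - w x) = inner u v - inner u w.
Proof. by move=> lu lv lw; rewrite innerDr ?innerNr //; exact: L2N. Qed.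

Lemma innerBl u v w : L2 u -> L2 v -> L2 w ->
  inner (fun x => v x - w x) u = inner v u - inner w u.
Proof. by move=> lu lv lw; rewrite innerDl ?innerNl //; exact: L2N. Qed.

Lemma rinner_linear (k : R) u v w : L2 u -> L2 v -> L2 w ->
  rinner (fun x => k%:C * u x + v x) w = k * rinner u w + rinner v w.
Proof.
move=> lu lv lw; have lku := L2Z k%:C lu.
by rewrite -!Re_inner ?innerDl ?innerZl ?ReImE //=; [ring | exact: L2D].
Qed.

Lemma rinner_cs u v : L2 u -> L2 v -> rinner u v ^+ 2 <= rinner u u * rinner v v.
Proof.
move=> lu lv.
(* [Rcomplex R] is the complex field regarded as a real vector space. *)
apply: (@ip_cauchy_schwarz R (T -> Rcomplex R) L2 rinner) => //.
- move=> k a b la lb; have := L2D (L2Z k%:C la) lb.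
  congr L2; apply/funext => x; rewrite !fctE; congr (_ + _).
  by case: (a x) => p q; apply/eqP; rewrite eq_complex /= !mul0r subr0 addr0 !eqxx.
- by move=> a b *; exact: rinnerC.
- move=> k a b w la lb lw; rewrite -(rinner_linear k la lb lw); congr rinner.
  apply/funext => x; rewrite !fctE; congr (_ + _).
  by case: (a x) => p q; apply/eqP; rewrite eq_complex /= !mul0r subr0 addr0 !eqxx.
- by move=> a _; exact: rinner_ge0.
Qed.

End ComplexL2.

(** * A criterion for essential self-adjointness *)

Lemma Re_Ni (R : rcfType) (y z : R[i]) :
  complex.Re (- 'i * y + - 'i * z) = complex.Im (y + z).
Proof. by case: y z => [a b] [c e] /=; rewrite oppr0 !mul0r !sub0r !mulN1r !opprK. Qed.

Section SelfAdjoint.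
Context d (T : measurableType d) (R : realType) (mu : {measure set T -> \bar R}).
Implicit Types (u v w : T -> R[i]).

Local Notation L2 := (L2 mu).
Local Notation inner := (L2inner mu).
Local Notation rinner := (rinner mu).

Lemma inner_small u v (e : R) : L2 u -> L2 v -> 0 < e -> rinner v v < e ^+ 2 ->
  `|complex.Re (inner u v)| <= Num.sqrt (rinner u u) * e /\
  `|complex.Im (inner u v)| <= Num.sqrt (rinner u u) * e.
Proof.
move=> lu lv e0 ve.
have main w : L2 w -> rinner w w = rinner u u ->
    `|rinner w v| <= Num.sqrt (rinner u u) * e.
  move=> lw wu; rewrite -(ger0_norm (ltW e0)) -[`|e|]sqrtr_sqr -sqrtrM ?rinner_ge0 //.
  rewrite -sqrtr_sqr ler_wsqrtr //.
  apply: le_trans (rinner_cs lw lv) _; rewrite wu.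
  by rewrite ler_wpM2l ?rinner_ge0 // ltW.
split; first by rewrite Re_inner //; exact: main.
rewrite Im_inner //; apply: main; first exact: L2Z.
have lw : L2 (fun x => 'i * u x) by exact: L2Z.
rewrite -!Re_inner // innerZl ?innerZr // mulrA.
have -> : conjc 'i * 'i = 1 :> R[i] by rewrite mulrC; apply: complexP; rewrite /=; ring.
by rewrite mul1r.
Qed.

Lemma inner_eq0_r u v : L2 u -> L2 v -> rinner v v = 0 -> inner u v = 0.
Proof.
move=> lu lv v0.
have h e : 0 < e -> rinner v v < e ^+ 2 by move=> e0; rewrite v0 exprn_gt0.
apply: complexP; apply: (@le_eps_eq0 _ (Num.sqrt (rinner u u))) => e e0;
  by have [] := inner_small lu lv e0 (h e e0).
Qed.

Lemma rinner0 : rinner (fun=> 0) (fun=> 0) = 0.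
Proof.
have l0 := @L2_0 _ _ _ mu.
have := rinner_linear 1 l0 l0 l0.
have -> : (fun _ : T => 1%:C * 0 + 0) = (fun=> 0 : R[i]).
  by apply/funext => x; rewrite mulr0 addr0.
by move/eqP; rewrite mul1r -subr_eq0 opprD addrA subrr sub0r oppr_eq0 => /eqP.
Qed.

Lemma rinner_add_null a b : L2 a -> L2 b -> rinner a a = 0 ->
  rinner (fun x => a x + b x) (fun x => a x + b x) = rinner b b.
Proof.
move=> la lb a0; have lab := L2D la lb.
rewrite -Re_inner // innerDr // !innerDl // (inner_eq0_r lb la a0).
by rewrite (inner_conj lb la) (inner_eq0_r lb la a0) (inner_eq0_r la la a0) conjc0 !add0r Re_inner.
Qed.

Lemma L2_complete (u : nat -> T -> R[i]) : (forall n, L2 (u n)) ->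
  (forall e : R, 0 < e -> exists N, forall n m, (N <= n)%N -> (N <= m)%N ->
    rinner (fun x => u n x - u m x) (fun x => u n x - u m x) < e) ->
  exists2 f, L2 f & forall e : R, 0 < e -> exists N, forall n, (N <= n)%N ->
    rinner (fun x => f x - u n x) (fun x => f x - u n x) < e.
Proof.
move=> lu cau.
have rB n m : rpart (fun x => u n x - u m x) = (fun x => rpart (u n) x - rpart (u m) x).
  by apply/funext => x; rewrite /rpart ReB.
have iB n m : ipart (fun x => u n x - u m x) = (fun x => ipart (u n) x - ipart (u m) x).
  by apply/funext => x; rewrite /ipart ImB.
have [||f lf fP] := @riesz_fischer _ T R mu (fun n => rpart (u n)).
- by move=> n; have /L2P[] := lu n.
- move=> e e0; have [N NP] := cau e e0; exists N => n m Nn Nm.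
  apply: le_lt_trans (NP n m Nn Nm); rewrite /rinner rB iB lerDl; exact: ip_ge0.
have [||g lg gP] := @riesz_fischer _ T R mu (fun n => ipart (u n)).
- by move=> n; have /L2P[] := lu n.
- move=> e e0; have [N NP] := cau e e0; exists N => n m Nn Nm.
  apply: le_lt_trans (NP n m Nn Nm); rewrite /rinner rB iB lerDr; exact: ip_ge0.
exists (fun x => f x +i* g x); first by apply/L2P; split.
move=> e e0; have e2 : 0 < e / 2 by rewrite divr_gt0.
have [N1 NP1] := fP _ e2; have [N2 NP2] := gP _ e2.
exists (maxn N1 N2) => n; rewrite geq_max => /andP[n1 n2].
have := NP1 n n1; have := NP2 n n2.
rewrite /rinner.
have -> : rpart (fun x => (f x +i* g x) - u n x) = (fun x => f x - rpart (u n) x).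
  by apply/funext => x; rewrite /rpart ReB.
have -> : ipart (fun x => (f x +i* g x) - u n x) = (fun x => g x - ipart (u n) x).
  by apply/funext => x; rewrite /ipart ImB.
lra.
Qed.

Lemma RcomplexZ (k : R) (z : Rcomplex R) : k *: z = k%:C * z :> R[i].
Proof.
by case: z => p q; apply/eqP; rewrite eq_complex /= !mul0r subr0 addr0 !eqxx.
Qed.

(** The projection in the real space of pairs gives vanishing real parts; as [G] is a complex
    subspace, the imaginary parts vanish as well. *)
Lemma L2_projection (G : set ((T -> R[i]) * (T -> R[i]))) (f : (T -> R[i]) * (T -> R[i])) :
  G (fun=> 0, fun=> 0) ->
  (forall (k : R[i]) p q, G p -> G q ->
     G (fun x => k * p.1 x + q.1 x, fun x => k * p.2 x + q.2 x)) ->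
  (forall p, G p -> L2 p.1 /\ L2 p.2) -> L2 f.1 -> L2 f.2 ->
  exists2 p, graph_closure mu G p &
    forall g, G g -> inner (fun x => f.1 x - p.1 x) g.1 +
                     inner (fun x => f.2 x - p.2 x) g.2 = 0.
Proof.
move=> G0 Glin GL2 lf1 lf2.
pose V := ((T -> Rcomplex R) * (T -> Rcomplex R))%type.
pose H : set V := [set p | L2 p.1 /\ L2 p.2].
pose ipp (p q : V) := rinner p.1 q.1 + rinner p.2 q.2.
have subE (p q : V) : p - q = (fun x => p.1 x - q.1 x, fun x => p.2 x - q.2 x) :> V by [].
have linE (k : R) (p q : V) :
    k *: p + q = (fun x => k%:C * p.1 x + q.1 x, fun x => k%:C * p.2 x + q.2 x) :> V.
  congr pair; apply/funext => x.
    exact: (congr1 (fun z : Rcomplex R => z + q.1 x) (RcomplexZ k (p.1 x))).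
  exact: (congr1 (fun z : Rcomplex R => z + q.2 x) (RcomplexZ k (p.2 x))).
have [|||||||||p [Hp pc po]] := @projection R V H ipp _ _ _ _ _ G f.
- move=> k u v [u1 u2] [v1 v2]; rewrite linE; split => /=; exact: L2D (L2Z _ _) _.
- by move=> u v _ _; rewrite /ipp rinnerC (rinnerC _ u.2).
- move=> k u v w [u1 u2] [v1 v2] [w1 w2]; rewrite linE /ipp /= !rinner_linear //; ring.
- by move=> u _; rewrite addr_ge0 ?rinner_ge0.
- move=> u Hu cau.
  have [||a la aP] := @L2_complete (fun n => (u n).1).
  + by move=> n; have [] := Hu n.
  + move=> e e0; have [N NP] := cau e e0; exists N => n m Nn Nm.
    by apply: le_lt_trans (NP n m Nn Nm); rewrite subE /ipp lerDl rinner_ge0.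
  have [||b lb bP] := @L2_complete (fun n => (u n).2).
  + by move=> n; have [] := Hu n.
  + move=> e e0; have [N NP] := cau e e0; exists N => n m Nn Nm.
    by apply: le_lt_trans (NP n m Nn Nm); rewrite subE /ipp lerDr rinner_ge0.
  exists (a, b) => // e e0; have e2 : 0 < e / 2 by rewrite divr_gt0.
  have [N1 NP1] := aP _ e2; have [N2 NP2] := bP _ e2.
  exists (maxn N1 N2) => n; rewrite geq_max => /andP[n1 n2].
  have := NP1 n n1; have := NP2 n n2; rewrite subE /ipp /=; lra.
- exact: G0.
- by move=> k u v Gu Gv; rewrite linE; exact: Glin.
- by move=> u /GL2.
- by [].
case: Hp => lp1 lp2; exists p.
  split => // e e0; have [g Gg] := pc _ (exprn_gt0 2 e0).
  have [lg1 lg2] := GL2 _ Gg.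
  rewrite subE /ipp /= => lt; exists g => //; split; rewrite L2norm_lt //; try exact: L2B.
    by apply: le_lt_trans lt; rewrite lerDl rinner_ge0.
  by apply: le_lt_trans lt; rewrite lerDr rinner_ge0.
have re g : G g -> complex.Re (inner (fun x => f.1 x - p.1 x) g.1 +
                     inner (fun x => f.2 x - p.2 x) g.2) = 0.
  move=> Gg; have [lg1 lg2] := GL2 _ Gg.
  by rewrite ReD !Re_inner //; try exact: L2B; exact: po.
move=> g Gg; apply: complexP; first exact: re.
have [lg1 lg2] := GL2 _ Gg.
(* Testing with [-i g] turns the imaginary part of the pairing into a real part. *)
have Gi : G (fun x => - 'i * g.1 x, fun x => - 'i * g.2 x).
  have := Glin (- 'i) _ _ Gg G0; congr (G (_, _)); apply/funext => x /=; exact: addr0.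
have := re _ Gi; rewrite [X in inner _ X]/= [X in _ + inner _ X]/=.
rewrite !innerZr //; try exact: L2B.
by move=> h; apply: etrans h; rewrite Re_Ni.
Qed.

Section Graph.
Variable G : set ((T -> R[i]) * (T -> R[i])).
Hypothesis GL2 : forall p, G p -> L2 p.1 /\ L2 p.2.

Lemma sub_closure : G `<=` graph_closure mu G.
Proof.
move=> p Gp; have [l1 l2] := GL2 Gp; split => // e e0; exists p => //.
have E w : (fun x : T => w x - w x : R[i]) = (fun=> 0) by apply/funext => x; rewrite subrr.
rewrite !E L2norm_lt //; last exact: L2_0.
rewrite rinner0.
by rewrite exprn_gt0.
Qed.

(** Both sides of the adjoint relation are continuous for L2 convergence of the two components of a
    graph element. *)
Lemma adjoint_closure v h : graph_adjoint mu G (v, h) ->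
  graph_adjoint mu (graph_closure mu G) (v, h).
Proof.
move=> [/= lv lh vh]; split => //= -[u f] [/= lu lf cl].
have key e : 0 < e -> `|complex.Re (inner v f - inner h u)| <=
      (Num.sqrt (rinner v v) + Num.sqrt (rinner h h)) * e /\
    `|complex.Im (inner v f - inner h u)| <=
      (Num.sqrt (rinner v v) + Num.sqrt (rinner h h)) * e.
  move=> e0; have [[u' f'] G' [c1 c2]] := cl e e0.
  have [lu' lf'] := GL2 G'; rewrite /= in lu' lf'.
  have -> : inner v f - inner h u =
      inner v (fun x => f x - f' x) - inner h (fun x => u x - u' x).
    rewrite !innerBr //; have := vh _ G'; rewrite /= => ->.
    by rewrite opprB addrA subrK.
  rewrite /= L2norm_lt // in c1; last exact: L2B.
  rewrite /= L2norm_lt // in c2; last exact: L2B.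
  have [a1 a2] := inner_small lv (L2B lf lf') e0 c2.
  have [b1 b2] := inner_small lh (L2B lu lu') e0 c1.
  rewrite mulrDl ReB ImB; split; apply: le_trans (ler_normB _ _) _; exact: lerD.
apply/eqP; rewrite -subr_eq0; apply/eqP.
apply: complexP; apply: (@le_eps_eq0 _ (Num.sqrt (rinner v v) + Num.sqrt (rinner h h))) => e e0.
  by case: (key e e0).
by case: (key e e0).
Qed.

End Graph.

Lemma adjoint_sub G G' : G `<=` G' -> graph_adjoint mu G' `<=` graph_adjoint mu G.
Proof. by move=> GG' p [l1 l2 h]; split => // q /GG'; exact: h. Qed.

Section EssentiallySelfadjoint.
Variables (D : set (T -> R[i])) (A : (T -> R[i]) -> (T -> R[i])).

Lemma esa_orthogonal : essentially_selfadjoint mu D A ->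
  forall f, L2 f -> (forall u, D u -> inner f u = 0) -> rinner f f = 0.
Proof.
move=> [[DL2 dense] _ _] f lf fD.
apply: (@le_eps_eq0 _ (Num.sqrt (rinner f f))) => e e0.
have [u Du fu] := dense f lf e e0; have lu := DL2 _ Du.
rewrite L2norm_lt // in fu; last exact: L2B.
have [+ _] := inner_small lf (L2B lf lu) e0 fu.
by rewrite innerBr // (fD _ Du) subr0 Re_inner.
Qed.

(** An adjoint pair also annihilates the closure of the graph. Self-adjointness places the second
    pair in that closure, where the first can be tested against it. *)
Lemma esa_adjoint_symmetric : essentially_selfadjoint mu D A ->
  forall v h b c, graph_adjoint mu (op_graph D A) (v, h) ->
    graph_adjoint mu (op_graph D A) (b, c) -> inner h b = inner v c.
Proof.
move=> [[DL2 _] AL2 [_ sa]] v h b c vh bc.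
have GL2 p : op_graph D A p -> L2 p.1 /\ L2 p.2.
  by move=> [Dp ->]; split; [exact: DL2 | exact: AL2].
have := adjoint_closure GL2 bc; rewrite sa => cbc.
by have [_ _ H] := adjoint_closure GL2 vh; have /= := H _ cbc.
Qed.

(* A pair orthogonal to the graph of [A], rotated by a quarter turn, lies in the
   adjoint; hence a symmetric adjoint is contained in the closure. *)
Lemma esa_criterion :
  (D (fun=> 0)) ->
  (forall (k : R[i]) u v, D u -> D v -> D (fun x => k * u x + v x)) ->
  (forall (k : R[i]) u v, D u -> D v ->
     A (fun x => k * u x + v x) = fun x => k * A u x + A v x) ->
  D `<=` L2 -> (forall u, D u -> L2 (A u)) ->
  (forall f, L2 f -> (forall u, D u -> inner f u = 0) -> rinner f f = 0) ->
  (forall u v, D u -> D v -> inner u (A v) = inner (A u) v) ->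
  (forall v h b c, graph_adjoint mu (op_graph D A) (v, h) ->
    graph_adjoint mu (op_graph D A) (b, c) -> inner h b = inner v c) ->
  essentially_selfadjoint mu D A.
Proof.
move=> D0 Dlin Alin DL2 AL2 Dtot sym adjsym.
have A0 : A (fun=> 0) = fun=> 0.
  have := Alin (-1) _ _ D0 D0; rewrite [X in A X](_ : _ = fun=> 0); last first.
    by apply/funext => x; rewrite mulr0 addr0.
  by move=> ->; apply/funext => x; rewrite mulN1r addNr.
have GL2 p : op_graph D A p -> L2 p.1 /\ L2 p.2.
  by move=> [Dp ->]; split; [exact: DL2 | exact: AL2].
have G0 : op_graph D A (fun=> 0, fun=> 0) by split => //=; rewrite A0.
have Glin (k : R[i]) p q : op_graph D A p -> op_graph D A q ->
    op_graph D A (fun x => k * p.1 x + q.1 x, fun x => k * p.2 x + q.2 x).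
  by move=> [Dp ->] [Dq ->]; split => /=; [exact: Dlin | rewrite Alin].
have dense : dense_in_L2 mu D.
  split => // f lf e e0.
  (* Density of [D] is the projection theorem for [D] itself; the zero second component allows
     [L2_projection] to be reused. *)
  pose G1 : set ((T -> R[i]) * (T -> R[i])) := [set p | D p.1 /\ p.2 = fun=> 0].
  have [|||||p [lp1 lp2 pc] po] := @L2_projection G1 (f, fun=> 0) => //=.
  - move=> k p q [Dp p2] [Dq q2]; split => /=; first exact: Dlin.
    by rewrite p2 q2; apply/funext => x; rewrite mulr0 addr0.
  - by move=> p [Dp ->]; split; [exact: DL2 | exact: L2_0].
  - exact: L2_0.
  have lfp : L2 (fun x => f x - p.1 x) by exact: L2B.
  have fp0 : rinner (fun x => f x - p.1 x) (fun x => f x - p.1 x) = 0.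
    apply: Dtot => // u Du; have := po (u, fun=> 0); rewrite /= => /(_ _)/=.
    have -> : inner (fun x : T => 0 - p.2 x) (fun=> 0) = 0.
      by apply: inner_eq0_r; [exact: L2B (@L2_0 _ _ _ mu) lp2 | exact: L2_0 | exact: rinner0].
    by rewrite addr0; apply; split.
  have [[u z] [/= Du _] [c1 _]] := pc e e0; have lu := DL2 _ Du.
  exists u => //; rewrite L2norm_lt //; last exact: L2B.
  rewrite L2norm_lt // in c1; last exact: L2B.
  have lpu : L2 (fun x => p.1 x - u x) by exact: L2B.
  apply: le_lt_trans c1.
  have -> : (fun x => f x - u x) = (fun x => (f x - p.1 x) + (p.1 x - u x)).
    by apply/funext => x; rewrite addrA subrK.
  by rewrite rinner_add_null.
split => //; split.
  split; first by move=> _ [p [l1 _ _] <-].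
  move=> f lf e e0; have [u Du fu] := dense.2 f lf e e0; exists u => //.
  by exists (u, A u) => //; apply: sub_closure => //; split.
apply/seteqP; split.
- move=> [v h] vh; have {vh}vh := adjoint_sub (sub_closure GL2) vh.
  have [lv lh _] := vh; rewrite /= in lv lh.
  have [[p q] pqc po] := @L2_projection (op_graph D A) (v, h) G0 Glin GL2 lv lh.
  have [/= lp lq pc] := pqc.
  pose a x := v x - p x; pose b x := h x - q x.
  have la : L2 a by exact: L2B. have lb : L2 b by exact: L2B.
  have ba : graph_adjoint mu (op_graph D A) (b, fun x => - a x).
    split => //=; first exact: L2N.
    move=> -[w z] [/= Dw ->]; have /= := po (w, A w) (conj Dw erefl).
    by move=> /eqP; rewrite addrC addr_eq0 => /eqP ->; rewrite innerNl //; exact: DL2.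
  have vhba : inner v a + inner h b = 0.
    have := adjsym _ _ _ _ vh ba; rewrite innerNr // => ->; by rewrite subrr.
  have pqba : inner p a + inner q b = 0.
    have [_ _ H] := adjoint_closure GL2 ba; have /= := H _ pqc.
    rewrite innerNl // => bq; rewrite (inner_conj lb lq) (inner_conj la lp) bq.
    by rewrite conjcN subrr.
  (* [(v, h)] is orthogonal to [(a, b)] by symmetry of the adjoint, and [(p, q)] because [(b, -a)]
     annihilates the closure; the difference of the two is [(a, b)] itself. *)
  have ab0 : rinner a a + rinner b b = 0.
    rewrite -!Re_inner // -ReD {1}/a {1}/b !innerBl //.
    by rewrite addrACA -opprD vhba pqba subr0.
  have a0 : rinner a a = 0.
    have := rinner_ge0 mu a; have := rinner_ge0 mu b; lra.
  have b0 : rinner b b = 0 by move: ab0; rewrite a0 add0r.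
  (* [(v, h)] and [(p, q)] agree only up to functions of norm zero, which approximation by graph
     elements does not detect. *)
  split => //= e e0; have e2 : 0 < e / 2 by rewrite divr_gt0.
  have [[u f] Guf [/= c1 c2]] := pc e e0; have [/= lu lf] := GL2 _ Guf.
  exists (u, f) => //=.
  have tr w z w' : L2 w -> L2 z -> L2 w' -> rinner (fun x => w x - z x) (fun x => w x - z x) = 0 ->
      (L2norm mu (fun x => (z x - w' x)%R) < e%:E)%E ->
      (L2norm mu (fun x => (w x - w' x)%R) < e%:E)%E.
    move=> lw lz lw' wz; rewrite !L2norm_lt //; try exact: L2B.
    apply: le_lt_trans.
    have l1 : L2 (fun x => w x - z x) by exact: L2B.
    have l2 : L2 (fun x => z x - w' x) by exact: L2B.
    have -> : (fun x => w x - w' x) = (fun x => (w x - z x) + (z x - w' x)).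
      by apply/funext => x; rewrite addrA subrK.
    by rewrite rinner_add_null.
  by split; [exact: (tr v p u) | exact: (tr h q f)].
- move=> [v h] cvh; apply: adjoint_closure => //.
  have [/= lv lh _] := cvh; split => //= -[u f] [/= Du ->].
  have lu := DL2 _ Du; have lAu := AL2 _ Du.
  have : graph_adjoint mu (op_graph D A) (u, A u).
    by split => //= -[w z] [/= Dw ->]; exact: sym.
  move=> /(adjoint_closure GL2)[_ _ H]; have /= E := H _ cvh.
  by rewrite (inner_conj lAu lv) -E -inner_conj.
Qed.

End EssentiallySelfadjoint.
End SelfAdjoint.

(** * The wave equation with a symmetric adjoint *)

Section InnerMore.
Context d (T : measurableType d) (R : realType) (mu : {measure set T -> \bar R}).
Implicit Types (u v : T -> R[i]).
Local Notation L2 := (L2 mu).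
Local Notation inner := (L2inner mu).

Lemma inner_mulr (W : T -> R) u v :
  inner (fun x => (W x)%:C * u x) v = inner u (fun x => (W x)%:C * v x).
Proof.
by rewrite /L2inner; congr complex_integral; apply/funext => x;
  apply: complexP; rewrite !ReImE /=; ring.
Qed.

Lemma inner_ae u u' v : L2 u -> L2 u' -> L2 v -> {ae mu, forall x, u x = u' x} ->
  inner u v = inner u' v.
Proof.
move=> lu lu' lv uu'.
have ur : {ae mu, forall x, rpart u x = rpart u' x}.
  by apply: filterS uu' => x; rewrite /rpart => ->.
have ui : {ae mu, forall x, ipart u x = ipart u' x}.
  by apply: filterS uu' => x; rewrite /ipart => ->.
rewrite !innerE // /rinner.
have [lr li] := (L2P mu u).1 lu; have [lr' li'] := (L2P mu u').1 lu'.
have [mr mi] := (L2P mu v).1 lv.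
by rewrite (ip_ae lr lr' mr ur) (ip_ae li li' mi ui) (ip_ae lr lr' mi ur) (ip_ae li li' mr ui).
Qed.

Lemma L2M_real (W : T -> R) (B : R) u : measurable_fun setT W -> (forall x, `|W x| <= B) ->
  L2 u -> L2 (fun x => (W x)%:C * u x).
Proof.
move=> mW WB; apply: (@L2M_bounded _ _ _ mu (fun x => (W x)%:C) B) => //.
- exact: measurable_cst.
- by move=> x; rewrite /ipart /= normr0; exact: le_trans (normr_ge0 _) (WB x).
Qed.

Lemma inner_int u v : L2 u -> L2 v ->
  mu.-integrable setT (EFin \o (fun x => complex.Re (conjc (u x) * v x))) /\
  mu.-integrable setT (EFin \o (fun x => complex.Im (conjc (u x) * v x))).
Proof.
move=> /L2P[ur ui] /L2P[vr vi]; split.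
  have := integrableD measurableT (l2_int ur vr) (l2_int ui vi).
  apply: eq_integrable => // x _ /=; rewrite -EFinD; congr EFin.
  by rewrite !ReImE /rpart /ipart; ring.
have := integrableB measurableT (l2_int ur vi) (l2_int ui vr).
apply: eq_integrable => // x _ /=; rewrite -EFinB; congr EFin.
by rewrite !ReImE /rpart /ipart; ring.
Qed.

End InnerMore.

Lemma conjc_2i (R : realType) : conjc (2 * 'i : R[i]) = - (2 * 'i).
Proof.
have -> : 2 * 'i = 'i + 'i :> R[i] by ring.
by apply: complexP => /=; ring.
Qed.

(** * Complex time convolution and the wave operator tested on packets *)

Section ComplexTimeConvolution.
Context d (T : measurableType d) (R : realType).
Context (mu : {sigma_finite_measure set T -> \bar R}).
Local Notation leb := (@lebR R).
Local Notation P := ((@lebR R) \x mu)%E.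
Implicit Types (u v b : R * T -> R[i]) (phi chi : R -> R) (psi : T -> R[i]).

Definition cnice v := nice mu (rpart v) /\ nice mu (ipart v).
Definition ctconv phi v z : R[i] := tconv phi (rpart v) z +i* tconv phi (ipart v) z.
Definition cslice v s : T -> R[i] := fun x => v (s, x).
Definition ctensor phi psi (z : R * T) : R[i] := (phi z.1)%:C * psi z.2.

Lemma cnice_L2 v : cnice v -> L2 P v.
Proof. by move=> [[l1 _] [l2 _]]; apply/L2P. Qed.

Lemma cnice_ae v : L2 P v -> exists2 v', cnice v' & {ae P, forall z, v z = v' z}.
Proof.
move=> /L2P[/nice_ae[f nf vf] /nice_ae[g ng vg]].
exists (fun z => f z +i* g z); first by split.
have : {ae P, forall z, rpart v z = f z /\ ipart v z = g z} by apply: filterS2 vf vg.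
apply: filterS => z; rewrite /rpart /ipart => -[h1 h2].
by apply: complexP.
Qed.

Lemma ctconv_cnice phi a M v : bump a M phi -> cnice v -> cnice (ctconv phi v).
Proof. by move=> B [n1 n2]; split; exact: (tconv_nice B). Qed.

Lemma cslice_L2 phi a M v s : bump a M phi -> cnice v -> L2 mu (cslice (ctconv phi v) s).
Proof. by move=> B [n1 n2]; apply/L2P; split; exact: (slice_l2 s B). Qed.

Lemma ctensor_cnice phi a M psi s : bump a M phi -> L2 mu psi ->
  cnice (ctensor (fun t => phi (s - t)) psi).
Proof.
move=> B /L2P[l1 l2]; split.
  have := tensor_nice s B l1; congr nice; apply/funext => z.
  by rewrite /rpart /ctensor /tensor !ReImE mul0r subr0.
have := tensor_nice s B l2; congr nice; apply/funext => z.
by rewrite /ipart /ctensor /tensor !ReImE mul0r addr0.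
Qed.

Lemma inner_ctensor phi a M psi s v : bump a M phi -> L2 mu psi -> cnice v ->
  L2inner P v (ctensor (fun t => phi (s - t)) psi) = L2inner mu (cslice (ctconv phi v) s) psi.
Proof.
move=> B lpsi nv; have nt := ctensor_cnice s B lpsi; have lc := cslice_L2 s B nv.
have [n1 n2] := nv; have [l1 l2] := (L2P mu psi).1 lpsi.
rewrite (innerE (cnice_L2 nv) (cnice_L2 nt)) (innerE lc lpsi) /rinner.
have -> : rpart (ctensor (fun t => phi (s - t)) psi) = tensor (fun t => phi (s - t)) (rpart psi).
  by apply/funext => z; rewrite /rpart /ctensor /tensor !ReImE mul0r subr0.
have -> : ipart (ctensor (fun t => phi (s - t)) psi) = tensor (fun t => phi (s - t)) (ipart psi).
  by apply/funext => z; rewrite /ipart /ctensor /tensor !ReImE mul0r addr0.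
by rewrite (ip_tensor s B l1 n1) (ip_tensor s B l2 n2) (ip_tensor s B l2 n1) (ip_tensor s B l1 n2).
Qed.

Lemma ctconv_by_parts a M phi phi' chi chi' v b :
  udiff a M phi phi' -> udiff a M chi chi' -> cnice v -> cnice b ->
  L2inner P (ctconv phi' v) (ctconv chi b) = - L2inner P (ctconv phi v) (ctconv chi' b).
Proof.
move=> u1 u2 nv nb; have [B1 B1' _] := u1; have [B2 B2' _] := u2.
have n1 := cnice_L2 (ctconv_cnice B1 nv); have n1' := cnice_L2 (ctconv_cnice B1' nv).
have n2 := cnice_L2 (ctconv_cnice B2 nb); have n2' := cnice_L2 (ctconv_cnice B2' nb).
rewrite (innerE n1' n2) (innerE n1 n2') /rinner.
have re p w : rpart (ctconv p w) = tconv p (rpart w) by [].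
have im p w : ipart (ctconv p w) = tconv p (ipart w) by [].
have [vr vi] := nv; have [br bi] := nb.
rewrite !re !im (tconv_by_parts u1 u2 vr br) (tconv_by_parts u1 u2 vi bi).
rewrite (tconv_by_parts u1 u2 vr bi) (tconv_by_parts u1 u2 vi br).
move: (ip P _ _) (ip P _ _) (ip P _ _) (ip P _ _) => p q r t.
by apply: complexP; rewrite /=; ring.
Qed.

Section Multiplication.
Variables (V : T -> R) (B : R).
Hypotheses (mV : measurable_fun setT V) (VB : forall x, `|V x| <= B).

Definition tmul v (z : R * T) : R[i] := (V z.2)%:C * v z.

Lemma nice_mul (f : R * T -> R) : nice mu f -> nice mu (fun z => V z.2 * f z).
Proof.
move=> [lf sf]; split; last by move=> x; exact: (l2Z (V x) (sf x)).
apply: (@l2M_bounded _ _ _ _ _ (fun z => V z.2) B) => //.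
exact: (measurableT_comp mV measurable_snd).
Qed.

Lemma cnice_mul v : cnice v -> cnice (tmul v).
Proof.
move=> [n1 n2]; split.
  have := nice_mul n1; congr nice; apply/funext => z.
  by rewrite /rpart /tmul !ReImE mul0r subr0.
have := nice_mul n2; congr nice; apply/funext => z.
by rewrite /ipart /tmul !ReImE mul0r addr0.
Qed.

Lemma ctconv_mul phi a M v : bump a M phi -> cnice v ->
  ctconv phi (tmul v) = tmul (ctconv phi v).
Proof.
move=> Bp [[_ s1] [_ s2]]; apply/funext => -[s x]; rewrite /ctconv /tmul /=.
have -> : tconv phi (rpart (tmul v)) (s, x) = V x * tconv phi (rpart v) (s, x).
  rewrite /tconv -(convZr (V x) _ Bp (s1 x)) /=; congr (conv phi _ s).
  by apply/funext => t; rewrite /sec /rpart /tmul !ReImE mul0r subr0.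
have -> : tconv phi (ipart (tmul v)) (s, x) = V x * tconv phi (ipart v) (s, x).
  rewrite /tconv -(convZr (V x) _ Bp (s2 x)) /=; congr (conv phi _ s).
  by apply/funext => t; rewrite /sec /ipart /tmul !ReImE mul0r addr0.
by apply: complexP; rewrite /= ?mul0r ?subr0 ?addr0.
Qed.

Lemma L2_tmul v : L2 P v -> L2 P (tmul v).
Proof.
apply: (L2M_real (W := fun z => V z.2) (B := B)) => //.
exact: (measurableT_comp mV measurable_snd).
Qed.

Lemma inner_tmul u v : L2inner P (tmul u) v = L2inner P u (tmul v).
Proof. exact: (inner_mulr P (fun z => V z.2)). Qed.

End Multiplication.

(** Fubini for the pairing: slicewise equality suffices, provided every slice is square
    integrable. *)
Lemma inner_slices u v u' v' : L2 P u -> L2 P v -> L2 P u' -> L2 P v' ->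
  (forall s, L2 mu (cslice u s)) -> (forall s, L2 mu (cslice v s)) ->
  (forall s, L2 mu (cslice u' s)) -> (forall s, L2 mu (cslice v' s)) ->
  (forall s, L2inner mu (cslice u s) (cslice v s) = L2inner mu (cslice u' s) (cslice v' s)) ->
  L2inner P u v = L2inner P u' v'.
Proof.
move=> lu lv lu' lv' su sv su' sv' h.
have key w z : L2 P w -> L2 P z -> (forall s, L2 mu (cslice w s)) -> (forall s, L2 mu (cslice z s)) ->
    L2inner P w z = complex_integral leb (fun s => L2inner mu (cslice w s) (cslice z s)).
  move=> lw lz sw sz; rewrite /L2inner /complex_integral; congr (_ +i* _).
    apply: Rintegral_fubini12; first exact: (inner_int lw lz).1.
    by move=> s; exact: (inner_int (sw s) (sz s)).1.
  apply: Rintegral_fubini12; first exact: (inner_int lw lz).2.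
  by move=> s; exact: (inner_int (sw s) (sz s)).2.
by rewrite (key _ _ lu lv su sv) (key _ _ lu' lv' su' sv') (funext h).
Qed.

Variables (rho rho1 rho2 : nat -> R -> R) (Mn : nat -> R).
Hypothesis rho_bump : forall n, bump n.+1%:R^-1 (2 * n.+1%:R) (rho n).
Hypothesis rho_int : forall n, \int[leb]_t rho n t = 1.
Hypothesis rho_d1 : forall n, udiff n.+1%:R^-1 (Mn n) (rho n) (rho1 n).
Hypothesis rho_d2 : forall n, udiff n.+1%:R^-1 (Mn n) (rho1 n) (rho2 n).

Lemma ctconv_cvg v : cnice v -> forall e : R, 0 < e -> exists N, forall n, (N <= n)%N ->
  rinner P (fun z => ctconv (rho n) v z - v z) (fun z => ctconv (rho n) v z - v z) < e.
Proof.
move=> [n1 n2] e e0; have e2 : 0 < e / 2 by rewrite divr_gt0.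
have /cvgrPdist_lt /(_ _ e2) [N1 _ H1] := tconv_cvg rho_bump rho_int n1.
have /cvgrPdist_lt /(_ _ e2) [N2 _ H2] := tconv_cvg rho_bump rho_int n2.
exists (maxn N1 N2) => n; rewrite geq_max => /andP[h1 h2].
have := H1 n h1; have := H2 n h2.
rewrite /= !sub0r !normrN !ger0_norm ?ip_ge0 // => a1 a2.
rewrite /rinner.
have -> : rpart (fun z => ctconv (rho n) v z - v z) = fun z => tconv (rho n) (rpart v) z - rpart v z.
  by apply/funext => z; rewrite /rpart ReB.
have -> : ipart (fun z => ctconv (rho n) v z - v z) = fun z => tconv (rho n) (ipart v) z - ipart v z.
  by apply/funext => z; rewrite /ipart ImB.
by move: a1 a2; move: (ip _ _ _) (ip _ _ _) => x y; lra.
Qed.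

(** The limit of concentrating mollifiers, phrased as an equality of two pairings so that an
    identity available only after mollification can be carried over. *)
Lemma mollified_inner_eq u v u' v' : cnice u -> cnice v -> cnice u' -> cnice v' ->
  (forall n, L2inner P (ctconv (rho n) u) (ctconv (rho n) v) =
             L2inner P (ctconv (rho n) u') (ctconv (rho n) v')) ->
  L2inner P u v = L2inner P u' v'.
Proof.
move=> nu nv nu' nv' h.
have dist w z : cnice w -> cnice z -> exists2 C : R, 0 <= C & forall e, 0 < e -> e <= 1 ->
    exists N, forall n, (N <= n)%N ->
    `|complex.Re (L2inner P (ctconv (rho n) w) (ctconv (rho n) z) - L2inner P w z)| <= C * e /\
    `|complex.Im (L2inner P (ctconv (rho n) w) (ctconv (rho n) z) - L2inner P w z)| <= C * e.
  move=> nw nz; have lw := cnice_L2 nw; have lz := cnice_L2 nz.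
  exists (Num.sqrt (rinner P w w) + 1 + Num.sqrt (rinner P z z)).
    by rewrite !addr_ge0 ?sqrtr_ge0.
  move=> e e0 e1; have ee0 : 0 < e ^+ 2 by rewrite exprn_gt0.
  have [N1 H1] := ctconv_cvg nw ee0; have [N2 H2] := ctconv_cvg nz ee0.
  exists (maxn N1 N2) => n; rewrite geq_max => /andP[h1 h2].
  have lwn := cnice_L2 (ctconv_cnice (rho_bump n) nw).
  have lzn := cnice_L2 (ctconv_cnice (rho_bump n) nz).
  have ldw := L2B lwn lw; have ldz := L2B lzn lz.
  (* <w_n, z_n> - <w, z> = <w, z_n - z> + <w_n - w, z_n - z> + <w_n - w, z> *)
  have -> : L2inner P (ctconv (rho n) w) (ctconv (rho n) z) - L2inner P w z =
      L2inner P w (fun x => ctconv (rho n) z x - z x) +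
      L2inner P (fun x => ctconv (rho n) w x - w x) (fun x => ctconv (rho n) z x - z x) +
      conjc (L2inner P z (fun x => ctconv (rho n) w x - w x)).
    rewrite -(inner_conj lz ldw) (innerBr lw lzn lz) (innerBl ldz lwn lw).
    rewrite (innerBr lwn lzn lz) (innerBr lw lzn lz) (innerBl lz lwn lw); ring.
  have [a1 a2] := inner_small lw ldz e0 (H2 n h2).
  have [b1 b2] := inner_small ldw ldz e0 (H2 n h2).
  have [c1 c2] := inner_small lz ldw e0 (H1 n h1).
  (* Since [e <= 1], the mollification error has norm at most 1, so the term quadratic in the errors
     is again at most [e]. *)
  have sq : Num.sqrt (rinner P (fun x => ctconv (rho n) w x - w x) (fun x => ctconv (rho n) w x - w x)) <= 1.
    rewrite -[leRHS]sqrtr1 ler_wsqrtr //; apply: le_trans (ltW (H1 n h1)) _.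
    by rewrite expr_le1 // ltW.
  have sqe := ler_wpM2r (ltW e0) sq.
  rewrite !(ReD, ImD, ReJ, ImJ) !mulrDl; split.
    apply: le_trans (ler_normD _ _) _; apply: lerD => //.
    by apply: le_trans (ler_normD _ _) _; apply: lerD => //; exact: le_trans b1 sqe.
  apply: le_trans (ler_normD _ _) _; apply: lerD => //; last by rewrite normrN.
  by apply: le_trans (ler_normD _ _) _; apply: lerD => //; exact: le_trans b2 sqe.
have [C C0 HC] := dist _ _ nu nv; have [C' C'0 HC'] := dist _ _ nu' nv'.
apply/eqP; rewrite -subr_eq0; apply/eqP.
have key e : 0 < e -> `|complex.Re (L2inner P u v - L2inner P u' v')| <= (C + C') * e /\
    `|complex.Im (L2inner P u v - L2inner P u' v')| <= (C + C') * e.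
  move=> e_gt0; pose e' := Num.min e 1.
  have e'0 : 0 < e' by rewrite lt_min e_gt0 ltr01.
  have e'1 : e' <= 1 by rewrite ge_min lexx orbT.
  have e'e : e' <= e by rewrite ge_min lexx.
  have [N HN] := HC e' e'0 e'1; have [N' HN'] := HC' e' e'0 e'1.
  have [a1 a2] := HN (maxn N N') (leq_maxl _ _).
  have [b1 b2] := HN' (maxn N N') (leq_maxr _ _).
  move: a1 a2 b1 b2; rewrite h.
  move: (L2inner P (ctconv _ u') _) (L2inner P u v) (L2inner P u' v') => x y z a1 a2 b1 b2.
  have Ce : C * e' + C' * e' <= (C + C') * e.
    by rewrite -mulrDl ler_wpM2l // addr_ge0.
  have -> : y - z = - (x - y) + (x - z) by ring.
  move: (x - y) (x - z) a1 a2 b1 b2 => p q a1 a2 b1 b2; rewrite ReD ImD ReN ImN.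
  split; apply: le_trans Ce; apply: le_trans (ler_normD _ _) _; rewrite normrN; exact: lerD.
by apply: complexP; apply: (@le_eps_eq0 _ (C + C')) => e e0; case: (key e e0).
Qed.

Variables (D : set (T -> R[i])) (A : (T -> R[i]) -> (T -> R[i])).
Hypotheses (DL2 : D `<=` L2 mu) (AL2 : forall u : T -> R[i], D u -> L2 mu (A u)).

Definition test n s := fun t => rho n (s - t).

(** By [inner_ctensor] every slice of every mollification of [v] is orthogonal to [D] and hence has
    norm zero; so the mollifications have norm zero, and so does their limit [v]. *)
Lemma ctensor_total (Dtot : forall f : T -> R[i], L2 mu f -> (forall u : T -> R[i], D u -> L2inner mu f u = 0) ->
    rinner mu f f = 0) v :
  L2 P v -> (forall n s psi, D psi -> L2inner P v (ctensor (test n s) psi) = 0) ->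
  rinner P v v = 0.
Proof.
move=> lv hv; have [v' nv' vv'] := cnice_ae lv; have lv' := cnice_L2 nv'.
have hv' n s psi : D psi -> L2inner P v' (ctensor (test n s) psi) = 0.
  move=> Dpsi; rewrite -(hv n s psi Dpsi); apply/esym/inner_ae => //.
  exact: cnice_L2 (ctensor_cnice s (rho_bump n) (DL2 Dpsi)).
have L20 : cnice (fun=> 0).
  split; (split; [exact: l2_0 | move=> x; exact: l2_0]).
have z n : rinner P (ctconv (rho n) v') (ctconv (rho n) v') = 0.
  have lc := cnice_L2 (ctconv_cnice (rho_bump n) nv').
  have l0 := @L2_0 _ _ _ P; have m0 := @L2_0 _ _ _ mu.
  rewrite -Re_inner //.
  have -> : L2inner P (ctconv (rho n) v') (ctconv (rho n) v') =
      L2inner P (ctconv (rho n) v') (fun=> 0).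
    have sl s := cslice_L2 s (rho_bump n) nv'.
    apply: (inner_slices lc lc lc l0 sl sl sl (fun=> m0)) => s.
    have ls := cslice_L2 s (rho_bump n) nv'.
    have s0 : rinner mu (cslice (ctconv (rho n) v') s) (cslice (ctconv (rho n) v') s) = 0.
      apply: Dtot => // psi Dpsi.
      by rewrite -(inner_ctensor s (rho_bump n) (DL2 Dpsi) nv'); exact: hv'.
    by rewrite (inner_eq0_r ls ls s0) (inner_eq0_r ls m0) // rinner0.
  by rewrite (inner_eq0_r lc l0) // rinner0.
have lr n : L2 P (ctconv (rho n) v') by exact: cnice_L2 (ctconv_cnice (rho_bump n) nv').
have : L2inner P v' v' = L2inner P (fun=> 0) (fun=> 0).
  apply: (mollified_inner_eq nv' nv' L20 L20) => n.
  rewrite (inner_eq0_r (lr n) (lr n) (z n)).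
  have l0 := cnice_L2 (ctconv_cnice (rho_bump n) L20).
  apply/esym/inner_eq0_r => //.
  have c0 : ctconv (rho n) (fun=> 0) = fun=> 0.
    apply/funext => w; rewrite /ctconv /tconv /conv.
    have -> : ip leb (fun t => rho n (w.1 - t)) (sec (rpart (fun=> 0)) w.2) = 0.
      by rewrite /ip /Rintegral integral0_eq // => t _; rewrite /sec /rpart /= mulr0.
    by [].
  by rewrite c0 rinner0.
move=> h; rewrite -Re_inner // (inner_ae lv lv' lv vv') (inner_conj lv lv').
rewrite (inner_ae lv lv' lv' vv') h.
by rewrite -(inner_conj (@L2_0 _ _ _ P) (@L2_0 _ _ _ P)) Re_inner ?rinner0 //; exact: L2_0.
Qed.

Variables (V : T -> R) (B : R).
Hypotheses (mV : measurable_fun setT V) (VB : forall x, `|V x| <= B).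

(** The expanded form of [-(D_t + V)^2 + A] applied to [rho n (s - t) psi x]. The derivative of
    [rho n (s - t)] in [t] is [- rho1 n (s - t)], which determines the sign of the middle term. *)
Definition wave n s psi (z : R * T) : R[i] :=
  ctensor (fun t => rho2 n (s - t)) psi z
  - 2 * 'i * tmul V (ctensor (fun t => rho1 n (s - t)) psi) z
  - tmul V (tmul V (ctensor (fun t => rho n (s - t)) psi)) z
  + ctensor (fun t => rho n (s - t)) (A psi) z.

(** The adjoint relation of the wave operator, recorded on products of a time mollifier and an
    element of [D] only: these are the test functions that produce slices. *)
Definition wave_adjoint v h := [/\ L2 P v, L2 P h & forall n s psi, D psi ->
  L2inner P v (wave n s psi) = L2inner P h (ctensor (test n s) psi)].

(* [L] applied to the mollification in time of [v]. *)
Definition mollified_image n v h (z : R * T) : R[i] :=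
  ctconv (rho n) h z - ctconv (rho2 n) v z
  - 2 * 'i * tmul V (ctconv (rho1 n) v) z + tmul V (tmul V (ctconv (rho n) v)) z.

Lemma wave_L2 n s psi : D psi -> L2 P (wave n s psi).
Proof.
move=> Dpsi; have lpsi := DL2 Dpsi; have lA := AL2 Dpsi.
have [_ B1 _] := rho_d1 n; have [_ B2 _] := rho_d2 n.
have t0 := cnice_L2 (ctensor_cnice s (rho_bump n) lpsi).
have t1 := cnice_L2 (ctensor_cnice s B1 lpsi).
have t2 := cnice_L2 (ctensor_cnice s B2 lpsi).
have tA := cnice_L2 (ctensor_cnice s (rho_bump n) lA).
exact: L2D (L2B (L2B t2 (L2Z _ (L2_tmul mV VB t1))) (L2_tmul mV VB (L2_tmul mV VB t0))) tA.
Qed.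

Lemma mollified_image_L2 n v h : cnice v -> cnice h ->
  L2 P (mollified_image n v h) /\ forall s, L2 mu (cslice (mollified_image n v h) s).
Proof.
move=> nv nh; have [_ B1 _] := rho_d1 n; have [_ B2 _] := rho_d2 n.
have B0 := rho_bump n; split.
  have t0 := cnice_L2 (ctconv_cnice B0 nv).
  have t1 := cnice_L2 (ctconv_cnice B1 nv).
  have t2 := cnice_L2 (ctconv_cnice B2 nv).
  have th := cnice_L2 (ctconv_cnice B0 nh).
  exact: L2D (L2B (L2B th t2) (L2Z _ (L2_tmul mV VB t1))) (L2_tmul mV VB (L2_tmul mV VB t0)).
move=> s.
have t0 := cslice_L2 s B0 nv; have t1 := cslice_L2 s B1 nv.
have t2 := cslice_L2 s B2 nv; have th := cslice_L2 s B0 nh.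
exact: L2D (L2B (L2B th t2) (L2Z _ (L2M_real mV VB t1))) (L2M_real mV VB (L2M_real mV VB t0)).
Qed.

(** By [inner_ctensor] each term of the tested equation is a pairing on [T] at time [s]; the
    equation is solved for the term with [A psi]. Moving [2 i] into the first argument conjugates
    it, so the middle term keeps its sign in [mollified_image]. *)
Lemma wave_adjoint_slice n s v h : cnice v -> cnice h -> wave_adjoint v h ->
  graph_adjoint mu (op_graph D A)
    (cslice (ctconv (rho n) v) s, cslice (mollified_image n v h) s).
Proof.
move=> nv nh [lv lh adj].
have [_ B1 _] := rho_d1 n; have [_ B2 _] := rho_d2 n; have B0 := rho_bump n.
have [_ lK] := mollified_image_L2 n nv nh.
split => //=; first exact: (cslice_L2 s B0 nv).
move=> -[psi Apsi] [/= Dpsi ->]; have lpsi := DL2 Dpsi; have lA := AL2 Dpsi.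
have lVpsi := L2M_real mV VB lpsi; have lVVpsi := L2M_real mV VB lVpsi.
have t0 := cnice_L2 (ctensor_cnice s B0 lpsi).
have t1 := cnice_L2 (ctensor_cnice s B1 lpsi).
have t2 := cnice_L2 (ctensor_cnice s B2 lpsi).
have tA := cnice_L2 (ctensor_cnice s B0 lA).
have V1 := L2_tmul mV VB t1; have V0 := L2_tmul mV VB (L2_tmul mV VB t0).
have := adj n s psi Dpsi.
rewrite (innerDr lv (L2B (L2B t2 (L2Z _ V1)) V0) tA) (innerBr lv (L2B t2 (L2Z _ V1)) V0).
rewrite (innerBr lv t2 (L2Z _ V1)) (innerZr _ lv V1).
have eV1 : tmul V (ctensor (fun t => rho1 n (s - t)) psi) =
    ctensor (fun t => rho1 n (s - t)) (fun x => (V x)%:C * psi x).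
  by apply/funext => z; rewrite /tmul /ctensor mulrCA.
have eV0 : tmul V (tmul V (ctensor (fun t => rho n (s - t)) psi)) =
    ctensor (fun t => rho n (s - t)) (fun x => (V x)%:C * ((V x)%:C * psi x)).
  by apply/funext => z; rewrite /tmul /ctensor; ring.
rewrite eV1 eV0 (inner_ctensor s B2 lpsi nv) (inner_ctensor s B1 lVpsi nv).
rewrite (inner_ctensor s B0 lVVpsi nv) (inner_ctensor s B0 lA nv) (inner_ctensor s B0 lpsi nh).
have s0 := cslice_L2 s B0 nv; have s1 := cslice_L2 s B1 nv.
have s2 := cslice_L2 s B2 nv; have sh := cslice_L2 s B0 nh.
have sV1 := L2M_real mV VB s1; have sV0 := L2M_real mV VB (L2M_real mV VB s0).
have -> : cslice (mollified_image n v h) s = (fun x => (cslice (ctconv (rho n) h) s x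
    - cslice (ctconv (rho2 n) v) s x) - 2 * 'i * ((V x)%:C * cslice (ctconv (rho1 n) v) s x)
    + (V x)%:C * ((V x)%:C * cslice (ctconv (rho n) v) s x)) by [].
rewrite (innerDl lpsi (L2B (L2B sh s2) (L2Z _ sV1)) sV0) (innerBl lpsi (L2B sh s2) (L2Z _ sV1)).
rewrite (innerBl lpsi sh s2) (innerZl _ lpsi sV1).
rewrite !inner_mulr.
rewrite conjc_2i.
move: (L2inner mu _ _) (L2inner mu _ _) (L2inner mu _ _) (L2inner mu _ _) (L2inner mu _ _) => a0 a1 a2 a3 a4 E.
by rewrite -E; ring.
Qed.

Lemma wave_adjoint_symmetric (Lsym : forall v h b c : T -> R[i],
    graph_adjoint mu (op_graph D A) (v, h) -> graph_adjoint mu (op_graph D A) (b, c) ->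
    L2inner mu h b = L2inner mu v c) v h b c :
  wave_adjoint v h -> wave_adjoint b c -> L2inner P h b = L2inner P v c.
Proof.
(* Changing [v] and [h] on null sets preserves the weak relation, so representatives with good
   sections may be used. *)
have red v0 h0 : wave_adjoint v0 h0 -> exists v1 h1, [/\ cnice v1, cnice h1,
    {ae P, forall z, v0 z = v1 z}, {ae P, forall z, h0 z = h1 z} & wave_adjoint v1 h1].
  move=> [lv lh adj]; have [v1 nv av] := cnice_ae lv; have [h1 nh ah] := cnice_ae lh.
  have lv1 := cnice_L2 nv; have lh1 := cnice_L2 nh.
  exists v1, h1; split => //; split => // n s psi Dpsi.
  rewrite -(inner_ae lv lv1 (wave_L2 n s Dpsi) av) adj //; apply: inner_ae => //.
  exact: cnice_L2 (ctensor_cnice s (rho_bump n) (DL2 Dpsi)).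
move=> wv wb; have [lv lh _] := wv; have [lb lc _] := wb.
have [v1 [h1 [nv nh av ah wv1]]] := red _ _ wv.
have [b1 [c1 [nb nc ab ac wb1]]] := red _ _ wb.
have lv1 := cnice_L2 nv; have lh1 := cnice_L2 nh; have lb1 := cnice_L2 nb; have lc1 := cnice_L2 nc.
rewrite (inner_ae lh lh1 lb ah) (inner_conj lb lh1) (inner_ae lb lb1 lh1 ab) -(inner_conj lb1 lh1).
rewrite (inner_ae lv lv1 lc av) (inner_conj lc lv1) (inner_ae lc lc1 lv1 ac) -(inner_conj lc1 lv1).
apply: (mollified_inner_eq nh nb nv nc) => n.
have [_ B1 _] := rho_d1 n; have [_ B2 _] := rho_d2 n; have B0 := rho_bump n.
have [lK sK] := mollified_image_L2 n nv nh; have [lL sL] := mollified_image_L2 n nb nc.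
have W0 := cnice_L2 (ctconv_cnice B0 nv); have Y0 := cnice_L2 (ctconv_cnice B0 nb).
have W1 := cnice_L2 (ctconv_cnice B1 nv); have Y1 := cnice_L2 (ctconv_cnice B1 nb).
have W2 := cnice_L2 (ctconv_cnice B2 nv); have Y2 := cnice_L2 (ctconv_cnice B2 nb).
have Wh := cnice_L2 (ctconv_cnice B0 nh); have Yc := cnice_L2 (ctconv_cnice B0 nc).
have : L2inner P (mollified_image n v1 h1) (ctconv (rho n) b1) =
       L2inner P (ctconv (rho n) v1) (mollified_image n b1 c1).
  have sb s := cslice_L2 s B0 nb; have sv s := cslice_L2 s B0 nv.
  apply: (inner_slices lK Y0 W0 lL sK sb sv sL) => s.
  exact: Lsym (wave_adjoint_slice n s nv nh wv1) (wave_adjoint_slice n s nb nc wb1).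
have WV1 := L2_tmul mV VB W1; have YV1 := L2_tmul mV VB Y1.
have WV0 := L2_tmul mV VB (L2_tmul mV VB W0); have YV0 := L2_tmul mV VB (L2_tmul mV VB Y0).
rewrite (innerDl Y0 (L2B (L2B Wh W2) (L2Z _ WV1)) WV0) (innerBl Y0 (L2B Wh W2) (L2Z _ WV1)).
rewrite (innerBl Y0 Wh W2) (innerZl _ Y0 WV1).
rewrite (innerDr W0 (L2B (L2B Yc Y2) (L2Z _ YV1)) YV0) (innerBr W0 (L2B Yc Y2) (L2Z _ YV1)).
rewrite (innerBr W0 Yc Y2) (innerZr _ W0 YV1).
rewrite conjc_2i.
(* Two integrations by parts in time, whose signs cancel. *)
have p2 : L2inner P (ctconv (rho2 n) v1) (ctconv (rho n) b1) =
    L2inner P (ctconv (rho n) v1) (ctconv (rho2 n) b1).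
  rewrite (ctconv_by_parts (rho_d2 n) (rho_d1 n) nv nb).
  by rewrite (ctconv_by_parts (rho_d1 n) (rho_d2 n) nv nb) opprK.
(* A single integration by parts; its sign compensates the conjugation of [2 i]. Convolution in time
   commutes with [V] because [V] does not depend on time. *)
have p1 : L2inner P (tmul V (ctconv (rho1 n) v1)) (ctconv (rho n) b1) =
    - L2inner P (ctconv (rho n) v1) (tmul V (ctconv (rho1 n) b1)).
  rewrite -(ctconv_mul V B1 nv) (ctconv_by_parts (rho_d1 n) (rho_d1 n) (cnice_mul mV VB nv) nb).
  by rewrite (ctconv_mul V B0 nv) inner_tmul.
rewrite p2 p1 !inner_tmul.
move: (L2inner P _ _) (L2inner P _ _) (L2inner P _ _) (L2inner P _ _) (L2inner P _ _) => a0 a1 a2 a3 a4 E.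
apply/eqP; rewrite -subr_eq0; move/eqP: E; rewrite -subr_eq0.
have -> // : a4 - a3 - - (2 * 'i) * - a2 + a1 - (a0 - a3 - 2 * 'i * a2 + a1) = a4 - a0 by ring.
Qed.

End ComplexTimeConvolution.

(** * Magnetic Laplacians in one chart *)

Section OpenSupport.
Variables (R : realType) (n : nat).
Implicit Types (U K : set 'rV[R]_n) (g : 'rV[R]_n -> R).

Lemma closed_compact_rV K : compact K -> closed K.
Proof. by apply: compact_closed; exact: norm_hausdorff. Qed.

Lemma compact_in_cube K : compact K -> exists2 r : R, 0 < r & K `<=` cube 0 r.
Proof.
move=> cK; have [C hC] := @compact_bounded_fun _ R K (fun y : 'rV[R]_n => `|y|) cK (fun y _ => @norm_continuous _ _ y).
exists (`|C| + 1); first by rewrite ltr_wpDl.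
move=> y Ky j; rewrite mxE subr0; apply: le_lt_trans (coord_le_norm y j) _.
have := hC y Ky; rewrite normr_id => h; apply: le_lt_trans h _.
by apply: le_lt_trans (ler_norm C) _; rewrite ltrDl.
Qed.

(** [U] and the complement of the closed set [K] are open and cover the space; on the second the
    extension is zero. *)
Lemma Ck_on_extend k U K g : open U -> compact K -> K `<=` U -> Ck_on k U g ->
  (forall y, U y -> ~ K y -> g y = 0) -> Ck_on k setT (g \_ U).
Proof.
move=> oU cK KU Cg g0; apply: Ck_on_local => y _.
have [Uy|nUy] := pselect (U y).
  by exists U, g; split => // z Uz; rewrite patchE mem_set.
exists (~` K), (fun=> 0); split.
- exact: closed_openC (closed_compact_rV cK).
- by move=> /KU.
- exact: Ck_on_cst.
move=> z nKz; rewrite patchE; case: ifPn => //; rewrite inE => Uz; exact: g0.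
Qed.

Lemma open_support_integrable U K g : open U -> compact K -> K `<=` U ->
  {in U, continuous g} -> (forall y, U y -> ~ K y -> g y = 0) ->
  (@lam R n).-integrable U (EFin \o g).
Proof.
move=> oU cK KU cg g0; have mU : measurable (U : set (borel 'rV[R]_n)) by exact: open_borel.
have Cg : Ck_on 0 U g by split.
have [r r0 Kr] := compact_in_cube cK.
have cT : continuous (g \_ U).
  by move=> y; apply: (Ck_on_continuous (Ck_on_extend oU cK KU Cg g0)); rewrite inE.
have z y : ~ cube 0 r y -> (g \_ U) y = 0.
  move=> ny; rewrite patchE; case: ifPn => //; rewrite inE => Uy; apply: g0 => // Ky.
  exact: ny (Kr _ Ky).
have := continuous_support_integrable cT z.
move=> /(integrableS measurableT mU (@subsetT _ _)).
by apply: eq_integrable => // y; rewrite inE => Uy /=; rewrite patchE mem_set.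
Qed.

Lemma open_support_partial U K g a : open U -> compact K -> K `<=` U ->
  Ck_on 1 U g -> (forall y, U y -> ~ K y -> g y = 0) ->
  \int[@lam R n]_(y in U) 'D_(basis_rV R a) g y = 0.
Proof.
move=> oU cK KU Cg g0; have CT := Ck_on_extend oU cK KU Cg g0.
have [r r0 Kr] := compact_in_cube cK.
have z y : ~ cube 0 r y -> (g \_ U) y = 0.
  move=> ny; rewrite patchE; case: ifPn => //; rewrite inE => Uy; apply: g0 => // Ky.
  exact: ny (Kr _ Ky).
have E : \int[@lam R n]_y 'D_(basis_rV R a) (g \_ U) y = 0.
  apply: (Rintegral_partial r0 _ _ z).
    by move=> y; exact: (Ck_on_derivable CT).
  by move=> y; apply: (Ck_on_continuous (Ck_on_derive a CT)); rewrite inE.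
rewrite -[RHS]E [LHS]Rintegral_mkcond; congr Rintegral; apply/funext => y.
rewrite patchE; case: ifPn; rewrite ?inE ?notin_setE => Uy.
  apply: near_eq_derive; apply: filterS (open_nbhs_nbhs (conj oU Uy)) => x Ux.
  by rewrite patchE mem_set.
transitivity ('D_(basis_rV R a) (cst (0 : R)) y); first by rewrite derive_cst.
apply: near_eq_derive; have nK : nbhs y (~` K).
  by apply: open_nbhs_nbhs; split; [exact: closed_openC (closed_compact_rV cK) | move=> /KU].
apply: filterS nK => x nKx; rewrite patchE; case: ifPn => //; rewrite inE => Ux.
by rewrite g0.
Qed.

End OpenSupport.

Lemma conjc_sum (R : rcfType) (I : Type) (r : seq I) (P : pred I) (F : I -> R[i]) :
  conjc (\sum_(i <- r | P i) F i) = \sum_(i <- r | P i) conjc (F i).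
Proof. by apply: big_morph; [exact: conjcD | apply: complexP; rewrite /= ?oppr0]. Qed.

Section ComplexCalculus.
Variables (R : realType) (n : nat) (U : set 'rV[R]_n).
Hypothesis oU : open U.
Implicit Types (F G : 'rV[R]_n -> R[i]) (a b : 'I_n).

Definition CCk k F := Ck_on k U (fun y => complex.Re (F y)) /\ Ck_on k U (fun y => complex.Im (F y)).

Definition pd a F y : R[i] := 'D_(basis_rV R a) (fun z => complex.Re (F z)) y +i*
  'D_(basis_rV R a) (fun z => complex.Im (F z)) y.

Lemma CCk_le k l F : (k <= l)%N -> CCk l F -> CCk k F.
Proof. by move=> kl [h1 h2]; split; exact: Ck_on_le kl _. Qed.

Lemma CCk_ext k F G : (forall y, U y -> F y = G y) -> CCk k G -> CCk k F.
Proof. by move=> FG [h1 h2]; split; [move: h1|move: h2]; apply: Ck_on_ext => // y Uy; rewrite FG. Qed.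

Lemma CCk_conj k F : CCk k F -> CCk k (fun y => conjc (F y)).
Proof.
move=> [h1 h2]; split; first by apply: (Ck_on_ext oU _ h1) => y _; rewrite ReJ.
by apply: (Ck_on_ext oU _ (Ck_onN oU h2)) => y _; rewrite ImJ.
Qed.

Lemma CCkD k F G : CCk k F -> CCk k G -> CCk k (fun y => F y + G y).
Proof.
move=> [f1 f2] [g1 g2]; split.
  by apply: (Ck_on_ext oU _ (Ck_onD oU f1 g1)) => y _; rewrite ReD.
by apply: (Ck_on_ext oU _ (Ck_onD oU f2 g2)) => y _; rewrite ImD.
Qed.

Lemma CCkM k F G : CCk k F -> CCk k G -> CCk k (fun y => F y * G y).
Proof.
move=> [f1 f2] [g1 g2]; split.
  by apply: (Ck_on_ext oU _ (Ck_onB oU (Ck_onM oU f1 g1) (Ck_onM oU f2 g2))) => y _; rewrite ReM.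
by apply: (Ck_on_ext oU _ (Ck_onD oU (Ck_onM oU f1 g2) (Ck_onM oU f2 g1))) => y _; rewrite ImM.
Qed.

Lemma CCk_cst k (c : R[i]) : CCk k (fun=> c).
Proof. by split; exact: Ck_on_cst. Qed.

Lemma CCk_real k (f : 'rV[R]_n -> R) : Ck_on k U f -> CCk k (fun y => (f y)%:C).
Proof. by move=> Cf; split => //=; exact: Ck_on_cst. Qed.

Lemma CCk_sum k (I : Type) (r : seq I) (F : I -> 'rV[R]_n -> R[i]) :
  (forall i, CCk k (F i)) -> CCk k (fun y => \sum_(i <- r) F i y).
Proof.
move=> h; elim: r => [|i r IH].
  by apply: (CCk_ext _ (CCk_cst k 0)) => y _; rewrite big_nil.
by apply: (CCk_ext _ (CCkD (h i) IH)) => y _; rewrite big_cons.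
Qed.

Lemma CCk_pd k a F : CCk k.+1 F -> CCk k (pd a F).
Proof. by move=> [h1 h2]; split; exact: Ck_on_derive. Qed.

Lemma pd_local a F G y : U y -> (forall z, U z -> F z = G z) -> pd a F y = pd a G y.
Proof.
move=> Uy FG; have nU : nbhs y U by exact: open_nbhs_nbhs.
by congr (_ +i* _); apply: near_eq_derive; apply: filterS nU => z /FG ->.
Qed.

Lemma pd_conj a F y : CCk 1 F -> U y -> pd a (fun z => conjc (F z)) y = conjc (pd a F y).
Proof.
move=> [h1 h2] Uy; apply: complexP.
  by rewrite ReJ /=; congr ('D__ _ y); apply/funext => z; rewrite ReJ.
rewrite ImJ /=; have <- := deriveN (Ck_on_derivable (j := a) h2 Uy).
have -> : (fun z => complex.Im (conjc (F z))) = - (fun z => complex.Im (F z)) by apply/funext => z; exact: ImJ.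
by [].
Qed.

Lemma pdM a F G y : CCk 1 F -> CCk 1 G -> U y ->
  pd a (fun z => F z * G z) y = pd a F y * G y + F y * pd a G y.
Proof.
move=> [f1 f2] [g1 g2] Uy.
have dM (f g : 'rV[R]_n -> R) : Ck_on 1 U f -> Ck_on 1 U g ->
    is_derive y (basis_rV R a) (fun z => f z * g z)
      (f y * 'D_(basis_rV R a) g y + g y * 'D_(basis_rV R a) f y).
  move=> cf cg; have df := Ck_on_derivable (j := a) cf Uy; have dg := Ck_on_derivable (j := a) cg Uy.
  by apply: DeriveDef; [exact: (derivableM df dg) | exact: (deriveM df dg)].
have [d1 e1] := dM _ _ f1 g1; have [d2 e2] := dM _ _ f2 g2.
have [d3 e3] := dM _ _ f1 g2; have [d4 e4] := dM _ _ f2 g1.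
apply: complexP.
  rewrite ReD !ReM /=.
  have -> : (fun z => complex.Re (F z * G z)) = (fun z => complex.Re (F z) * complex.Re (G z))
      - (fun z => complex.Im (F z) * complex.Im (G z)).
    by apply/funext => z; rewrite ReM.
  by rewrite (deriveB d1 d2) e1 e2; ring.
rewrite ImD !ImM /=.
have -> : (fun z => complex.Im (F z * G z)) = (fun z => complex.Re (F z) * complex.Im (G z))
    + (fun z => complex.Im (F z) * complex.Re (G z)).
  by apply/funext => z; rewrite ImM.
by rewrite (deriveD d3 d4) e3 e4; ring.
Qed.

(** The magnetic momentum [D_a - A_a] for functions of the coordinates. *)
Definition cmom a (A : 'rV[R]_n -> R) F y : R[i] := - 'i * pd a F y - (A y)%:C * F y.

Lemma CCk_cmom k a A F : Ck_on k U A -> CCk k.+1 F -> CCk k (cmom a A F).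
Proof.
move=> CA CF; apply: (@CCk_ext _ _ (fun y => - 'i * pd a F y + (- (A y)%:C) * F y)).
  by move=> y _; rewrite /cmom [- _%:C * _]mulNr.
apply: CCkD; apply: CCkM.
- exact: CCk_cst.
- exact: CCk_pd.
- apply: (@CCk_ext _ _ (fun y => (- A y)%:C)) => [y _|].
    by apply: complexP => /=; rewrite ?oppr0.
  by apply: CCk_real; exact: Ck_onN.
exact: (CCk_le (leqnSn k)).
Qed.

Section Laplacian.
Variables (w : 'rV[R]_n -> R) (h : 'rV[R]_n -> 'M[R]_n) (A : 'I_n -> 'rV[R]_n -> R).

Definition flux F a y : R[i] := (w y)%:C * \sum_b (h y a b)%:C * cmom b (A b) F y.
(** The magnetic Laplacian without its prefactor [1/w], which cancels against the density [w] when
    it is integrated. *)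
Definition elap F y : R[i] := \sum_a cmom a (A a) (flux F a) y.
Definition eform F G y : R[i] :=
  \sum_a \sum_b (h y a b)%:C * (conjc (cmom a (A a) F y) * cmom b (A b) G y).

Hypotheses (Cw : Ck_on 1 U w) (Ch : forall a b, Ck_on 1 U (fun y => h y a b)).
Hypothesis CA : forall a, Ck_on 1 U (A a).

Lemma CCk_flux F a : CCk 2 F -> CCk 1 (flux F a).
Proof.
move=> CF; apply: (CCkM (CCk_real Cw)); apply: CCk_sum => b.
exact: (CCkM (CCk_real (Ch a b)) (CCk_cmom b (CA b) CF)).
Qed.

Lemma elap_continuous F : CCk 2 F -> CCk 0 (elap F).
Proof.
move=> CF; apply: CCk_sum => a; apply: CCk_cmom; last exact: CCk_flux.
exact: (Ck_on_le (leqnSn 0)).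
Qed.

Lemma eform_continuous F G : CCk 1 F -> CCk 1 G -> CCk 0 (eform F G).
Proof.
have CA0 a : Ck_on 0 U (A a) by apply: (Ck_on_le (leqnSn 0)).
move=> CF CG; apply: CCk_sum => a; apply: CCk_sum => b; apply: CCkM.
  by apply: CCk_real; apply: (Ck_on_le (leqnSn 0)).
by apply: CCkM; [apply: CCk_conj; exact: CCk_cmom | exact: CCk_cmom].
Qed.

Lemma eform_conj F G y : (h y)^T = h y -> eform F G y = conjc (eform G F y).
Proof.
move=> hT; rewrite /eform [in RHS]exchange_big conjc_sum; apply: eq_bigr => a _.
rewrite conjc_sum; apply: eq_bigr => b _.
rewrite -{1}hT mxE !conjcM conjcK [conjc _%:C](_ : _ = (h y b a)%:C); last by apply: complexP; rewrite /= ?oppr0.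
by rewrite [cmom b _ _ _ * _]mulrC.
Qed.

(** The Leibniz rule for [conjc F * flux]: the part of the momentum that involves [A] is real and
    moves to the other factor, and what remains is a divergence. *)
Lemma elap_by_parts F G y : CCk 1 F -> CCk 2 G -> U y ->
  conjc (F y) * elap G y = (w y)%:C * eform F G y +
    \sum_a - 'i * pd a (fun z => conjc (F z) * flux G a z) y.
Proof.
move=> CF CG Uy; rewrite /elap /eform !mulr_sumr -big_split /=; apply: eq_bigr => a _.
rewrite (pdM a (CCk_conj CF) (CCk_flux a CG) Uy) (pd_conj a CF Uy).
have -> : (w y)%:C * \sum_b (h y a b)%:C * (conjc (cmom a (A a) F y) * cmom b (A b) G y) =
    conjc (cmom a (A a) F y) * flux G a y.
  rewrite /flux mulrCA; congr (_ * _); rewrite mulr_sumr; apply: eq_bigr => b _.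
  by rewrite mulrCA.
rewrite [in LHS]/cmom [in RHS]/cmom conjcD conjcN !conjcM.
have -> : conjc (- 'i : R[i]) = - - 'i by apply: complexP; rewrite /= ?oppr0 ?opprK.
have -> : conjc (A a y)%:C = (A a y)%:C by apply: complexP; rewrite /= ?oppr0.
move: (conjc _) (pd _ _ _) (flux _ _ _) (conjc _) => c d f p; ring.
Qed.

End Laplacian.

End ComplexCalculus.

(** * Integration by parts and the weak form in coordinates *)

Section WeakForm.
Variables (R : realType) (n : nat) (U K : set 'rV[R]_n).
Hypotheses (oU : open U) (cK : compact K) (KU : K `<=` U).
Implicit Types (F G : 'rV[R]_n -> R[i]) (g : 'rV[R]_n -> R).
Local Notation lam := (@lam R n).

Definition cint F : R[i] := (\int[lam]_(y in U) complex.Re (F y)) +i* (\int[lam]_(y in U) complex.Im (F y)).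

Let mU : measurable (U : set (borel 'rV[R]_n)).
Proof. exact: open_borel. Qed.

Lemma Rintegral_sum0 (I : Type) (r : seq I) (g : I -> 'rV[R]_n -> R) :
  (forall i, lam.-integrable U (EFin \o g i)) -> (forall i, \int[lam]_(y in U) g i y = 0) ->
  lam.-integrable U (EFin \o (fun y => \sum_(i <- r) g i y)) /\
  \int[lam]_(y in U) (\sum_(i <- r) g i y) = 0.
Proof.
move=> ig g0; elim: r => [|i r [IH1 IH2]].
  have -> : (fun y => \sum_(i <- [::]) g i y) = fun=> 0 by apply/funext => y; rewrite big_nil.
  by split; [exact: integrable0 | rewrite /Rintegral integral0_eq].
have -> : (fun y => \sum_(i <- i :: r) g i y) = (fun y => g i y + \sum_(i <- r) g i y).
  by apply/funext => y; rewrite big_cons.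
split; last by rewrite RintegralD // g0 IH2 addr0.
by have := integrableD mU (ig i) IH1; apply: eq_integrable.
Qed.

Lemma zero_off_open F y : (forall y, U y -> ~ K y -> F y = 0) -> U y -> ~ K y ->
  \forall z \near y, F z = 0.
Proof.
move=> F0 Uy nKy; have nK : nbhs y (~` K).
  by apply: open_nbhs_nbhs; split => //; exact: closed_openC (closed_compact_rV cK).
by apply: filterS2 nK (open_nbhs_nbhs (conj oU Uy)) => z nKz Uz; exact: F0.
Qed.

Lemma pd_zero a F y : (\forall z \near y, F z = 0) -> pd a F y = 0.
Proof.
move=> F0; apply: complexP => /=.
  rewrite -(derive_cst (0 : R) y (basis_rV R a)); apply: near_eq_derive.
  by apply: filterS F0 => z ->.
rewrite -(derive_cst (0 : R) y (basis_rV R a)); apply: near_eq_derive.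
by apply: filterS F0 => z ->.
Qed.

Lemma cmom_zero a A F y : (\forall z \near y, F z = 0) -> cmom a A F y = 0.
Proof. by move=> F0; rewrite /cmom pd_zero // (nbhs_singleton F0) !mulr0 subr0. Qed.

Variables (w : 'rV[R]_n -> R) (h : 'rV[R]_n -> 'M[R]_n) (A : 'I_n -> 'rV[R]_n -> R).
Hypotheses (Cw : Ck_on 1 U w) (Ch : forall a b, Ck_on 1 U (fun y => h y a b)).
Hypothesis CA : forall a, Ck_on 1 U (A a).

Lemma CCk0_integrable F : CCk U 0 F -> (forall y, U y -> ~ K y -> F y = 0) ->
  lam.-integrable U (EFin \o (fun y => complex.Re (F y))) /\
  lam.-integrable U (EFin \o (fun y => complex.Im (F y))).
Proof.
move=> [c1 c2] F0; split.
  by apply: (open_support_integrable oU cK KU (Ck_on_continuous c1)) => y Uy nKy; rewrite F0.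
by apply: (open_support_integrable oU cK KU (Ck_on_continuous c2)) => y Uy nKy; rewrite F0.
Qed.

Lemma flux_zero F a y : (\forall z \near y, F z = 0) -> flux w h A F a y = 0.
Proof. by move=> F0; rewrite /flux big1 ?mulr0 // => b _; rewrite cmom_zero // mulr0. Qed.

Lemma elap_zero F y : (\forall z \near y, F z = 0) -> elap w h A F y = 0.
Proof.
move=> /near_join F0; rewrite /elap big1 // => a _; apply: cmom_zero.
by apply: filterS F0 => z Fz; exact: flux_zero.
Qed.

(** It is enough that one of [F], [G] vanish off [K]: the products [conjc F * flux] then vanish
    there too, and their divergences integrate to zero. *)
Lemma elap_weak F G : CCk U 2 F -> CCk U 2 G ->
  (forall y, U y -> ~ K y -> F y = 0) \/ (forall y, U y -> ~ K y -> G y = 0) ->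
  cint (fun y => conjc (F y) * elap w h A G y) = cint (fun y => (w y)%:C * eform h A F G y).
Proof.
move=> CF CG FG0; have CF1 : CCk U 1 F := CCk_le (isT : (1 <= 2)%N) CF.
pose N a y := conjc (F y) * flux w h A G a y.
have CN a : CCk U 1 (N a) by exact: (CCkM oU (CCk_conj oU CF1) (CCk_flux oU Cw Ch CA a CG)).
have N0 a y : U y -> ~ K y -> N a y = 0.
  move=> Uy nKy; case: FG0 => H; first by rewrite /N H // conjc0 mul0r.
  by rewrite /N flux_zero ?mulr0 //; exact: zero_off_open.
have E0 y : U y -> ~ K y -> (w y)%:C * eform h A F G y = 0.
  move=> Uy nKy; rewrite /eform big1 ?mulr0 // => a _; rewrite big1 // => b _.
  case: FG0 => H; last by rewrite [cmom b _ G y]cmom_zero ?mulr0 //; exact: zero_off_open.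
  by rewrite [cmom a _ F y]cmom_zero ?conjc0 ?mul0r ?mulr0 //; exact: zero_off_open.
have CE : CCk U 0 (fun y => (w y)%:C * eform h A F G y).
  have CG1 : CCk U 1 G := CCk_le (isT : (1 <= 2)%N) CG.
  exact: (CCkM oU (CCk_real (Ck_on_le (leqnSn 0) Cw)) (eform_continuous oU Ch CA CF1 CG1)).
have [i1 i2] := CCk0_integrable CE E0.
have iN a : lam.-integrable U (EFin \o (fun y => complex.Re (pd a (N a) y))) /\
    lam.-integrable U (EFin \o (fun y => complex.Im (pd a (N a) y))).
  apply: (CCk0_integrable (F := pd a (N a))); first exact: CCk_pd.
  by move=> y Uy nKy; apply: pd_zero; apply: (zero_off_open _ Uy nKy); exact: N0.
have zN a : \int[lam]_(y in U) complex.Re (pd a (N a) y) = 0 /\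
    \int[lam]_(y in U) complex.Im (pd a (N a) y) = 0.
  have [c1 c2] := CN a; split.
    by apply: (open_support_partial a oU cK KU c1) => y Uy nKy; rewrite N0.
  by apply: (open_support_partial a oU cK KU c2) => y Uy nKy; rewrite N0.
have [j1 z1] := Rintegral_sum0 (index_enum 'I_n) (fun a => (iN a).2) (fun a => (zN a).2).
have iNn a : lam.-integrable U (EFin \o (fun y => - complex.Re (pd a (N a) y))).
  by have := integrableN (iN a).1; apply: eq_integrable.
have zNn a : \int[lam]_(y in U) - complex.Re (pd a (N a) y) = 0.
  have -> : (fun y => - complex.Re (pd a (N a) y)) = (fun y => -1 * complex.Re (pd a (N a) y)).
    by apply/funext => y; rewrite mulN1r.
  by rewrite RintegralZl ?(zN a).1 ?mulr0 //; exact: (iN a).1.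
have [j2 z2] := Rintegral_sum0 (index_enum 'I_n) iNn zNn.
have Re_sum (I : Type) (r : seq I) (f : I -> R[i]) :
    complex.Re (\sum_(i <- r) f i) = \sum_(i <- r) complex.Re (f i).
  by apply: (big_morph (fun z : R[i] => complex.Re z)) => // x y; rewrite ReD.
have Im_sum (I : Type) (r : seq I) (f : I -> R[i]) :
    complex.Im (\sum_(i <- r) f i) = \sum_(i <- r) complex.Im (f i).
  by apply: (big_morph (fun z : R[i] => complex.Im z)) => // x y; rewrite ImD.
congr (_ +i* _).
  transitivity (\int[lam]_(y in U) (complex.Re ((w y)%:C * eform h A F G y) +
      \sum_a complex.Im (pd a (N a) y))); last by rewrite RintegralD // z1 addr0.
  apply: eq_Rintegral => y; rewrite inE => Uy.
  rewrite (elap_by_parts oU Cw Ch CA CF1 CG Uy) ReD Re_sum; congr (_ + _); apply: eq_bigr => a _.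
  by rewrite ReM /=; ring.
transitivity (\int[lam]_(y in U) (complex.Im ((w y)%:C * eform h A F G y) +
    \sum_a - complex.Re (pd a (N a) y))); last by rewrite RintegralD // z2 addr0.
apply: eq_Rintegral => y; rewrite inE => Uy.
rewrite (elap_by_parts oU Cw Ch CA CF1 CG Uy) ImD Im_sum; congr (_ + _); apply: eq_bigr => a _.
by rewrite ImM /=; ring.
Qed.

End WeakForm.

(** * Integrals on the manifold computed in one chart *)

Section ChartTransport.
Variables (R : realType) (X : ptopologicalType) (n : nat) (c : chart R X n).
Variables (w : X -> R) (mu : {measure set (borel X) -> \bar R}).
Hypotheses (ic : is_chart c) (hX : hausdorff_space X).
Local Notation U := (chart_cod c).
Local Notation dom := (chart_dom c).
Local Notation lam := (@lam R n).
Hypotheses (cw : {in U, continuous (w \o chart_inv c)}) (w0 : forall p, dom p -> 0 < w p).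
Hypothesis dens : forall B : set (borel X), measurable B -> B `<=` dom ->
  mu B = (\int[@lebesgue_rV R n : set (borel 'rV[R]_n) -> \bar R]_(y in chart_map c @` B)
    (w (chart_inv c y))%:E)%E.

Lemma chart_cod_inv y : U y -> dom (chart_inv c y) /\ chart_map c (chart_inv c y) = y.
Proof. by move=> [p dp <-]; case: ic => _ _ /(_ p (mem_set dp)) -> _ _. Qed.

Lemma chart_dom_map p : dom p -> U (chart_map c p) /\ chart_inv c (chart_map c p) = p.
Proof. by move=> dp; split; [exists p | case: ic => _ _ /(_ p (mem_set dp))]. Qed.

Lemma chart_image B : chart_map c @` (B `&` dom) = U `&` chart_inv c @^-1` B.
Proof.
apply/seteqP; split => [_ [p [Bp dp] <-]|y [Uy By]].
  by have [h1 h2] := chart_dom_map dp; split; rewrite //= h2.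
by have [h1 h2] := chart_cod_inv Uy; exists (chart_inv c y).
Qed.

Let oU : open U. Proof. by case: ic. Qed.
Let oD : open dom. Proof. by case: ic. Qed.

Lemma measurable_chart_inv : measurable_fun (U : set (borel 'rV[R]_n))
  (chart_inv c : borel 'rV[R]_n -> borel X).
Proof.
apply: (@measurability _ _ (borel 'rV[R]_n) (borel X) U (chart_inv c) (@open X)) => //.
move=> _ [W oW <-]; apply: open_borel.
suff : open (U `&` chart_inv c @^-1` W) by [].
rewrite openE => y [Uy Wy].
have [_ _ _ _ ci] := ic; have h := ci y (mem_set Uy) W; apply: filterI.
  exact: open_nbhs_nbhs.
by apply: h; exact: open_nbhs_nbhs.
Qed.

Let mD : measurable (dom : set (borel X)). Proof. exact: open_borel. Qed.
Let mU : measurable (U : set (borel 'rV[R]_n)). Proof. exact: open_borel. Qed.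
Let mw : measurable_fun (U : set (borel 'rV[R]_n)) (w \o chart_inv c : borel 'rV[R]_n -> R).
Proof. exact: open_continuous_borel. Qed.
Let wU y : U y -> 0 <= w (chart_inv c y). Proof. by move=> /chart_cod_inv[/w0/ltW]. Qed.

Lemma ge0_chart_integral (F : X -> \bar R) :
  measurable_fun [set: borel X] (F : borel X -> \bar R) -> (forall x, 0 <= F x)%E ->
  (\int[mu]_(x in dom) F x = \int[lam]_(y in U) (F (chart_inv c y) * (w (chart_inv c y))%:E))%E.
Proof.
move=> mF F0.
have d (B : set (borel X)) : measurable B -> mu (B `&` dom) =
    (\int[lam]_(y in U `&` chart_inv c @^-1` B) (w (chart_inv c y))%:E)%E.
  move=> mB; rewrite dens; [by rewrite chart_image | exact: measurableI | by move=> p []].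
exact: (ge0_transport mD mU measurable_chart_inv mw wU d mF F0).
Qed.

Lemma chart_integral (F : X -> R) : measurable_fun [set: borel X] (F : borel X -> R) ->
  \int[mu]_(x in dom) F x = \int[lam]_(y in U) (F (chart_inv c y) * w (chart_inv c y)).
Proof.
move=> mF; have mE : measurable_fun [set: borel X] (EFin \o F) by exact/measurable_EFinP.
rewrite /Rintegral integralE [in RHS]integralE; congr (fine (_ - _)%E).
  rewrite (ge0_chart_integral (measurable_funepos mE) (@funepos_ge0 _ _ _)).
  apply: eq_integral => y; rewrite inE => Uy.
  by rewrite !funeposE /= maxeMl ?mul0e ?EFinM // lee_fin wU.
rewrite (ge0_chart_integral (measurable_funeneg mE) (@funeneg_ge0 _ _ _)).
apply: eq_integral => y; rewrite inE => Uy.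
by rewrite !funenegE /= maxeMl ?lee_fin ?wU // mul0e -EFinM mulNr.
Qed.

Lemma chart_compact_image K : compact K -> K `<=` dom -> compact (chart_map c @` K).
Proof.
move=> cK Kd; apply: continuous_compact => //; apply: continuous_in_subspaceT => p; rewrite inE => Kp.
by case: ic => _ _ _ h _; apply: h; rewrite inE; exact: Kd.
Qed.

Section Support.
Variables (F : X -> R) (K : set X).
Hypotheses (cK : compact K) (Kd : K `<=` dom) (cF : {in U, continuous (F \o chart_inv c)}).
Hypothesis F0 : forall p, ~ K p -> F p = 0.

(** On the chart domain continuity is that of the coordinate expression; elsewhere the function is
    locally zero because the compact set [K] is closed in a Hausdorff space. *)
Lemma chart_support_continuous : continuous F.
Proof.
move=> p; have [dp|ndp] := pselect (dom p).
  have [Up ip] := chart_dom_map dp.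
  have E : {for p, continuous ((F \o chart_inv c) \o chart_map c)}.
    by apply: continuous_comp; [case: ic => _ _ _ h _; apply: h; rewrite inE | apply: cF; rewrite inE].
  move=> W nW; have := E W; rewrite /= ip => /(_ nW).
  apply: filterS2 (open_nbhs_nbhs (conj oD dp)) => q dq /=.
  by rewrite (chart_dom_map dq).2.
have nK : nbhs p (~` K).
  by apply: open_nbhs_nbhs; split; [exact: closed_openC (compact_closed hX cK) | move=> /Kd].
move=> W /nbhs_singleton; rewrite F0 => [W0|/Kd]; last by [].
by apply: filterS nK => q nKq; rewrite /= F0.
Qed.

Lemma chart_support_integral :
  \int[mu]_x F x = \int[lam]_(y in U) (F (chart_inv c y) * w (chart_inv c y)).
Proof.
have mF := continuous_borel_real chart_support_continuous.
by rewrite -chart_integral // -Rintegral_support // => p ndp; apply: F0 => /Kd.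
Qed.

Lemma chart_support_integrable : mu.-integrable setT (EFin \o F).
Proof.
have mF := continuous_borel_real chart_support_continuous.
have mE : measurable_fun [set: borel X] (EFin \o F) by exact/measurable_EFinP.
apply/integrableP; split => //.
have -> : (\int[mu]_x `|(EFin \o F) x| = \int[mu]_(x in dom) `|(EFin \o F) x|)%E.
  rewrite [RHS]integral_mkcond; apply: eq_integral => p _; rewrite patchE.
  by case: ifPn => //; rewrite notin_setE => ndp /=; rewrite F0 ?normr0 // => /Kd.
have mA : measurable_fun [set: borel X] (fun x : borel X => `|(EFin \o F) x|%E) by exact: measurableT_comp.
rewrite (ge0_chart_integral mA) //.
have cK' := chart_compact_image cK Kd.
have KU' : chart_map c @` K `<=` U by move=> _ [p Kp <-]; exists p => //; exact: Kd.
have cI : {in U, continuous (fun y => F (chart_inv c y) * w (chart_inv c y))}.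
  by move=> y Uy; exact: (cvgM (cF Uy) (cw Uy)).
have I0 y : U y -> ~ (chart_map c @` K) y -> F (chart_inv c y) * w (chart_inv c y) = 0.
  move=> Uy nKy; rewrite F0 ?mul0r // => Ky; apply: nKy.
  by exists (chart_inv c y) => //; exact: (chart_cod_inv Uy).2.
have /integrableP[_] := open_support_integrable oU cK' KU' cI I0.
apply: le_lt_trans; rewrite le_eqVlt; apply/orP; left; apply/eqP; apply: eq_integral => y; rewrite inE => Uy.
by rewrite /= normrM EFinM [`|w _|]ger0_norm // wU.
Qed.

End Support.

End ChartTransport.

(** * Bump functions on manifolds *)

Section Plateau.
Variables (R : realType) (n : nat) (y0 : 'rV[R]_n) (r : R).
Hypothesis r0 : 0 < r.

(** With [q] the product of one-dimensional bumps, [1 - (1 - 2 q)_+^3] is 1 where [q >= 1/2], in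
    particular near [y0], and 0 where [q = 0]. The exponents keep it of class C^2. *)
Definition plateau (y : 'rV[R]_n) : R :=
  1 - ppow 3 (1 - 2 * \prod_(a < n) ppow 3 (1 - ((y 0 a - y0 0 a) / r) ^+ 2)).

Lemma plateau_range y : 0 <= plateau y <= 1.
Proof.
have p0 : 0 <= \prod_(a < n) ppow 3 (1 - ((y 0 a - y0 0 a) / r) ^+ 2).
  by apply: prodr_ge0 => a _; exact: ppow_ge0.
rewrite /plateau subr_ge0 lerBlDr lerDl ppow_ge0 andbT /ppow expr_le1 //; last by rewrite le_max lexx.
by rewrite ge_max ler01 /=; lra.
Qed.

Lemma plateau_off (y : 'rV[R]_n) (a : 'I_n) : r <= `|y 0 a - y0 0 a| -> plateau y = 0.
Proof.
move=> ra; have q : ppow 3 (1 - ((y 0 a - y0 0 a) / r) ^+ 2) = 0.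
  apply: ppow_neg; rewrite subr_le0 -real_normK ?num_real // exprn_ege1 //.
  by rewrite normrM normfV (gtr0_norm r0) ler_pdivlMr // mul1r.
rewrite /plateau (bigD1 a) //= q mul0r mulr0 subr0.
by rewrite /ppow max_r // expr1n subrr.
Qed.

Lemma Ck_on_plateau m (U : set 'rV[R]_m) (T : 'rV[R]_m -> 'rV[R]_n) : open U ->
  (forall a, Ck_on 2 U (fun y => T y 0 a)) -> Ck_on 2 U (fun y => plateau (T y)).
Proof.
move=> oU CT; rewrite /plateau.
apply: (Ck_onB oU (Ck_on_cst 2 U 1)); apply: (Ck_on_ppow 0 oU).
apply: (Ck_onB oU (Ck_on_cst 2 U 1)); apply: (Ck_onZ 2 oU); apply: (Ck_on_prod _ oU) => a.
apply: (Ck_on_ppow 0 oU); apply: (Ck_onB oU (Ck_on_cst 2 U 1)).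
have H : Ck_on 2 U (fun y => (T y 0 a - y0 0 a) * r^-1).
  exact: (Ck_onM oU (Ck_onB oU (CT a) (Ck_on_cst 2 U _)) (Ck_on_cst 2 U _)).
by apply: (Ck_on_ext oU _ (Ck_onM oU H H)) => y _; rewrite expr2.
Qed.

Lemma plateau_near : \forall y \near y0, plateau y = 1.
Proof.
have C : Ck_on 0 setT (fun y => \prod_(a < n) ppow 3 (1 - ((y 0 a - y0 0 a) / r) ^+ 2)).
  apply: Ck_on_prod => [|a]; first exact: openT.
  apply: (Ck_on_le (isT : (0 <= 2)%N)); apply: Ck_on_ppow; first exact: openT.
  apply: (Ck_onB openT (Ck_on_cst 2 setT 1)).
  have H : Ck_on 2 setT (fun y : 'rV[R]_n => (y 0 a - y0 0 a) * r^-1).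
    apply: (Ck_onM openT); last exact: Ck_on_cst.
    by apply: (Ck_onB openT); [exact: Ck_on_coord | exact: Ck_on_cst].
  by apply: (Ck_on_ext openT _ (Ck_onM openT H H)) => y _; rewrite expr2.
have /cvgrPdist_lt /(_ 2^-1) := Ck_on_continuous C (mem_set (I : [set: 'rV[R]_n] y0)).
rewrite big1 => [|a _]; last by rewrite subrr mul0r expr0n /= subr0 ppow_pos // expr1n.
move=> /(_ ltac:(by [])); apply: filterS => y; rewrite /plateau.
move: (\prod_(_ < n) _) => q; rewrite ltr_norml => /andP[h1 h2].
by rewrite ppow_neg ?subr0 //; lra.
Qed.

End Plateau.

Section Manifold.
Variables (R : realType) (X : ptopologicalType) (n : nat) (M : atlas R X n).
Hypothesis hM : smooth_manifold M.
Implicit Types (i j : idx M) (p : X) (f : X -> R) (u : X -> R[i]).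
Local Notation dom i := (chart_dom (chart_of i)).
Local Notation cod i := (chart_cod (chart_of i)).
Local Notation cmap i := (chart_map (chart_of i)).
Local Notation cinv i := (chart_inv (chart_of i)).

Let hX : hausdorff_space X. Proof. by case: hM. Qed.
Let ic i : is_chart (chart_of i). Proof. by case: hM. Qed.
Let cov p : dom (chart_at M p) p. Proof. by case: hM. Qed.
Let oU i : open (cod i). Proof. by case: (ic i). Qed.
Let oD i : open (dom i). Proof. by case: (ic i). Qed.

Lemma chart_inv_open i (W : set X) : open W -> open (cod i `&` cinv i @^-1` W).
Proof.
move=> oW; rewrite openE => y [Uy Wy]; have [_ _ _ _ ci] := ic i.
have h := ci y (mem_set Uy) W; apply: filterI; first by apply: open_nbhs_nbhs.
by apply: h; exact: open_nbhs_nbhs.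
Qed.

Lemma overlap_image i j : cmap i @` overlap i j = cod i `&` cinv i @^-1` (dom j).
Proof. by rewrite -(chart_image (ic i)) /overlap setIC. Qed.

Lemma open_overlap i j : open (cmap i @` overlap i j).
Proof. by rewrite overlap_image; exact: chart_inv_open. Qed.

Lemma chart_continuous_at i f p : dom i p ->
  {for cmap i p, continuous (f \o cinv i)} -> {for p, continuous f}.
Proof.
move=> dp cf; have [Up ip] := chart_dom_map (ic i) dp.
have E : {for p, continuous ((f \o cinv i) \o cmap i)}.
  by apply: continuous_comp => //; case: (ic i) => _ _ _ h _; apply: h; rewrite inE.
move=> W nW; have := E W; rewrite /= ip => /(_ nW).
apply: filterS2 (open_nbhs_nbhs (conj (oD i) dp)) => q dq /=.
by rewrite (chart_dom_map (ic i) dq).2.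
Qed.

Lemma Ck_fun_continuous k f : Ck_fun M k f -> continuous f.
Proof.
move=> Cf p; have dp := cov p; apply: (chart_continuous_at dp).
apply: (Ck_on_continuous (Cf _)); rewrite inE.
exact: (chart_dom_map (ic _) dp).1.
Qed.

Lemma Ck_funM k f g : Ck_fun M k f -> Ck_fun M k g -> Ck_fun M k (fun x => f x * g x).
Proof. by move=> Cf Cg i; exact (Ck_onM (@oU i) (Cf i) (Cg i)). Qed.

Lemma Ck_funB k f g : Ck_fun M k f -> Ck_fun M k g -> Ck_fun M k (fun x => f x - g x).
Proof. by move=> Cf Cg i; exact (Ck_onB (@oU i) (Cf i) (Cg i)). Qed.

Lemma Ck_fun_cst k (a : R) : Ck_fun M k (fun=> a).
Proof. by move=> i; exact: Ck_on_cst. Qed.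

Lemma support_compact u (K : set X) : compact K -> (forall p, ~ K p -> u p = 0) ->
  compactly_supported u.
Proof.
move=> cK u0; apply: (subclosed_compact _ cK); first exact: closed_closure.
rewrite [X in _ `<=` X](_ : K = closure K); last by apply/closure_id; exact: compact_closed.
by apply: closure_subset => p /= /eqP up; apply: contrapT => /u0.
Qed.

Lemma off_support u p : ~ closure [set x | u x != 0] p -> u p = 0.
Proof.
by move=> np; apply: contrapT => /eqP up; apply: np; exact: subset_closure.
Qed.

Record is_bump i p (W : set X) (b : X -> R) (K : set X) : Prop := IsBump {
  bump_Ck : Ck_fun M 2 b;
  bump_compact : compact K;
  bump_dom : K `<=` dom i;
  bump_in : K `<=` W;
  bump_off : forall x, ~ K x -> b x = 0;
  bump_range : forall x, 0 <= b x <= 1;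
  bump_near : \forall x \near p, b x = 1 }.

(** A plateau on a small closed box in the chart image is pulled back to the manifold and extended
    by zero; the preimage of the box is the compact set [K]. *)
Lemma exists_bump i p (W : set X) : dom i p -> open W -> W p ->
  exists b K, is_bump i p W b K.
Proof.
move=> dp oW Wp; have [Up ip] := chart_dom_map (ic i) dp.
have nV : nbhs (cmap i p) (cod i `&` cinv i @^-1` W).
  by apply: open_nbhs_nbhs; split; [exact: chart_inv_open | split; rewrite //= ip].
have /nbhs_ballP[e /= e0 eV] := nV.
pose r := e / 2; have r0 : 0 < r by rewrite divr_gt0.
pose y0 := cmap i p.
pose Kb : set 'rV[R]_n := [set y | forall a, `|y 0 a - y0 0 a| <= r].
have cKb : compact Kb.
  have := @rV_compact R n (fun a => `[y0 0 a - r, y0 0 a + r]%classic) (fun=> @segment_compact R _ _).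
  congr compact; apply/seteqP; split => y h a; have := h a; rewrite /= in_itv /= ler_distl //.
have KbV : Kb `<=` cod i `&` cinv i @^-1` W.
  move=> y Ky; apply: eV; split => // k a; rewrite (ord1 k) /ball /= distrC.
  by apply: le_lt_trans (Ky a) _; rewrite /r ltr_pdivrMr // ltr_pMr // ltr1n.
pose K := cinv i @` Kb.
have cK : compact K.
  apply: continuous_compact => //; apply: continuous_in_subspaceT => y; rewrite inE => Ky.
  by case: (ic i) => _ _ _ _ h; apply: h; rewrite inE; case: (KbV y Ky).
have Kd : K `<=` dom i by move=> _ [y Ky <-]; have [Uy _] := KbV y Ky; exact: (chart_cod_inv (ic i) Uy).1.
pose b x := if pselect (dom i x) then plateau y0 r (cmap i x) else 0.
have bE x : dom i x -> b x = plateau y0 r (cmap i x) by rewrite /b; case: pselect.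
have b0 x : ~ K x -> b x = 0.
  move=> nKx; rewrite /b; case: pselect => // dx.
  have [a ha] : exists a, r <= `|cmap i x 0 a - y0 0 a|.
    apply: contrapT => no; apply: nKx; exists (cmap i x); last exact: (chart_dom_map (ic i) dx).2.
    by move=> a; rewrite leNgt; apply/negP => h; apply: no; exists a; exact: ltW.
  exact: (plateau_off r0 ha).
exists b, K; split => //.
(* Seen from another chart, the bump is a plateau composed with a smooth transition on the overlap,
   and zero off the closed set [K]; since [K] lies in the domain of chart [i], these two regions
   cover everything. *)
- move=> j; apply: Ck_on_local => y Uy; have [dx jy] := chart_cod_inv (ic j) Uy.
  have [dix|ndix] := pselect (dom i (cinv j y)).
    exists (cmap j @` overlap j i), (fun y => plateau y0 r (transition j i y)); split.
    + exact: open_overlap.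
    + by rewrite overlap_image; split.
    + apply: Ck_on_plateau => // [|a]; first exact: open_overlap.
      by case: hM => _ _ _ _ h; exact: h.
    by move=> z; rewrite overlap_image => -[_ /= dz]; rewrite bE.
  exists (cod j `&` cinv j @^-1` (~` K)), (fun=> 0); split.
  + by apply: chart_inv_open; exact: closed_openC (compact_closed hX cK).
  + by split => //= /Kd.
  + exact: Ck_on_cst.
  by move=> z [_ /= nKz]; rewrite b0.
- by move=> _ [y Ky <-]; have [_] := KbV y Ky.
- by move=> x; rewrite /b; case: pselect => dx; [exact: plateau_range | rewrite lexx ler01].
have := plateau_near y0 r; rewrite /y0 => pn.
have cm : {for p, continuous (cmap i)} by case: (ic i) => _ _ _ h _; apply: h; rewrite inE.
have := cm _ pn; apply: filterS2 (open_nbhs_nbhs (conj (oD i) dp)) => x dx /= h.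
by rewrite bE.
Qed.

(** Finitely many of the open sets where a bump is locally equal to 1 cover [C]; this serves in
    place of a partition of unity. *)
Lemma compact_bump_cover (C : set X) : compact C -> exists (b : X -> X -> R) (K : X -> set X) (s : seq X),
  (forall q, is_bump (chart_at M q) q setT (b q) (K q)) /\
  forall p, C p -> exists2 q, q \in s & b q p = 1.
Proof.
move=> cC.
have ex q : exists bK : (X -> R) * set X, is_bump (chart_at M q) q setT bK.1 bK.2.
  by have [b [K h]] := exists_bump (cov q) (@openT X) (I : setT q); exists (b, K).
have [bK hbK] := choice ex.
exists (fun q => (bK q).1), (fun q => (bK q).2).
pose W q := interior [set x | (bK q).1 x = 1].
have oW q : open (W q) by exact: open_interior.
move: cC; rewrite compact_cover => /(_ X setT W (fun q _ => oW q)) [|D _ hD].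
  by move=> q _; exists q => //; exact: (bump_near (hbK q)).
exists (finmap.enum_fset D); split => // p /hD[q /= qD /interior_subset h].
by exists q.
Qed.

Lemma Cck2_mul_real (b : X -> R) u : Ck_fun M 2 b -> Cck M 2 u -> Cck M 2 (fun x => (b x)%:C * u x).
Proof.
move=> Cb [[C1 C2] cu]; split; first split.
- have -> : (fun x => complex.Re ((b x)%:C * u x)) = (fun x => b x * complex.Re (u x)).
    by apply/funext => x; rewrite ReM /= mul0r subr0.
  exact: Ck_funM.
- have -> : (fun x => complex.Im ((b x)%:C * u x)) = (fun x => b x * complex.Im (u x)).
    by apply/funext => x; rewrite ImM /= mul0r addr0.
  exact: Ck_funM.
by apply: (support_compact cu) => p /off_support ->; rewrite mulr0.
Qed.

(** Localization to charts by peeling off one bump at a time: [f = b f + (1 - b) f], where the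
    second term vanishes wherever [b = 1] and so needs only the remaining bumps of the list. *)
Lemma Cck2_local (S : (X -> R[i]) -> Prop) : S (fun=> 0) ->
  (forall f g : X -> R[i], Cck M 2 f -> Cck M 2 g -> S f -> S g -> S (fun x => f x + g x)) ->
  (forall i K (f : X -> R[i]), compact K -> K `<=` dom i -> (forall p, ~ K p -> f p = 0) -> Cck M 2 f -> S f) ->
  forall f : X -> R[i], Cck M 2 f -> S f.
Proof.
move=> S0 SD Sl f Cf; have [b [K [s [hb hs]]]] := compact_bump_cover Cf.2.
have : forall p, f p != 0 -> exists2 q, q \in s & b q p = 1.
  by move=> p fp; apply: hs; exact: subset_closure.
elim: s f Cf {hs} => [|q s IH] f Cf hs.
  have -> // : f = fun=> 0.
  by apply/funext => p; apply: contrapT => /eqP /hs[].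
have Cbf := Cck2_mul_real (bump_Ck (hb q)) Cf.
have C1 : Ck_fun M 2 (fun x => 1 - b q x) by apply: Ck_funB; [exact: Ck_fun_cst | exact: bump_Ck (hb q)].
have C1f := Cck2_mul_real C1 Cf.
have -> : f = fun x => (b q x)%:C * f x + (1 - b q x)%:C * f x.
  by apply/funext => x; apply: complexP; rewrite !(ReD, ImD, ReM, ImM) /=; ring.
apply: SD => //.
  apply: (Sl (chart_at M q) (K q)) => //; [exact: bump_compact (hb q) | exact: bump_dom (hb q) | ].
  by move=> p /(bump_off (hb q)) ->; rewrite mul0r.
(* Where [(1 - b q) f] is nonzero, the bump equal to 1 at that point cannot be [b q], so it belongs
   to the tail of the list. *)
apply: IH => // p pn; have fp : f p != 0 by apply: contraNneq pn => ->; rewrite mulr0.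
have [q' q's bq'] := hs p fp; exists q' => //.
move: q's; rewrite inE => /predU1P[qq|//]; move: pn; rewrite -qq bq' subrr.
by rewrite [X in X * _](_ : _ = 0) ?mul0r ?eqxx.
Qed.

End Manifold.

(** * Densities on manifolds *)

Section Geometry.
Variables (R : realType) (X : ptopologicalType) (n : nat) (M : atlas R X n).
Hypothesis hM : smooth_manifold M.
Implicit Types (i j : idx M) (p : X) (f : X -> R) (u v : X -> R[i]).
Local Notation dom i := (chart_dom (chart_of i)).
Local Notation cod i := (chart_cod (chart_of i)).
Local Notation cmap i := (chart_map (chart_of i)).
Local Notation cinv i := (chart_inv (chart_of i)).
Local Notation lam := (@lam R n).

Let hX : hausdorff_space X. Proof. by case: hM. Qed.
Let ic i : is_chart (chart_of i). Proof. by case: hM. Qed.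
Let cov p : dom (chart_at M p) p. Proof. by case: hM. Qed.
Let oU i : open (cod i). Proof. by case: (ic i). Qed.
Let oD i : open (dom i). Proof. by case: (ic i). Qed.

Variables (w : idx M -> X -> R) (mu : {measure set (borel X) -> \bar R}).
Hypotheses (Cw : forall i, Ck_on 1 (cod i) (fun y => w i (cinv i y)))
  (w0 : forall i p, dom i p -> 0 < w i p) (hmu : is_density_measure w mu).

Let cw i : {in cod i, continuous (w i \o cinv i)}.
Proof. exact: Ck_on_continuous (Cw i). Qed.

Lemma chart_bump_integrable i p W b K : is_bump i p W b K -> mu.-integrable setT (EFin \o b).
Proof.
move=> B; have cb : {in cod i, continuous (b \o cinv i)} by exact: (Ck_on_continuous (bump_Ck B i)).
exact (chart_support_integrable (ic i) hX (@cw i) (@w0 i) (@hmu i) (bump_compact B)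
  (bump_dom B) cb (bump_off B)).
Qed.

Lemma compact_measurable (C : set X) : compact C -> measurable (C : set (borel X)).
Proof. by move=> cC; apply: closed_borel; exact: compact_closed. Qed.

(** The set where a bump equals 1 has measure at most the integral of the bump, which a single chart
    shows to be finite; finitely many such sets cover [C]. *)
Lemma compact_finite_measure (C : set X) : compact C -> (mu C < +oo)%E.
Proof.
move=> cC; have [b [K [s [hb hs]]]] := compact_bump_cover hM cC.
pose E q : set (borel X) := [set x | b q x = 1].
have cb q : continuous (b q) by exact: (Ck_fun_continuous hM (bump_Ck (hb q))).
have mE q : measurable (E q).
  have := continuous_borel_real (cb q) measurableT (measurable_set1 (1 : R)).
  by rewrite setTI; congr measurable; apply/seteqP; split => x.
have Efin q : (mu (E q) < +oo)%E.
  have /integrableP[_] := chart_bump_integrable (hb q); apply: le_lt_trans.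
  have -> : mu (E q) = (\int[mu]_x (\1_(E q) x)%:E)%E by rewrite integral_indic // setIT.
  apply: ge0_le_integral => //.
  - by apply/measurable_EFinP; exact: measurable_indic.
  - by apply: measurableT_comp => //; apply/measurable_EFinP; exact: continuous_borel_real.
  move=> x _ /=; rewrite lee_fin indicE; case: (boolP (x \in E q)) => [|_]; last exact: normr_ge0.
  by rewrite inE => ->; rewrite normr1.
have U : exists2 F : set (borel X), measurable F & (mu F < +oo)%E /\ forall q, q \in s -> E q `<=` F.
  elim: (s) => [|q s' [F mF [Ff EF]]]; first by exists set0 => //; rewrite measure0.
  exists (E q `|` F); first exact: measurableU.
  split; first by exact: (le_lt_trans (measureU2 mu (mE q) mF) (lte_add_pinfty (Efin q) Ff)).
  move=> q'; rewrite inE => /predU1P[->|/EF] h; first by move=> x; left.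
  by move=> x /h; right.
have [F mF [Ff EF]] := U; apply: le_lt_trans Ff; apply: le_measure; rewrite ?inE //.
  exact: compact_measurable.
by move=> p /hs[q qs bq]; exact: (EF q qs).
Qed.

Lemma compact_support_bounded f (K : set X) : compact K -> continuous f -> (forall p, ~ K p -> f p = 0) ->
  exists2 C, 0 <= C & forall p, `|f p| <= C.
Proof.
move=> cK cf f0; have [C hC] := compact_bounded_fun cK (fun p _ => cf p).
exists `|C| => // p; have [Kp|nKp] := pselect (K p); last by rewrite f0 // normr0.
exact: le_trans (hC p Kp) (ler_norm C).
Qed.

Lemma compact_support_integrable f (K : set X) : compact K -> continuous f ->
  (forall p, ~ K p -> f p = 0) -> mu.-integrable setT (EFin \o f).
Proof.
move=> cK cf f0; have [C C0 hC] := compact_support_bounded cK cf f0.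
apply: (@bounded_support_integrable _ (borel X) R mu K C) => //.
- exact: continuous_borel_real.
- exact: compact_measurable.
exact: compact_finite_measure.
Qed.

Lemma compact_support_l2 f (K : set X) : compact K -> continuous f ->
  (forall p, ~ K p -> f p = 0) -> l2 mu f.
Proof.
move=> cK cf f0; have c2 : continuous (fun x => f x * f x) by move=> x; exact: (cvgM (cf x) (cf x)).
split; first exact: continuous_borel_real.
have z p : ~ K p -> f p * f p = 0 by move=> /f0 ->; rewrite mulr0.
have /integrableP[_] := compact_support_integrable cK c2 z.
apply: le_lt_trans; rewrite le_eqVlt; apply/orP; left; apply/eqP; apply: eq_integral => p _ /=.
by rewrite -expr2 ger0_norm // sqr_ge0.
Qed.

(** If [f p > 0], then [f w > e / 2] near [p], and a bump supported there gives an integral of at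
    least [e / 2] times the volume of a cube on which the bump is 1. Applied to a difference with
    both signs, it yields equality. *)
Lemma du_bois_reymond i p (W : set X) f : dom i p -> open W -> W p -> W `<=` dom i ->
  (forall x, W x -> {for x, continuous f}) ->
  (forall b K, is_bump i p W b K -> \int[mu]_x (b x * f x) = 0) -> f p <= 0.
Proof.
move=> dp oW Wp Wd cf Hb; rewrite leNgt; apply/negP => fp.
have [Up ip] := chart_dom_map (ic i) dp.
pose e := f p * w i p; have e0 : 0 < e by rewrite mulr_gt0 // w0.
have cwp x : dom i x -> {for x, continuous (w i)}.
  move=> dx; apply: (chart_continuous_at hM dx); apply: cw; rewrite inE.
  exact: (chart_dom_map (ic i) dx).1.
have near_big : \forall x \near p, W x /\ e / 2 < f x * w i x.
  apply: filterI; first exact: open_nbhs_nbhs.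
  have cfw : {for p, continuous (fun x => f x * w i x)} by exact: (cvgM (cf p Wp) (cwp p dp)).
  have /cvgrPdist_lt /(_ (e / 2) ltac:(by rewrite divr_gt0)) := cfw.
  by apply: filterS => x; rewrite -/e ltr_norml => /andP[_]; move: (f x * w i x) => q; lra.
pose W' := [set x | W x /\ e / 2 < f x * w i x]^°.
have W'W x : W' x -> W x /\ e / 2 < f x * w i x by move=> /interior_subset.
have [b [K B]] := exists_bump hM dp (open_interior _ : open W') near_big.
have BW : is_bump i p W b K by case: B => *; split => // x Kx; apply: (W'W x _).1; auto.
have := Hb b K BW.
have cbf x : K x -> {for x, continuous f} by move=> /(bump_in BW); exact: cf.
have cb := Ck_fun_continuous hM (bump_Ck B).
have cF : {in cod i, continuous ((fun x => b x * f x) \o cinv i)}.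
  move=> y; rewrite inE => Uy; have [dy ky] := chart_cod_inv (ic i) Uy.
  have ci : {for y, continuous (cinv i)} by case: (ic i) => _ _ _ _ h; apply: h; rewrite inE.
  have [Wy|nWy] := pselect (W (cinv i y)).
    apply: (@continuous_comp _ _ _ (cinv i) (fun x => b x * f x)) => //.
    exact: (cvgM (cb _) (cf _ Wy)).
  have nK : nbhs (cinv i y) (~` K).
    apply: open_nbhs_nbhs; split; first exact: closed_openC (compact_closed hX (bump_compact B)).
    by move=> /(bump_in BW).
  have n0 : \forall z \near y, b (cinv i z) * f (cinv i z) = 0.
    have nK' : nbhs y (cinv i @^-1` (~` K)) by exact: ci.
    by apply: (filterS _ nK') => z nKz; rewrite (bump_off B) // mul0r.
  move=> V /nbhs_singleton; rewrite /= (nbhs_singleton n0) => V0.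
  by apply: filterS n0 => z /= ->.
have F0 x : ~ K x -> b x * f x = 0 by move=> /(bump_off B) ->; rewrite mul0r.
rewrite (chart_support_integral (ic i) hX (@cw i) (@w0 i) (@hmu i) (bump_compact B) (bump_dom B) cF F0).
have nb : \forall y \near cmap i p, cod i y /\ b (cinv i y) = 1.
  apply: filterI; first by apply: open_nbhs_nbhs.
  have ci : {for cmap i p, continuous (cinv i)} by case: (ic i) => _ _ _ _ h; apply: h; rewrite inE.
  by apply: (ci [set x | b x = 1]); rewrite /= ip; exact: (bump_near B).
have /nbhs_ballP[r /= r0 hr] := nb.
have mC : measurable (cube (cmap i p) r : set (borel 'rV[R]_n)).
  by apply: open_borel; rewrite cube_ball //; exact: ball_open.
have CU : cube (cmap i p) r `<=` cod i by rewrite cube_ball // => y /hr[].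
have mU : measurable (cod i : set (borel 'rV[R]_n)) by apply: open_borel.
have iC : lam.-integrable (cod i) (EFin \o (fun y => e / 2 * \1_(cube (cmap i p) r) y)).
  have := @bounded_support_integrable _ (borel 'rV[R]_n) R lam (cube (cmap i p) r) (e / 2)
     (fun y => e / 2 * \1_(cube (cmap i p) r) y).
  move=> H; apply: (integrableS measurableT mU (@subsetT _ _)); apply: H => //.
  - by apply: measurable_funM => //; exact: measurable_indic.
  - by apply: lam_cube_fin; exact: ltW.
  - move=> y; rewrite normrM (ger0_norm (_ : 0 <= e / 2)) ?divr_ge0 ?(ltW e0) // ler_piMr ?divr_ge0 ?(ltW e0) //.
    by rewrite indicE; case: (_ \in _); rewrite ?normr1 ?normr0.
  by move=> y ny; rewrite indicE memNset // mulr0.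
have cI : {in cod i, continuous (fun y => (b (cinv i y) * f (cinv i y)) * w i (cinv i y))}.
  by move=> y Uy; exact: (cvgM (cF y Uy) (cw Uy)).
have K0 y : cod i y -> ~ (cmap i @` K) y -> (b (cinv i y) * f (cinv i y)) * w i (cinv i y) = 0.
  move=> Uy nKy; rewrite F0 ?mul0r // => Ky; apply: nKy.
  by exists (cinv i y) => //; exact: (chart_cod_inv (ic i) Uy).2.
have KU : cmap i @` K `<=` cod i by move=> _ [x Kx <-]; exists x => //; exact: (bump_dom B).
have iI := open_support_integrable (@oU i) (chart_compact_image (ic i) (bump_compact B) (bump_dom B)) KU cI K0.
have : \int[lam]_(y in cod i) (e / 2 * \1_(cube (cmap i p) r) y) <=
    \int[lam]_(y in cod i) ((b (cinv i y) * f (cinv i y)) * w i (cinv i y)).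
  apply: le_Rintegral => // y Uy; have [dy ky] := chart_cod_inv (ic i) Uy.
  rewrite indicE; case: (boolP (y \in _)) => [|_].
    rewrite inE cube_ball // => /hr[_ by1]; rewrite by1 mul1r mulr1.
    have Ky : K (cinv i y) by apply: contrapT => /(bump_off B); rewrite by1; apply/eqP; exact: oner_neq0.
    by apply: ltW; exact: (W'W _ (bump_in B Ky)).2.
  rewrite mulr0; have [Ky|nKy] := pselect (K (cinv i y)); last by rewrite F0 // mul0r.
  rewrite -mulrA mulr_ge0 //; first by case/andP: (bump_range B (cinv i y)).
  by apply: ltW; apply: lt_trans (W'W _ (bump_in B Ky)).2; rewrite divr_gt0.
have e2 : 0 < e / 2 by rewrite divr_gt0.
have -> : \int[lam]_(y in cod i) (e / 2 * \1_(cube (cmap i p) r) y) = e / 2 * (2 * r) ^+ n.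
  rewrite /Rintegral; under eq_integral do rewrite EFinM.
  rewrite ge0_integralZl //; last 2 first.
  - by apply/measurable_EFinP; exact: measurable_indic.
  - by rewrite lee_fin ltW.
  have -> : (\int[lam]_(y in cod i) (\1_(cube (cmap i p) r) y)%:E)%E = ((2 * r) ^+ n)%:E.
    rewrite integral_indic // (setIidl CU); apply: lebesgue_cube; exact: ltW.
  by [].
move=> le1 eq0; have : 0 < e / 2 * (2 * r) ^+ n by rewrite mulr_gt0 // exprn_gt0 // mulr_gt0.
by rewrite ltNge; move: le1; rewrite eq0 => ->.
Qed.

End Geometry.

(** * The magnetic Laplacian on a manifold *)

Section Geometry.
Variables (R : realType) (X : ptopologicalType) (n : nat) (M : atlas R X n).
Hypothesis hM : smooth_manifold M.
Implicit Types (i j : idx M) (p : X) (f : X -> R) (u v : X -> R[i]).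
Local Notation dom i := (chart_dom (chart_of i)).
Local Notation cod i := (chart_cod (chart_of i)).
Local Notation cmap i := (chart_map (chart_of i)).
Local Notation cinv i := (chart_inv (chart_of i)).
Local Notation lam := (@lam R n).

Let hX : hausdorff_space X. Proof. by case: hM. Qed.
Let ic i : is_chart (chart_of i). Proof. by case: hM. Qed.
Let cov p : dom (chart_at M p) p. Proof. by case: hM. Qed.
Let oU i : open (cod i). Proof. by case: (ic i). Qed.
Let oD i : open (dom i). Proof. by case: (ic i). Qed.

Variables (w : idx M -> X -> R) (mu : {measure set (borel X) -> \bar R}).
Hypotheses (Cw : forall i, Ck_on 1 (cod i) (fun y => w i (cinv i y)))
  (w0 : forall i p, dom i p -> 0 < w i p) (hmu : is_density_measure w mu).

Let cw i : {in cod i, continuous (w i \o cinv i)}.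
Proof. exact: Ck_on_continuous (Cw i). Qed.

Variables (h : idx M -> X -> 'M[R]_n) (A : idx M -> X -> 'rV[R]_n).
Hypotheses (Ch : forall i a b, Ck_on 1 (cod i) (fun y => h i (cinv i y) a b))
  (hT : forall i p, dom i p -> (h i p)^T = h i p)
  (hJ : forall i j p, overlap i j p -> let J := jacobian (transition i j) (cmap i p) in
     h j p = J^T *m h i p *m J)
  (hA : one_form 1 A).

Definition lap i u p := magnetic_laplacian (chart_of i) id (w i) (h i) (fun a x => A i x 0 a) u p.

Local Notation Wi i := (fun y => w i (cinv i y)).
Local Notation Hi i := (fun y => h i (cinv i y)).
Local Notation Ai i := (fun a y => A i (cinv i y) 0 a).
Local Notation pull i u := (fun y => u (cinv i y)).

Let CA i a : Ck_on 1 (cod i) (Ai i a). Proof. by case: hA. Qed.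

Lemma Ck_cfun_pull k u i : Ck_cfun M k u -> CCk (cod i) k (pull i u).
Proof. by move=> [h1 h2]; split; [exact: h1 | exact: h2]. Qed.

Lemma magnetic_mom_chart i a f u p : dom i p ->
  magnetic_mom (chart_of i) a f u p = cmom a (pull i f) (pull i u) (cmap i p).
Proof.
by move=> dp; have [_ ip] := chart_dom_map (ic i) dp; rewrite /magnetic_mom /cmom ip.
Qed.

Lemma lap_elap i u p : dom i p -> (w i p)%:C * lap i u p = elap (Wi i) (Hi i) (Ai i) (pull i u) (cmap i p).
Proof.
move=> dp; have [Up ip] := chart_dom_map (ic i) dp.
rewrite /lap /magnetic_laplacian mulrA -rmorphM /= divff ?gt_eqF ?w0 // mul1r.
rewrite /elap; apply: eq_bigr => a _; rewrite (magnetic_mom_chart _ _ _ dp).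
set F := fun y => (w i (cinv i y))%:C * _.
have E y : cod i y -> F y = flux (Wi i) (Hi i) (Ai i) (pull i u) a y.
  move=> Uy; have [dy ky] := chart_cod_inv (ic i) Uy; rewrite /F /flux; congr (_ * _).
  by apply: eq_bigr => b _; rewrite (magnetic_mom_chart _ _ _ dy) ky.
by rewrite /cmom (pd_local (@oU i) a Up E) (E _ Up).
Qed.

Lemma lap_chart i u p : dom i p ->
  lap i u p = ((w i p)^-1)%:C * elap (Wi i) (Hi i) (Ai i) (pull i u) (cmap i p).
Proof. by move=> dp; rewrite -lap_elap // mulrA -rmorphM /= mulVf ?gt_eqF ?w0 // mul1r. Qed.

Lemma CCk_lap i u : Ck_cfun M 2 u -> CCk (cod i) 0 (pull i (lap i u)).
Proof.
move=> Cu; have U0 y : cod i y -> w i (cinv i y) != 0.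
  by move=> Uy; rewrite gt_eqF // w0 //; exact: (chart_cod_inv (ic i) Uy).1.
apply: (@CCk_ext _ _ _ (@oU i) _ _ (fun y => ((w i (cinv i y))^-1)%:C * elap (Wi i) (Hi i) (Ai i) (pull i u) y)).
  by move=> y Uy; have [dy ky] := chart_cod_inv (ic i) Uy; rewrite (lap_chart u dy) ky.
apply: (CCkM (@oU i)).
  apply: CCk_real; apply: (Ck_on_inv (@oU i) U0); exact: (Ck_on_le (leqnSn 0) (Cw i)).
exact: (elap_continuous (@oU i) (Cw i) (@Ch i) (@CA i) (Ck_cfun_pull i Cu)).
Qed.

Definition cform i (phi u : X -> R[i]) x := eform (Hi i) (Ai i) (pull i phi) (pull i u) (cmap i x).

Lemma near_chart i (P : set X) p : dom i p -> open P -> P p -> \forall y \near cmap i p, P (cinv i y).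
Proof.
move=> dp oP Pp; have [Up ip] := chart_dom_map (ic i) dp.
have ci : {for cmap i p, continuous (cinv i)} by case: (ic i) => _ _ _ _ H; apply: H; rewrite inE.
by apply: (ci P); rewrite ip; exact: open_nbhs_nbhs.
Qed.

Lemma near_chart_zero i (K : set X) u p : dom i p -> compact K -> (forall x, ~ K x -> u x = 0) -> ~ K p ->
  \forall y \near cmap i p, u (cinv i y) = 0.
Proof.
move=> dp cK u0 nKp; have H := near_chart dp (closed_openC (compact_closed hX cK)) nKp.
by apply: (filterS _ H) => y /u0.
Qed.

Lemma cform_zero i (K : set X) phi u p : dom i p -> compact K -> ~ K p ->
  (forall x, ~ K x -> phi x = 0) \/ (forall x, ~ K x -> u x = 0) -> cform i phi u p = 0.
Proof.
move=> dp cK nKp z; rewrite /cform /eform big1 // => a _; rewrite big1 // => b _.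
case: z => z; have N := near_chart_zero dp cK z nKp.
  by rewrite (cmom_zero _ _ N) rmorph0 mul0r mulr0.
by rewrite [cmom b _ _ _](cmom_zero _ _ N) !mulr0.
Qed.

Lemma lap_zero i (K : set X) u p : dom i p -> compact K -> (forall x, ~ K x -> u x = 0) -> ~ K p -> lap i u p = 0.
Proof.
move=> dp cK u0 nKp; rewrite lap_chart // elap_zero ?mulr0 //.
exact: near_chart_zero dp cK u0 nKp.
Qed.

(** Outside its chart domain [cform i] has no geometric meaning. Cutting it off at [K] discards
    those values and changes nothing inside the chart if one of the two functions is supported in
    [K]. *)
Definition restricted (K : set X) (F : X -> R[i]) x : R[i] := if x \in K then F x else 0.

Lemma chart_complex_integral i (K : set X) (F : X -> R[i]) : compact K -> K `<=` dom i ->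
  CCk (cod i) 0 (pull i F) -> (forall p, ~ K p -> F p = 0) ->
  complex_integral mu F = cint (cod i) (fun y => (w i (cinv i y))%:C * F (cinv i y)).
Proof.
move=> cK Kd [c1 c2] F0; rewrite /complex_integral /cint; congr (_ +i* _).
  rewrite (chart_support_integral (ic i) hX (@cw i) (@w0 i) (@hmu i) cK Kd (Ck_on_continuous c1)).
    by apply: eq_Rintegral => y _; rewrite ReM /= mul0r subr0 mulrC.
  by move=> p /F0 ->.
rewrite (chart_support_integral (ic i) hX (@cw i) (@w0 i) (@hmu i) cK Kd (Ck_on_continuous c2)).
  by apply: eq_Rintegral => y _; rewrite ImM /= mul0r addr0 mulrC.
by move=> p /F0 ->.
Qed.

Lemma cint_eq (U : set 'rV[R]_n) (F G : 'rV[R]_n -> R[i]) : (forall y, U y -> F y = G y) -> cint U F = cint U G.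
Proof.
by move=> FG; congr (_ +i* _); apply: eq_Rintegral => y; rewrite inE => /FG ->.
Qed.

Lemma restricted_cform i (K : set X) phi u : compact K -> K `<=` dom i ->
  Ck_cfun M 2 phi -> Ck_cfun M 2 u ->
  (forall x, ~ K x -> phi x = 0) \/ (forall x, ~ K x -> u x = 0) ->
  (forall y, cod i y -> restricted K (cform i phi u) (cinv i y) = eform (Hi i) (Ai i) (pull i phi) (pull i u) y) /\
  CCk (cod i) 0 (pull i (restricted K (cform i phi u))).
Proof.
move=> cK Kd Cphi Cu z.
have C1 v : Ck_cfun M 2 v -> CCk (cod i) 1 (pull i v).
  by move=> Cv; apply: (CCk_le (isT : (1 <= 2)%N)); exact: Ck_cfun_pull.
have E y : cod i y -> restricted K (cform i phi u) (cinv i y) = eform (Hi i) (Ai i) (pull i phi) (pull i u) y.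
  move=> Uy; have [dy ky] := chart_cod_inv (ic i) Uy.
  rewrite -[in RHS]ky -/(cform i phi u (cinv i y)) /restricted; case: (boolP (_ \in _)) => // /negP.
  by rewrite inE => nK; rewrite (cform_zero dy cK nK z).
split=> //; apply: (@CCk_ext _ _ _ (@oU i) _ _ _ E).
exact: (eform_continuous (@oU i) (@Ch i) (@CA i) (C1 _ Cphi) (C1 _ Cu)).
Qed.

(** [L] is any function that agrees with [lap i] on the domain, so that both the expression of a
    fixed chart and the one with the chart selected at each point can be inserted. *)
Lemma weak_chart i (K : set X) phi u (L : X -> R[i]) : compact K -> K `<=` dom i ->
  Ck_cfun M 2 phi -> Ck_cfun M 2 u ->
  (forall x, ~ K x -> phi x = 0) \/ (forall x, ~ K x -> u x = 0) ->
  (forall x, dom i x -> L x = lap i u x) -> (forall x, ~ K x -> conjc (phi x) * L x = 0) ->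
  complex_integral mu (fun x => conjc (phi x) * L x) = complex_integral mu (restricted K (cform i phi u)).
Proof.
move=> cK Kd Cphi Cu z HL L0.
have [E CE] := restricted_cform cK Kd Cphi Cu z.
rewrite (chart_complex_integral cK Kd _ L0); last first.
  apply: (CCkM (@oU i)).
    by apply: (CCk_conj (@oU i)); apply: (CCk_le (isT : (0 <= 2)%N)); exact: Ck_cfun_pull.
  apply: (@CCk_ext _ _ _ (@oU i) _ _ (pull i (lap i u))); last exact: CCk_lap.
  by move=> y Uy; apply: HL; exact: (chart_cod_inv (ic i) Uy).1.
rewrite (chart_complex_integral cK Kd CE); last by move=> p nK; rewrite /restricted memNset.
rewrite [RHS](cint_eq (G := fun y => (w i (cinv i y))%:C * eform (Hi i) (Ai i) (pull i phi) (pull i u) y)); last first.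
  by move=> y Uy; rewrite E.
rewrite -(elap_weak (@oU i) (chart_compact_image (ic i) cK Kd) _ (Cw i) (@Ch i) (@CA i)
  (Ck_cfun_pull i Cphi) (Ck_cfun_pull i Cu)).
- apply: cint_eq => y Uy; have [dy ky] := chart_cod_inv (ic i) Uy.
  rewrite (HL _ dy) mulrCA; congr (_ * _); rewrite (lap_elap u dy) ky; reflexivity.
- by move=> _ [x Kx <-]; exists x => //; exact: Kd.
have nK y : cod i y -> ~ (cmap i @` K) y -> ~ K (cinv i y).
  by move=> Uy nKy Ky; apply: nKy; exists (cinv i y) => //; exact: (chart_cod_inv (ic i) Uy).2.
by case: z => z; [left|right] => y Uy /(nK y Uy) /z.
Qed.

(** The magnetic momentum transforms as a covector: the derivative by the chain rule, the potential
    by the rule for 1-forms, with the same Jacobian. *)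
Lemma cmom_transition i j a u p : Ck_cfun M 1 u -> overlap i j p ->
  let J := jacobian (transition i j) (cmap i p) in
  cmom a (Ai i a) (pull i u) (cmap i p) = \sum_b (J a b)%:C * cmom b (Ai j b) (pull j u) (cmap j p).
Proof.
move=> [C1 C2] [di dj] J; have [Ui ii] := chart_dom_map (ic i) di; have [Uj ij] := chart_dom_map (ic j) dj.
have oT : open (cmap i @` overlap i j) by exact: open_overlap.
have CT b : Ck_on 1 (cmap i @` overlap i j) (fun y => transition i j y 0 b) by case: hM => _ _ _ _ H; exact: H.
have ov : (cmap i @` overlap i j) (cmap i p) by exists p.
have Tp : transition i j (cmap i p) = cmap j p by rewrite /transition /= ii.
have D (f : X -> R) : Ck_fun M 1 f -> 'D_(basis_rV R a) (f \o cinv i) (cmap i p) =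
    \sum_b J a b * 'D_(basis_rV R b) (f \o cinv j) (cmap j p).
  move=> Cf; have df : differentiable (f \o cinv j) (transition i j (cmap i p)).
    by rewrite Tp; exact: (Ck_on_differentiable (@oU j) (Cf j) Uj).
  have [_] := derive_chain a oT ov CT df.
  rewrite Tp => <-; apply: near_eq_derive; apply: (filterS _ (open_nbhs_nbhs (conj oT ov))) => y [x [dx dx'] <-].
  by rewrite /transition /= (chart_dom_map (ic i) dx).2 (chart_dom_map (ic j) dx').2.
have EA : A i p 0 a = \sum_b J a b * A j p 0 b.
  have /= -> := hA.2 i j p (conj di dj); rewrite mxE; apply: eq_bigr => b _.
  by rewrite [_^T]lock -lock [X in _ * X]mxE mulrC.
rewrite /cmom ii ij EA /pd.
have -> : 'D_(basis_rV R a) (fun z => complex.Re (u (cinv i z))) (cmap i p) = _ := D _ C1.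
have -> : 'D_(basis_rV R a) (fun z => complex.Im (u (cinv i z))) (cmap i p) = _ := D _ C2.
rewrite [_ +i* _](_ : _ = \sum_b (J a b)%:C * pd b (pull j u) (cmap j p)); last first.
  by apply: complexP; rewrite (raddf_sum (@complex.Re R), raddf_sum (@complex.Im R)) /=; apply: eq_bigr => b _;
    rewrite ?ReM ?ImM /= ?mul0r ?subr0 ?addr0.
rewrite rmorph_sum /= mulr_sumr mulr_suml -sumrB; apply: eq_bigr => b _.
by rewrite rmorphM /= mulrBr mulrCA !mulrA.
Qed.

Lemma sum_rot4 (m : nat) (F : 'I_m -> 'I_m -> 'I_m -> 'I_m -> R[i]) :
  \sum_a \sum_b \sum_c \sum_d F a b c d = \sum_c \sum_d \sum_b \sum_a F a b c d.
Proof.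
rewrite [LHS](eq_bigr (fun a => \sum_c \sum_d \sum_b F a b c d)); last first.
  by move=> a _; rewrite exchange_big; apply: eq_bigr => c _; rewrite exchange_big.
rewrite exchange_big; apply: eq_bigr => c _; rewrite exchange_big; apply: eq_bigr => d _.
exact: exchange_big.
Qed.

(** Two covectors contracted with the inverse metric give a scalar; the Jacobians are absorbed by
    the transformation law [hJ]. *)
Lemma cform_chart i j phi u p : Ck_cfun M 1 phi -> Ck_cfun M 1 u -> overlap i j p ->
  cform i phi u p = cform j phi u p.
Proof.
move=> Cphi Cu ov; have [di dj] := ov.
have [Ui ii] := chart_dom_map (ic i) di; have [Uj ij] := chart_dom_map (ic j) dj.
rewrite /cform /eform ii ij; have /= -> := hJ ov.
set J := jacobian _ _.
under eq_bigr => a _ do under eq_bigr => b _ do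
  rewrite (cmom_transition a Cphi ov) (cmom_transition b Cu ov) -/J conjc_sum.
clearbody J.
transitivity (\sum_a \sum_b \sum_c \sum_d (h i p a b * J a c * J b d)%:C * (conjc (cmom c (Ai j c) (pull j phi) (cmap j p)) *
   cmom d (Ai j d) (pull j u) (cmap j p))).
  apply: eq_bigr => a _; apply: eq_bigr => b _; rewrite mulr_suml mulr_sumr; apply: eq_bigr => c _.
  rewrite !mulr_sumr; apply: eq_bigr => d _; rewrite conjcM !rmorphM /=.
  have -> : J a c -i* 0 = (J a c)%:C by apply: complexP; rewrite /= ?oppr0.
  move: (conjc _) => x; move: (cmom _ _ _ _) => y; move: (_%:C) (_%:C) (_%:C) => z s t; ring.
rewrite sum_rot4; apply: eq_bigr => c _; apply: eq_bigr => d _.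
rewrite mxE rmorph_sum mulr_suml /=; apply: eq_bigr => b _.
rewrite [(J^T *m _) c b]mxE mulr_suml rmorph_sum mulr_suml; apply: eq_bigr => a _.
by rewrite [J^T c a]mxE [J a c * _]mulrC.
Qed.

Lemma Ck_cfun_le1 u : Ck_cfun M 2 u -> Ck_cfun M 1 u.
Proof. by move=> [C1 C2]; split=> i; [exact: Ck_on_le (C1 i) | exact: Ck_on_le (C2 i)]. Qed.

Lemma Re_scale (k : R) (z : R[i]) : complex.Re (k%:C * z) = k * complex.Re z.
Proof. by case: z => a b /=; rewrite mul0r subr0. Qed.

Lemma Im_scale (k : R) (z : R[i]) : complex.Im (k%:C * z) = k * complex.Im z.
Proof. by case: z => a b /=; rewrite mul0r addr0. Qed.

(** The weak form involves first derivatives only, so second derivatives of the transition maps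
    never appear. The compatibility of the densities enters through [hmu], as both charts compute
    integrals for the same [mu]. Pointwise equality then follows by testing with bumps. *)
Lemma lap_overlap i j u p : Ck_cfun M 2 u -> overlap i j p -> lap i u p = lap j u p.
Proof.
move=> Cu ov; have oW : open (overlap i j) by apply: openI.
have Cu1 := Ck_cfun_le1 Cu.
have cl k x : dom k x -> {for x, continuous (fun y => complex.Re (lap k u y))} /\
    {for x, continuous (fun y => complex.Im (lap k u y))}.
  move=> dx; have [c1 c2] := CCk_lap k Cu; have Ux := mem_set (chart_dom_map (ic k) dx).1.
  split; apply: (chart_continuous_at hM dx); [exact: (Ck_on_continuous c1 Ux) | exact: (Ck_on_continuous c2 Ux)].
have eqb b K : is_bump i p (overlap i j) b K ->
    complex_integral mu (fun x => (b x)%:C * lap i u x) = complex_integral mu (fun x => (b x)%:C * lap j u x) /\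
   forall k, k = i \/ k = j ->
    mu.-integrable setT (EFin \o (fun x => b x * complex.Re (lap k u x))) /\
    mu.-integrable setT (EFin \o (fun x => b x * complex.Im (lap k u x))).
  move=> B; pose phi x := (b x)%:C.
  have Kk k : k = i \/ k = j -> K `<=` dom k by case=> -> x /(bump_in B)[].
  have Cphi : Ck_cfun M 2 phi by split; [exact: (bump_Ck B) | exact: Ck_fun_cst].
  have Cphi1 := Ck_cfun_le1 Cphi.
  have z : (forall x, ~ K x -> phi x = 0) by move=> x /(bump_off B); rewrite /phi => ->.
  have cj x : conjc (phi x) = (b x)%:C by apply: complexP; rewrite /= ?oppr0.
  have wk k : k = i \/ k = j -> complex_integral mu (fun x => (b x)%:C * lap k u x) =
      complex_integral mu (restricted K (cform k phi u)).
    move=> /Kk Kd; rewrite -(weak_chart (L := lap k u) (bump_compact B) Kd Cphi Cu (or_introl z)) //.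
      by congr (complex_integral mu); apply/funext => x; rewrite cj.
    by move=> x /z ->; rewrite rmorph0 mul0r.
  split.
    have E : restricted K (cform i phi u) = restricted K (cform j phi u).
      apply/funext => x; rewrite /restricted; case: ifPn => //; rewrite inE => /(bump_in B) ovx.
      exact: (cform_chart Cphi1 Cu1 ovx).
    exact: (etrans (wk i (or_introl erefl)) (etrans (congr1 (complex_integral mu) E) (esym (wk j (or_intror erefl))))).
  move=> k /Kk Kd; have [c1 c2] := CCk_lap k Cu.
  have Cb : Ck_on 0 (cod k) (b \o cinv k) by apply: (Ck_on_le (isT : (0 <= 2)%N)); exact: (bump_Ck B).
  split.
    apply: (chart_support_integrable (ic k) hX (@cw k) (@w0 k) (@hmu k) (bump_compact B) Kd).
      exact: (Ck_on_continuous (Ck_onM (@oU k) Cb c1)).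
    by move=> x /(bump_off B) ->; rewrite mul0r.
  apply: (chart_support_integrable (ic k) hX (@cw k) (@w0 k) (@hmu k) (bump_compact B) Kd).
    exact: (Ck_on_continuous (Ck_onM (@oU k) Cb c2)).
  by move=> x /(bump_off B) ->; rewrite mul0r.
have DBR (f g : X -> R) : (forall x, overlap i j x -> {for x, continuous f} /\ {for x, continuous g}) ->
    (forall b K, is_bump i p (overlap i j) b K -> mu.-integrable setT (EFin \o (fun x => b x * f x)) /\
       mu.-integrable setT (EFin \o (fun x => b x * g x)) /\
       \int[mu]_x (b x * f x) = \int[mu]_x (b x * g x)) -> f p - g p <= 0.
  move=> cfg H; apply: (du_bois_reymond hM Cw w0 hmu ov.1 oW ov (@subIsetl _ _ _) (f := fun x => f x - g x)).
    by move=> x /cfg[cf cg]; exact: (cvgB cf cg).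
  move=> b K /H[if_ [ig e]]; under eq_Rintegral => x _ do rewrite mulrBr.
  by rewrite RintegralB // e subrr.
have Rb (b : X -> R) k : complex.Re (complex_integral mu (fun x => (b x)%:C * lap k u x)) =
    \int[mu]_x (b x * complex.Re (lap k u x)).
  by apply: eq_Rintegral => x _; exact: Re_scale.
have Ib (b : X -> R) k : complex.Im (complex_integral mu (fun x => (b x)%:C * lap k u x)) =
    \int[mu]_x (b x * complex.Im (lap k u x)).
  by apply: eq_Rintegral => x _; exact: Im_scale.
(* [P] is the real or the imaginary part, and [k], [k'] range over both charts, so that the
   one-sided conclusion of [du_bois_reymond] is available in both directions. *)
have RI (P : R[i] -> R) : P = @complex.Re R \/ P = @complex.Im R -> forall k k', k = i \/ k = j -> k' = i \/ k' = j ->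
    P (lap k u p) - P (lap k' u p) <= 0.
  move=> hP k k' hk hk'; apply: (DBR (fun x => P (lap k u x)) (fun x => P (lap k' u x))).
    move=> x [dx dx']; have d l : l = i \/ l = j -> dom l x by case=> ->.
    have [c1 c2] := cl _ _ (d _ hk); have [c3 c4] := cl _ _ (d _ hk').
    case: hP => ->; first exact (conj c1 c3).
    exact (conj c2 c4).
  move=> b K /eqb[e I]; have [i1 i2] := I k hk; have [i3 i4] := I k' hk'.
  have ek : complex_integral mu (fun x => (b x)%:C * lap k u x) = complex_integral mu (fun x => (b x)%:C * lap k' u x).
    case: hk => ->; case: hk' => ->; [exact: erefl | exact: e | exact: (esym e) | exact: erefl].
  case: hP => ->; [apply: (conj i1 (conj i3 _)) | apply: (conj i2 (conj i4 _))].
    exact: (etrans (esym (Rb b k)) (etrans (congr1 (@complex.Re R) ek) (Rb b k'))).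
  exact: (etrans (esym (Ib b k)) (etrans (congr1 (@complex.Im R) ek) (Ib b k'))).
by apply: complexP; apply/eqP; rewrite -subr_eq0 eq_le RI /=; auto; rewrite -opprB oppr_ge0 RI; auto.
Qed.

Definition laplacian u p := lap (chart_at M p) u p.

Lemma laplacian_chart i u p : Ck_cfun M 2 u -> dom i p -> laplacian u p = lap i u p.
Proof. by move=> Cu dp; apply: lap_overlap. Qed.

Lemma laplacian_zero (K : set X) u p : compact K -> (forall x, ~ K x -> u x = 0) -> ~ K p -> laplacian u p = 0.
Proof. by move=> cK u0; apply: lap_zero. Qed.

Lemma laplacian_continuous u : Ck_cfun M 2 u ->
  continuous (fun x => complex.Re (laplacian u x)) /\ continuous (fun x => complex.Im (laplacian u x)).
Proof.
move=> Cu; have E i : CCk (cod i) 0 (pull i (laplacian u)).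
  apply: (@CCk_ext _ _ _ (@oU i) _ _ (pull i (lap i u))); last exact: CCk_lap.
  by move=> y Uy; apply: laplacian_chart => //; exact: (chart_cod_inv (ic i) Uy).1.
by split; apply: (@Ck_fun_continuous _ _ _ M hM 0) => i; have [] := E i.
Qed.

Lemma Cck_zero u : Cck M 2 u -> exists2 K : set X, compact K & forall p, ~ K p -> u p = 0.
Proof. by move=> [_ cu]; exists (closure [set x | u x != 0]) => // p; exact: off_support. Qed.

Lemma Cck2_L2 u : Cck M 2 u -> L2 mu u.
Proof.
move=> Cu; have [K cK u0] := Cck_zero Cu; have [[C1 C2] _] := Cu; apply/L2P; split.
  apply: (compact_support_l2 hM Cw w0 hmu cK (Ck_fun_continuous hM C1)) => p /u0; by rewrite /rpart => ->.
apply: (compact_support_l2 hM Cw w0 hmu cK (Ck_fun_continuous hM C2)) => p /u0; by rewrite /ipart => ->.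
Qed.

Lemma laplacian_L2 u : Cck M 2 u -> L2 mu (laplacian u).
Proof.
move=> Cu; have [K cK u0] := Cck_zero Cu; have [Cu2 _] := Cu.
have [c1 c2] := laplacian_continuous Cu2; apply/L2P; split.
  by apply: (compact_support_l2 hM Cw w0 hmu cK c1) => p nK; rewrite /rpart (laplacian_zero cK u0 nK).
by apply: (compact_support_l2 hM Cw w0 hmu cK c2) => p nK; rewrite /ipart (laplacian_zero cK u0 nK).
Qed.

Lemma pd_linear i a (k : R[i]) (F G : 'rV[R]_n -> R[i]) y : CCk (cod i) 1 F -> CCk (cod i) 1 G -> cod i y ->
  pd a (fun z => k * F z + G z) y = k * pd a F y + pd a G y.
Proof.
move=> CF CG Uy; have Ck := CCk_cst (cod i) 1 k; have CkF := CCkM (@oU i) Ck CF.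
have pd0 : pd a (fun=> k) y = 0 by rewrite /pd !derive_cst.
have <- : pd a (fun z => k * F z) y = k * pd a F y by rewrite (pdM _ Ck CF Uy) pd0 mul0r add0r.
have [[f1 f2] [g1 g2]] := (CkF, CG).
have d1 := Ck_on_derivable (j := a) f1 Uy; have d2 := Ck_on_derivable (j := a) f2 Uy.
have d3 := Ck_on_derivable (j := a) g1 Uy; have d4 := Ck_on_derivable (j := a) g2 Uy.
rewrite /pd; apply: complexP => /=.
  have -> : (fun z => complex.Re (k * F z + G z)) = (fun z => complex.Re (k * F z)) + (fun z => complex.Re (G z)).
    by apply/funext => z; exact: ReD.
  exact: (deriveD d1 d3).
have -> : (fun z => complex.Im (k * F z + G z)) = (fun z => complex.Im (k * F z)) + (fun z => complex.Im (G z)).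
  by apply/funext => z; exact: ImD.
exact: (deriveD d2 d4).
Qed.

Lemma cmom_linear i a (B : 'rV[R]_n -> R) (k : R[i]) (F G : 'rV[R]_n -> R[i]) y : CCk (cod i) 1 F -> CCk (cod i) 1 G -> cod i y ->
  cmom a B (fun z => k * F z + G z) y = k * cmom a B F y + cmom a B G y.
Proof.
move=> CF CG Uy; rewrite /cmom (pd_linear a k CF CG Uy).
by move: (pd _ _ _) (pd _ _ _) (F y) (G y) (_%:C) => p q r s t; ring.
Qed.

Lemma laplacian_linear (k : R[i]) u v p : Ck_cfun M 2 u -> Ck_cfun M 2 v ->
  laplacian (fun x => k * u x + v x) p = k * laplacian u p + laplacian v p.
Proof.
move=> Cu Cv; rewrite /laplacian; set i := chart_at M p; have dp : dom i p by exact: cov.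
have Up := (chart_dom_map (ic i) dp).1.
rewrite !lap_chart // mulrCA -mulrDr; congr (_ * _); rewrite /elap mulr_sumr -big_split /=.
have Cu2 := Ck_cfun_pull i Cu; have Cv2 := Ck_cfun_pull i Cv.
have C1 F : CCk (cod i) 2 F -> CCk (cod i) 1 F by exact: CCk_le.
apply: eq_bigr => a _.
rewrite -(cmom_linear a (Ai i a) k (CCk_flux (@oU i) (Cw i) (@Ch i) (@CA i) a Cu2)
  (CCk_flux (@oU i) (Cw i) (@Ch i) (@CA i) a Cv2) Up).
have E y : cod i y -> flux (Wi i) (Hi i) (Ai i) (pull i (fun x => k * u x + v x)) a y =
    k * flux (Wi i) (Hi i) (Ai i) (pull i u) a y + flux (Wi i) (Hi i) (Ai i) (pull i v) a y.
  move=> Uy; rewrite /flux mulrCA -mulrDr; congr (_ * _); rewrite mulr_sumr -big_split /=; apply: eq_bigr => b _.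
  by rewrite (cmom_linear b (Ai i b) k (C1 _ Cu2) (C1 _ Cv2) Uy) mulrDr mulrCA.
by rewrite /cmom (E _ Up) (pd_local (@oU i) a Up E).
Qed.

Lemma Ck_cfun_linear (k : R[i]) u v : Ck_cfun M 2 u -> Ck_cfun M 2 v -> Ck_cfun M 2 (fun x => k * u x + v x).
Proof.
move=> Cu Cv; suff H i : CCk (cod i) 2 (pull i (fun x => k * u x + v x)) by split=> i; [exact: (H i).1 | exact: (H i).2].
apply: (CCkD (@oU i)); last exact: Ck_cfun_pull.
by apply: (CCkM (@oU i)); [exact: CCk_cst | exact: Ck_cfun_pull].
Qed.

Lemma Cck2_linear (k : R[i]) u v : Cck M 2 u -> Cck M 2 v -> Cck M 2 (fun x => k * u x + v x).
Proof.
move=> Cu Cv; have [K cK u0] := Cck_zero Cu; have [K' cK' v0] := Cck_zero Cv.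
split; first exact: (Ck_cfun_linear k Cu.1 Cv.1).
apply: (support_compact hM (compactU cK cK')) => p /not_orP[/u0 -> /v0 ->].
by rewrite mulr0 addr0.
Qed.

Lemma Cck2_0 : Cck M 2 (fun=> 0).
Proof.
split; first by split; exact: Ck_fun_cst.
exact: (support_compact hM compact0).
Qed.

(** Only [u] is cut into pieces supported in one chart; [v] is left whole, because [weak_chart] asks
    for the support of one argument. In that chart both sides are values of the same Hermitian
    form. *)
Lemma laplacian_symmetric u v : Cck M 2 u -> Cck M 2 v -> L2inner mu u (laplacian v) = L2inner mu (laplacian u) v.
Proof.
move=> Cu Cv; move: u Cu; apply: (Cck2_local hM).
- have -> : laplacian (fun=> 0) = (fun=> 0) by apply/funext => p; apply: (laplacian_zero compact0).
  by congr (complex_integral mu); apply/funext => x; rewrite rmorph0 !mul0r.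
- move=> f g Cf Cg ef eg.
  have -> : laplacian (fun x => f x + g x) = fun x => laplacian f x + laplacian g x.
    apply/funext => p; rewrite -[in RHS](mul1r (laplacian f p)) -(laplacian_linear 1 p Cf.1 Cg.1).
    by congr (laplacian _ p); apply/funext => x; rewrite mul1r.
  have lv := Cck2_L2 Cv; have lf := Cck2_L2 Cf; have lg := Cck2_L2 Cg.
  have Lf := laplacian_L2 Cf; have Lg := laplacian_L2 Cg.
  by rewrite (innerDl (laplacian_L2 Cv) lf lg) (innerDl lv Lf Lg) ef eg.
move=> i K u cK Kd u0 Cu.
rewrite (inner_conj (Cck2_L2 Cv) (laplacian_L2 Cu)).
have z1 x : ~ K x -> conjc (u x) * laplacian v x = 0 by move=> /u0 ->; rewrite rmorph0 mul0r.
have z2 x : ~ K x -> conjc (v x) * laplacian u x = 0.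
  by move=> nK; rewrite (laplacian_zero cK u0 nK) mulr0.
have e1 := weak_chart cK Kd Cu.1 Cv.1 (or_introl u0) (fun x dx => laplacian_chart Cv.1 dx) z1.
have e2 := weak_chart cK Kd Cv.1 Cu.1 (or_intror u0) (fun x dx => laplacian_chart Cu.1 dx) z2.
apply: (etrans e1 (etrans _ (esym (congr1 (@conjc R) e2)))).
(* Hermitian symmetry of the form, from the symmetry of the matrix [h]. *)
have E x : restricted K (cform i u v) x = conjc (restricted K (cform i v u) x).
  rewrite /restricted; case: ifPn; rewrite ?rmorph0 // inE => /Kd dx.
  rewrite /cform; apply: eform_conj; rewrite (chart_dom_map (ic i) dx).2; exact: hT.
rewrite /complex_integral; apply: complexP => /=.
  by apply: eq_Rintegral => x _; rewrite E ReJ.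
have [_ [_ c2]] := restricted_cform cK Kd Cv.1 Cu.1 (or_intror u0).
rewrite -mulN1r -RintegralZl //; first by apply: eq_Rintegral => x _; rewrite E ImJ mulN1r.
apply: (chart_support_integrable (ic i) hX (@cw i) (@w0 i) (@hmu i) cK Kd (Ck_on_continuous c2)).
by move=> x nK; rewrite /restricted memNset.
Qed.

End Geometry.

(** * The product of the time axis and a manifold *)

Lemma open_setX (R : realType) (X : ptopologicalType) (A : set R) (B : set X) :
  open A -> open B -> open (A `*` B : set (R * X)%type).
Proof.
move=> oA oB; rewrite openE => -[t x] [/= At Bx]; exists (A, B) => //.
by split; apply: open_nbhs_nbhs.
Qed.

Lemma second_countable_prod (R : realType) (X : ptopologicalType) :
  @second_countable X -> @second_countable (R * X)%type.
Proof.
move=> [B cB [oB bB]].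
pose ball_ (q : rat * rat) : set R := [set s | `|s - ratr q.1| < ratr q.2].
have ballE q : ball_ q = ball (ratr q.1 : R) (ratr q.2).
  by apply/seteqP; split => s; rewrite /ball_ /ball /= distrC.
exists ((fun p : (rat * rat) * set X => ball_ p.1 `*` p.2) @` ([set: rat * rat] `*` B)).
  apply: (sub_countable (card_image_le _ _)).
  by apply: countableX => //; exact: countableP.
split.
  move=> _ [[q V] [/= _ BV] <-]; apply: open_setX; last exact: oB.
  rewrite ballE; have [r0|r0] := ltP 0 (ratr q.2 : R); first exact: ball_open.
  rewrite (_ : ball _ _ = set0); first exact: open0.
  apply/seteqP; split => // s; rewrite /ball /= => h; have := le_lt_trans (normr_ge0 _) h; by rewrite ltNge r0.
move=> [t x] W [[/= P Q] [nP nQ] PQ].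
have [e /= e0 eP] := (nbhs_ballP t P).1 nP.
have [q [q1 q2]] := rat_ball t e0.
have [V [/= BV Vx] VQ] := bB x _ nQ.
exists (ball_ q `*` V); first by split => //; exists (q, V).
move=> [s z] [/= sq Vz]; apply: (PQ (s, z)); split => /=; last exact: VQ.
by apply: eP; exact: q2.
Qed.

Lemma hausdorff_prod (R : realType) (X : ptopologicalType) :
  hausdorff_space X -> hausdorff_space (R * X)%type.
Proof.
move=> hX [s x] [t y] cl; congr (_, _).
  apply: (@Rhausdorff R) => P Q nP nQ.
  have [[r z] [[/= Pr _] [/= Qr _]]] := cl (P `*` setT) (Q `*` setT)
    (ex_intro2 _ _ (P, setT) (conj nP filterT) (@subset_refl _ _))
    (ex_intro2 _ _ (Q, setT) (conj nQ filterT) (@subset_refl _ _)).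
  by exists r.
apply: hX => P Q nP nQ.
have [[r z] [[/= _ Pz] [/= _ Qz]]] := cl (setT `*` P) (setT `*` Q)
  (ex_intro2 _ _ (setT, P) (conj filterT nP) (@subset_refl _ _))
  (ex_intro2 _ _ (setT, Q) (conj filterT nQ) (@subset_refl _ _)).
by exists z.
Qed.

Section TimeManifold.
Variables (R : realType) (X : ptopologicalType) (n : nat) (S : atlas R X n).
Hypothesis hS : smooth_manifold S.
Local Notation M := (time_atlas S).
Local Notation dom i := (chart_dom (chart_of i)).
Local Notation cod i := (chart_cod (chart_of i)).
Local Notation cmap i := (chart_map (chart_of i)).
Local Notation cinv i := (chart_inv (chart_of i)).
Implicit Types (i j : idx S) (y : 'rV[R]_(1 + n)).

Let ic i : is_chart (chart_of i). Proof. by case: hS. Qed.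
Let oU i : open (cod i). Proof. by case: (ic i). Qed.

Lemma continuous_lsubmx0 : continuous (fun y : 'rV[R]_(1 + n) => lsubmx y 0 0).
Proof.
have -> : (fun y : 'rV[R]_(1 + n) => lsubmx y 0 0) = (fun y => y 0 (lshift n ord0)).
  by apply/funext => y; rewrite mxE.
by move=> y; exact: coord_continuous.
Qed.

Lemma rsubmx_consr (z : R * 'rV[R]_n) : rsubmx (consr z) = z.2.
Proof. by rewrite /consr row_mxKr. Qed.

Lemma lsubmx_consr (z : R * 'rV[R]_n) : lsubmx (consr z) 0 0 = z.1.
Proof. by rewrite /consr row_mxKl mxE eqxx. Qed.

Lemma time_image i (W : set X) :
  chart_map (@chart_of R _ _ M i) @` (setT `*` W) = [set y | (cmap i @` W) (rsubmx y)].
Proof.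
apply/seteqP; split => [_ [[t x] [/= _ Wx] <-]|y [x Wx xy]] /=.
  by exists x => //; rewrite row_mxKr.
exists (lsubmx y 0 0, x); first by split.
by rewrite -[RHS]consr_hd_tl -xy.
Qed.

Lemma time_cod i : chart_cod (@chart_of R _ _ M i) = [set y | cod i (rsubmx y)].
Proof. exact: time_image. Qed.

Lemma time_is_chart i : is_chart (@chart_of R _ _ M i).
Proof.
have [oD oC ck cm ci] := ic i; split.
- exact: (open_setX openT oD).
- rewrite time_cod; apply: (open_comp _ oC) => y _; exact: continuous_rsubmx.
- move=> [t x]; rewrite inE => -[/= _ dx]; rewrite row_mxKl row_mxKr ck ?inE //.
  by rewrite mxE eqxx.
- move=> [t x]; rewrite inE => -[/= _ dx].
  apply: (@continuous_comp _ _ _ (fun q : R * X => (q.1, cmap i q.2)) (@consr R n)); last exact: continuous_consr.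
  have c2 : {for (t, x), continuous (fun q : R * X => cmap i q.2)}.
    by apply: (@continuous_comp _ _ _ snd (cmap i)); [exact: cvg_snd | apply: cm; rewrite inE].
  have c1 : {for (t, x), continuous (fun q : R * X => q.1)} by exact: cvg_fst.
  exact: (cvg_pair c1 c2).
move=> y; rewrite time_cod inE => /= Uy.
have c2 : {for y, continuous (fun y : 'rV[R]_(1 + n) => cinv i (rsubmx y))}.
  apply: (@continuous_comp _ _ _ rsubmx (cinv i)); first exact: continuous_rsubmx.
  by apply: ci; rewrite inE.
exact: (cvg_pair (continuous_lsubmx0 (x := y)) c2).
Qed.

Lemma time_transitionE i j y : transition (M := M) i j y =
  consr (lsubmx y 0 0, transition i j (rsubmx y)).
Proof. by []. Qed.

Lemma time_overlap i j : overlap (M := M) i j = setT `*` overlap i j.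
Proof.
by apply/seteqP; split => [[t x] [[_ a] [_ b]]|[t x] [_ [a b]]].
Qed.

Lemma time_smooth_manifold : smooth_manifold M.
Proof.
have [hX sc _ cv tr] := hS; split.
- exact: hausdorff_prod.
- exact: second_countable_prod.
- exact: time_is_chart.
- by move=> [t x]; split => //=; exact: cv.
move=> i j b k; rewrite time_overlap time_image.
have [k0 Eb|k1 Eb] := split_ordP b; rewrite Eb.
  rewrite (ord1 k0).
  have -> : (fun y => transition (M := M) i j y 0 (lshift n ord0)) = (fun y => y 0 (lshift n ord0)).
    by apply/funext => y; rewrite time_transitionE (consr0 (_, _)) /= mxE.
  exact: Ck_on_coord.
have -> : (fun y => transition (M := M) i j y 0 (rshift 1 k1)) = (fun y => @transition R X n S i j (rsubmx y) 0 k1).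
  by apply/funext => y; rewrite time_transitionE (consrS (_, _)).
exact: (Ck_on_rsubmx (tr i j k1 k)).
Qed.

Lemma jacobian_coord (m : nat) (U : set 'rV[R]_m) (T : 'rV[R]_m -> 'rV[R]_m) (x : 'rV[R]_m) a b : open U -> U x ->
  (forall b, Ck_on 1 U (fun z : 'rV[R]_m => T z 0 b)) ->
  jacobian T x a b = 'D_(basis_rV R a) (fun z : 'rV[R]_m => T z 0 b) x.
Proof.
move=> oW Ux CT; have df : differentiable (fun y : 'rV[R]_m => y 0 b) (T x).
  exact: (Ck_on_differentiable openT (Ck_on_coord 1 setT b) I).
have [_ ->] := derive_chain a oW Ux CT df.
rewrite (bigD1 b) //= big1 ?addr0 => [|c cb].
  by have [_ ->] := @derive_coord R m b b (T x); rewrite eqxx mulr1.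
by have [_ ->] := @derive_coord R m b c (T x); rewrite eq_sym (negbTE cb) mulr0.
Qed.

(** Transition maps fix the time coordinate and act on space independently of it. *)
Lemma time_jacobian i j (q : R * X) : overlap (M := M) i j q ->
  jacobian (transition (M := M) i j) (chart_map (@chart_of R _ _ M i) q) =
  block_mx (1%:M : 'M[R]_1) 0 0 (jacobian (transition i j) (cmap i q.2)).
Proof.
move=> ov; have [_ _ _ _ tr] := time_smooth_manifold; have [_ _ _ _ trS] := hS.
have ovS : overlap i j q.2 by move: ov; rewrite time_overlap => -[].
have oT := open_overlap time_smooth_manifold (i := i) (j := j).
have oT' := open_overlap hS (i := i) (j := j).
apply/matrixP => a b; have Uq : (chart_map (@chart_of R _ _ M i) @` overlap (M := M) i j) (chart_map (@chart_of R _ _ M i) q) by exists q.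
rewrite (jacobian_coord a b oT Uq (fun c => tr i j c 1)).
have [b0 Eb|b1 Eb] := split_ordP b; rewrite Eb.
  have -> : (fun y => transition (M := M) i j y 0 (lshift n b0)) = (fun y => y 0 (lshift n b0)).
    by apply/funext => y; rewrite (ord1 b0) time_transitionE (consr0 (_, _)) /= mxE.
  have [_ ->] := @derive_coord R (1 + n) (lshift n b0) a (chart_map (@chart_of R _ _ M i) q).
  have [a0 Ea|a1 Ea] := split_ordP a; rewrite Ea.
    by rewrite block_mxEul mxE (ord1 a0) (ord1 b0) !eqxx.
  by rewrite block_mxEdl mxE; case: eqP => // E; have := congr1 val E; rewrite /= (ord1 b0).
have -> : (fun y => transition (M := M) i j y 0 (rshift 1 b1)) = (fun y => @transition R X n S i j (rsubmx y) 0 b1).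
  by apply/funext => y; rewrite time_transitionE (consrS (_, _)).
have [a0 Ea|a1 Ea] := split_ordP a; rewrite Ea.
  rewrite block_mxEur mxE.
  by have [_ ->] := is_derive_rsubmx0 (fun y : 'rV[R]_n => @transition R X n S i j y 0 b1) a0 (chart_map (@chart_of R _ _ M i) q).
rewrite block_mxEdr (derive_rsubmx (fun y : 'rV[R]_n => @transition R X n S i j y 0 b1)) row_mxKr.
have Uq' : (cmap i @` overlap i j) (cmap i q.2) by exists q.2.
by rewrite (jacobian_coord a1 b1 oT' Uq' (fun c => trS i j c 1)).
Qed.

End TimeManifold.

(** * The measure on the product manifold *)

Section SigmaFinite.
Variables (R : realType) (X : ptopologicalType) (n : nat) (S : atlas R X n).
Hypothesis hS : smooth_manifold S.
Local Notation dom i := (chart_dom (chart_of i)).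
Local Notation cod i := (chart_cod (chart_of i)).
Local Notation cmap i := (chart_map (chart_of i)).
Local Notation cinv i := (chart_inv (chart_of i)).

(** Bumps show that the basic open sets contained in a compact subset of some chart domain cover the
    manifold; second countability leaves countably many of them. *)
Lemma countable_chart_cover : exists (D : nat -> set X) (c : nat -> idx S),
  [/\ forall k, open (D k), forall k, D k `<=` dom (c k),
      forall k, exists2 C : set X, compact C & D k `<=` C & forall p, exists k, D k p].
Proof.
have [hX [B cB [oB bB]] ic cov tr] := hS.
pose good (W : set X) := exists (i : idx S) (C : set X), [/\ W `<=` dom i, compact C & W `<=` C].
have [f If] : exists f : set X -> nat, {in B &, injective f} by apply/countable_injP.
pose P k (W : set X) := [/\ B W, good W & f W = k].
have ex k : exists Wi : set X * idx S, [/\ open Wi.1, Wi.1 `<=` dom Wi.2,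
    exists2 C : set X, compact C & Wi.1 `<=` C & forall W, P k W -> Wi.1 = W].
  have [[W [BW [i [C [Wd cC WC]]] fW]]|no] := pselect (exists W, P k W).
    exists (W, i); split => //=; first exact: oB.
      by exists C.
    by move=> W' [BW' _ fW']; apply: If; rewrite ?inE // fW.
  (* An index that is not attained receives the empty set and an arbitrary chart. *)
  exists (set0, chart_at S point); split => //=; first exact: open0.
    by exists set0 => //; exact: compact0.
  by move=> W PW; exfalso; apply: no; exists W.
have [g hg] := choice ex.
exists (fun k => (g k).1), (fun k => (g k).2); split => [k|k|k|p]; try by case: (hg k).
have [b [K Bu]] := exists_bump hS (cov p) openT (I : setT p).
have nE : nbhs p [set x | b x = 1] by exact: (bump_near Bu).
have [W [/= BW Wp] WE] := bB p _ nE.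
have WK : W `<=` K.
  by move=> x /WE /= bx; apply: contrapT => /(bump_off Bu); rewrite bx; apply/eqP; exact: oner_neq0.
exists (f W); have [_ _ _ h] := hg (f W); rewrite (h W) //; split => //.
exists (chart_at S p), K; split => //; last exact: (bump_compact Bu).
by move=> x /WK /(bump_dom Bu).
Qed.

Variables (w : idx S -> X -> R) (mu : {measure set (borel X) -> \bar R}).
Hypotheses (Cw : forall i, Ck_on 1 (cod i) (fun y => w i (cinv i y)))
  (w0 : forall i p, dom i p -> 0 < w i p) (hmu : is_density_measure w mu).

Lemma density_sigma_finite : sigma_finite setT mu.
Proof.
have [D [c [oD Dc DC cov]]] := countable_chart_cover.
exists D; first by apply/seteqP; split => // p _; have [k Dk] := cov p; exists k.
move=> k; split; first exact: open_borel.
have [C cC DkC] := DC k; apply: le_lt_trans (compact_finite_measure hS Cw w0 hmu cC).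
apply: le_measure; rewrite ?inE //; first exact: open_borel.
by apply: (compact_measurable hS).
Qed.

Local Notation P := ((@lebR R) \x (sf_measure density_sigma_finite))%E.

Variable (muM : {measure set (borel (R * X)%type) -> \bar R}).
Hypothesis hmuM : @is_density_measure R (R * X)%type (1 + n) (time_atlas S) (fun i q => w i q.2) muM.

Let sc : @second_countable X. Proof. by case: hS. Qed.

(** The density does not depend on time, and the time sections of the chart image of [B] are the
    chart images of the sections of [B]. Iterated Lebesgue integration therefore yields the integral
    over time of the measures of the sections. *)
Lemma product_density_chart (i : idx S) (B : set (R * X)) : measurable (B : set (borel (R * X)%type)) ->
  B `<=` setT `*` dom i -> muM B = P B.
Proof.
move=> mB Bd; have mB' : measurable (B : set (R * borel X)) by apply/prod_borel_measurable.
have hM := time_smooth_manifold hS; have [_ _ ic _ _] := hS; have [_ _ icM _ _] := hM.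
pose c := @chart_of R _ _ (time_atlas S) i.
pose B' := chart_map c @` B.
pose F (y : 'rV[R]_n) := w i (cinv i y).
have oU : open (cod i) by case: (ic i).
have mB'' : measurable (B' : set (borel 'rV[R]_(1 + n))).
  have := chart_image (icM i) B; rewrite setIidl // /B' => ->.
  have oUM : open (chart_cod c) by case: (icM i).
  exact: (measurable_chart_inv (icM i)) (open_borel oUM) _ mB.
have B'U y : B' y -> cod i (rsubmx y).
  by move=> [[t x] /Bd[/= _ dx] <-]; rewrite row_mxKr; exists x.
have sec t y : B' (consr (t, y)) <-> (cmap i @` xsection B t) y.
  split=> [[[s x] Bsx]|[x]].
    rewrite /c /= -/(consr (s, cmap i x)) => E.
    have := congr1 (fun z => lsubmx z 0 0) E; rewrite !lsubmx_consr /= => st.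
    have := congr1 rsubmx E; rewrite !rsubmx_consr /= => xy.
    by exists x => //; rewrite /xsection /= inE -st.
  by rewrite /xsection /= inE => Btx <-; exists (t, x).
have Fpos y : cod i y -> 0 <= F y.
  by move=> Uy; apply: ltW; apply: w0; exact: (chart_cod_inv (ic i) Uy).1.
pose G := ((fun y : 'rV[R]_(1 + n) => (F (rsubmx y))%:E) \_ B')%E.
have G0 y : (0 <= G y)%E.
  by rewrite /G patchE; case: ifPn => // /[!inE] /B'U Uy; rewrite lee_fin Fpos.
have mG : measurable_fun [set: borel 'rV[R]_(1 + n)] (G : borel 'rV[R]_(1 + n) -> \bar R).
  apply/(measurable_restrictT _ mB''); apply/measurable_EFinP.
  have oV : open [set y : 'rV[R]_(1 + n) | cod i (rsubmx y)].
    by apply: (open_comp _ oU) => y _; exact: continuous_rsubmx.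
  apply: (measurable_funS (open_borel oV)) => //.
  apply: open_continuous_borel => // y; rewrite inE => Uy.
  apply: (@continuous_comp _ _ _ rsubmx F); first exact: continuous_rsubmx.
  by apply: (Ck_on_continuous (Cw i)); rewrite inE.
have -> : muM B = (\int[@lam R (1 + n)]_y G y)%E.
  rewrite (@hmuM i B mB Bd) /G -integral_mkcond.
  change (@lebesgue_rV R (1 + n)) with (@lam R (1 + n) : set (borel 'rV[R]_(1 + n)) -> \bar R).
  reflexivity.
rewrite (lam_pushforward mG G0).
have mGc : measurable_fun [set: R * borel 'rV[R]_n] (fun z : R * 'rV[R]_n => G (consr z)).
  exact: (measurableT_comp mG (@measurable_consr R n)).
rewrite (fubini_tonelli1 (m1 := @lebR R) (m2 := @lam R n) (fun z => G (consr z)) mGc (fun z => G0 (consr z))).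
apply: eq_integral => t _.
have mx : measurable (xsection B t : set (borel X)) by exact: measurable_xsection.
have xd : xsection B t `<=` dom i by move=> x; rewrite /xsection /= inE => /Bd[].
rewrite /fubini_F /= /sf_measure (@hmu i _ mx xd).
change (@lebesgue_rV R n) with (@lam R n : set (borel 'rV[R]_n) -> \bar R).
apply: etrans (esym (integral_mkcond (mu := @lam R n) _ _)).
apply: eq_integral => y _.
rewrite /G !patchE; have [|nB] := boolP (consr (t, y) \in B').
  by rewrite inE => /sec By; rewrite ifT ?inE // rsubmx_consr.
by rewrite ifF //; apply/negbTE; move: nB; apply: contra; rewrite !inE => /sec.
Qed.

(** The countable chart cover is made disjoint, and the equality on each piece is summed. *)
Lemma product_density (B : set (R * X)) : measurable (B : set (borel (R * X)%type)) -> muM B = P B.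
Proof.
move=> mB; have [D [c [oD Dc _ cov]]] := countable_chart_cover.
pose E := seqDU D.
have mE k : measurable (E k : set (borel X)).
  by apply: measurableD; [exact: open_borel | apply: bigsetU_measurable => j _; exact: open_borel].
have tE : trivIset setT E by exact: trivIset_seqDU.
have UE : \bigcup_k E k = setT.
  rewrite -seqDU_bigcup_eq; apply/seteqP; split => // p _; have [k Dk] := cov p; by exists k.
pose BE k : set (R * X) := B `&` (setT `*` E k).
have -> : B = \bigcup_k BE k.
  apply/seteqP; split => [[t x] Bx|[t x] [k _ []] //].
  have [k _ Ek] : (\bigcup_k E k) x by rewrite UE.
  by exists k.
have mBE' k : measurable (BE k : set (R * borel X)).
  by apply: measurableI; [apply/prod_borel_measurable | apply: measurableX].
have mBE k : measurable (BE k : set (borel (R * X)%type)) by apply/prod_borel_measurable.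
have tB : trivIset setT BE.
  apply/trivIsetP => j k _ _ jk; apply/seteqP; split => // -[t x] [[_ [_ /= Ej]] [_ [_ /= Ek]]].
  have /trivIsetP /(_ j k I I jk) := tE; move=> /seteqP[/(_ x) + _]; exact.
rewrite (measure_bigcup muM) // (measure_bigcup P) //.
apply: eq_eseriesr => k _; apply: (@product_density_chart (c k)) => //.
by move=> [t x] [_ [_ /= /(subset_seqDU (A := D)) /Dc]].
Qed.

Lemma product_integral (f : R * X -> \bar R) :
  measurable_fun [set: R * borel X] (f : R * borel X -> \bar R) -> (forall z, 0 <= f z)%E ->
  (\int[muM]_z f z = \int[P]_z f z)%E.
Proof.
move=> mf f0; have mi : measurable_fun [set: R * borel X] (id : R * borel X -> borel (R * X)%type).
  by move=> _ B mB; rewrite setTI; apply/prod_borel_measurable.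
have mf' : measurable_fun [set: borel (R * X)%type] (f : borel (R * X)%type -> \bar R).
  move=> _ B mB; apply/prod_borel_measurable => //; exact: mf.
have -> : (\int[P]_z f z = \int[pushforward P (id : R * borel X -> borel (R * X)%type)]_z f z)%E.
  by rewrite (ge0_integral_pushforward mi).
by apply: eq_measure_integral => B mB _; rewrite /pushforward product_density.
Qed.

Lemma product_measurable_fun d (T : measurableType d) (f : R * X -> T) :
  measurable_fun [set: R * borel X] (f : R * borel X -> T) <->
  measurable_fun [set: borel (R * X)%type] (f : borel (R * X)%type -> T).
Proof.
by split=> mf _ B mB; apply/prod_borel_measurable => //; apply: mf.
Qed.

Lemma product_L2 (u : R * X -> R[i]) : L2 muM u <-> L2 P u.
Proof.
have H (f : R * X -> R) : l2 muM f <-> l2 P f.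
  split=> -[mf I]; have mf' := (product_measurable_fun f).1; have mf'' := (product_measurable_fun f).2.
    split; first exact: mf''.
    rewrite -product_integral //; first by apply/measurable_EFinP; apply: measurable_funX; exact: mf''.
    by move=> z; rewrite lee_fin sqr_ge0.
  split; first exact: mf'.
  rewrite product_integral //; first by apply/measurable_EFinP; exact: measurable_funX.
  by move=> z; rewrite lee_fin sqr_ge0.
split=> /L2P[/H h1 /H h2]; apply/L2P; by split.
Qed.

Lemma product_Rintegral (f : R * X -> R) : measurable_fun [set: R * borel X] (f : R * borel X -> R) ->
  \int[muM]_z f z = \int[P]_z f z.
Proof.
move=> mf; have mE : measurable_fun [set: R * borel X] (EFin \o f : R * borel X -> \bar R) by exact/measurable_EFinP.
rewrite /Rintegral integralE [in RHS]integralE; congr (fine (_ - _)%E).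
  by apply: product_integral; [exact: measurable_funepos | move=> z; exact: funepos_ge0].
by apply: product_integral; [exact: measurable_funeneg | move=> z; exact: funeneg_ge0].
Qed.

Lemma product_inner (u v : R * X -> R[i]) : L2 P u -> L2 P v -> L2inner muM u v = L2inner P u v.
Proof.
move=> lu lv; have [/integrableP[/measurable_EFinP m1 _] /integrableP[/measurable_EFinP m2 _]] := inner_int lu lv.
by rewrite /L2inner /complex_integral (product_Rintegral m1) (product_Rintegral m2).
Qed.

End SigmaFinite.

(** * Static geometry *)

Section Lines.
Variables (R : realType) (m : nat).
Implicit Types (f g : 'rV[R]_m -> R) (y v : 'rV[R]_m).

(** The difference quotients see only the line through [y], so agreement on a neighbourhood is not
    involved. *)
Lemma derive_line f g y v : (forall h : R, f (h *: v + y) = g (h *: v + y)) -> 'D_v f y = 'D_v g y.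
Proof.
move=> fg; have fg0 : f y = g y by have := fg 0; rewrite scale0r add0r.
have E : (fun h : R => h^-1 *: (f (h *: v + y) - f y)) = (fun h : R => h^-1 *: (g (h *: v + y) - g y)).
  by apply/funext => h; rewrite fg fg0.
by rewrite /derive E.
Qed.

(* A non-existing derivative is [0]. *)
Lemma deriveZ_total (k : R) f y v : 'D_v (fun z => k * f z) y = k * 'D_v f y.
Proof.
have H k' g : derivable g y v -> 'D_v (fun z => k' * g z) y = k' * 'D_v g y /\ derivable (fun z => k' * g z) y v.
  by move=> dg; split; [exact: (deriveZ k' dg) | exact: (@derivableZ _ _ _ g k' y v dg)].
have [->|k0] := eqVneq k 0.
  have -> : (fun z => 0 * f z) = cst 0 by apply/funext => z; exact: mul0r.
  by rewrite mul0r derive_cst.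
have [df|ndf] := pselect (derivable f y v); first exact: (H k f df).1.
have Z g : ~ derivable g y v -> 'D_v g y = 0 by move=> ng; rewrite /derive (dvgP ng).
rewrite (Z f ndf) mulr0; apply: Z => dkf; apply: ndf.
have E : (fun z => k^-1 * (k * f z)) = f by apply/funext => z; exact: mulKf.
exact: (eq_ind _ (fun F => derivable F y v) (H k^-1 _ dkf).2 _ E).
Qed.

End Lines.

(** * Time and space derivatives in product charts *)

Section TimeDerivatives.
Variables (R : realType) (X : ptopologicalType) (n : nat) (c : chart R X n).
Hypothesis ic : is_chart c.
Implicit Types (F G : R * X -> R[i]) (t : R) (x : X).
Local Notation tc := (time_chart c).

Lemma time_line (h : R) (t : R) (y : 'rV[R]_n) :
  h *: basis_rV R (@time_index n) + row_mx t%:M y = row_mx (h + t)%:M y.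
Proof.
apply/rowP => k; rewrite !mxE; case: splitP => j kj; rewrite ?mxE /time_index.
  by rewrite (ord1 j) (_ : k == lshift n ord0) ?mulr1 //; apply/eqP/val_inj; rewrite /= kj (ord1 j).
by rewrite (_ : (k == lshift n ord0) = false) ?mulr0 ?add0r //; apply/negP => /eqP /(congr1 val) /=; rewrite kj.
Qed.

Lemma space_line (j : 'I_n) (h t : R) (y : 'rV[R]_n) :
  h *: basis_rV R (space_index j) + row_mx t%:M y = row_mx t%:M (h *: basis_rV R j + y).
Proof.
apply/rowP => k; rewrite !mxE; case: splitP => l kl; rewrite ?mxE /space_index.
  rewrite (_ : (k == rshift 1 j) = false) ?mulr0 ?add0r //; apply/negP => /eqP /(congr1 val) /=.
  by rewrite kl (ord1 l).
by congr (_ * (_ && _)%:R + _); rewrite -val_eqE /= kl eqSS.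
Qed.

Lemma time_inv_row t y : chart_inv tc (row_mx (t%:M : 'M[R]_1) y) = (t, chart_inv c y).
Proof. by rewrite /= row_mxKl row_mxKr mxE eqxx. Qed.

Lemma derive_time (f : R * X -> R) t x : chart_dom c x ->
  'D_(basis_rV R (@time_index n)) (fun y => f (chart_inv tc y)) (chart_map tc (t, x)) =
  'D_1 (fun s : R => f (s, x)) t.
Proof.
move=> dx; have [_ ix] := chart_dom_map ic dx.
have E : (fun h : R => h^-1 *: (f (chart_inv tc (h *: basis_rV R (@time_index n) + chart_map tc (t, x))) - f (chart_inv tc (chart_map tc (t, x))))) =
    (fun h : R => h^-1 *: (f (h *: (1 : R) + t, x) - f (t, x))).
  apply/funext => h; rewrite -[chart_map tc _]/(row_mx t%:M (chart_map c x)) time_line !time_inv_row ix.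
  by rewrite [h *: (1 : R)]mulr1.
by rewrite /derive E.
Qed.

Lemma mom_time F t x (a b : R) : chart_dom c x ->
  is_derive t (1 : R) (fun s => complex.Re (F (s, x))) a ->
  is_derive t (1 : R) (fun s => complex.Im (F (s, x))) b ->
  mom tc (@time_index n) F (t, x) = - 'i * (a +i* b).
Proof.
move=> dx [_ da] [_ db]; rewrite /mom /cpartial.
by rewrite (derive_time (fun q => complex.Re (F q)) t dx) (derive_time (fun q => complex.Im (F q)) t dx) da db.
Qed.

(** The relation between [F] and [G] concerns only the time line above [x], so the factor [k] may be
    the value at [x] of a function on [X]. *)
Lemma mom_time_scale (k : R) F G t x : chart_dom c x -> (forall s, F (s, x) = k%:C * G (s, x)) ->
  mom tc (@time_index n) F (t, x) = k%:C * mom tc (@time_index n) G (t, x).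
Proof.
move=> dx FG; have [_ ix] := chart_dom_map ic dx.
have line h : chart_inv tc (h *: basis_rV R (@time_index n) + chart_map tc (t, x)) = (h + t, x).
  by rewrite -[chart_map tc _]/(row_mx t%:M (chart_map c x)) time_line time_inv_row ix.
have D (f : R[i] -> R) : (forall k z, f (k%:C * z) = k * f z) ->
    'D_(basis_rV R (@time_index n)) (fun y => f (F (chart_inv tc y))) (chart_map tc (t, x)) =
    k * 'D_(basis_rV R (@time_index n)) (fun y => f (G (chart_inv tc y))) (chart_map tc (t, x)).
  by move=> fZ; rewrite -deriveZ_total; apply: derive_line => h; rewrite (line h) FG fZ.
rewrite /mom mulrCA; congr (_ * _); rewrite /cpartial (D _ (@Re_scale R)) (D _ (@Im_scale R)).
by apply: complexP; rewrite ?Re_scale ?Im_scale.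
Qed.

(** At fixed time [phi t] is a constant, and [derive] commutes with constants unconditionally by
    [deriveZ_total]; the formula thus holds at every point and can be iterated. *)
Lemma magnetic_mom_space (j : 'I_n) (a : R * X -> R) (phi : R -> R) (F : X -> R[i]) t x :
  (forall s x, a (s, x) = a (0, x)) ->
  magnetic_mom tc (space_index j) a (fun r => (phi r.1)%:C * F r.2) (t, x) =
  (phi t)%:C * magnetic_mom c j (fun x => a (0, x)) F x.
Proof.
move=> ta; rewrite /magnetic_mom ta mulrBr; congr (_ - _); last by rewrite mulrCA.
rewrite /mom [RHS]mulrCA; congr (_ * _); rewrite /cpartial.
have D (f : R[i] -> R) : (forall k z, f (k%:C * z) = k * f z) ->
    'D_(basis_rV R (space_index j)) (fun y => f ((phi (chart_inv tc y).1)%:C * F (chart_inv tc y).2)) (chart_map tc (t, x)) =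
    phi t * 'D_(basis_rV R j) (fun y => f (F (chart_inv c y))) (chart_map c x).
  move=> fZ; rewrite -[chart_map tc _]/(row_mx t%:M (chart_map c x)).
  transitivity ('D_(basis_rV R (space_index j)) (fun y : 'rV[R]_(1 + n) => phi t * f (F (chart_inv c (rsubmx y)))) (row_mx t%:M (chart_map c x))).
    apply: derive_line => h; rewrite space_line time_inv_row fZ /= row_mxKr; by [].
  by rewrite deriveZ_total (derive_rsubmx (fun y => f (F (chart_inv c y)))) row_mxKr.
rewrite (D _ (@Re_scale R)) (D _ (@Im_scale R)).
by apply: complexP; rewrite ?Re_scale ?Im_scale.
Qed.

Lemma magnetic_laplacian_space (w : X -> R) (h : X -> 'M[R]_n) (A : 'I_n -> R * X -> R) (phi : R -> R) (F : X -> R[i]) t x :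
  (forall j s x, A j (s, x) = A j (0, x)) ->
  magnetic_laplacian tc (@space_index n) (fun r => w r.2) (fun r => h r.2) A (fun r => (phi r.1)%:C * F r.2) (t, x) =
  (phi t)%:C * magnetic_laplacian c id w h (fun j x => A j (0, x)) F x.
Proof.
move=> tA; rewrite /magnetic_laplacian /= mulrCA; congr (_ * _); rewrite mulr_sumr; apply: eq_bigr => j _.
set K := fun q : X => (w q)%:C * _.
have -> : (fun q : R * X => (w q.2)%:C * \sum_(k < n) (h q.2 j k)%:C *
    magnetic_mom tc (space_index k) (A k) (fun r : R * X => (phi r.1)%:C * F r.2) q) =
    fun r : R * X => (phi r.1)%:C * K r.2.
  apply/funext => -[s y]; rewrite /K /= [RHS]mulrCA; congr (_ * _); rewrite mulr_sumr; apply: eq_bigr => k _.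
  by rewrite (magnetic_mom_space k phi F s y (tA k)) mulrCA.
exact: magnetic_mom_space.
Qed.

End TimeDerivatives.

Section StaticGeometry.
Variables (R : realType) (X : ptopologicalType) (n : nat) (S : atlas R X n).
Hypothesis hS : smooth_manifold S.
Variables (g : idx S -> X -> 'M[R]_n) (beta : X -> R).
Hypotheses (hg : riemannian_metric 2 g) (hbeta : Ck_fun S 2 beta) (beta_gt0 : forall p, 0 < beta p).
Variables (A : idx (time_atlas S) -> R * X -> 'rV[R]_(1 + n)) (Y : R * X -> R).
Hypotheses (hA : one_form 1 A) (A_static : forall i, time_independent (A i)).
Local Notation M := (time_atlas S).
Local Notation dom i := (chart_dom (chart_of i)).
Local Notation cod i := (chart_cod (chart_of i)).
Local Notation cmap i := (chart_map (chart_of i)).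
Local Notation cinv i := (chart_inv (chart_of i)).
Implicit Types (i j : idx S) (p x : X) (q : R * X).

Let ic i : is_chart (chart_of i). Proof. by case: hS. Qed.
Let oU i : open (cod i). Proof. by case: (ic i). Qed.

Local Notation G := (static_metric beta g).

Lemma det_metric_neq0 i p : dom i p -> \det (g i p) != 0.
Proof.
move=> dp; apply/negP => /det0P[v v0 vg]; have [_ _ pos _] := hg.
by have := pos i p dp v v0; rewrite vg mul0mx mxE ltxx.
Qed.

Lemma det_static_metric i p : \det (G i p) = - beta p * \det (g i p).
Proof. by rewrite /static_metric det_ublock det_scalar1. Qed.

Lemma det_static_metric_neq0 i p : dom i p -> \det (G i p) != 0.
Proof.
move=> dp; rewrite det_static_metric; apply: mulf_neq0; last exact: det_metric_neq0.
by rewrite oppr_eq0 gt_eqF.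
Qed.

Lemma static_metric_unit i p : dom i p -> G i p \in unitmx.
Proof. by move=> dp; rewrite unitmxE unitfE det_static_metric_neq0. Qed.

Lemma static_density_gt0 i p : dom i p -> 0 < static_density beta g i p.
Proof. by move=> dp; rewrite sqrtr_gt0 normr_gt0 det_static_metric_neq0. Qed.

Lemma Ck_static_metric i (a b : 'I_(1 + n)) : Ck_on 2 (cod i) (fun y => G i (cinv i y) a b).
Proof.
have [Cg _ _ _] := hg.
have [a0 ->|a1 ->] := split_ordP a; have [b0 ->|b1 ->] := split_ordP b.
- apply: (Ck_on_ext (@oU i) _ (Ck_onN (@oU i) (hbeta i))) => y _.
  by rewrite /static_metric block_mxEul mxE (ord1 a0) (ord1 b0) eqxx mulr1n.
- apply: (Ck_on_ext (@oU i) _ (Ck_on_cst 2 (cod i) 0)) => y _.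
  by rewrite /static_metric block_mxEur mxE.
- apply: (Ck_on_ext (@oU i) _ (Ck_on_cst 2 (cod i) 0)) => y _.
  by rewrite /static_metric block_mxEdl mxE.
apply: (Ck_on_ext (@oU i) _ (Cg i a1 b1)) => y _.
by rewrite /static_metric block_mxEdr.
Qed.

Let unitU i y : cod i y -> \det (G i (cinv i y)) != 0.
Proof. by move=> Uy; apply: det_static_metric_neq0; exact: (chart_cod_inv (ic i) Uy).1. Qed.

Lemma Ck_static_density i : Ck_on 2 (cod i) (fun y => static_density beta g i (cinv i y)).
Proof.
apply: (Ck_on_sqrt (@oU i)) => [y Uy|]; first by rewrite normr_gt0 unitU.
apply: (Ck_on_abs (@oU i)) => [y Uy|]; first exact: unitU.
by apply: (Ck_on_det (@oU i)) => a b; exact: Ck_static_metric.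
Qed.

Definition time_density (i : idx M) q := static_density beta g i q.2.
Definition time_inverse (i : idx M) q : 'M[R]_(1 + n) := invmx (G i q.2).

Lemma time_density_gt0 (i : idx M) q : dom i q -> 0 < time_density i q.
Proof. by move=> [_ dx]; exact: static_density_gt0. Qed.

Lemma Ck_time_density (i : idx M) : Ck_on 1 (cod i) (fun y => time_density i (cinv i y)).
Proof.
rewrite time_cod; apply: (Ck_on_rsubmx (f := fun y => static_density beta g i (chart_inv (@chart_of R X n S i) y))).
exact: (Ck_on_le (isT : (1 <= 2)%N) (Ck_static_density i)).
Qed.

Lemma Ck_time_inverse (i : idx M) a b : Ck_on 1 (cod i) (fun y => time_inverse i (cinv i y) a b).
Proof.
rewrite time_cod; apply: (Ck_on_rsubmx (f := fun y => invmx (G i (chart_inv (@chart_of R X n S i) y)) a b)).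
apply: (Ck_on_invmx (@oU i)) => [y Uy|a' b'].
  by apply: static_metric_unit; exact: (chart_cod_inv (ic i) Uy).1.
exact: (Ck_on_le (isT : (1 <= 2)%N) (Ck_static_metric i a' b')).
Qed.

Lemma time_inverse_sym (i : idx M) q : dom i q -> (time_inverse i q)^T = time_inverse i q.
Proof.
move=> [_ dx]; have [_ gT _ _] := hg.
by rewrite /time_inverse trmx_inv /static_metric tr_block_mx !trmx0 tr_scalar_mx (gT i q.2 dx).
Qed.

Lemma block_diag_congr (a : 'M[R]_1) (K N : 'M[R]_n) :
  block_mx 1%:M 0 0 K *m block_mx a 0 0 N *m block_mx 1%:M 0 0 K^T = block_mx a 0 0 (K *m N *m K^T).
Proof.
have -> : block_mx 1%:M 0 0 K *m block_mx a 0 0 N = block_mx a 0 0 (K *m N).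
  by rewrite mulmx_block !mul0mx !mulmx0 !add0r !addr0 mul1mx.
by rewrite mulmx_block !mul0mx !mulmx0 !add0r !addr0 mulmx1.
Qed.

(** Inverts [G i = J *m G j *m J^T]; the same identity shows that [J] is invertible, because [G i]
    is. *)
Lemma time_inverse_transform (i j : idx M) q : overlap i j q ->
  let J := jacobian (transition i j) (cmap i q) in time_inverse j q = J^T *m time_inverse i q *m J.
Proof.
move=> ov J; have ovS : overlap (M := S) i j q.2 by move: ov; rewrite time_overlap => -[].
have [_ _ _ tr] := hg; have [di dj] := ovS.
have EG : G i q.2 = J *m G j q.2 *m J^T.
  rewrite /J (time_jacobian hS ov) /static_metric (tr i j q.2 ovS) tr_block_mx !trmx0 trmx1.
  exact: (esym (block_diag_congr _ _ _)).
have Ui := static_metric_unit di; have Uj := static_metric_unit dj.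
have UJ : J \in unitmx.
  by move: Ui; rewrite EG !unitmx_mul => /andP[/andP[]].
rewrite /time_inverse; apply: (can_inj (mulKmx Uj)); rewrite mulmxV //.
apply: (can_inj (mulKmx UJ)); rewrite mulmx1.
have -> : J *m (G j q.2 *m (J^T *m invmx (G i q.2) *m J)) = (J *m G j q.2 *m J^T) *m invmx (G i q.2) *m J.
  by rewrite !mulmxA.
by rewrite -EG mulmxV // mul1mx.
Qed.

Lemma time_inverseE (i : idx M) q : dom i q ->
  time_inverse i q = block_mx (- (beta q.2)^-1)%:M 0 0 (static_inv beta g i q.2).
Proof.
move=> [_ dx]; have U := static_metric_unit dx; rewrite /static_inv /time_inverse.
rewrite [in LHS]/static_metric (invmx_block_diag U) invmx_scalar invrN.
by rewrite block_mxKdr.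
Qed.

(** The part of [K] without [Y], as the magnetic Laplacian of the Lorentzian metric on [R * X]. The
    theory of [laplacian] rests on symmetry and the transformation law of the inverse metric, so it
    applies to indefinite signature. *)
Definition time_laplacian := laplacian (M := M) time_density time_inverse A.

Lemma static_V_time s t x : static_V A (s, x) = static_V A (t, x).
Proof. by rewrite /static_V /= (A_static _ s t). Qed.

Lemma magnetic_mom_time u t x : let i := chart_at S x in
  magnetic_mom (@chart_of R _ _ M i) (@time_index n) (fun q => A i q 0 (@time_index n)) u (t, x) =
  op_DtV A i u (t, x).
Proof. by rewrite /= /magnetic_mom /op_DtV /static_V /= rmorphN mulNr /=. Qed.

Lemma magnetic_mom_local (i : idx M) a f (F F' : R * X -> R[i]) q : dom i q ->
  (forall r, dom i r -> F r = F' r) -> magnetic_mom (chart_of i) a f F q = magnetic_mom (chart_of i) a f F' q.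
Proof.
move=> dq FF; have hM := time_smooth_manifold hS; have [_ _ icM _ _] := hM.
have oUM : open (cod i) by case: (icM i).
rewrite !(magnetic_mom_chart hM _ _ _ dq) /cmom.
have Uq := (chart_dom_map (icM i) dq).1.
have E y : cod i y -> F (cinv i y) = F' (cinv i y) by move=> /(chart_cod_inv (icM i))[/FF].
by rewrite (pd_local oUM a Uq E) (E _ Uq).
Qed.

(** The entry [-1/beta] of the inverse metric reproduces the time part, with [D_t - A_0 = D_t + V];
    the mixed entries vanish, which separates time from space. *)
Lemma op_KE u q : op_K beta g A Y u q = time_laplacian u q + (Y q)%:C * u q.
Proof.
congr (_ + _); case: q => t x; set q := (t, x).
have [_ _ _ cov _] := hS; have dx := cov x; set i := chart_at S x in dx *.
have dq : chart_dom (@chart_of R _ _ M i) q by [].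
have w0 : static_density beta g i x != 0 by rewrite gt_eqF // static_density_gt0.
rewrite /time_laplacian /laplacian /lap /= -/i {2}/magnetic_laplacian big_split_ord big_ord1 /= [RHS]mulrDr.
apply: (congr2 +%R).
  set F := fun r => _ * \sum_(k < _) _.
  (* Above [x] the time component of the flux is [op_DtV] times a factor independent of time, which
     therefore passes through the outer [D_t + V]. *)
  have EF s : F (s, x) = (static_density beta g i x * - (beta x)^-1)%:C * op_DtV A i u (s, x).
    rewrite /F /time_density /= big_split_ord big_ord1 /= big1 ?addr0 => [|k _]; last first.
      by rewrite (@time_inverseE i (s, x)) // block_mxEur mxE mul0r.
    rewrite (@time_inverseE i (s, x)) // block_mxEul mxE eqxx mulr1n /= mulrA -rmorphM /=.
    by congr (_ * _); exact: magnetic_mom_time.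
  set k := static_density beta g i x * - (beta x)^-1 in EF.
  have E2 : op_DtV A i F (t, x) = k%:C * op_DtV A i (op_DtV A i u) (t, x).
    rewrite -[LHS]/(mom _ _ F (t, x) + (static_V A (t, x))%:C * F (t, x)).
    rewrite (mom_time_scale (ic i) t dx EF) EF [RHS]mulrDr; congr (_ + _).
    by rewrite mulrCA.
  rewrite [magnetic_mom _ _ _ _ _](magnetic_mom_time F t x) E2 mulrA -rmorphM /= /k mulrA mulVf // mul1r rmorphN.
  by [].
rewrite /magnetic_laplacian; congr (_ * _); apply: eq_bigr => j _.
apply: (magnetic_mom_local (i := i) _ _ dq) => r dr.
congr (_ * _); rewrite big_split_ord big_ord1 /= (time_inverseE dr) block_mxEdl mxE mul0r add0r.
by apply: eq_bigr => k _; rewrite block_mxEdr.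
Qed.

End StaticGeometry.

(** * The Klein-Gordon operator *)

Section Main.
Variables (R : realType) (Sigma : ptopologicalType) (n : nat) (S : atlas R Sigma n).
Hypothesis hS : smooth_manifold S.
Variables (g : idx S -> Sigma -> 'M[R]_n) (beta : Sigma -> R).
Hypotheses (hg : riemannian_metric 2 g) (hbeta : Ck_fun S 2 beta) (beta_gt0 : forall p, 0 < beta p).
Variable C0 : R.
Hypotheses (hC0 : 0 < C0) (beta_bounds : forall p, C0 <= beta p <= C0^-1).
Variables (muS : {measure set (borel Sigma) -> \bar R}) (muM : {measure set (borel (R * Sigma)%type) -> \bar R}).
Hypothesis hmuS : is_density_measure (static_density beta g) muS.
Hypothesis hmuM : @is_density_measure R (R * Sigma)%type (1 + n) (time_atlas S)
     (fun i q => static_density beta g i q.2) muM.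
Variables (A : idx (time_atlas S) -> R * Sigma -> 'rV[R]_(1 + n)) (Y : R * Sigma -> R).
Hypotheses (hA : one_form 1 A) (A_static : forall i, time_independent (A i)).
Variable B : R.
Hypothesis VB : forall q, `|static_V A q| <= B.
Hypotheses (hY : locally_L2 muM Y) (Y_static : time_independent Y).
Local Notation M := (time_atlas S).
Local Notation dom i := (chart_dom (chart_of i)).
Local Notation cod i := (chart_cod (chart_of i)).
Local Notation cmap i := (chart_map (chart_of i)).
Local Notation cinv i := (chart_inv (chart_of i)).
Local Notation L := (op_L beta g A Y).
Local Notation K := (op_K beta g A Y).
Local Notation w := (time_density g beta).
Local Notation lapl := (time_laplacian g beta A).

Let hM : smooth_manifold M. Proof. exact: time_smooth_manifold. Qed.
Let wS0 i p : dom i p -> 0 < static_density beta g i p.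
Proof. exact: (static_density_gt0 hg beta_gt0). Qed.
Let CwS (i : idx S) : Ck_on 1 (cod i) (fun y => static_density beta g i (cinv i y)).
Proof. exact: (Ck_on_le (isT : (1 <= 2)%N) (Ck_static_density hS hg hbeta beta_gt0 i)). Qed.
Let Cw (i : idx M) : Ck_on 1 (cod i) (fun y => w i (cinv i y)).
Proof. exact: (Ck_time_density hS hg hbeta beta_gt0 i). Qed.
Let w0 (i : idx M) p : dom i p -> 0 < w i p.
Proof. exact: (time_density_gt0 hg beta_gt0). Qed.
Let Ch (i : idx M) a b : Ck_on 1 (cod i) (fun y => time_inverse g beta i (cinv i y) a b).
Proof. exact: (Ck_time_inverse hS hg hbeta beta_gt0 i a b). Qed.
Let hT (i : idx M) p : dom i p -> (time_inverse g beta i p)^T = time_inverse g beta i p.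
Proof. exact: time_inverse_sym. Qed.
Let hJ (i j : idx M) p : overlap i j p -> let J := jacobian (transition i j) (cmap i p) in
  time_inverse g beta j p = J^T *m time_inverse g beta i p *m J.
Proof. exact: (time_inverse_transform hS hg beta_gt0). Qed.

Let KE u : K u = fun q => lapl u q + (Y q)%:C * u q.
Proof. by apply/funext => q; exact: (op_KE hS hg beta_gt0). Qed.

(** [Y] times the indicator of [C] is in L2 by local square integrability, and [f] is bounded. *)
Lemma bounded_potential_l2 (f : R * Sigma -> R) (C : set (R * Sigma)) : compact C -> continuous f ->
  (forall p, ~ C p -> f p = 0) -> l2 muM (fun q => Y q * f q).
Proof.
move=> cC cf f0; have [mY IY] := hY; have mC := compact_measurable hM cC.
have [b b0 fb] := compact_support_bounded cC cf f0.
have lY : l2 muM (fun q => Y q * \1_C q).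
  have mYC : measurable_fun [set: borel (R * Sigma)%type] (fun q : borel (R * Sigma)%type => Y q * \1_C q).
    by apply: measurable_funM => //; exact: measurable_indic.
  split => //; apply: le_lt_trans (IY C cC); rewrite le_eqVlt; apply/orP; left; apply/eqP.
  rewrite [RHS]integral_mkcond; apply: eq_integral => q _.
  rewrite patchE indicE; case: (q \in C); first by rewrite mulr1.
  by rewrite mulr0 expr0n.
have mf : measurable_fun [set: borel (R * Sigma)%type] (f : borel (R * Sigma)%type -> R) by exact: continuous_borel_real.
have := l2M_bounded mf fb lY; congr (l2 muM _); apply/funext => q.
rewrite indicE; have [qC|nC] := boolP (q \in C); first by rewrite mulr1 mulrC.
by rewrite f0 ?mul0r ?mulr0 // => Cq; move: nC; rewrite mem_set.
Qed.

Lemma potential_L2 u : Cck M 2 u -> L2 muM (fun q => (Y q)%:C * u q).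
Proof.
move=> Cu; have [C cC u0] := Cck_zero Cu; have [[C1 C2] _] := Cu; apply/L2P; split.
  suff : l2 muM (fun q => Y q * complex.Re (u q)).
    by congr (l2 muM _); apply/funext => q; rewrite /rpart Re_scale.
  by apply: (bounded_potential_l2 cC (Ck_fun_continuous hM C1)) => p /u0 ->.
suff : l2 muM (fun q => Y q * complex.Im (u q)).
  by congr (l2 muM _); apply/funext => q; rewrite /ipart Im_scale.
by apply: (bounded_potential_l2 cC (Ck_fun_continuous hM C2)) => p /u0 ->.
Qed.

Lemma op_K_L2 u : Cck M 2 u -> L2 muM (K u).
Proof.
move=> Cu; rewrite KE; apply: L2D; last exact: potential_L2.
exact: (laplacian_L2 hM Cw w0 hmuM Ch hJ hA Cu).
Qed.

Lemma op_K_symmetric u v : Cck M 2 u -> Cck M 2 v -> L2inner muM u (K v) = L2inner muM (K u) v.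
Proof.
move=> Cu Cv; have lu := Cck2_L2 hM Cw w0 hmuM Cu; have lv := Cck2_L2 hM Cw w0 hmuM Cv.
have pu := potential_L2 Cu; have pv := potential_L2 Cv.
have Lu := laplacian_L2 hM Cw w0 hmuM Ch hJ hA Cu; have Lv := laplacian_L2 hM Cw w0 hmuM Ch hJ hA Cv.
rewrite !KE (innerDr lu Lv pv) (innerDl lv Lu pu).
congr (_ + _); first exact: (laplacian_symmetric hM Cw w0 hmuM Ch hT hJ hA).
by rewrite inner_mulr.
Qed.

Lemma op_K_linear (k : R[i]) u v : Cck M 2 u -> Cck M 2 v ->
  K (fun x => k * u x + v x) = fun x => k * K u x + K v x.
Proof.
move=> Cu Cv; rewrite !KE; apply/funext => q.
rewrite /time_laplacian (laplacian_linear hM Cw w0 Ch hA k q Cu.1 Cv.1).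
by move: (laplacian _ _ _ _ _) (laplacian _ _ _ _ _) (u q) (v q) (_%:C) => a b c d y; ring.
Qed.

Definition potential (x : Sigma) : R := static_V A (0, x).

(** Changes of chart act on space alone, so the time component of a 1-form is the same in all of
    them. Continuity of [potential] needs this, because the chart selected by [chart_at] may vary
    irregularly with the point. *)
Lemma potential_chart (i : idx S) x : dom i x -> potential x = - A i (0, x) 0 (@time_index n).
Proof.
move=> dx; have [_ _ _ cov _] := hS; set j := chart_at S x; have dj : dom j x by exact: cov.
have ov : overlap (M := M) j i (0, x) by rewrite time_overlap.
rewrite /potential /static_V /= -/j; congr (- _).
rewrite (hA.2 j i (0, x) ov) (time_jacobian hS ov) tr_block_mx !trmx0 trmx1 mxE.
rewrite big_split_ord big_ord1 /= big1 ?addr0 => [|b _].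
  by rewrite block_mxEul mxE eqxx mulr1.
by rewrite block_mxEdl mxE mulr0.
Qed.

Lemma potential_continuous : continuous potential.
Proof.
apply: (@Ck_fun_continuous _ _ _ S hS 0) => i; split => // y; rewrite inE => Uy.
have [_ _ ic _ _] := hS; have oU : open (cod i) by case: (ic i).
suff C : Ck_on 0 (cod i) (fun y => - A i (0, cinv i y) 0 (@time_index n)).
  have CE : Ck_on 0 (cod i) (potential \o cinv i).
    apply: (Ck_on_ext oU _ C) => z Uz; apply: potential_chart; exact: (chart_cod_inv (ic i) Uz).1.
  by apply: (Ck_on_continuous CE); rewrite inE.
apply: (Ck_onN oU); split => // z; rewrite inE => Uz.
have CA := hA.1 i (@time_index n).
have E : (fun y : 'rV[R]_n => A i (0, cinv i y) 0 (@time_index n)) =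
    (fun y : 'rV[R]_(1 + n) => A i (chart_inv (@chart_of R _ _ M i) y) 0 (@time_index n)) \o (fun y : 'rV[R]_n => consr (0 : R, y)).
  apply/funext => y'; rewrite /= /consr row_mxKl row_mxKr mxE eqxx; by [].
rewrite E; apply: continuous_comp.
  apply: (@continuous_comp _ _ _ (fun y : 'rV[R]_n => (0 : R, y)) (@consr R n)); last exact: continuous_consr.
  have c1 : {for z, continuous (fun _ : 'rV[R]_n => 0 : R)} by exact: cst_continuous.
  have c2 : {for z, continuous (fun y : 'rV[R]_n => y)} by exact: cvg_id.
  exact: (cvg_pair c1 c2).
by apply: (Ck_on_continuous CA); rewrite inE time_cod /= rsubmx_consr.
Qed.

Let mV : measurable_fun [set: borel Sigma] (potential : borel Sigma -> R).
Proof. by apply: continuous_borel_real; exact: potential_continuous. Qed.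

Local Notation sfm := (sf_measure (density_sigma_finite hS CwS wS0 hmuS)).
Local Notation P := ((@lebR R) \x sfm)%E.

Definition lapse (x : Sigma) : R := Num.sqrt (beta x).

Lemma lapse_gt0 x : 0 < lapse x. Proof. by rewrite sqrtr_gt0. Qed.

Lemma lapse_sqr x : lapse x * lapse x = beta x.
Proof. by rewrite -expr2 sqr_sqrtr // ltW. Qed.

Lemma lapse_continuous : continuous lapse.
Proof.
move=> x; apply: (@continuous_comp _ _ _ beta Num.sqrt); last exact: sqrt_continuous.
exact: (Ck_fun_continuous hS hbeta).
Qed.

Let measurable_root : measurable_fun [set: borel Sigma] (lapse : borel Sigma -> R).
Proof. by apply: continuous_borel_real; exact: lapse_continuous. Qed.

Let lapseM_measurable : measurable_fun [set: R * borel Sigma] (fun z : R * borel Sigma => lapse z.2).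
Proof. exact: (measurableT_comp measurable_root measurable_snd). Qed.

Let lapseV_measurable : measurable_fun [set: R * borel Sigma] (fun z : R * borel Sigma => (lapse z.2)^-1).
Proof.
have cV : continuous (fun x => (lapse x)^-1).
  by move=> x; apply: cvgV; [rewrite gt_eqF // lapse_gt0 | exact: lapse_continuous].
exact: (measurableT_comp (continuous_borel_real cV) measurable_snd).
Qed.

Lemma lapse_bound x : `|lapse x| <= Num.sqrt C0^-1.
Proof.
by rewrite ger0_norm ?sqrtr_ge0 // ler_wsqrtr //; case/andP: (beta_bounds x).
Qed.

Lemma lapseV_bound x : `|(lapse x)^-1| <= Num.sqrt C0^-1.
Proof.
rewrite ger0_norm ?invr_ge0 ?sqrtr_ge0 // /lapse -sqrtrV ?(ltW (beta_gt0 x)) //.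
rewrite ler_wsqrtr // lef_pV2 ?posrE //.
by case/andP: (beta_bounds x).
Qed.

Lemma lapse_L2 v : L2 P v -> L2 P (fun z => (lapse z.2)%:C * v z).
Proof. by move=> lv; apply: (L2M_real lapseM_measurable _ lv) => z; exact: lapse_bound. Qed.

Lemma lapseV_L2 v : L2 P v -> L2 P (fun z => ((lapse z.2)^-1)%:C * v z).
Proof. by move=> lv; apply: (L2M_real lapseV_measurable _ lv) => z; exact: lapseV_bound. Qed.

Let lapseK x (z : R[i]) : ((lapse x)^-1)%:C * ((lapse x)%:C * z) = z.
Proof. by rewrite mulrA -rmorphM /= mulVf ?mul1r // gt_eqF // lapse_gt0. Qed.

Variables (rho rho1 rho2 : nat -> R -> R) (Mn : nat -> R).
Hypothesis rho_bump : forall N, bump N.+1%:R^-1 (2 * N.+1%:R) (rho N).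
Hypothesis rho_int : forall N, \int[@lebR R]_t rho N t = 1.
Hypothesis rho_d1 : forall N, udiff N.+1%:R^-1 (Mn N) (rho N) (rho1 N).
Hypothesis rho_d2 : forall N, udiff N.+1%:R^-1 (Mn N) (rho1 N) (rho2 N).
Hypothesis rho_derive1 : forall N t, is_derive t (1 : R) (rho N) (rho1 N t).
Hypothesis rho_derive2 : forall N t, is_derive t (1 : R) (rho1 N) (rho2 N t).
Hypothesis rhoE : forall N, exists c, rho N = fun t => c * ppow 4 (1 - (N.+1%:R * t) ^+ 2).

Definition packet N s (psi : Sigma -> R[i]) (z : R * Sigma) : R[i] :=
  (lapse z.2)%:C * ((test rho N s z.1)%:C * psi z.2).

(** Class C^2 is all that [lapse] inherits from [beta], even though [psi] is smooth; the packets fit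
    exactly the domain chosen for [K]. *)
Lemma packet_Cck N s psi : Cc_infty S psi -> Cck M 2 (packet N s psi).
Proof.
move=> [Cpsi cpsi]; have [_ _ ic _ _] := hS; have [C1 C2] := Cpsi 2%N.
have Ct (i : idx M) : Ck_on 2 (cod i) (fun y : 'rV[R]_(1 + n) => rho N (s - lsubmx y 0 0)).
  have oU : open (cod i) by case: hM => _ _ h _ _; case: (h i).
  have [c ->] := rhoE N; apply: (Ck_onZ c oU); apply: (Ck_on_ppow 1 oU).
  apply: (Ck_onB oU (Ck_on_cst 2 _ 1)).
  have Cl : Ck_on 2 (cod i) (fun y : 'rV[R]_(1 + n) => N.+1%:R * (s - lsubmx y 0 0)).
    apply: (Ck_onZ _ oU); apply: (Ck_onB oU (Ck_on_cst 2 _ s)).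
    apply: (Ck_on_ext oU _ (Ck_on_coord 2 (cod i) (lshift n ord0))) => y _; by rewrite mxE.
  by apply: (Ck_on_ext oU _ (Ck_onM oU Cl Cl)) => y _; rewrite expr2.
have CR (f : Sigma -> R) : Ck_fun S 2 f -> Ck_fun M 2 (fun z => lapse z.2 * (test rho N s z.1 * f z.2)).
  move=> Cf i; have oU : open (cod i) by case: hM => _ _ h _ _; case: (h i).
  have oU' : open (chart_cod (@chart_of R _ _ S i)) by case: (ic i).
  have Cr : Ck_on 2 (chart_cod (@chart_of R _ _ S i)) (fun y => lapse (chart_inv (@chart_of R _ _ S i) y)).
    by apply: (Ck_on_sqrt oU') => // y _.
  have := Ck_onM oU (Ck_on_sub _ (Ck_on_rsubmx Cr)) (Ck_onM oU (Ct i) (Ck_on_sub _ (Ck_on_rsubmx (Cf i)))).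
  by rewrite time_cod; apply.
split.
  split; [have := CR _ C1 | have := CR _ C2]; congr (Ck_fun M 2 _); apply/funext => z.
    by rewrite /packet !Re_scale.
  by rewrite /packet !Im_scale.
pose a := N.+1%:R^-1 : R.
have cK : compact (`[s - a, s + a]%classic `*` closure [set x | psi x != 0] : set (R * Sigma)%type).
  by apply: compact_setX => //; exact: segment_compact.
apply: (support_compact hM cK) => -[t x] nK; rewrite /packet /=.
have [tI|ntI] := pselect (`[s - a, s + a]%classic t).
  by rewrite (off_support (p := x) (u := psi)) ?mulr0 // => xc; apply: nK.
have [_ _ _ z _] := rho_bump N.
rewrite /test z ?mul0r ?mulr0 // ltNge; apply/negP => h; apply: ntI.
by move: h; rewrite /= in_itv /= ler_norml => /andP[]; rewrite -/a => h1 h2; apply/andP; split; lra.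
Qed.

Local Notation im := ('i%R : R[i]).

Lemma imaginary_sqr : im * im = -1.
Proof. by rewrite -expr2 sqrCi. Qed.

(** Two summands are allowed because one application of [D_t + V] to a packet already produces two.
    The factor is [+i]: the sign in [-i] cancels that of the derivative of [s - t]. *)
Lemma mom_packet N' s t x (f df f1 df1 : R -> R) (a b : R[i]) (G : R * Sigma -> R[i]) :
  let i := chart_at S x in N' = i ->
  (forall t, is_derive t (1 : R) f (df t)) -> (forall t, is_derive t (1 : R) f1 (df1 t)) ->
  (forall t, G (t, x) = (f (s - t))%:C * a + (f1 (s - t))%:C * b) ->
  mom (@chart_of R _ _ M N') (@time_index n) G (t, x) = im * ((df (s - t))%:C * a + (df1 (s - t))%:C * b).
Proof.
move=> i -> Df Df1 EG; have [_ _ ic cov _] := hS.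
have dr (h dh : R -> R) (c : R) : (forall t, is_derive t (1 : R) h (dh t)) ->
    is_derive t (1 : R) (fun r => h (s - r) * c) (- dh (s - t) * c).
  move=> Dh; have [d0 e0] := is_deriveB (is_derive_cst s t (1 : R)) (is_derive_id t (1 : R)).
  have [d1 e1] := derive_comp_real d0 (Dh (s - t)).
  have [d2 e2] := is_deriveZ c (DeriveDef d1 e1).
  have E : (fun r => h (s - r) * c) = c \*: (h \o (cst s - id)) by apply/funext => r; rewrite mulrC.
  by rewrite E; apply: DeriveDef => //; rewrite [LHS]e2 e0 sub0r mulrN1 [_ *: _]mulrC.
have D (P : R[i] -> R) : (forall k z, P (k%:C * z) = k * P z) -> (forall y z, P (y + z) = P y + P z) ->
    is_derive t (1 : R) (fun r => P (G (r, x))) (P (- ((df (s - t))%:C * a + (df1 (s - t))%:C * b))).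
  move=> PZ PD; have [d e] := is_deriveD (dr f df (P a) Df) (dr f1 df1 (P b) Df1).
  have E : (fun r => P (G (r, x))) = (fun r => f (s - r) * P a) + (fun r => f1 (s - r) * P b).
    by apply/funext => r; rewrite EG PD !PZ.
  rewrite E; apply: DeriveDef => //; rewrite [LHS]e opprD PD -!mulNr -!rmorphN !PZ.
  by [].
have := mom_time (ic i) (cov x) (D _ (@Re_scale R) (@ReD R)) (D _ (@Im_scale R) (@ImD R)).
by move=> ->; case: (_ + _) => p q; rewrite -[in RHS]mulrNN.
Qed.

(** The prefactor arises since [1/beta] times [lapse] is [1/lapse], while [L] carries one more
    factor [lapse] on the left than the spatial part of [K], and [beta * Y] is
    [lapse * Y * lapse]. *)
Lemma op_K_packet N s psi z :
  K (packet N s psi) z = ((lapse z.2)^-1)%:C * @wave _ (borel Sigma) R rho rho1 rho2 L potential N s psi z.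
Proof.
case: z => t x; set i := chart_at S x.
pose F y := (lapse y)%:C * psi y.
have packetE : packet N s psi = fun r => (rho N (s - r.1))%:C * F r.2.
  by apply/funext => r; rewrite /packet /F /test mulrCA.
have Vt t' : static_V A (t', x) = potential x by exact: (static_V_time A_static t' 0 x).
have D1 t' : op_DtV A i (packet N s psi) (t', x) =
    (rho1 N (s - t'))%:C * (im * F x) + (rho N (s - t'))%:C * ((potential x)%:C * F x).
  rewrite /op_DtV Vt.
  rewrite (@mom_packet i s t' x (rho N) (rho1 N) (rho N) (rho1 N) (F x) 0) //; last by move=> t2; rewrite packetE mulr0 addr0.
  rewrite packetE mulr0 addr0 /=.
  by move: im (F x) (_%:C) (_%:C) (_%:C) => j f a b c; ring.
have D2 : op_DtV A i (op_DtV A i (packet N s psi)) (t, x) =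
    - ((rho2 N (s - t))%:C * F x) + 2 * im * ((potential x)%:C * ((rho1 N (s - t))%:C * F x)) + (potential x)%:C * ((potential x)%:C * ((rho N (s - t))%:C * F x)).
  rewrite {1}/op_DtV Vt D1.
  rewrite (@mom_packet i s t x (rho1 N) (rho2 N) (rho N) (rho1 N) _ _ _ erefl (rho_derive2 N) (rho_derive1 N) D1).
  have := imaginary_sqr; move: im (F x) (_%:C) (_%:C) (_%:C) (_%:C) => j f a b c d jj.
  have -> : - (d * f) = (j * j) * (d * f) by rewrite jj mulN1r.
  by ring.
rewrite /op_K -/i D2 packetE.
have As j s' x' : A i (s', x') 0 (space_index j) = A i (0, x') 0 (space_index j) by rewrite (A_static i s' 0).
have [_ _ ic _ _] := hS.
rewrite (magnetic_laplacian_space (chart_of i) (static_density beta g i) (static_inv beta g i) (A := fun j r => A i r 0 (space_index j))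
  (fun r => rho N (s - r)) F t x As).
rewrite /wave /tmul /ctensor /op_L -/i /=.
set m := magnetic_laplacian _ _ _ _ _ F x.
have -> : Num.sqrt (beta x) = lapse x by [].
have bb : ((lapse x)^-1)%:C * (lapse x)%:C = 1 :> R[i].
  by rewrite -rmorphM /= mulVf // gt_eqF // lapse_gt0.
have bV : ((beta x)^-1)%:C = ((lapse x)^-1)%:C * ((lapse x)^-1)%:C :> R[i].
  by rewrite -rmorphM /= -invfM lapse_sqr.
have bY : (beta x * Y (0, x))%:C = (lapse x)%:C * (lapse x)%:C * (Y (t, x))%:C :> R[i].
  by rewrite (Y_static t 0) -!rmorphM /= lapse_sqr.
rewrite bV bY /F; move: bb.
move: ((lapse x)^-1%:C) (lapse x)%:C => bi b; move: (Y (t, x))%:C (potential x)%:C => y v.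
move: m (psi x) im => m' p j; move: (rho2 N _)%:C (rho1 N _)%:C (rho N _)%:C => a c d bb.
have z q : (bi * b - 1) * q = 0 by rewrite bb subrr mul0r.
(* The identity holds modulo [bi * b = 1]; the cofactor of [bi * b - 1] is supplied explicitly so
   that [ring] can verify it. *)
apply/eqP; rewrite -subr_eq0 -(z (bi * (a * p - 2 * j * (v * (c * p)) - v * (v * (d * p))) - d * m' - y * (d * (b * p)))).
by apply/eqP; ring.
Qed.

Let sfL2 (u : borel Sigma -> R[i]) : L2 muS u <-> L2 sfm u.
Proof. by split=> /L2P[h1 h2]; apply/L2P; split; [exact: h1 | exact: h2 | exact: h1 | exact: h2]. Qed.

Local Notation GK := (@op_graph _ (borel (R * Sigma)%type) R (Cck M 2) K).
Local Notation GL := (@op_graph _ (borel Sigma) R (Cc_infty S) L).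

Lemma packet_L2 N s psi : Cc_infty S psi -> L2 muM (packet N s psi).
Proof. by move=> Cpsi; apply: (Cck2_L2 hM Cw w0 hmuM); exact: packet_Cck. Qed.

Let PL2 (u : R * Sigma -> R[i]) : L2 muM u <-> L2 P u. Proof. exact: (product_L2 hS CwS wS0 hmuS hmuM). Qed.
Let Pinner (u v : R * Sigma -> R[i]) : L2 P u -> L2 P v -> L2inner muM u v = L2inner P u v.
Proof. exact: (product_inner hmuM). Qed.

(** The real weights move across the pairing: [1/lapse] from [op_K_packet] goes to [v], and the
    [lapse] in the packet goes to [h]. *)
Lemma op_K_wave_adjoint (v h : R * Sigma -> R[i]) : graph_adjoint muM GK (v, h) ->
  @wave_adjoint _ (borel Sigma) R sfm rho rho1 rho2 (Cc_infty S) L potential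
    (fun z => ((lapse z.2)^-1)%:C * v z) (fun z => (lapse z.2)%:C * h z).
Proof.
move=> [/= /PL2 lv /PL2 lh H]; split; [exact: lapseV_L2 | exact: lapse_L2 | move=> N s psi Dpsi].
have Cp := packet_Cck N s Dpsi.
rewrite (inner_mulr P (fun z => (lapse z.2)^-1)).
have -> : (fun z => ((lapse z.2)^-1)%:C * @wave _ (borel Sigma) R rho rho1 rho2 L potential N s psi z) = K (packet N s psi).
  by apply/funext => z; rewrite op_K_packet.
have lK := (PL2 _).1 (op_K_L2 Cp); have lp := (PL2 _).1 (packet_L2 N s Dpsi).
rewrite -(Pinner lv lK) (H (packet N s psi, K (packet N s psi)) (conj Cp erefl)) /= (Pinner lh lp).
by rewrite (inner_mulr P (fun z => lapse z.2)).
Qed.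

Hypothesis hL : essentially_selfadjoint muS (Cc_infty S) L.

Let DL2 : Cc_infty S `<=` L2 sfm. Proof. by move=> u Du; apply/sfL2; case: hL => -[h _] _ _; exact: h. Qed.
Let AL2 (u : borel Sigma -> R[i]) : Cc_infty S u -> L2 sfm (L u). Proof. by move=> Du; apply/sfL2; case: hL => _ h _; exact: h. Qed.

Let Lsym (v h b c : borel Sigma -> R[i]) : graph_adjoint sfm GL (v, h) ->
  graph_adjoint sfm GL (b, c) -> L2inner sfm h b = L2inner sfm v c.
Proof.
have E (v' h' : borel Sigma -> R[i]) : graph_adjoint sfm GL (v', h') ->
    graph_adjoint muS GL (v', h').
  by move=> [l1 l2 H]; split; [exact/sfL2 | exact/sfL2 | exact: H].
by move=> /E vh /E bc; exact: (esa_adjoint_symmetric hL vh bc).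
Qed.

Let Ltot (f : borel Sigma -> R[i]) : L2 sfm f -> (forall u : borel Sigma -> R[i], Cc_infty S u -> L2inner sfm f u = 0) ->
  rinner sfm f f = 0.
Proof. by move=> /sfL2 lf f0; exact: (esa_orthogonal hL lf f0). Qed.

(** The weights [lapse] and [1/lapse] sit on opposite components of the two pairs, so they cancel in
    both pairings. *)
Lemma op_K_adjoint_symmetric (v h b c : R * Sigma -> R[i]) : graph_adjoint muM GK (v, h) ->
  graph_adjoint muM GK (b, c) -> L2inner muM h b = L2inner muM v c.
Proof.
move=> vh bc; have [/= /PL2 lv /PL2 lh _] := vh; have [/= /PL2 lb /PL2 lc _] := bc.
have := wave_adjoint_symmetric (mu := sfm) rho_bump rho_int rho_d1 rho_d2 DL2 AL2 mV (fun x => VB (0, x))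
  Lsym (op_K_wave_adjoint vh) (op_K_wave_adjoint bc).
rewrite (inner_mulr P (fun z => lapse z.2)) (inner_mulr P (fun z => (lapse z.2)^-1)).
rewrite !Pinner //; congr (_ = _); congr (L2inner P _ _); apply/funext => z.
  by rewrite mulrA -rmorphM /= mulfV ?mul1r // gt_eqF // lapse_gt0.
exact: lapseK.
Qed.

(** Orthogonality to the packets makes [lapse * f] a function of norm zero by [ctensor_total]; then
    [<f, f> = <lapse * f, f / lapse>] vanishes by Cauchy-Schwarz. *)
Lemma packets_total (f : R * Sigma -> R[i]) : L2 muM f -> (forall u : R * Sigma -> R[i], Cck M 2 u -> L2inner muM f u = 0) -> rinner muM f f = 0.
Proof.
move=> lf f0; have lfP := (PL2 f).1 lf; have lr := lapse_L2 lfP.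
have r0 : rinner P (fun z => (lapse z.2)%:C * f z) (fun z => (lapse z.2)%:C * f z) = 0.
  apply: (ctensor_total (mu := sfm) rho_bump rho_int DL2 Ltot lr) => N s psi Dpsi.
  rewrite (inner_mulr P (fun z => lapse z.2)) -[RHS](f0 _ (packet_Cck N s Dpsi)).
  by rewrite (Pinner lfP ((PL2 _).1 (packet_L2 N s Dpsi))).
have := rinner_cs lr (lapseV_L2 lfP); rewrite r0 mul0r.
rewrite -(Re_inner lr (lapseV_L2 lfP)) (inner_mulr P (fun z => lapse z.2)).
have -> : (fun z => (lapse z.2)%:C * (((lapse z.2)^-1)%:C * f z)) = f.
  by apply/funext => z; rewrite mulrA -rmorphM /= mulfV ?mul1r // gt_eqF // lapse_gt0.
rewrite -Pinner // Re_inner // => h.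
by apply/eqP; rewrite -sqrf_eq0 eq_le h sqr_ge0.
Qed.

Lemma op_K_essentially_selfadjoint : essentially_selfadjoint muM (Cck M 2) K.
Proof.
apply: esa_criterion.
- exact: (Cck2_0 hM).
- by move=> k u v Cu Cv; exact: (Cck2_linear hM).
- exact: op_K_linear.
- by move=> u Cu; exact: (Cck2_L2 hM Cw w0 hmuM Cu).
- exact: op_K_L2.
- exact: packets_total.
- exact: op_K_symmetric.
- exact: op_K_adjoint_symmetric.
Qed.

End Main.

Local Close Scope complex_scope.

Theorem theorem2p6 (R : realType) (Sigma : ptopologicalType) (n : nat)
  (S : atlas R Sigma n) (hS : smooth_manifold S)
  (gSigma : idx S -> Sigma -> 'M[R]_n) (hg : riemannian_metric 2 gSigma)
  (beta : Sigma -> R) (hbeta : Ck_fun S 2 beta) (beta_gt0 : forall p, 0 < beta p)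
  (C0 : R) (hC0 : 0 < C0) (beta_bounds : forall p, C0 <= beta p <= C0^-1)
  (muSigma : {measure set (borel Sigma) -> \bar R})
  (hmuSigma : is_density_measure (static_density beta gSigma) muSigma)
  (muM : {measure set (borel (R * Sigma)%type) -> \bar R})
  (hmuM : @is_density_measure R (R * Sigma)%type (1 + n) (time_atlas S)
     (fun i q => static_density beta gSigma i q.2) muM)
  (A : idx (time_atlas S) -> R * Sigma -> 'rV[R]_(1 + n))
  (hA : one_form 1 A) (A_static : forall i, time_independent (A i))
  (V_bounded : exists B : R, forall q, `|static_V A q| <= B)
  (Y : R * Sigma -> R) (hY : locally_L2 muM Y) (Y_ge0 : forall q, 0 <= Y q)
  (Y_static : time_independent Y)
  (hL : essentially_selfadjoint muSigma (Cc_infty S) (op_L beta gSigma A Y)) :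
  essentially_selfadjoint muM (Cck (time_atlas S) 2) (op_K beta gSigma A Y).
Proof.
have [B VB] := V_bounded.
have [rho [rho1 [rho2 [Mn [rb ri r1 r2 [d1 d2 rE]]]]]] := mollifier_family R.
exact: (op_K_essentially_selfadjoint hS hg hbeta beta_gt0 hC0 beta_bounds hmuSigma hmuM hA A_static VB hY Y_static rb ri r1 r2 d1 d2 rE hL).
Qed.
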